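(* Let $d\ge 2$, and let $\mathbb{P}$ be the law of a family of non-negative conductances $\omega=(\omega_b)_b$ on the nearest-neighbour edges of $\mathbb{Z}^d$ which is stationary and ergodic with respect to the shifts of $\mathbb{Z}^d$ and satisfies Condition UE: there is $\kappa>0$ such that, $\mathbb{P}$-a.s., $\kappa<\omega_{0,x}<\kappa^{-1}$ for all $x\sim 0$. Let $Z^n$, $D$ and $\Lambda_n$ be as defined in the context, and let $\mu^n_\omega$ be the probability measure on $C([0,1])$ (continuous functions from $[0,1]$ to $\mathbb{R}^d$, with its Borel $\sigma$-field) given by $\mu^n_\omega(A)=\mathtt{P}_\omega[DZ^n\in A\mid \Lambda_n]$. Then, $\mathbb{P}$-a.s., $\mu^n_\omega$ converges weakly, as $n\to\infty$, to $P_{W^+}\otimes P_{W^{(d-1)}}$ (as probability measures on $C([0,1])$), where $P_{W^+}\otimes P_{W^{(d-1)}}$ is the law of the $\mathbb{R}^d$-valued process on $[0,1]$ whose first coordinate is a Brownian meander and whose last $d-1$ coordinates form a $(d-1)$-dimensional standard Brownian motion independent of the first coordinate.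
   Context: Random walk: write $x\sim y$ if $x,y$ are nearest neighbours in $\mathbb{Z}^d$. For an environment $\omega$ let $\pi_x=\sum_{y\sim x}\omega_{x,y}$. The random walk $X=(X(k))_{k\ge0}$ in environment $\omega$ is the Markov chain on $\mathbb{Z}^d$ with transition probabilities $p_\omega(x,y)=\omega_{x,y}/\pi_x$ if $y\sim x$ and $0$ otherwise. $\mathtt{P}_\omega^x$ is its (quenched) law started from $x$, and $\mathtt{P}_\omega=\mathtt{P}^0_\omega$. Write $X=(X_1,\dots,X_d)$ in the canonical basis $\mathbf{e}_1,\dots,\mathbf{e}_d$ of $\mathbb{R}^d$. Rescaled path: $Z^n=(Z^n(t))_{t\in[0,1]}$ is the polygonal (piecewise linear) interpolation of $k/n\mapsto n^{-1/2}X(k)$, i.e. $\sqrt n\,Z^n(t)=X(\lfloor nt\rfloor)+(nt-\lfloor nt\rfloor)\big(X(\lfloor nt\rfloor+1)-X(\lfloor nt\rfloor)\big)$. The linear map $D$: it is known that under these assumptions, $\mathbb{P}$-a.s., under $\mathtt{P}_\omega$ the processes $Z^n$ converge weakly to a $d$-dimensional Brownian motion with a deterministic positive definite covariance matrix $\Sigma$. $D:\mathbb{R}^d\to\mathbb{R}^d$ is a fixed invertible linear map which leaves the hyperplane $\{x_1=0\}$ invariant, satisfies $D\mathbf{e}_1\cdot\mathbf{e}_1>0$, and is such that $DZ^n$ converges weakly to the $d$-dimensional standard Brownian motion $W^{(d)}$ (i.e. $D\Sigma D^{T}=I$). Conditioning event: $\Lambda_n=\{X_1(k)>0\text{ for all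 }k=1,\dots,n\}$. Brownian meander: for a one-dimensional standard Brownian motion $W_1$, let $\tau_1=\sup\{s\in[0,1]:W_1(s)=0\}$ and $\Delta_1=1-\tau_1$; then $W^+(s)=\Delta_1^{-1/2}|W_1(\tau_1+s\Delta_1)|$, $0\le s\le1$. *)

(* Defs.v *)
From HB Require Import structures.
From mathcomp Require Import all_boot all_order all_algebra.
From mathcomp Require Import all_classical all_reals all_analysis.

Set Implicit Arguments.
Unset Strict Implicit.
Unset Printing Implicit Defensive.

Import Order.TTheory GRing.Theory Num.Theory.
Import numFieldNormedType.Exports.

Local Open Scope classical_set_scope.
Local Open Scope ring_scope.

Definition zd (d : nat) : Type := 'rV[int]_d.

HB.instance Definition _ d := Choice.on (zd d).
HB.instance Definition _ d := isPointed.Build (zd d) (0 : 'rV[int]_d).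

Definition unitv (d : nat) (i : 'I_d) : zd d := delta_mx 0 i.

Definition neighbour (d : nat) (x y : zd d) : bool :=
  [exists i, (y == x + unitv i) || (y == x - unitv i)].

(** The pair [(x, i)] encodes the unoriented edge [{x, x + e_i}]. *)
Definition edge (d : nat) : Type := (zd d * 'I_d)%type.

Definition env (R : realType) (d : nat) : Type := edge d -> R.

Definition env_cylinders (R : realType) (d : nat) : set (set (env R d)) :=
  [set C | exists (b : edge d) (A : set R),
     measurable A /\ C = [set w | A (w b)]].

Definition env_space (R : realType) (d : nat) :=
  g_sigma_algebraType (@env_cylinders R d).

(** [omega_{x,y}]: at most one of the terms is nonzero, and the value is [0]
    when [x] and [y] are not neighbours. *)
Definition conductance (R : realType) (d : nat) (w : env R d) (x y : zd d) : R :=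
  \sum_(i < d) ((if y == x + unitv i then w (x, i) else 0) +
                (if x == y + unitv i then w (y, i) else 0)).

Definition env_shift (R : realType) (d : nat) (z : zd d) (w : env R d) :
  env R d := fun b => w (b.1 + z, b.2).

Definition stationary (R : realType) (d : nat)
    (P : probability (env_space R d) R) : Prop :=
  forall (z : zd d) (A : set (env_space R d)), measurable A ->
    P (env_shift z @^-1` A) = P A.

Definition ergodic (R : realType) (d : nat)
    (P : probability (env_space R d) R) : Prop :=
  forall A : set (env_space R d), measurable A ->
    (forall z : zd d, env_shift z @^-1` A = A) -> P A = 0%E \/ P A = 1%E.

Definition nonnegative_conductances (R : realType) (d : nat)
    (P : probability (env_space R d) R) : Prop :=
  {ae P, forall w : env R d, forall b : edge d, 0 <= w b}.

Definition condition_UE (R : realType) (d : nat)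
    (P : probability (env_space R d) R) : Prop :=
  exists2 kappa : R, 0 < kappa &
    {ae P, forall w : env R d, forall x : zd d, neighbour 0 x ->
       kappa < conductance w 0 x < kappa^-1}.

Definition pi_env (R : realType) (d : nat) (w : env R d) (x : zd d) : R :=
  \sum_(i < d) (conductance w x (x + unitv i) + conductance w x (x - unitv i)).

Definition transition (R : realType) (d : nat) (w : env R d) (x y : zd d) : R :=
  if neighbour x y then conductance w x y / pi_env w x else 0.

Definition trajectory (d : nat) : Type := nat -> zd d.

Definition trajectory_cylinders (d : nat) : set (set (trajectory d)) :=
  [set C | exists (k : nat) (x : zd d), C = [set X | X k = x]].

Definition trajectory_space (d : nat) :=
  g_sigma_algebraType (@trajectory_cylinders d).

(** Under [Q] the canonical process is the Markov chain with transition
    probabilities [p_omega] started from [x]; the Markov property is written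
    multiplicatively, so that no conditioning on a null event occurs. *)
Definition quenched_law (R : realType) (d : nat) (w : env R d) (x : zd d)
    (Q : probability (trajectory_space d) R) : Prop :=
  Q [set X | X 0%N = x] = 1%E /\
  forall (n : nat) (s : trajectory d),
    Q [set X | forall k, (k <= n.+1)%N -> X k = s k] =
    (Q [set X | forall k, (k <= n)%N -> X k = s k] *
      (transition w (s n) (s n.+1))%:E)%E.

Definition stay_positive (d : nat) (n : nat) : set (trajectory_space d.+1) :=
  [set X | forall k, (1 <= k <= n)%N -> 0 < (X k : 'rV[int]_d.+1) 0 0].

Definition I01 (R : realType) : Type := set_type `[0%R : R, 1%R].

Definition time (R : realType) (t : I01 R) : R := \val t.

Definition C01 (R : realType) (V : pseudoMetricType R) : Type :=
  continuousType (I01 R) V.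

(** The topology of [C([0,1])] is that of uniform convergence. *)
HB.instance Definition _ (R : realType) (V : pseudoMetricType R) :=
  PseudoMetric.copy (C01 V)
    (initial_topology (fun w : C01 V => w : arrow_uniform_type (I01 R) V)).
HB.instance Definition _ (R : realType) (V : normedModType R) :=
  isPointed.Build (C01 V) (cst (0 : V)).

Definition borel (T : ptopologicalType) := g_sigma_algebraType (@open T).

Definition weak_cvg (R : realType) (T : ptopologicalType)
    (mu : nat -> probability (borel T) R) (nu : probability (borel T) R) : Prop :=
  forall f : T -> R, continuous f -> (exists M : R, forall x, `|f x| <= M) ->
    (\int[mu n]_x (f x)%:E)%E @[n --> \oo] --> (\int[nu]_x (f x)%:E)%E.

Lemma continuous_comp_fun (X Y Z : topologicalType) (f : X -> Y) (g : Y -> Z) :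
  continuous f -> continuous g -> continuous (fun x => g (f x)).
Proof. by move=> cf cg x; apply: continuous_comp; [exact: cf | exact: cg]. Qed.

Lemma clip_subproof (R : realType) (x : R) :
  Num.max 0 (Num.min x 1) \in `[0%R : R, 1%R]%classic.
Proof.
rewrite inE /= in_itv /= le_max lexx /= ge_max ler01 /=.
by rewrite ge_min lexx orbT.
Qed.

(** Nearest-point projection of the line onto the unit interval. *)
Definition clip (R : realType) (x : R) : I01 R :=
  @exist R (fun y => y \in `[0%R : R, 1%R]%classic) _ (clip_subproof x).

Lemma time_continuous (R : realType) : continuous (@time R).
Proof. exact: initial_continuous. Qed.

Lemma time_itv (R : realType) (t : I01 R) : 0 <= time t <= 1.
Proof. by have := valP t; rewrite inE /= in_itv. Qed.

Lemma clamp_continuous (R : realType) :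
  continuous (fun x : R => Num.max 0 (Num.min x 1)).
Proof.
move=> x; apply: (@continuous_max R R (cst 0) (fun y => Num.min y 1)).
  exact: cvg_cst.
by apply: (@continuous_min R R id (cst 1)); [exact: cvg_id | exact: cvg_cst].
Qed.

Lemma clip_continuous (R : realType) : continuous (@clip R).
Proof. by apply: continuous_comp_initial; exact: clamp_continuous. Qed.

Definition polygonal (R : realType) (V : lmodType R) (x : nat -> V) (u : R) : V :=
  let k := Num.truncn u in x k + (u - k%:R) *: (x k.+1 - x k).

Definition intr_vec (R : realType) (d : nat) (x : zd d) : 'rV[R]_d :=
  map_mx intr (x : 'rV[int]_d).

Definition Zpath (R : realType) (d n : nat) (X : trajectory d) (t : I01 R) :
    'rV[R]_d :=
  (Num.sqrt n%:R)^-1 *: polygonal (fun k => intr_vec R (X k)) (n%:R * time t).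

Lemma polygonalE (R : realType) (V : lmodType R) (x : nat -> V) (N : nat) (u : R) :
  0 <= u <= N%:R ->
  polygonal x u =
  x 0%N + \sum_(k < N.+1) Num.max 0 (Num.min (u - k%:R) 1) *: (x k.+1 - x k).
Proof.
move=> /andP[u0 uN]; rewrite /polygonal; set m := Num.truncn u.
have /andP[mu um] : m%:R <= u < m.+1%:R by rewrite /m truncn_itv.
have mN : (m <= N)%N by rewrite -(ler_nat R) (le_trans mu).
rewrite -(big_mkord xpredT (fun k => Num.max 0 (Num.min (u - k%:R) 1) *:
  (x k.+1 - x k))).
rewrite (big_cat_nat (n := m)) //=; last exact: leq_trans mN _.
rewrite [X in _ + (X + _)](_ : _ = x m - x 0%N); last first.
  rewrite -telescope_sumr // big_nat_cond [RHS]big_nat_cond.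
  apply: eq_bigr => k; rewrite andbT => /andP[_ km].
  have : k.+1%:R <= u by rewrite (le_trans _ mu) // ler_nat.
  rewrite -natr1 -lerBrDl => ku; rewrite min_r // max_r ?scale1r //.
rewrite big_nat_recl //= big_nat_cond big1 ?addr0; last first.
  move=> k; rewrite andbT => /andP[mk _].
  have uk : u - k.+1%:R <= 0.
    by rewrite subr_le0 (le_trans (ltW um)) // ler_nat ltnS.
  rewrite min_l ?max_l ?scale0r // (le_trans uk) //.
rewrite min_l; last by rewrite lerBlDr addrC natr1 ltW.
by rewrite max_r ?subr_ge0 // addrA [x 0%N + _]addrC subrK.
Qed.

Lemma Zpath_continuous (R : realType) (d n : nat) (X : trajectory d) :
  continuous (@Zpath R d n X).
Proof.
pose x k := intr_vec R (X k).
have -> : @Zpath R d n X = fun t => (Num.sqrt n%:R)^-1 *: (x 0%N +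
    \sum_(k < n.+1) Num.max 0 (Num.min (n%:R * time t - k%:R) 1) *:
      (x k.+1 - x k)).
  apply/funext => t; rewrite /Zpath (@polygonalE _ _ _ n) //.
  have /andP[t0 t1] := time_itv t.
  by rewrite mulr_ge0 ?ler0n //= ler_piMr ?ler0n.
move=> t; apply: (@continuous_comp _ _ _ (@time R) (fun u => (Num.sqrt n%:R)^-1 *:
  (x 0%N + \sum_(k < n.+1) Num.max 0 (Num.min (n%:R * u - k%:R) 1) *:
    (x k.+1 - x k)))).
  exact: time_continuous.
apply: cvgZl_tmp; apply: cvgD; first exact: cvg_cst.
apply: cvg_big => [|k _]; first exact: add_continuous.
apply: cvgZr_tmp.
have kc : continuous (fun u : R => n%:R * u - k%:R).
  move=> u; apply: cvgB; last exact: cvg_cst.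
  by apply: cvgM; [exact: cvg_cst | exact: cvg_id].
exact: (continuous_comp_fun kc (@clamp_continuous R)).
Qed.

Lemma linear_rV_continuous (R : realType) (m n : nat)
    (D : {linear 'rV[R]_m -> 'rV[R]_n}) : continuous D.
Proof.
have -> : (D : _ -> _) = fun v => \sum_(i < m) v 0 i *: D (delta_mx 0 i).
  apply/funext => v; rewrite [in LHS](row_sum_delta v) linear_sum.
  by apply: eq_bigr => i _; rewrite linearZ.
apply: continuous_big => [|i _]; first exact: add_continuous.
have cz : continuous (fun a : R => a *: D (delta_mx 0 i)).
  by move=> a; apply: cvgZr_tmp; exact: cvg_id.
exact: (continuous_comp_fun (@coord_continuous R 1 m 0 i) cz).
Qed.

Lemma DZpath_continuous (R : realType) (d n : nat)
    (D : {linear 'rV[R]_d -> 'rV[R]_d}) (X : trajectory d) :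
  continuous (fun t : I01 R => D (Zpath n X t)).
Proof.
exact: (continuous_comp_fun (@Zpath_continuous R d n X)
  (@linear_rV_continuous R d d D)).
Qed.

Definition DZ (R : realType) (d : nat) (D : {linear 'rV[R]_d -> 'rV[R]_d})
    (n : nat) (X : trajectory_space d) : borel (C01 'rV[R]_d) :=
  mkcts (@DZpath_continuous R d n D X) : C01 'rV[R]_d.

Lemma measurable_prefix (d : nat) N (P : trajectory d -> Prop) :
  (forall X Y : trajectory d, (forall k, (k <= N)%N -> X k = Y k) -> P X -> P Y) ->
  measurable ([set X | P X] : set (trajectory_space d)).
Proof.
move=> NP.
pose F (s : N.+1.-tuple 'rV[int]_d) := [set X : trajectory_space d |
  P (fun k => nth 0 s k) /\ forall k, (k <= N)%N -> X k = nth 0 s k].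
have -> : [set X | P X] = \bigcup_s F s.
  apply/seteqP; split => [X PX | X [s _ [Ps Xs]]]; last first.
    by apply: NP Ps => k kN; rewrite Xs.
  pose s := [tuple (X i : 'rV[int]_d) | i < N.+1].
  have E k : (k <= N)%N -> X k = nth 0 s k.
    by move=> kN; rewrite -(tnth_nth 0 s (Ordinal (kN : (k < N.+1)%N))) tnth_mktuple.
  by exists s => //; split=> //; apply: NP PX.
apply: countable_bigcupT_measurable => [|s]; first exact: countableP.
have [Ps|nPs] := pselect (P (fun k => nth 0 s k)); last first.
  by rewrite (_ : F s = set0) //; apply/seteqP; split => // X [].
rewrite (_ : F s = \bigcap_(k in `I_N.+1) [set X : trajectory_space d | X k = nth 0 s k]).
  apply: bigcap_measurableType => k _.
  by apply: sub_sigma_algebra; exists k, (nth 0 s k).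
by apply/seteqP; split => [X [_ Xs] // | X Xs]; split.
Qed.

Lemma DZ_local (R : realType) (d : nat) (D : {linear 'rV[R]_d -> 'rV[R]_d})
    (n : nat) (X Y : trajectory d) :
  (forall k, (k <= n.+1)%N -> X k = Y k) -> DZ D n X = DZ D n Y.
Proof.
move=> XY; apply/continuousEP => t /=; congr (D _).
rewrite /Zpath /polygonal; congr (_ *: _).
have /andP[t0 t1] := time_itv t.
have kn : (Num.truncn (n%:R * time t) <= n)%N.
  rewrite -ltnS truncn_lt_nat ?mulr_ge0 //.
  by rewrite (@le_lt_trans _ _ n%:R) ?ltr_nat // ler_piMr.
by rewrite !XY // ltnW.
Qed.

Lemma measurable_DZ (R : realType) (d : nat)
    (D : {linear 'rV[R]_d -> 'rV[R]_d}) (n : nat) :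
  measurable_fun [set: trajectory_space d] (DZ D n).
Proof.
move=> _ A mA; rewrite setTI.
apply: (@measurable_prefix d n.+1 (fun X => A (DZ D n X))) => X Y XY.
by rewrite (DZ_local D XY).
Qed.

HB.instance Definition _ (R : realType) (d : nat)
    (D : {linear 'rV[R]_d -> 'rV[R]_d}) (n : nat) :=
  isMeasurableFun.Build _ _ _ _ (DZ D n) (measurable_DZ D n).

Lemma measurable_stay_positive (d n : nat) : measurable (@stay_positive d n).
Proof.
apply: (@measurable_prefix d.+1 n) => X Y XY XL k /andP[k0 kn].
by rewrite -XY //; apply: XL; rewrite k0.
Qed.

(** [Q] conditioned on [L]; the fallback measure given to [mnormalize] only
    matters when [Q L = 0]. *)
Definition conditional (dT : measure_display) (T : measurableType dT)
    (R : realType) (Q : probability T R) (L : set T) (mL : measurable L) :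
    probability T R :=
  mnormalize (mrestr Q mL) Q.

Definition mu_cond (R : realType) (d : nat)
    (D : {linear 'rV[R]_d.+1 -> 'rV[R]_d.+1})
    (Q : probability (trajectory_space d.+1) R) (n : nat) :
    probability (borel (C01 'rV[R]_d.+1)) R :=
  distribution (conditional Q (@measurable_stay_positive d n)) (DZ D n).

Definition mutually_independent (dT : measure_display) (T : measurableType dT)
    (R : realType) (P : probability T R) (J : finType) (X : J -> T -> R) : Prop :=
  forall A : J -> set R, (forall j, measurable (A j)) ->
    P [set w | forall j, A j (X j w)] = (\prod_j P (X j @^-1` A j))%E.

(** [B i t] is the [i]-th coordinate at time [t]; path continuity is not part of
    the definition, which is only applied to processes valued in [C([0,1])]. *)
Definition standard_BM (dT : measure_display) (T : measurableType dT)
    (R : realType) (P : probability T R) (k : nat)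
    (B : 'I_k -> I01 R -> T -> R) : Prop :=
  [/\ P [set w | forall i, B i (clip 0) w = 0] = 1%E,
      forall (m : nat) (t : 'I_m.+1 -> I01 R),
        (forall i j : 'I_m.+1, (i < j)%N -> time (t i) < time (t j)) ->
        mutually_independent P (fun (ij : 'I_k * 'I_m) (w : T) =>
          B ij.1 (t (lift ord0 ij.2)) w - B ij.1 (t (widen_ord (leqnSn m) ij.2)) w)
    & forall (i : 'I_k) (s t : I01 R), time s < time t ->
        forall A : set R, measurable A ->
          P [set w | A (B i t w - B i s w)] =
          normal_prob 0 (Num.sqrt (time t - time s)) A].

Definition wiener_measure (R : realType) (k : nat)
    (mu : probability (borel (C01 'rV[R]_k)) R) : Prop :=
  standard_BM mu (fun i t (w : C01 'rV[R]_k) => w t 0 i).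

Definition wiener_measure1 (R : realType)
    (mu : probability (borel (C01 R)) R) : Prop :=
  standard_BM mu (fun (_ : 'I_1) t (w : C01 R) => w t).

Definition last_zero (R : realType) (w : I01 R -> R) : R :=
  sup [set time s | s in [set s | w s = 0]].

(** [tau + s * delta] lies in the unit interval, so [clip] only serves to type
    it as a time. *)
Definition meander_fun (R : realType) (w : I01 R -> R) (s : I01 R) : R :=
  let tau := last_zero w in let delta := 1 - tau in
  (Num.sqrt delta)^-1 * `|w (clip (tau + time s * delta))|.

Lemma meander_continuous (R : realType) (w : C01 R) :
  continuous (meander_fun w).
Proof.
rewrite /meander_fun; set tau := last_zero w.
have ca : continuous (fun u : R => tau + u * (1 - tau)).
  move=> u; apply: cvgD; first exact: cvg_cst.
  by apply: cvgM; [exact: cvg_id | exact: cvg_cst].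
have cn : continuous (fun y : R => (Num.sqrt (1 - tau))^-1 * `|y|).
  by move=> y; apply: cvgM; [exact: cvg_cst | exact: norm_continuous].
have cs := continuous_comp_fun (@time_continuous R) ca.
have cw := continuous_comp_fun cs (@clip_continuous R).
exact: (continuous_comp_fun (continuous_comp_fun cw (@cts_fun _ _ w)) cn).
Qed.

Definition meander (R : realType) (w : C01 R) : C01 R :=
  mkcts (@meander_continuous R w).

Definition meander_law (R : realType) (mu : probability (borel (C01 R)) R) : Prop :=
  exists2 W : probability (borel (C01 R)) R, wiener_measure1 W &
    forall A : set (borel (C01 R)), measurable A -> mu A = W (@meander R @^-1` A).

Lemma head_continuous (R : realType) (d : nat) (w : C01 'rV[R]_d.+1) :
  continuous (fun t => w t 0 0).
Proof.
exact: (continuous_comp_fun (@cts_fun _ _ w) (@coord_continuous R 1 d.+1 0 0)).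
Qed.

Definition head_path (R : realType) (d : nat) (w : C01 'rV[R]_d.+1) : C01 R :=
  mkcts (@head_continuous R d w).

Definition tail_fun (R : realType) (d : nat) (v : 'rV[R]_d.+1) : 'rV[R]_d :=
  \row_j v 0 (lift ord0 j).

Lemma tail_fun_is_linear (R : realType) (d : nat) : linear (@tail_fun R d).
Proof. by move=> a u v; apply/rowP => j; rewrite !mxE. Qed.

HB.instance Definition _ (R : realType) (d : nat) :=
  GRing.isLinear.Build R 'rV[R]_d.+1 'rV[R]_d _ (@tail_fun R d)
    (@tail_fun_is_linear R d).

Lemma tail_continuous (R : realType) (d : nat) (w : C01 'rV[R]_d.+1) :
  continuous (fun t => tail_fun (w t)).
Proof.
exact: (continuous_comp_fun (@cts_fun _ _ w)
  (@linear_rV_continuous R _ _ (@tail_fun R d))).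
Qed.

Definition tail_path (R : realType) (d : nat) (w : C01 'rV[R]_d.+1) :
    C01 'rV[R]_d := mkcts (@tail_continuous R d w).

(** [nu = P1 \otimes P2] under the identification of [C([0,1], R^(d+1))] with
    [C([0,1], R) x C([0,1], R^d)]. *)
Definition product_law (R : realType) (d : nat)
    (nu : probability (borel (C01 'rV[R]_d.+1)) R)
    (P1 : probability (borel (C01 R)) R)
    (P2 : probability (borel (C01 'rV[R]_d)) R) : Prop :=
  forall (A : set (borel (C01 R))) (B : set (borel (C01 'rV[R]_d))),
    measurable A -> measurable B ->
    nu [set w | A (head_path w) /\ B (tail_path w)] = (P1 A * P2 B)%E.

(* Main.v *)
(* Let the slab be [0 <= x_1 <= H].  De Giorgi truncation, run through a Caccioppoli and a
   discrete Faber-Krahn inequality, bounds positive subsolutions by their averages, and a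
   logarithmic energy estimate shows that the walk started at height one is much more
   likely to reach height [H] before returning to [0] than to linger below it for a time
   of order [H^2].  By stationarity and the maximal inequality the quenched invariance
   principle holds uniformly over all starting points at distance [O(sqrt n)].  Hence,
   conditionally on survival, the walk reaches a small multiple of [sqrt n] after a short
   time and then looks like a Brownian motion kept positive, so the conditional
   expectation of a functional [F] is close to a constant [a], uniformly over all starting
   points of height [0].  Decomposing the unconditioned path, positive at time [n], at its
   last visit to height [0] expresses the expectation of [F] of the Brownian path after
   the last zero of its first coordinate through the same [a].  That path is a meander
   times an independent Brownian motion, which identifies [a]. *)
Require Import Defs.
From HB Require Import structures.
From mathcomp Require Import all_boot all_order all_algebra.
From mathcomp Require Import reals sequences exp.
From mathcomp Require Import ring lra zify.
Set Implicit Arguments.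
Unset Strict Implicit.
Unset Printing Implicit Defensive.
Import Order.TTheory GRing.Theory Num.Theory.
Local Open Scope ring_scope.

(** The conditioning event becomes negligible as [n] grows, so an error that is merely small says
    nothing: every bound must carry the survival probability [surv c n y] itself as a factor. No
    asymptotics of that probability are derived; relative errors come from a competition of scales
    governed by one integer [m]. From height about [m^-4 * sqrt n] survival costs only a factor of
    order [m^-4], whereas lingering below that height is exponentially small in [m] compared with
    reaching it. The resulting constant [a] is not the limit: it depends on the tolerance, but
    neither on the starting point nor on [n], which is why one unconditioned path suffices to
    determine it. The path after the last zero is not a continuous functional, so the invariance
    principle is needed for functionals continuous off a Wiener-null set; they are approximated by
    members of a countable family fixed in advance, so that a single null set of environments serves
    them all. The walk is handled through finite sums over lists of sites, which turns the Markov
    property into list algebra and makes measurability in the environment immediate. *)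

Lemma le_of_eq {disp : Order.disp_t} {T : porderType disp} (x y : T) : x = y -> (x <= y)%O.
Proof. by move->. Qed.

(** * Sup norm, boxes and a discrete Faber-Krahn inequality *)

Section LatticeGeometry.
Variable d : nat.
Local Notation pt := 'rV[int]_d.+1.
Implicit Types x y z h k : pt.

Definition step : Type := ('I_d.+1 * bool)%type.
HB.instance Definition _ := Finite.on step.

Definition dir (s : step) : pt :=
  if s.2 then delta_mx 0 s.1 else - delta_mx 0 s.1.

Definition flip (s : step) : step := (s.1, ~~ s.2).

Lemma flipK : involutive flip.
Proof. by case=> i b; rewrite /flip /= negbK. Qed.

Lemma dir_flip s : dir (flip s) = - dir s.
Proof. by case: s => i []; rewrite /dir /= ?opprK. Qed.

Lemma coordD x y i : (x + y) ord0 i = (x ord0 i : int) + (y ord0 i : int).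
Proof. by rewrite mxE. Qed.

Lemma coordN x i : (- x) ord0 i = - (x ord0 i : int).
Proof. by rewrite mxE. Qed.

Definition nrm (x : pt) : nat := \max_(i < d.+1) `|x ord0 i|%N.

Lemma nrm_leP (x : pt) n : reflect (forall i, (`|x ord0 i| <= n)%N) (nrm x <= n)%N.
Proof.
apply: (iffP (bigmax_leqP _ _ _)) => H i; first exact: H.
by move=> _; apply: H.
Qed.

Lemma nrm_coord (x : pt) i : (`|x ord0 i| <= nrm x)%N.
Proof. by move/nrm_leP: (leqnn (nrm x)). Qed.

Lemma nrm0 : nrm 0 = 0%N.
Proof. by apply/eqP; rewrite -leqn0; apply/nrm_leP => i; rewrite mxE. Qed.

Lemma nrmN x : nrm (- x) = nrm x.
Proof. by apply: eq_bigr => i _; rewrite mxE abszN. Qed.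

Lemma nrmD x y : (nrm (x + y) <= nrm x + nrm y)%N.
Proof.
apply/nrm_leP => i; rewrite coordD.
have := nrm_coord x i; have := nrm_coord y i; lia.
Qed.

Lemma nrmB x y : (nrm (x - y) <= nrm x + nrm y)%N.
Proof. by rewrite -[nrm y]nrmN nrmD. Qed.

Lemma nrmC x y : nrm (x - y) = nrm (y - x).
Proof. by rewrite -opprB nrmN. Qed.

Lemma nrm_delta i : nrm (delta_mx 0 i) = 1%N.
Proof.
apply/eqP; rewrite eqn_leq; apply/andP; split.
  by apply/nrm_leP => j; rewrite mxE; case: andb.
by apply: leq_trans (nrm_coord _ i); rewrite mxE !eqxx.
Qed.

Lemma nrm_dir s : nrm (dir s) = 1%N.
Proof. by case: s => i []; rewrite /dir /= ?nrmN nrm_delta. Qed.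

Lemma nrm_step x s : (nrm (x + dir s) <= (nrm x).+1)%N.
Proof. by apply: leq_trans (nrmD _ _) _; rewrite nrm_dir addn1. Qed.

Lemma nrm_step_ge x s : (nrm x <= (nrm (x + dir s)).+1)%N.
Proof.
by have := nrmB (x + dir s) (dir s); rewrite addrK nrm_dir addn1.
Qed.

Definition box_pt (N : nat) (f : {ffun 'I_d.+1 -> 'I_(N + N).+1}) : pt :=
  \row_i ((f i : nat)%:Z - N%:Z).

Lemma box_ptE N (f : {ffun 'I_d.+1 -> 'I_(N + N).+1}) i :
  box_pt f ord0 i = (f i : nat)%:Z - N%:Z.
Proof. by rewrite mxE. Qed.

Definition box (N : nat) : seq pt :=
  [seq box_pt f | f <- enum {: {ffun 'I_d.+1 -> 'I_(N + N).+1}}].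

Lemma box_uniq N : uniq (box N).
Proof.
rewrite map_inj_uniq ?enum_uniq // => f g fg.
apply/ffunP => i; apply: val_inj => /=; have := box_ptE f i.
by rewrite fg box_ptE => /addIr [].
Qed.

Lemma mem_box N x : (x \in box N) = (nrm x <= N)%N.
Proof.
apply/mapP/nrm_leP => [[f _ ->] i | H].
  by rewrite box_ptE; move: (ltn_ord (f i)); move: (nat_of_ord (f i)) => a; lia.
have P i : (`|((x ord0 i : int) + N%:Z)%R| < (N + N).+1)%N by have := H i; lia.
exists [ffun i => Ordinal (P i)]; first by rewrite mem_enum.
apply/rowP => i; rewrite box_ptE ffunE /=; have := H i.
by move: (x ord0 i : int) => a; lia.
Qed.

Lemma size_box N : size (box N) = ((N + N).+1 ^ d.+1)%N.
Proof. by rewrite size_map -cardE card_ffun !card_ord. Qed.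

Section Sums.
Variable R : realType.
Implicit Types f g : pt -> R.

Definition bsum N f : R := \sum_(x <- box N) f x.

(** Sums over the lattice are replaced by sums over a box. Once the box contains both the support
    and its translate, summation is exactly invariant under the shift, so no boundary term appears;
    this is why later bounds carry a support radius [M] and a box radius [N]. *)
Lemma bsum_shift N M h f : (forall x, f x != 0 -> (nrm x <= M)%N) ->
  (M + nrm h <= N)%N -> bsum N (fun x => f (x + h)) = bsum N f.
Proof.
move=> fM MN; rewrite /bsum.
rewrite (bigID (fun x => f (x + h) != 0)) /= [X in _ + X]big1 ?addr0; last first.
  by move=> x; rewrite negbK => /eqP.
rewrite [RHS](bigID (fun x => f x != 0)) /= [X in _ = _ + X]big1 ?addr0; last first.
  by move=> x; rewrite negbK => /eqP.
rewrite -big_filter -[RHS]big_filter -(big_map (+%R^~ h) xpredT f).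
apply: perm_big; apply: uniq_perm.
- by rewrite map_inj_uniq; [exact: filter_uniq (box_uniq _) | exact: addIr].
- exact: filter_uniq (box_uniq _).
move=> x; rewrite mem_filter mem_box; apply/mapP/andP => [[y]|[fx _]].
  rewrite mem_filter => /andP[fy _] ->; split=> //.
  by apply: leq_trans (fM _ fy) _; lia.
exists (x - h); last by rewrite subrK.
rewrite mem_filter subrK fx mem_box.
by apply: leq_trans (nrmB _ _) _; have := fM _ fx; lia.
Qed.

Lemma ler_bsum N f g : (forall x, f x <= g x) -> bsum N f <= bsum N g.
Proof. by move=> fg; apply: ler_sum => x _; apply: fg. Qed.

Lemma bsum_ge0 N f : (forall x, 0 <= f x) -> 0 <= bsum N f.
Proof. by move=> f0; apply: sumr_ge0 => x _; apply: f0. Qed.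

(* At least half of the shifts [h] in a cube of twice the volume of the support of
   [g] leave the support, so the average of [(g x - g (x + h))^2] controls [g x ^ 2]. *)
Section FaberKrahn.
Variables (g : pt -> R) (M N : nat).
Hypothesis gM : forall x, g x != 0 -> (nrm x <= M)%N.

Definition sqinc h := bsum N (fun x => (g x - g (x + h)) ^+ 2).

Definition inc_energy := \sum_(i < d.+1) sqinc (delta_mx 0 i).

Lemma sqinc_ge0 h : 0 <= sqinc h.
Proof. by apply: bsum_ge0 => x; apply: sqr_ge0. Qed.

Lemma sqinc_supp h x : (g x - g (x + h)) ^+ 2 != 0 -> (nrm x <= M + nrm h)%N.
Proof.
move=> H; case: (boolP (g x == 0)) => [/eqP g0|/gM]; last lia.
have : g (x + h) != 0 by apply: contraNneq H => ->; rewrite g0 subr0 expr0n.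
move=> /gM H1; rewrite -[x](addrK h); by apply: leq_trans (nrmB _ _) _; rewrite leq_add2r.
Qed.

(** The triangle inequality for the quadratic mean, kept free of square roots: Young's inequality
    with weights [m / n] and [n / m] has the defect [(m a - n b)^2 / (n m)], and with these weights
    the constants add up to [(n + m)^2] exactly. *)
Lemma sqincD n m h k : (0 < n)%N -> (0 < m)%N ->
  (M + nrm k + nrm h <= N)%N ->
  sqinc h <= n%:R ^+ 2 * inc_energy -> sqinc k <= m%:R ^+ 2 * inc_energy ->
  sqinc (h + k) <= (n + m)%:R ^+ 2 * inc_energy.
Proof.
move=> n0 m0 Nl Hh Hk.
have n0' : (0 : R) < n%:R by rewrite ltr0n.
have m0' : (0 : R) < m%:R by rewrite ltr0n.
have Sk : bsum N (fun x => (g (x + h) - g (x + h + k)) ^+ 2) = sqinc k.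
  exact: (bsum_shift (@sqinc_supp k) Nl).
have : sqinc (h + k) <= (1 + m%:R / n%:R) * sqinc h + (1 + n%:R / m%:R) * sqinc k.
  rewrite -Sk /sqinc /bsum !mulr_sumr -big_split /=; apply: ler_sum => x _.
  rewrite addrA; set a := g x - g (x + h); set b := g (x + h) - g (x + h + k).
  have -> : g x - g (x + h + k) = a + b by rewrite /a /b addrA subrK.
  have -> : (1 + m%:R / n%:R) * a ^+ 2 + (1 + n%:R / m%:R) * b ^+ 2 =
     (a + b) ^+ 2 + (m%:R * a - n%:R * b) ^+ 2 / (n%:R * m%:R).
    by field; rewrite !gt_eqF.
  by rewrite lerDl divr_ge0 ?sqr_ge0 // mulr_ge0 // ltW.
move=> /le_trans; apply.
apply: le_trans (lerD (ler_wpM2l _ Hh) (ler_wpM2l _ Hk)) _.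
- by rewrite addr_ge0 // divr_ge0.
- by rewrite addr_ge0 // divr_ge0.
rewrite natrD; apply: le_of_eq.
by field; rewrite !gt_eqF.
Qed.

(** Closed under addition, so that a point of the cube can be built from unit vectors by induction
    on big sums. Length zero is set apart because the weights in [sqincD] must be positive, and the
    box condition sits inside the implication because it is only known for the total length. *)
Definition small_inc (h : pt) (n : nat) : Prop :=
  (n = 0%N /\ h = 0) \/ ((0 < n)%N /\ ((M + n <= N)%N ->
     (nrm h <= n)%N /\ sqinc h <= n%:R ^+ 2 * inc_energy)).

Lemma small_incD h k n m :
  small_inc h n -> small_inc k m -> small_inc (h + k) (n + m).
Proof.
move=> [[-> ->]|[n0 Hn]]; first by rewrite add0r add0n.
move=> [[-> ->]|[m0 Hm]]; first by rewrite addr0 addn0; right.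
right; split; first by rewrite addn_gt0 n0.
move=> Nl; have [nh Hh] : _ /\ _ := Hn ltac:(lia).
have [nk Hk] : _ /\ _ := Hm ltac:(lia).
split; first by apply: leq_trans (nrmD _ _) _; lia.
by apply: sqincD => //; lia.
Qed.

Lemma small_inc_delta i : small_inc (delta_mx 0 i) 1.
Proof.
right; split=> // _; rewrite nrm_delta; split=> //.
rewrite expr1n mul1r /inc_energy (bigD1 i) //= lerDl.
by apply: sumr_ge0 => j _; apply: sqinc_ge0.
Qed.

Definition cube_pt r (f : {ffun 'I_d.+1 -> 'I_r}) : pt :=
  \sum_i delta_mx 0 i *+ f i.

Lemma cube_ptE r (f : {ffun 'I_d.+1 -> 'I_r}) i : cube_pt f 0 i = (f i : nat)%:Z.
Proof.
rewrite /cube_pt summxE (bigD1 i) //= big1 ?addr0; last first.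
  by move=> j ji; rewrite mulmxnE mxE eqxx eq_sym (negPf ji) mul0rn.
by rewrite mulmxnE mxE !eqxx; apply: natz.
Qed.

Lemma cube_pt_inj r : injective (@cube_pt r).
Proof.
move=> f f' /rowP E; apply/ffunP => i; apply: val_inj => /=.
by have := E i; rewrite !cube_ptE => -[].
Qed.

Lemma small_inc_mul i n : small_inc (delta_mx 0 i *+ n) n.
Proof.
elim: n => [|n IH]; first by left; rewrite mulr0n.
by rewrite mulrSr -[n.+1]addn1; apply: small_incD => //; apply: small_inc_delta.
Qed.

Lemma small_inc_cube r (f : {ffun 'I_d.+1 -> 'I_r}) :
  small_inc (cube_pt f) (\sum_i f i).
Proof.
apply: (big_ind2 small_inc); first by left.
  by move=> h n k m; apply: small_incD.
by move=> i _; apply: small_inc_mul.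
Qed.

Lemma faber_krahn (B : seq pt) (r : nat) : uniq B ->
  (forall x, g x != 0 -> x \in B) -> (0 < r)%N -> (size B * 2 <= r ^ d.+1)%N ->
  (M + d.+1 * r <= N)%N ->
  bsum N (fun x => g x ^+ 2) <= 2 * d.+1%:R ^+ 2 * r%:R ^+ 2 * inc_energy.
Proof.
move=> uB gB r0 Br Nl.
have E0 : 0 <= inc_energy by apply: sumr_ge0 => i _; apply: sqinc_ge0.
have up (f : {ffun 'I_d.+1 -> 'I_r}) :
    sqinc (cube_pt f) <= (d.+1 * r)%:R ^+ 2 * inc_energy.
  have sf : (\sum_i f i <= d.+1 * r)%N.
    apply: (@leq_trans (\sum_(i < d.+1) r)); last by rewrite sum_nat_const card_ord.
    by apply: leq_sum => i _; apply/ltnW.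
  case: (small_inc_cube f) => [[_ ->]|[f0 /(_ ltac:(lia))[_ H]]].
    rewrite /sqinc /bsum big1 ?mulr_ge0 ?sqr_ge0 // => x _.
    by rewrite addr0 subrr expr0n.
  apply: (le_trans H); rewrite ler_wpM2r // lerXn2r ?nnegrE // ler_nat //.
have lo x : g x ^+ 2 * (r ^ d.+1)%:R <=
    2 * \sum_(f : {ffun 'I_d.+1 -> 'I_r}) (g x - g (x + cube_pt f)) ^+ 2.
  pose In := [pred f : {ffun 'I_d.+1 -> 'I_r} | g (x + cube_pt f) != 0].
  have cI : (#|In| <= size B)%N.
    rewrite cardE -(size_map (fun h : {ffun 'I_d.+1 -> 'I_r} => x + cube_pt h)); apply: uniq_leq_size.
      by rewrite map_inj_uniq ?enum_uniq // => h h' /addrI /cube_pt_inj.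
    by move=> y /mapP[h]; rewrite mem_enum => hI ->; apply: gB.
  have cO : (r ^ d.+1 <= 2 * #|[predC In]|)%N.
    have cc := cardC In; rewrite card_ffun !card_ord in cc.
    move: cI Br; rewrite -cc; move: #|In| #|[predC In]| => a b.
    by move=> aB Bab; lia.
  rewrite (bigID (mem [predC In])) /= mulrDr.
  apply: (@le_trans _ _ (2 * \sum_(f in [predC In]) g x ^+ 2)).
    rewrite sumr_const -[g x ^+ 2 *+ _]mulr_natr mulrCA ler_wpM2l ?sqr_ge0 //.
    by rewrite -natrM ler_nat.
  rewrite -[leLHS]addr0 lerD //.
    rewrite ler_pM2l //; apply: ler_sum => f; rewrite !inE negbK => /eqP ->.
    by rewrite subr0.
  by rewrite mulr_ge0 //; apply: sumr_ge0 => f _; apply: sqr_ge0.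
have rp : (0 : R) < (r ^ d.+1)%:R by rewrite ltr0n expn_gt0 r0.
rewrite -(ler_pM2r rp) /bsum mulr_suml.
apply: (le_trans (ler_sum _ (fun x _ => lo x))).
rewrite -mulr_sumr exchange_big /=.
apply: (@le_trans _ _ (2 * \sum_(f : {ffun 'I_d.+1 -> 'I_r})
    (d.+1 * r)%:R ^+ 2 * inc_energy)).
  by rewrite ler_pM2l //; apply: ler_sum => f _; apply: up.
rewrite sumr_const card_ffun !card_ord -mulr_natr natrM le_eqVlt.
by apply/orP; left; apply/eqP; ring.
Qed.

End FaberKrahn.
End Sums.
End LatticeGeometry.

Definition clamp01 (R : realType) (u : R) : R := Num.max 0 (Num.min 1 u).

Lemma clamp01_itv (R : realType) (u : R) : 0 <= clamp01 u <= 1.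
Proof. by rewrite /clamp01 le_max lexx /= ge_max ler01 ge_min lexx. Qed.

Lemma clamp01_eq1 (R : realType) (u : R) : 1 <= u -> clamp01 u = 1.
Proof. by move=> u1; rewrite /clamp01 min_l // max_r. Qed.

Lemma clamp01_eq0 (R : realType) (u : R) : u <= 0 -> clamp01 u = 0.
Proof. by move=> u0; rewrite /clamp01 min_r ?max_l // (le_trans u0). Qed.

Lemma clamp01_id (R : realType) (u : R) : 0 <= u <= 1 -> clamp01 u = u.
Proof. by move=> /andP[u0 u1]; rewrite /clamp01 min_r // max_r. Qed.

Lemma clamp01_lip (R : realType) (u v : R) :
  (clamp01 u - clamp01 v) ^+ 2 <= (u - v) ^+ 2.
Proof.
wlog vu : u v / v <= u.
  move=> H; have [/H//|/ltW/H] := leP v u.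
  by rewrite -(sqrrN (clamp01 v - _)) -(sqrrN (v - u)) !opprB.
rewrite lerXn2r ?nnegrE ?subr_ge0 //.
  by rewrite /clamp01 ge_max !le_max lexx /= le_min !ge_min lexx vu !orbT.
have [u0|u0] := leP u 0; first by rewrite !clamp01_eq0 ?subrr ?subr_ge0 // (le_trans vu).
have /andP[c0 c1] := clamp01_itv v.
have [u1|u1] := leP 1 u.
  rewrite (clamp01_eq1 u1); have [v1|v1] := leP 1 v; first by rewrite clamp01_eq1 //; lra.
  have [v0|v0] := leP v 0; first by rewrite clamp01_eq0 //; lra.
  by rewrite clamp01_id ?(ltW v0) ?(ltW v1) //; lra.
rewrite (@clamp01_id _ u) ?(ltW u0) ?(ltW u1) //.
have [v0|v0] := leP v 0; first by rewrite clamp01_eq0 //; lra.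
by rewrite clamp01_id ?(ltW v0) // (le_trans vu) // ltW.
Qed.

(** * Reversible kernels, the Caccioppoli identity and De Giorgi's local maximum principle *)

Section Kernel.
Variables (R : realType) (d : nat).
Local Notation pt := 'rV[int]_d.+1.
Local Notation D := (d.+1%:R : R).
Implicit Types (x y z : pt) (f g u v : pt -> R) (c : pt -> step d -> R).

(** All that the energy estimates see of an environment: bounds at every edge, and the same weight
    from either end. *)
Definition conductances (kappa : R) c : Prop :=
  (forall x s, kappa <= c x s <= kappa^-1) /\
  (forall x s, c (x + dir s) (flip s) = c x s).

Definition cweight c x : R := \sum_s c x s.

Definition tprob c x (s : step d) : R := c x s / cweight c x.

Definition avg c f x : R := \sum_s tprob c x s * f (x + dir s).

Lemma card_step : #|{: step d}| = (d.+1 * 2)%N.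
Proof. by rewrite card_prod card_ord card_bool. Qed.

Lemma sum_step (F : step d -> R) :
  \sum_s F s = \sum_i (F (i, true) + F (i, false)).
Proof.
transitivity (\sum_(p : 'I_d.+1 * bool) F p); first by [].
rewrite (eq_bigr (fun p => F (p.1, p.2))); last by case.
rewrite -(pair_bigA _ (fun i b => F (i, b))) /=.
by apply: eq_bigr => i _; rewrite big_bool.
Qed.

Section Bounds.
Variables (kappa : R) (c : pt -> step d -> R).
Hypotheses (k0 : 0 < kappa) (cP : conductances kappa c).

Lemma cond_ge x s : kappa <= c x s.
Proof. by case: cP => /(_ x s)/andP[]. Qed.

Lemma cond_le x s : c x s <= kappa^-1.
Proof. by case: cP => /(_ x s)/andP[]. Qed.

Lemma cond_gt0 x s : 0 < c x s.
Proof. exact: lt_le_trans k0 (cond_ge x s). Qed.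

Lemma cond_ge0 x s : 0 <= c x s. Proof. exact/ltW/cond_gt0. Qed.

Lemma cond_sym x s : c (x + dir s) (flip s) = c x s.
Proof. by case: cP. Qed.

Lemma cweight_gt0 x : 0 < cweight c x.
Proof.
rewrite /cweight (bigD1 (ord0, true)) //=.
by rewrite ltr_pwDl ?cond_gt0 // sumr_ge0 // => s _; apply: cond_ge0.
Qed.

Lemma cweight_le x : cweight c x <= 2 * D * kappa^-1.
Proof.
apply: (@le_trans _ _ (\sum_(s : step d) kappa^-1)).
  by apply: ler_sum => s _; apply: cond_le.
by rewrite sumr_const card_step -[leLHS]mulr_natl natrM [D * _]mulrC.
Qed.

Lemma tprob_gt0 x s : 0 < tprob c x s.
Proof. by rewrite divr_gt0 ?cond_gt0 ?cweight_gt0. Qed.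

Lemma tprob_ge0 x s : 0 <= tprob c x s. Proof. exact/ltW/tprob_gt0. Qed.

Lemma tprob_lb x s : kappa ^+ 2 / (2 * D) <= tprob c x s.
Proof.
rewrite /tprob ler_pdivlMr ?cweight_gt0 // mulrAC.
have D0 : 0 < 2 * D by rewrite mulr_gt0 // ltr0n.
rewrite ler_pdivrMr //.
apply: le_trans (ler_wpM2l _ (cweight_le x)) _; first exact: sqr_ge0.
rewrite [leLHS](_ : _ = kappa * (2 * D)).
  by rewrite ler_wpM2r ?cond_ge // ltW.
by field; rewrite gt_eqF.
Qed.

Lemma tprob_sum x : \sum_s tprob c x s = 1.
Proof. by rewrite -mulr_suml divff // gt_eqF ?cweight_gt0. Qed.

Lemma avg_le f g x : (forall s, f (x + dir s) <= g (x + dir s)) ->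
  avg c f x <= avg c g x.
Proof.
by move=> fg; apply: ler_sum => s _; rewrite ler_wpM2l // tprob_ge0.
Qed.

Lemma avg_cst a x : avg c (fun=> a) x = a.
Proof. by rewrite /avg -mulr_suml tprob_sum mul1r. Qed.

Lemma avgD f g x : avg c (fun y => f y + g y) x = avg c f x + avg c g x.
Proof. by rewrite /avg -big_split; apply: eq_bigr => s _; rewrite mulrDr. Qed.

Lemma avgM a f x : avg c (fun y => a * f y) x = a * avg c f x.
Proof. by rewrite /avg mulr_sumr; apply: eq_bigr => s _; rewrite mulrCA. Qed.

Lemma avg_ge0 f x : (forall y, 0 <= f y) -> 0 <= avg c f x.
Proof. by move=> f0; apply: sumr_ge0 => s _; rewrite mulr_ge0 ?tprob_ge0. Qed.

Lemma cweight_avg f x : cweight c x * avg c f x = \sum_s c x s * f (x + dir s).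
Proof.
rewrite /avg mulr_sumr; apply: eq_bigr => s _.
by rewrite /tprob mulrA mulrCA divff ?mulr1 // gt_eqF ?cweight_gt0.
Qed.

(** Reversibility. Flipping the step and translating the base point replaces each oriented edge by
    its reverse, and the symmetry of [c] keeps the weight; this is the summation by parts behind all
    energy identities below. *)
Lemma edge_sum_swap N M (G : pt -> pt -> R) :
  (forall x s, G x (x + dir s) != 0 -> (nrm x <= M)%N) -> (M + 1 <= N)%N ->
  bsum N (fun x => \sum_s c x s * G x (x + dir s)) =
  bsum N (fun x => \sum_s c x s * G (x + dir s) x).
Proof.
move=> GM MN; rewrite /bsum exchange_big [RHS]exchange_big /=.
rewrite [RHS](reindex_inj (inv_inj (@flipK d))) /=; apply: eq_bigr => s _.
pose f x := c x s * G x (x + dir s).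
rewrite -[LHS]/(bsum N f) -(@bsum_shift _ _ N M (- dir s) f).
- by apply: eq_bigr => x _; rewrite /f subrK -cond_sym subrK dir_flip.
- by move=> x; rewrite mulf_eq0 negb_or => /andP[_] /GM.
- by rewrite nrmN nrm_dir.
Qed.

Definition energy N f : R :=
  bsum N (fun x => \sum_s c x s * (f x - f (x + dir s)) ^+ 2).

Lemma inc_energy_le N f : kappa * inc_energy f N <= energy N f.
Proof.
rewrite /inc_energy mulr_sumr /energy /bsum exchange_big /= sum_step.
apply: ler_sum => i _; rewrite -[leLHS]addr0 lerD //.
  rewrite /sqinc /bsum mulr_sumr; apply: ler_sum => x _.
  by rewrite ler_wpM2r ?sqr_ge0 ?cond_ge.
by apply: sumr_ge0 => x _; rewrite mulr_ge0 ?sqr_ge0 ?cond_ge0.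
Qed.

(** An identity rather than an inequality. On one edge, [(phi_x f_x - phi_y f_y)^2] equals [(f_x -
    f_y) (phi_x^2 f_x - phi_y^2 f_y) + f_x f_y (phi_x - phi_y)^2]; reversibility turns the first
    term into twice a sum over vertices containing [f - avg c f], and that is where a subsolution
    gains. *)
Lemma caccioppoli N M (phi f : pt -> R) :
  (forall x, phi x != 0 -> (nrm x <= M)%N) -> (M + 1 <= N)%N ->
  energy N (fun x => phi x * f x) =
  2 * bsum N (fun x => cweight c x * (phi x ^+ 2 * f x) * (f x - avg c f x)) +
  bsum N (fun x => \sum_s c x s * (f x * f (x + dir s) *
    (phi x - phi (x + dir s)) ^+ 2)).
Proof.
move=> pM MN.
pose G x y := (f x - f y) * (phi x ^+ 2 * f x).
have GM x s : G x (x + dir s) != 0 -> (nrm x <= M)%N.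
  by rewrite /G mulrA !mulf_eq0 orbb !negb_or => /andP[/andP[_ /pM]].
have S := edge_sum_swap GM MN.
rewrite mulrDl mul1r.
have E : bsum N (fun x => cweight c x * (phi x ^+ 2 * f x) * (f x - avg c f x)) =
    bsum N (fun x => \sum_s c x s * G x (x + dir s)).
  apply: eq_bigr => x _.
  rewrite [LHS](_ : _ = phi x ^+ 2 * f x *
    (cweight c x * f x - cweight c x * avg c f x)); last by ring.
  rewrite cweight_avg /cweight !mulr_suml -sumrB mulr_sumr.
  by apply: eq_bigr => s _; rewrite /G; ring.
rewrite E {2}S -!big_split; apply: eq_bigr => x _; rewrite -!big_split /=.
by apply: eq_bigr => s _; rewrite /G; ring.
Qed.

End Bounds.

Section LocalMaximum.
Variables (kappa : R) (k0 : 0 < kappa).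

(** The second bound makes one step of the iteration contract: Faber-Krahn with a cube of side at
    most [2 * c0 * rad / t] contributes [8 * c0^2], the energy bound contributes [136], and
    [8 * 136 = 1088] is a quarter of [4352]. The bound by [8^-1] keeps the cutoff at least one
    lattice step wide. *)
Definition dg_gap : R := Num.min (8^-1) (kappa ^+ 2 / (4352 * D ^+ 3 * 2 ^+ d.+1)).
Local Notation c0 := dg_gap.

Lemma dg_gap_gt0 : 0 < c0.
Proof.
by rewrite lt_min invr_gt0 ltr0n /= divr_gt0 ?exprn_gt0 // !mulr_gt0 ?exprn_gt0 ?ltr0n.
Qed.

Lemma dg_gap_le8 : c0 <= 8^-1. Proof. by rewrite ge_min lexx. Qed.

Lemma dg_gap_sq : 1088 * D ^+ 3 * kappa ^- 2 * c0 ^+ 2 <= 4^-1 * 2 ^- d.+1.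
Proof.
have c0p := dg_gap_gt0.
have c1 : c0 <= 1 by apply: le_trans dg_gap_le8 _; rewrite invf_le1 // ler1n.
apply: (@le_trans _ _ (1088 * D ^+ 3 * kappa ^- 2 * c0)).
  rewrite ler_wpM2l //; last by rewrite expr2 ler_piMr // ltW.
  by rewrite !mulr_ge0 ?exprn_ge0 // invr_ge0 sqr_ge0.
apply: (@le_trans _ _ (1088 * D ^+ 3 * kappa ^- 2 *
    (kappa ^+ 2 / (4352 * D ^+ 3 * 2 ^+ d.+1)))).
  rewrite ler_wpM2l ?ge_min ?lexx ?orbT //.
  by rewrite !mulr_ge0 ?exprn_ge0 // invr_ge0 sqr_ge0.
apply: le_of_eq.
have gen (A B k : R) : A != 0 -> B != 0 -> k != 0 ->
  1088 * A ^+ 3 * k ^- 2 * (k ^+ 2 / (4352 * A ^+ 3 * B)) = 4^-1 * B^-1.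
  by move=> A0 B0 kn; field; rewrite A0 B0.
by apply: gen; rewrite ?pnatr_eq0 ?expf_neq0 ?pnatr_eq0 // gt_eqF.
Qed.

Section Iteration.
Variables (c : pt -> step d -> R) (v : pt -> R) (rad : nat) (a K : R).
Hypotheses (cP : conductances kappa c) (rad0 : (0 < rad)%N) (K0 : 0 < K).
Hypotheses (v0 : forall x, 0 <= v x) (aK : a * rad%:R ^+ 2 <= K) (a0 : 0 <= a).
Hypothesis vsub : forall x, (nrm x <= rad)%N -> 0 < v x -> v x <= avg c v x + a.
Let N := (rad + d.+1 * rad + 2)%N.
(** De Giorgi's scheme with [t = 2 ^ j]: the levels increase to [K], the radii shrink to [rad / 2],
    and [mass t] is the squared excess over the current level in the current ball. *)
Let lev (t : R) := K * (1 - t^-1).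
Let rr (t : R) := rad%:R / 2 * (1 + t^-1).
Let trunc (k : R) x := Num.max 0 (v x - k).
Let mass (t : R) :=
  bsum N (fun x => if (nrm x)%:R <= rr t then trunc (lev t) x ^+ 2 else 0).
Let high (t : R) :=
  [seq x <- box d rad | ((nrm x)%:R <= rr t) && (lev (2 * t) < v x)].

Lemma rr_le t : 1 <= t -> rr t <= rad%:R.
Proof.
move=> t1; have t0 : 0 < t by apply: lt_le_trans t1.
have ti : t^-1 <= 1 by rewrite invf_le1.
rewrite /rr; have : (0 : R) <= rad%:R by []. nra.
Qed.

Lemma levS t : 0 < t -> lev (2 * t) = lev t + K / (2 * t).
Proof. by move=> t0; rewrite /lev; field; rewrite gt_eqF. Qed.

Lemma trunc_high t x : 0 < t -> lev (2 * t) < v x ->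
  [/\ trunc (lev t) x = v x - lev t, trunc (lev (2 * t)) x = v x - lev (2 * t)
    & K / (2 * t) <= v x - lev t].
Proof.
move=> t0; rewrite levS // => h.
have Kt : 0 < K / (2 * t) by rewrite divr_gt0 // mulr_gt0.
rewrite /trunc max_r; last by move: h Kt; lra.
rewrite max_r; last by move: h Kt; lra.
by split=> //; move: h; lra.
Qed.

Lemma trunc_low k x : v x <= k -> trunc k x = 0.
Proof. by move=> vk; rewrite /trunc max_l // subr_le0. Qed.

Lemma trunc_ge0 k x : 0 <= trunc k x. Proof. by rewrite /trunc le_max lexx. Qed.

Lemma mass_ge0 t : 0 <= mass t.
Proof. by apply: bsum_ge0 => x; case: ifP => // _; apply: sqr_ge0. Qed.

(** Chebyshev: where [v] exceeds the next level, its excess over the current one is at least the gap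
    [K / (2 * t)]. *)
Lemma size_high t : 0 < t -> 1 <= t ->
  (size (high t))%:R * (K / (2 * t)) ^+ 2 <= mass t.
Proof.
move=> t0 t1; have Kt : 0 < K / (2 * t) by rewrite divr_gt0 // mulr_gt0.
have -> : (size (high t))%:R * (K / (2 * t)) ^+ 2 =
    \sum_(x <- high t) (K / (2 * t)) ^+ 2.
  by rewrite big_const_seq count_predT iter_addr_0 mulr_natl.
rewrite /mass /bsum /high big_filter.
rewrite [leRHS](bigID (fun x => (nrm x <= rad)%N)) /=.
rewrite -[leLHS]addr0 lerD //; last first.
  by apply: sumr_ge0 => x _; case: ifP => // _; apply: sqr_ge0.
rewrite -[leRHS]big_filter.
have pm : perm_eq [seq x <- box d N | (nrm x <= rad)%N] (box d rad).
  apply: uniq_perm; rewrite ?filter_uniq ?box_uniq // => x.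
  rewrite mem_filter !mem_box; apply/andP/idP => [[]//|h]; split => //.
  by apply: leq_trans h _; rewrite /N -addnA leq_addr.
rewrite (perm_big _ pm) /= big_mkcond /=; apply: ler_sum => x _.
case: ifP => [/andP[-> /(trunc_high t0)[-> _ h]]|_].
  by rewrite lerXn2r // nnegrE ltW // (lt_le_trans Kt).
by case: ifP => // _; apply: sqr_ge0.
Qed.

Lemma trunc_sub k x : 0 <= k -> (nrm x <= rad)%N -> 0 < trunc k x ->
  trunc k x <= avg c (trunc k) x + a.
Proof.
move=> kp xr; rewrite [in X in X -> _]/trunc lt_max ltxx /= => vk.
have -> : trunc k x = v x - k by rewrite /trunc max_r // ltW.
have vx : 0 < v x by lra.
have sub := vsub xr vx.
have : avg c v x - k <= avg c (trunc k) x.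
  rewrite -[X in _ - X](avg_cst k0 cP k x) -mulN1r -avgM -avgD.
  by apply: (avg_le k0 cP) => s; rewrite mulN1r /trunc le_max lexx orbT.
lra.
Qed.

(** The truncation at the next level lives on [high t], a set so small that Faber-Krahn applies with
    a cube of side about [c0 * rad / t]; its energy is bounded by the mass at the current level
    through Caccioppoli. The powers of [t] cancel, which leaves a fixed contraction. *)
Lemma mass_step t : 1 <= t -> 1 <= c0 * rad%:R / t ->
  (size (high t))%:R * 2 <= (c0 * rad%:R / t) ^+ d.+1 ->
  mass (2 * t) <= 4^-1 * 2 ^- d.+1 * mass t.
Proof.
move=> t1 ct hB; have t0 : 0 < t by apply: lt_le_trans t1.
have radp : (0 : R) < rad%:R by rewrite ltr0n.
have c0p := dg_gap_gt0.
pose w := rad%:R / (8 * t).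
have w1 : 1 <= w.
  have -> : w = 8^-1 * rad%:R / t by rewrite /w; field; rewrite gt_eqF.
  by apply: (le_trans ct); rewrite ler_pM2r ?invr_gt0 // ler_pM2r // dg_gap_le8.
have w0 : 0 < w by apply: lt_le_trans w1.
(* Successive radii differ by [2 * w] with [w >= 1]: the cutoff is [1] up to the smaller radius, and
   the shift by [1] keeps both ends of every edge on which it varies within [rr t]. *)
pose phi x := clamp01 ((rr t - 1 - (nrm x)%:R) / w).
pose k' := lev (2 * t); pose f := trunc k'; pose F := trunc (lev t).
pose near x := (nrm x)%:R <= rr t.
have phi0 x : phi x != 0 -> (nrm x)%:R <= rr t - 1.
  move=> h; rewrite leNgt; apply: contra h => h; rewrite /phi clamp01_eq0 //.
  by rewrite pmulr_lle0 ?invr_gt0 // ltW // subr_lt0.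
have phi_rad x : phi x != 0 -> (nrm x <= rad)%N.
  move/phi0 => h; rewrite -(ler_nat R); have := rr_le t1; lra.
have kp : 0 <= k'.
  rewrite /k' /lev mulr_ge0 ?subr_ge0 ?invf_le1 ?mulr_gt0 ?(ltW K0) //; lra.
have phi01 x : 0 <= phi x <= 1 by apply: clamp01_itv.
have near_phi x s : phi x - phi (x + dir s) != 0 -> near x.
  rewrite /near; have [p0|/phi0] := eqVneq (phi x) 0; last lra.
  rewrite p0 sub0r oppr_eq0 => /phi0.
  by have := nrm_step_ge x s; rewrite -(ler_nat R) -natr1; lra.
have dphi x s : (phi x - phi (x + dir s)) ^+ 2 <= w ^- 2.
  apply: le_trans (clamp01_lip _ _) _.
  rewrite -mulrBl exprMn exprVn -[leRHS]mul1r ler_wpM2r ?invr_ge0 ?sqr_ge0 //.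
  have -> : rr t - 1 - (nrm x)%:R - (rr t - 1 - (nrm (x + dir s))%:R) =
    (nrm (x + dir s))%:R - (nrm x)%:R :> R by ring.
  have := nrm_step x s; have := nrm_step_ge x s.
  by rewrite -!(ler_nat R) -!natr1 => h1 h2; nra.
(* A linear term must be bounded by a quadratic mass: where [f] is positive, [F] is at least
   [K / (2 * t)], so [F <= (2 * t / K) * F^2]. *)
have fF x : phi x ^+ 2 * f x <= if near x then (2 * t / K) * F x ^+ 2 else 0.
  have [->|] := eqVneq (phi x) 0.
    rewrite expr0n mul0r; case: ifP => // _; rewrite mulr_ge0 ?sqr_ge0 //.
    by rewrite divr_ge0 ?mulr_ge0 ?ltW.
  move=> /phi0 nx; rewrite /near ifT; last lra.
  have [h|h] := ltP k' (v x); last first.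
    by rewrite /f trunc_low // mulr0 mulr_ge0 ?sqr_ge0 ?divr_ge0 ?mulr_ge0 ?ltW.
  have [E1 E2 E3] := trunc_high t0 h; rewrite /f /F E1 E2.
  have Kt : 0 < K / (2 * t) by rewrite divr_gt0 // mulr_gt0.
  have ff : v x - k' <= v x - lev t by rewrite /k' levS //; lra.
  apply: (@le_trans _ _ (v x - lev t)).
    have /andP[p0 p1] := phi01 x.
    apply: le_trans ff; rewrite ler_piMl //; first by rewrite subr_ge0 ltW.
    by rewrite expr_le1.
  rewrite -[X in X <= _]mul1r expr2 mulrA ler_wpM2r; first lra.
    by apply: le_trans E3; exact: ltW.
  rewrite -(ler_pM2l Kt) mulr1; apply: le_trans E3 _.
  by rewrite mulrA (_ : K / (2 * t) * (2 * t / K) = 1) ?mul1r //; field; rewrite !gt_eqF.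
have fFsq x : f x ^+ 2 <= F x ^+ 2.
  rewrite lerXn2r ?nnegrE ?trunc_ge0 // /f /F /trunc /k' levS //.
  have Kt : 0 < K / (2 * t) by rewrite divr_gt0 // mulr_gt0.
  rewrite ge_max le_max lexx /= le_max; apply/orP; right.
  by move: Kt; lra.
have Nrad : (rad + 1 <= N)%N by rewrite /N -addnA leq_add2l addn2.
have wt := cweight_le cP; have wp := cweight_gt0 k0 cP.
have ki : 0 <= kappa^-1 by rewrite invr_ge0 ltW.
(* [136 = 8 + 128]: the source gives [8 * t * a / K], at most [8 * t^2 / rad^2], and the cutoff
   gives [2 * w^-2 = 128 * t^2 / rad^2]. *)
have en : energy c N (fun x => phi x * f x) <=
    136 * D * kappa^-1 * t ^+ 2 / rad%:R ^+ 2 * mass t.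
  rewrite (@caccioppoli kappa c k0 cP N rad phi f phi_rad Nrad).
  apply: (@le_trans _ _ (2 * (2 * D * kappa^-1 * a * (2 * t / K) * mass t) +
      2 * D * kappa^-1 * w ^- 2 * mass t)).
    apply: lerD.
      rewrite ler_pM2l // /mass /bsum mulr_sumr; apply: ler_sum => x _.
      have p2 : 0 <= phi x ^+ 2 * f x by rewrite mulr_ge0 ?sqr_ge0 ?trunc_ge0.
      apply: (@le_trans _ _ (cweight c x * (phi x ^+ 2 * f x) * a)).
        have [->|h] := eqVneq (phi x) 0; first by rewrite expr0n !mul0r mulr0 !mul0r.
        have [->|f0] := eqVneq (f x) 0; first by rewrite !mulr0 !mul0r.
        apply: ler_wpM2l; first by rewrite mulr_ge0 // ltW.
        rewrite lerBlDl; apply: trunc_sub; rewrite ?phi_rad //.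
        by rewrite lt_neqAle eq_sym f0 trunc_ge0.
      rewrite -/(near x).
      have -> : 2 * D / kappa * a * (2 * t / K) * (if near x then F x ^+ 2 else 0) =
        2 * D / kappa * (if near x then 2 * t / K * F x ^+ 2 else 0) * a.
        by case: ifP => _; ring.
      by rewrite ler_wpM2r // ler_pM ?(ltW (wp _)).
    pose G x y := f x ^+ 2 * (phi x - phi y) ^+ 2.
    have GM x s : G x (x + dir s) != 0 -> (nrm x <= rad)%N.
      rewrite mulf_eq0 negb_or sqrf_eq0 => /andP[_]; rewrite sqrf_eq0 => /near_phi h.
      by rewrite -(ler_nat R); apply: le_trans h (rr_le t1).
    apply: (@le_trans _ _ (bsum N (fun x => \sum_s c x s * G x (x + dir s)))).
      rewrite -(ler_pM2l (ltr0Sn R 1)) [leRHS]mulr_natl mulr2n.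
      rewrite [X in _ <= _ + X](edge_sum_swap cP GM Nrad).
      rewrite /bsum mulr_sumr -big_split /=; apply: ler_sum => x _.
      rewrite mulr_sumr -big_split /=; apply: ler_sum => s _.
      rewrite mulrCA -mulrDr ler_wpM2l ?(cond_ge0 k0 cP) // /G.
      have -> : (phi (x + dir s) - phi x) ^+ 2 = (phi x - phi (x + dir s)) ^+ 2.
        by rewrite -sqrrN opprB.
      rewrite -mulrDl mulrA ler_wpM2r ?sqr_ge0 //.
      by have := sqr_ge0 (f x - f (x + dir s)); rewrite sqrrB; lra.
    rewrite /mass /bsum mulr_sumr; apply: ler_sum => x _; rewrite -/(near x).
    case: ifP => nx; last first.
      rewrite mulr0 big1 // => s _; rewrite /G.
      have [->|/near_phi] := eqVneq (phi x - phi (x + dir s)) 0; last by rewrite nx.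
      by rewrite expr0n !mulr0.
    apply: (@le_trans _ _ (\sum_s c x s * (F x ^+ 2 * w ^- 2))).
      apply: ler_sum => s _; rewrite ler_wpM2l ?(cond_ge0 k0 cP) //.
      by rewrite ler_pM ?sqr_ge0.
    rewrite -mulr_suml -[leRHS]mulrA [w ^- 2 * _]mulrC.
    by apply: ler_wpM2r; [rewrite mulr_ge0 ?sqr_ge0 // invr_ge0 sqr_ge0 | exact: wt].
  have m0 := mass_ge0 t.
  rewrite [leLHS](_ : _ = D * kappa^-1 * mass t * (8 * t * (a / K) + 2 * w ^- 2)); last by ring.
  rewrite [leRHS](_ : _ = D * kappa^-1 * mass t * (136 * t ^+ 2 / rad%:R ^+ 2)); last by ring.
  rewrite ler_wpM2l ?mulr_ge0 //.
  have -> : w ^- 2 = 64 * t ^+ 2 / rad%:R ^+ 2.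
    by rewrite /w; field; rewrite !gt_eqF.
  have aK' : a / K <= rad%:R ^- 2.
    by rewrite ler_pdivrMr // mulrC ler_pdivlMr ?exprn_gt0.
  have r2 : 0 < rad%:R ^- 2 :> R by rewrite invr_gt0 exprn_gt0.
  have : 8 * t * (a / K) <= 8 * t ^+ 2 * rad%:R ^- 2.
    have tt : 8 * t <= 8 * t ^+ 2 by rewrite ler_pM2l // expr2 ler_peMl // ltW.
    by apply: ler_pM => //; [rewrite mulr_ge0 // ltW | rewrite divr_ge0 // ltW].
  lra.
(* The cube needs an integer side; since [c0 * rad / t >= 1], rounding up at most doubles it. *)
have [r [r0 rlo rup]] : exists r : nat, [/\ (0 < r)%N, c0 * rad%:R / t <= r%:R
    & r%:R <= 2 * (c0 * rad%:R / t)].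
  have cp : 0 <= c0 * rad%:R / t by apply: le_trans ct.
  exists (Num.truncn (c0 * rad%:R / t)).+1; have /andP[h1 h2] := truncn_itv cp.
  split=> //; first exact: ltW.
  by rewrite -natr1; lra.
have rrad : (r <= rad)%N.
  rewrite -(ler_nat R); apply: (le_trans rup).
  rewrite mulrA ler_pdivrMr // mulrA [leRHS]mulrC ler_wpM2r ?ltW //.
  by have := dg_gap_le8; lra.
have := @faber_krahn d R (fun x => phi x * f x) rad N _ (high t) r _ _ r0 _ _.
rewrite filter_uniq ?box_uniq // => FK.
have {}FK := FK _ isT.
apply: (@le_trans _ _ (bsum N (fun x => (phi x * f x) ^+ 2))).
  apply: ler_bsum => x; case: ifP => nx; last exact: sqr_ge0.
  rewrite /phi clamp01_eq1 ?mul1r //.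
  rewrite ler_pdivlMr // mul1r.
  have E : rr t - rr (2 * t) = 2 * w by rewrite /rr /w; field; rewrite gt_eqF.
  move: nx E w1; lra.
apply: le_trans (FK _ _ _ _) _.
- by move=> x; rewrite mulf_eq0 negb_or => /andP[/phi_rad].
- move=> x; rewrite mulf_eq0 negb_or mem_filter mem_box => /andP[px fx].
  rewrite phi_rad // andbT; apply/andP; split; first by have := phi0 _ px; lra.
  by rewrite ltNge; apply: contra fx => h; rewrite /f trunc_low.
- rewrite -(ler_nat R) natrM natrX; apply: le_trans hB _.
  by rewrite lerXn2r ?nnegrE // (le_trans _ ct).
- by rewrite /N -addnA leq_add2l (leq_trans _ (leq_addr _ _)) // leq_mul2l rrad orbT.
have ie : inc_energy (fun x => phi x * f x) N <=
    kappa^-1 * (136 * D * kappa^-1 * t ^+ 2 / rad%:R ^+ 2 * mass t).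
  rewrite -(ler_pM2l k0) [leRHS]mulrA mulfV ?gt_eqF // mul1r.
  exact: le_trans (inc_energy_le k0 cP _ _) en.
have rsq : r%:R ^+ 2 <= (2 * (c0 * rad%:R / t)) ^+ 2.
  by rewrite lerXn2r ?nnegrE // mulr_ge0 // (le_trans _ ct).
apply: (@le_trans _ _ (2 * D ^+ 2 * (2 * (c0 * rad%:R / t)) ^+ 2 *
   (kappa^-1 * (136 * D * kappa^-1 * t ^+ 2 / rad%:R ^+ 2 * mass t)))).
  rewrite ler_pM ?mulr_ge0 ?sqr_ge0 //.
  - by apply: sumr_ge0 => i _; apply: sqinc_ge0.
  - by rewrite ler_wpM2l // mulr_ge0 ?sqr_ge0.
rewrite [leLHS](_ : _ = 1088 * D ^+ 3 * kappa ^- 2 * c0 ^+ 2 * mass t).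
  by rewrite ler_wpM2r ?mass_ge0 // dg_gap_sq.
by field; rewrite !gt_eqF.
Qed.

Hypothesis small :
  bsum rad (fun x => v x ^+ 2) <= c0 ^+ d.+1 / 8 * K ^+ 2 * rad%:R ^+ d.+1.

(** The contraction [4^-1 * 2^-(d+1)] matches the two quantities that shrink when [t] doubles, the
    square of the level gap and the volume of the cube, so the smallness of [high t] required by the
    next step reproduces itself. The iteration stops at the lattice scale: once [c0 * rad / t < 1],
    the set [high t] has less than one point and misses the origin. *)
Lemma local_max_at0 : v 0 <= K.
Proof.
have radp : (0 : R) < rad%:R by rewrite ltr0n.
have c0p := dg_gap_gt0.
pose t j : R := 2 ^+ j.
have t1 j : 1 <= t j by rewrite /t exprn_ege1 ?ler1n.
have t0 j : 0 < t j by apply: lt_le_trans (t1 j).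
have key j : mass (t j) <=
    c0 ^+ d.+1 / 8 * K ^+ 2 * rad%:R ^+ d.+1 * (4^-1 * 2 ^- d.+1) ^+ j ->
    (size (high (t j)))%:R * 2 <= (c0 * rad%:R / t j) ^+ d.+1.
  move=> mj; have sz := le_trans (size_high (t0 j) (t1 j)) mj.
  have Kt : 0 < (K / (2 * t j)) ^+ 2 by rewrite exprn_gt0 // divr_gt0 // mulr_gt0.
  rewrite -(ler_pM2r Kt) mulrAC.
  apply: le_trans (ler_wpM2r _ sz) _ => //.
  apply: le_of_eq.
  have -> : (4^-1 * 2 ^- d.+1) ^+ j = t j ^- 2 * t j ^- d.+1 :> R.
    rewrite exprMn; congr (_ * _).
      have -> : (4 : R) = 2 ^+ 2 by ring.
      by rewrite exprVn /t -!exprM mulnC.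
    by rewrite exprVn /t -!exprM mulnC.
  rewrite !exprMn exprVn; have := gt_eqF (t0 j) => tn.
  have tdn : t j ^+ d.+1 != 0 by rewrite expf_neq0 // tn.
  by field; rewrite tdn tn.
have fin j : c0 * rad%:R / t j < 1 ->
    (size (high (t j)))%:R * 2 <= (c0 * rad%:R / t j) ^+ d.+1 -> v 0 <= K.
  move=> lt1 sz.
  have E : size (high (t j)) = 0%N.
    apply/eqP; rewrite -leqn0 -ltnS -(ltr_nat R).
    have : (c0 * rad%:R / t j) ^+ d.+1 < 1.
      by rewrite exprn_ilt1 // divr_ge0 ?mulr_ge0 ?ltW.
    lra.
  have : (0 : pt) \notin high (t j) by rewrite (size0nil E).
  rewrite mem_filter mem_box nrm0 /= andbT negb_and => /orP[].
    rewrite /rr mulr_ge0 ?divr_ge0 // addr_ge0 // invr_ge0 ltW //.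
  rewrite -leNgt => /le_trans; apply.
  rewrite /lev ler_piMr ?(ltW K0) // gerBl invr_ge0 ltW // mulr_gt0 //.
have step j : v 0 <= K \/ mass (t j) <=
    c0 ^+ d.+1 / 8 * K ^+ 2 * rad%:R ^+ d.+1 * (4^-1 * 2 ^- d.+1) ^+ j.
  elim: j => [|j [IH|IH]]; [right | by left |].
    rewrite expr0 mulr1; apply: le_trans small.
    rewrite /mass /bsum.
    rewrite (bigID (fun x => (nrm x <= rad)%N)) /= [X in _ + X]big1 ?addr0; last first.
      move=> x; rewrite -ltnNge -(ltr_nat R) => h; rewrite ifF //.
      by apply/negbTE; rewrite -ltNge; apply: le_lt_trans h; apply: rr_le.
    rewrite -big_filter.
    have pm : perm_eq [seq x <- box d N | (nrm x <= rad)%N] (box d rad).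
      apply: uniq_perm; rewrite ?filter_uniq ?box_uniq // => x.
      rewrite mem_filter !mem_box; apply/andP/idP => [[]//|h]; split => //.
      by apply: leq_trans h _; rewrite /N -addnA leq_addr.
    rewrite (perm_big _ pm) /=; apply: ler_sum => x _.
    case: ifP => _; last exact: sqr_ge0.
    rewrite /lev /t expr0 invr1 subrr mulr0 /trunc subr0 max_r ?v0 //.
  have [lt1|ge1] := ltP (c0 * rad%:R / t j) 1.
    by left; apply: (fin j lt1); apply: key.
  right; have ms := mass_step (t1 j) ge1 (key j IH).
  have -> : t j.+1 = 2 * t j by rewrite /t exprS.
  apply: (le_trans ms); rewrite [_ ^+ j.+1]exprS mulrCA.
  by rewrite ler_wpM2l // mulr_ge0 ?invr_ge0 ?exprn_ge0.
pose j := Num.truncn (c0 * rad%:R).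
have lt1 : c0 * rad%:R / t j < 1.
  rewrite ltr_pdivrMr // mul1r.
  have cp : 0 <= c0 * rad%:R by rewrite mulr_ge0 ?ltW.
  have /andP[_ h] := truncn_itv cp; apply: lt_le_trans h _.
  by rewrite /t -natrX ler_nat ltn_expl.
by case: (step j) => // h; apply: (fin j lt1); apply: key.
Qed.

End Iteration.
End LocalMaximum.
End Kernel.

(** * The logarithmic inequality on a single edge *)

Section EdgeLog.
Variable R : realType.
Implicit Types a b t : R.

Lemma ln_le_sub1 t : 0 < t -> ln t <= t - 1.
Proof.
by move=> t0; have := @le_ln1Dx R (t - 1); rewrite addrCA subrr addr0; apply; lra.
Qed.

Lemma ln_sq_le t : 1 <= t -> ln t ^+ 2 <= 4 * ((t - 1) ^+ 2 / t).
Proof.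
move=> t1; have t0 : 0 < t by apply: lt_le_trans t1.
pose r := Num.sqrt t; have r0 : 0 < r by rewrite sqrtr_gt0.
have rt : r ^+ 2 = t by rewrite sqr_sqrtr ?ltW.
have r1 : 1 <= r by rewrite -(@expr_ge1 _ 2) ?rt // ltW.
have lr := ln_le_sub1 r0.
have lr0 : 0 <= ln r by rewrite ln_ge0.
have -> : ln t = 2 * ln r by rewrite -rt lnXn // mulr_natl.
have -> : 4 * ((t - 1) ^+ 2 / t) = (2 * ((r - 1) * (r + 1) / r)) ^+ 2.
  by rewrite -rt; field; rewrite gt_eqF.
rewrite lerXn2r ?nnegrE ?mulr_ge0 //; try by rewrite ?invr_ge0; lra.
rewrite ler_pM2l //; apply: (le_trans lr).
rewrite -mulrA ler_peMr ?subr_ge0 // ler_pdivlMr //; lra.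
Qed.

(** What testing a supersolution with the squared cutoff over the function produces on one edge. Up
    to terms containing [b - a] the left side is [- a^2 (t - 1)^2 / t]; half of it absorbs the cross
    term by completing a square, and the other half dominates the squared logarithm. *)
Lemma edge_log_ge1 a b t : 0 <= a -> 0 <= b -> 1 <= t ->
  a ^+ 2 * (1 - t) + b ^+ 2 * (1 - t^-1) <=
  3 * (a - b) ^+ 2 - 8^-1 * Num.min a b ^+ 2 * ln t ^+ 2.
Proof.
move=> a0 b0 t1; have t0 : 0 < t by apply: lt_le_trans t1.
pose s := t - 1; have s0 : 0 <= s by rewrite subr_ge0.
have ti : t^-1 <= 1 by rewrite invf_le1.
have ti0 : 0 < t^-1 by rewrite invr_gt0.
have mab : Num.min a b ^+ 2 <= a ^+ 2.
  by rewrite lerXn2r ?nnegrE ?le_min ?a0 // ge_min lexx.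
have m1 : 8^-1 * Num.min a b ^+ 2 * ln t ^+ 2 <= 2^-1 * a ^+ 2 * (s ^+ 2 / t).
  apply: (@le_trans _ _ (8^-1 * a ^+ 2 * (4 * (s ^+ 2 / t)))).
    apply: ler_pM; [by rewrite mulr_ge0 ?sqr_ge0 ?invr_ge0 | exact: sqr_ge0 |
      by rewrite ler_pM2l ?invr_gt0 | exact: ln_sq_le].
  by apply: le_of_eq; field; rewrite gt_eqF.
have E : a ^+ 2 * (1 - t) + b ^+ 2 * (1 - t^-1) =
   - (2^-1 * a ^+ 2 * (s ^+ 2 / t)) + (b - a) ^+ 2 * (1 - t^-1)
   + 2 * (b - a) ^+ 2 * t^-1 - t^-1 / 2 * (a * s - 2 * (b - a)) ^+ 2.
  by rewrite /s; field; rewrite gt_eqF.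
have h1 : 0 <= t^-1 / 2 * (a * s - 2 * (b - a)) ^+ 2.
  by rewrite mulr_ge0 ?sqr_ge0 // divr_ge0 // ltW.
have h2 : (b - a) ^+ 2 * (1 - t^-1) + 2 * (b - a) ^+ 2 * t^-1 <= 3 * (a - b) ^+ 2.
  rewrite [X in _ <= 3 * X](_ : _ = (b - a) ^+ 2); last by ring.
  have := sqr_ge0 (b - a); set q := (b - a) ^+ 2; nra.
rewrite E; lra.
Qed.

Lemma edge_log a b m n : 0 <= a -> 0 <= b -> 0 < m -> 0 < n ->
  a ^+ 2 * (1 - n / m) + b ^+ 2 * (1 - m / n) <=
  3 * (a - b) ^+ 2 - 8^-1 * Num.min a b ^+ 2 * (ln m - ln n) ^+ 2.
Proof.
move=> a0 b0 m0 n0; have [mn|nm] := leP m n.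
  have := @edge_log_ge1 a b (n / m) a0 b0.
  rewrite ler_pdivlMr // mul1r invf_div => /(_ mn).
  rewrite lnM ?posrE ?invr_gt0 // lnV ?posrE //.
  by have -> : (ln m - ln n) ^+ 2 = (ln n - ln m) ^+ 2 by ring.
have := @edge_log_ge1 b a (m / n) b0 a0.
rewrite ler_pdivlMr // mul1r invf_div => /(_ (ltW nm)).
rewrite lnM ?posrE ?invr_gt0 // lnV ?posrE // minC addrC.
by have -> : (a - b) ^+ 2 = (b - a) ^+ 2 by ring.
Qed.

End EdgeLog.

(** * Logarithmic energy estimate and a lower bound for supersolutions *)

Section Climb.
Variables (R : realType) (d : nat).
Local Notation pt := 'rV[int]_d.+1.
Local Notation D := (d.+1%:R : R).
Implicit Types (x y z : pt) (f g u v : pt -> R) (c : pt -> step d -> R).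
Variables (kappa : R) (k0 : 0 < kappa).

Lemma conductances_shift c x0 :
  conductances kappa c -> conductances kappa (fun x => c (x0 + x)).
Proof. by move=> [h1 h2]; split=> x s //; rewrite addrA. Qed.

Lemma avg_shift c x0 f x :
  avg (fun x => c (x0 + x)) (fun x => f (x0 + x)) x = avg c f (x0 + x).
Proof. by rewrite /avg /tprob /cweight; under eq_bigr do rewrite addrA. Qed.

Lemma local_max c v x0 rad a K : conductances kappa c -> (0 < rad)%N -> 0 < K ->
  (forall x, 0 <= v x) -> a * rad%:R ^+ 2 <= K -> 0 <= a ->
  (forall x, (nrm (x - x0) <= rad)%N -> 0 < v x -> v x <= avg c v x + a) ->
  bsum rad (fun x => v (x0 + x) ^+ 2) <=
    dg_gap d kappa ^+ d.+1 / 8 * K ^+ 2 * rad%:R ^+ d.+1 ->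
  v x0 <= K.
Proof.
move=> cP r0 K0 v0 aK a0 vsub sm.
rewrite -[x0]addr0.
apply: (@local_max_at0 R d kappa k0 (fun x => c (x0 + x)) (fun x => v (x0 + x))
  rad a K) => //; first exact: conductances_shift.
by move=> x xr vx; rewrite avg_shift; apply: vsub => //; rewrite addrC addKr.
Qed.

Definition height x : int := x ord0 ord0.

Definition up : step d := (ord0, true).

Lemma heightD x y : height (x + y) = height x + height y.
Proof. exact: coordD. Qed.

Lemma height_up : height (dir up) = 1.
Proof. by rewrite /height /dir /up /= mxE !eqxx. Qed.

Lemma height_nrm x y : (`|height x - height y| <= nrm (x - y))%N.
Proof.
have -> : height x - height y = (x - y) ord0 ord0 :> int.
  by rewrite coordD coordN.
exact: nrm_coord.
Qed.

Lemma height_dir s : (`|height (dir s)| <= 1)%N.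
Proof. by rewrite -(nrm_dir s) nrm_coord. Qed.

Section LogBound.
Variables (c : pt -> step d -> R) (m : pt -> R) (rho : nat) (a : R).
Hypotheses (cP : conductances kappa c) (rho0 : (0 < rho)%N).
Hypotheses (m01 : forall x, 0 < m x <= 1) (aE : a = rho%:R ^- 2).
Hypothesis msup : forall x, (nrm x <= 3 * rho)%N -> avg c m x <= (1 + a) * m x.
Hypothesis mtop : forall x, rho%:Z <= height x -> m x = 1.
Let u x := - ln (m x).
Let rp : (0 : R) < rho%:R. Proof. by rewrite ltr0n. Qed.

Let m0 x : 0 < m x. Proof. by case/andP: (m01 x). Qed.

Let u0 x : 0 <= u x.
Proof. by rewrite /u oppr_ge0 ln_le0 //; case/andP: (m01 x). Qed.

Let a0 : 0 <= a. Proof. by rewrite aE invr_ge0 sqr_ge0. Qed.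

(** Jensen for the logarithm, through the tangent line [ln s <= s - 1] at the mean [avg c m x]. *)
Lemma log_subsolution x : (nrm x <= 3 * rho)%N -> u x <= avg c u x + a.
Proof.
move=> xr; have A0 : 0 < avg c m x.
  rewrite /avg (bigD1 up) //=; apply: ltr_pwDl.
    by rewrite mulr_gt0 // (tprob_gt0 k0 cP).
  by apply: sumr_ge0 => s _; rewrite mulr_ge0 ?(tprob_ge0 k0 cP) // ltW.
have J : avg c (fun y => - u y) x <= ln (avg c m x).
  apply: (@le_trans _ _ (avg c (fun y =>
     (ln (avg c m x) - 1) + (avg c m x)^-1 * m y) x)).
    apply: (avg_le k0 cP) => s; rewrite /u opprK.
    set y := x + dir s.
    have := @ln_le_sub1 R ((avg c m x)^-1 * m y).
    rewrite mulr_gt0 ?invr_gt0 // => /(_ isT).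
    by rewrite lnM ?posrE ?invr_gt0 // lnV ?posrE //; lra.
  by rewrite avgD avgM (avg_cst k0 cP) mulVf ?gt_eqF // subrK.
have J2 : avg c (fun y => - u y) x = - avg c u x.
  by rewrite /avg -sumrN; apply: eq_bigr => s _; rewrite mulrN.
have L : ln (avg c m x) <= ln (m x) + a.
  apply: (@le_trans _ _ (ln ((1 + a) * m x))).
    by rewrite ler_ln ?posrE ?msup // mulr_gt0 // ltr_pwDl.
  rewrite lnM ?posrE ?ltr_pwDl // addrC lerD2l le_ln1Dx //.
  by apply: lt_le_trans a0; rewrite oppr_lt0.
by rewrite J2 in J; rewrite /u; lra.
Qed.

Let N := (5 * rho)%N.
Let phi x := clamp01 ((3 * rho%:R - (nrm x)%:R) / rho%:R : R).

(** Testing the supersolution with [phi^2 / m] leaves the squared increments of [u = - ln m],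
    however small [m] may be. The cutoff and the source [a = rho^-2] contribute at the same order:
    [80 = 8 * (3 * 2 + 2 * 2)], and [11 * rho] bounds the side [10 * rho + 1] of the box. *)
Lemma log_gradient :
  bsum N (fun x => \sum_s c x s * (Num.min (phi x) (phi (x + dir s)) ^+ 2 *
     (u x - u (x + dir s)) ^+ 2)) <=
  80 * D * kappa^-1 * 11 ^+ d.+1 * rho%:R ^+ d.+1 / rho%:R ^+ 2.
Proof.
have ph01 x : 0 <= phi x <= 1 by apply: clamp01_itv.
have ph0 x : phi x != 0 -> (nrm x <= 3 * rho)%N.
  move=> h; rewrite leqNgt; apply: contra h => h; rewrite /phi clamp01_eq0 //.
  rewrite pmulr_lle0 ?invr_gt0 // subr_le0.
  by rewrite -natrM ler_nat ltnW.
pose G x y := phi x ^+ 2 * (1 - m y / m x).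
have GM x s : G x (x + dir s) != 0 -> (nrm x <= 3 * rho)%N.
  by rewrite mulf_eq0 negb_or sqrf_eq0 => /andP[/ph0].
have MN : (3 * rho + 1 <= N)%N by rewrite /N; lia.
have S := edge_sum_swap cP GM MN.
have low : - (a * bsum N (fun x => cweight c x * phi x ^+ 2)) <=
    bsum N (fun x => \sum_s c x s * G x (x + dir s)).
  rewrite -mulNr /bsum mulr_sumr; apply: ler_sum => x _.
  have -> : \sum_s c x s * G x (x + dir s) =
      phi x ^+ 2 * (cweight c x * (1 - avg c m x / m x)).
    rewrite mulrBr mulr1 [cweight c x * (_ / _)]mulrA (cweight_avg k0 cP).
    rewrite /cweight mulr_suml -sumrB mulr_sumr; apply: eq_bigr => s _.
    by rewrite /G; ring.
  have [->|/ph0 h] := eqVneq (phi x) 0; first by rewrite expr0n mulr0 mul0r mulr0.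
  rewrite [leLHS](_ : _ = phi x ^+ 2 * (cweight c x * - a)); last by ring.
  apply: ler_wpM2l; first exact: sqr_ge0.
  apply: ler_wpM2l; first exact/ltW/(cweight_gt0 k0 cP).
  have : avg c m x / m x <= 1 + a by rewrite ler_pdivrMr // msup.
  lra.
have up1 : bsum N (fun x => \sum_s c x s * (Num.min (phi x) (phi (x + dir s)) ^+ 2 *
     (u x - u (x + dir s)) ^+ 2)) <=
   8 * (3 * bsum N (fun x => \sum_s c x s * (phi x - phi (x + dir s)) ^+ 2) -
        2 * bsum N (fun x => \sum_s c x s * G x (x + dir s))).
  rewrite [2 * _]mulr_natl mulr2n [X in 3 * _ - (_ + X)]S.
  rewrite /bsum -big_split mulr_sumr -sumrB mulr_sumr; apply: ler_sum => x _.
  rewrite /= -big_split mulr_sumr -sumrB mulr_sumr; apply: ler_sum => s _ /=.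
  set y := x + dir s.
  rewrite [leRHS](_ : _ = c x s *
    (8 * (3 * (phi x - phi y) ^+ 2 - (G x y + G y x)))); last by ring.
  apply: ler_wpM2l; first exact: (cond_ge0 k0 cP).
  have := @edge_log R (phi x) (phi y) (m x) (m y).
  case/andP: (ph01 x) => -> _; case/andP: (ph01 y) => -> _.
  move=> /(_ isT isT (m0 x) (m0 y)); rewrite /G /u.
  have -> : (- ln (m x) - - ln (m y)) ^+ 2 = (ln (m x) - ln (m y)) ^+ 2 by ring.
  lra.
have sz : ((size (box d N))%:R : R) <= 11 ^+ d.+1 * rho%:R ^+ d.+1.
  by rewrite size_box -exprMn -natrM -natrX ler_nat leq_exp2r // /N; lia.
have k1 : 0 <= kappa^-1 by rewrite invr_ge0 ltW.
have cw : bsum N (fun x => cweight c x * phi x ^+ 2) <=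
    (size (box d N))%:R * (2 * D * kappa^-1).
  rewrite mulr_natl -iter_addr_0 -count_predT -big_const_seq.
  apply: ler_sum => x _; rewrite -[leRHS]mulr1.
  rewrite ler_pM ?sqr_ge0 ?(cweight_le cP) ?(ltW (cweight_gt0 k0 cP _)) //.
  by case/andP: (ph01 x) => p0 p1; rewrite expr_le1.
have gr : bsum N (fun x => \sum_s c x s * (phi x - phi (x + dir s)) ^+ 2) <=
    (size (box d N))%:R * (2 * D * kappa^-1 * a).
  rewrite mulr_natl -iter_addr_0 -count_predT -big_const_seq.
  apply: ler_sum => x _.
  apply: (@le_trans _ _ (\sum_s c x s * a)); last first.
    by rewrite -mulr_suml ler_wpM2r // (cweight_le cP).
  apply: ler_sum => s _; rewrite ler_wpM2l ?(cond_ge0 k0 cP) //.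
  apply: le_trans (clamp01_lip _ _) _.
  rewrite -mulrBl exprMn exprVn aE -[leRHS]mul1r ler_wpM2r ?invr_ge0 ?sqr_ge0 //.
  have -> : 3 * rho%:R - (nrm x)%:R - (3 * rho%:R - (nrm (x + dir s))%:R) =
    (nrm (x + dir s))%:R - (nrm x)%:R :> R by ring.
  have := nrm_step x s; have := nrm_step_ge x s.
  by rewrite -!(ler_nat R) -!natr1 => h1 h2; nra.
apply: (le_trans up1).
apply: (@le_trans _ _ (8 * (3 * ((size (box d N))%:R * (2 * D * kappa^-1 * a)) +
   2 * (a * ((size (box d N))%:R * (2 * D * kappa^-1)))))).
  by have cw' := ler_wpM2l a0 cw; rewrite ler_pM2l //; lra.
rewrite [leLHS](_ : _ = 80 * D * kappa^-1 * a * (size (box d N))%:R); last by ring.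
rewrite [leRHS](_ : _ = 80 * D * kappa^-1 * a * (11 ^+ d.+1 * rho%:R ^+ d.+1)).
  by rewrite ler_wpM2l // !mulr_ge0.
by rewrite aE; ring.
Qed.

Let G y : R := if (nrm y <= 2 * rho)%N && (height y < rho%:Z)
  then (u y - u (y + dir up)) ^+ 2 else 0.

Lemma nrm_up y : (nrm y <= 2 * rho)%N -> height y < rho%:Z ->
  (nrm (y + dir up) <= 2 * rho)%N.
Proof.
move=> /nrm_leP ny hy; apply/nrm_leP => i; rewrite coordD /dir /up /=.
have -> : ((delta_mx 0 ord0 : pt) ord0 i : int) = (i == ord0)%:Z.
  by rewrite mxE eqxx /=; case: eqP.
have := ny i; have [->|] := eqVneq i ord0; last by lia.
by move: hy; rewrite /height; move: (y ord0 ord0 : int) => h; lia.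
Qed.

(** A Poincare inequality along one vertical line: [u] is zero from height [rho] on, so it is the
    sum of its upward increments below. The weights [1 + n] and [1 + 1 / n] in Young's inequality
    make the induction reproduce the constant. *)
Lemma vertical_line n x : (nrm x <= 2 * rho)%N -> rho%:Z - height x <= n%:Z ->
  u x ^+ 2 <= n%:R * \sum_(0 <= j < n) G (x + dir up *+ j).
Proof.
have top y : rho%:Z <= height y -> u y ^+ 2 <= 0.
  by move=> h; rewrite /u mtop // ln1 oppr0 expr0n.
have G0 y : 0 <= G y by rewrite /G; case: ifP => // _; apply: sqr_ge0.
elim: n x => [|n IH] x nx hx; first by rewrite mul0r; apply: top; lia.
have [h|h] := leP rho%:Z (height x).
  by apply: le_trans (top _ h) _; rewrite mulr_ge0 // sumr_ge0.
have := IH (x + dir up) (nrm_up nx h).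
rewrite heightD height_up => /(_ ltac:(lia)) IHx.
rewrite big_nat_recl // mulr0n addr0 {1}/G nx h /=.
rewrite [X in _ * (_ + X)](_ : _ = \sum_(0 <= j < n) G (x + dir up + dir up *+ j)).
  set S := \sum_(_ <= _ < _) _ in IHx *.
  move: IHx; set A := u x; set B := u (x + dir up) => IHx.
  have [n0|n0] := posnP n.
    move: IHx; rewrite n0 mul0r => IHx.
    have -> : B = 0 by apply/eqP; rewrite -sqrf_eq0 eq_le IHx sqr_ge0.
    have : 0 <= S by apply: sumr_ge0.
    by rewrite subr0; have := sqr_ge0 A; nra.
  have np : (0 : R) < n%:R by rewrite ltr0n.
  have : A ^+ 2 <= (1 + n%:R) * (A - B) ^+ 2 + (1 + n%:R^-1) * B ^+ 2.
    have -> : (1 + n%:R) * (A - B) ^+ 2 + (1 + n%:R^-1) * B ^+ 2 =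
      A ^+ 2 + (n%:R * (A - B) - B) ^+ 2 / n%:R by field; rewrite gt_eqF.
    by rewrite lerDl divr_ge0 ?sqr_ge0 // ltW.
  have h2 : (1 + n%:R^-1) * B ^+ 2 <= (n%:R + 1) * S.
    apply: le_trans (ler_wpM2l _ IHx) _; first by rewrite addr_ge0 // invr_ge0 ltW.
    by rewrite mulrA mulrDl mul1r mulVf ?gt_eqF.
  by move=> /le_trans; apply; rewrite -natr1; lra.
by apply: eq_big_nat => j _; rewrite mulrS addrA.
Qed.

(** Within the ball of radius [2 * rho] a vertical line meets height [rho] after at most [3 * rho]
    steps; the Poincare constant [9 * rho^2] cancels the [rho^-2] of the gradient bound, whence
    [720 = 9 * 80]. *)
Lemma log_l2 : bsum (2 * rho) (fun x => u x ^+ 2) <=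
  720 * D * kappa ^- 2 * 11 ^+ d.+1 * rho%:R ^+ d.+1.
Proof.
have G0 y : 0 <= G y by rewrite /G; case: ifP => // _; apply: sqr_ge0.
have GN y : G y != 0 -> (nrm y <= 2 * rho)%N by rewrite /G; case: ifP => [/andP[]|]//; rewrite eqxx.
pose n := (3 * rho)%N.
have ki : 0 <= kappa^-1 by rewrite invr_ge0 ltW.
have sG : bsum N G <= kappa^-1 *
    (80 * D * kappa^-1 * 11 ^+ d.+1 * rho%:R ^+ d.+1 / rho%:R ^+ 2).
  apply: le_trans (ler_wpM2l ki log_gradient).
  rewrite /bsum mulr_sumr; apply: ler_sum => y _.
  rewrite (bigD1 up) //= mulrDr -[leLHS]addr0 lerD //; last first.
    apply: mulr_ge0 => //; apply: sumr_ge0 => s _.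
    by apply: mulr_ge0; [exact: (cond_ge0 k0 cP) | apply: mulr_ge0; apply: sqr_ge0].
  rewrite /G; case: ifP => [/andP[ny hy]|_]; last first.
    apply: mulr_ge0 => //; apply: mulr_ge0; first exact: (cond_ge0 k0 cP).
    by apply: mulr_ge0; apply: sqr_ge0.
  have one z : (nrm z <= 2 * rho)%N -> phi z = 1.
    move=> nz; rewrite /phi clamp01_eq1 // ler_pdivlMr // mul1r.
    by move: nz; rewrite -(ler_nat R) natrM; lra.
  rewrite !one ?nrm_up // minxx expr1n mul1r mulrA ler_peMl ?sqr_ge0 //.
  by rewrite mulrC ler_pdivlMr // mul1r (cond_ge cP).
have big : bsum (2 * rho) (fun x => u x ^+ 2) <= n%:R * (n%:R * bsum N G).
  apply: (@le_trans _ _ (n%:R * \sum_(0 <= j < n) bsum (2 * rho) (fun x => G (x + dir up *+ j)))).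
    rewrite /bsum exchange_big mulr_sumr /= big_seq [leRHS]big_seq.
    apply: ler_sum => x; rewrite mem_box => nx; apply: vertical_line => //.
    have := nrm_coord x ord0; rewrite /height /n; move: (x ord0 ord0 : int) => h; lia.
  rewrite ler_wpM2l // mulr_natl -[X in bsum N G *+ X]subn0 -sumr_const_nat.
  apply: ler_sum_nat => j jn.
  have nj : (nrm (dir up *+ j) <= j)%N.
    elim: (j) => [|i IH]; first by rewrite mulr0n nrm0.
    by rewrite mulrSr; apply: leq_trans (nrmD _ _) _; rewrite nrm_dir addn1.
  rewrite -(@bsum_shift d R N (2 * rho) (dir up *+ j) G) //; last first.
    by move: jn nj; rewrite /n /N; lia.
  rewrite /bsum [leRHS](bigID (fun x => (nrm x <= 2 * rho)%N)) /=.
  rewrite -[leLHS]addr0 lerD ?sumr_ge0 //.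
  rewrite -[leRHS]big_filter; apply: le_of_eq; apply/perm_big.
  apply: uniq_perm; rewrite ?filter_uniq ?box_uniq // => x.
  rewrite mem_filter !mem_box; apply/idP/andP => [h|[]//]; split => //.
  by apply: leq_trans h _; rewrite /N; lia.
apply: (le_trans big); apply: le_trans (ler_wpM2l _ (ler_wpM2l _ sG)) _ => //.
rewrite /n natrM; apply: le_of_eq.
by field; rewrite !gt_eqF.
Qed.

(** The level at which [log_l2] meets the smallness condition of [local_max] with radius [2 * rho];
    the summand [4] covers the source, since [a * (2 * rho)^2 = 4]. It does not depend on [rho]. *)
Definition log_level : R :=
  4 + 8 * (720 * D * kappa ^- 2 * 11 ^+ d.+1) / (dg_gap d kappa * 2) ^+ d.+1.

Lemma log_bound : expR (- log_level) <= m 0.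
Proof.
have gp := dg_gap_gt0 d k0.
set C3 := 720 * D * kappa ^- 2 * 11 ^+ d.+1.
have C30 : 0 <= C3 by rewrite !mulr_ge0 ?exprn_ge0 // invr_ge0 sqr_ge0.
have q0 : 0 < (dg_gap d kappa * 2) ^+ d.+1 by rewrite exprn_gt0 // mulr_gt0.
have e0 : 0 <= 8 * C3 / (dg_gap d kappa * 2) ^+ d.+1.
  by apply: divr_ge0; [exact: mulr_ge0 | exact: ltW].
have K4 : 4 <= log_level by rewrite /log_level -/C3; lra.
have K0 : 0 < log_level by lra.
suff : u 0 <= log_level.
  by rewrite /u lerNl => h; rewrite -[m 0]lnK ?posrE // ler_expR.
apply: (@local_max c u 0 (2 * rho) a log_level) => //.
- by rewrite muln_gt0.
- rewrite aE natrM exprMn; apply: le_trans K4.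
  by rewrite mulrCA mulVf ?mulr1 ?expf_neq0 ?gt_eqF // -natrX ler_nat.
- move=> x; rewrite subr0 => nx _; apply: log_subsolution; lia.
have -> : bsum (2 * rho) (fun x => u (0 + x) ^+ 2) = bsum (2 * rho) (fun x => u x ^+ 2).
  by apply: eq_bigr => x _; rewrite add0r.
apply: (le_trans log_l2); rewrite -/C3.
rewrite [leRHS](_ : _ = (dg_gap d kappa * 2) ^+ d.+1 / 8 * log_level ^+ 2 * rho%:R ^+ d.+1).
  rewrite ler_wpM2r ?exprn_ge0 // mulrAC ler_pdivlMr // mulrC -ler_pdivrMl //.
  rewrite mulrC; apply: (@le_trans _ _ log_level); first by rewrite /log_level -/C3; lra.
  by rewrite expr2 ler_peMl //; lra.
by rewrite natrM !exprMn; ring.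
Qed.

End LogBound.
End Climb.

(** * Stopped walks: climbing, lingering in a slab, rising before a return to zero *)

Section Stopping.
Variables (R : realType) (d : nat).
Local Notation pt := 'rV[int]_d.+1.
Local Notation D := (d.+1%:R : R).
Implicit Types (x y z : pt) (f g u v : pt -> R) (c : pt -> step d -> R).
Implicit Types (A B S : pred pt).

Lemma nrm_tri x y z : (nrm (x - z)%R <= nrm (x - y)%R + nrm (y - z)%R)%N.
Proof. by apply: leq_trans (nrmD _ _); rewrite addrA subrK. Qed.

Lemma nrm_stepB x s z : (nrm (x + dir s - z)%R <= (nrm (x - z)%R).+1)%N.
Proof. by rewrite addrAC; apply: nrm_step. Qed.

(** The mean of [g] at the exit time from [A] or at time [n], whichever comes first, as a recursion
    on the first step; no path measure is involved. [dstopv] discounts each step spent in [A] by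
    [lam]. *)
Fixpoint stopv c A g n x : R :=
  if n is k.+1 then if A x then avg c (stopv c A g k) x else g x else g x.

Fixpoint dstopv c (lam : R) A g n x : R :=
  if n is k.+1 then if A x then lam * avg c (dstopv c lam A g k) x else g x
  else g x.

(** A point of [S] outside [A] still counts, so leaving [A] directly into [S] is a hit. *)
Definition hitp c S A := stopv c (fun x => A x && ~~ S x) (fun x => (S x)%:R).

Lemma avg_eq c f g x : (forall s, f (x + dir s) = g (x + dir s)) ->
  avg c f x = avg c g x.
Proof. by move=> fg; apply: eq_bigr => s _; rewrite fg. Qed.

Lemma stopv_shift c x0 A g n x :
  stopv (fun y => c (x0 + y)) (fun y => A (x0 + y)) (fun y => g (x0 + y)) n x =
  stopv c A g n (x0 + x).
Proof.
elim: n x => //= n IH x; case: ifP => // _.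
by rewrite -avg_shift; apply: avg_eq => s; rewrite IH.
Qed.

Lemma stopv_out c A g n x : ~~ A x -> stopv c A g n x = g x.
Proof. by case: n => //= n /negPf ->. Qed.

Lemma dstopv_out c lam A g n x : ~~ A x -> dstopv c lam A g n x = g x.
Proof. by case: n => //= n /negPf ->. Qed.

Lemma eq_stopv c A B g g' n x : A =1 B -> g =1 g' ->
  stopv c A g n x = stopv c B g' n x.
Proof.
move=> AB gg; elim: n x => [|n IH] x /=; first exact: gg.
by rewrite AB; case: ifP => // _; apply: avg_eq => s; apply: IH.
Qed.

(** Takes the place of exponential estimates: it gives [(1 - t)^n <= 1 / (1 + n t)]. *)
Lemma bernoulli_le (t : R) n : 0 <= t <= 1 -> (1 - t) ^+ n * (1 + n%:R * t) <= 1.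
Proof.
move=> /andP[t0 t1]; elim: n => [|n IH]; first by rewrite expr0 mul0r addr0 mulr1.
apply: le_trans IH; rewrite exprS -natr1 mulrAC [leRHS]mulrC.
rewrite ler_wpM2r ?exprn_ge0 ?subr_ge0 //.
by have : (0 : R) <= n%:R by []; nra.
Qed.

Section Fixed.
Variables (kappa : R) (k0 : 0 < kappa) (c : pt -> step d -> R).
Hypothesis cP : conductances kappa c.

Lemma stopv_le A f g n x : (forall y, f y <= g y) ->
  stopv c A f n x <= stopv c A g n x.
Proof.
move=> fg; elim: n x => //= n IH x; case: ifP => // _.
exact: (avg_le k0 cP).
Qed.

Lemma avg1B f x : avg c (fun y => 1 - f y) x = 1 - avg c f x.
Proof.
rewrite /avg; under eq_bigr do rewrite mulrBr mulr1.
by rewrite sumrB (tprob_sum k0 cP).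
Qed.

Lemma stopv_ge0 A g n x : (forall y, 0 <= g y) -> 0 <= stopv c A g n x.
Proof.
move=> g0; elim: n x => //= n IH x; case: ifP => // _.
exact: (avg_ge0 k0 cP).
Qed.

Lemma stopv_le1 A g n x : (forall y, g y <= 1) -> stopv c A g n x <= 1.
Proof.
move=> g0; elim: n x => //= n IH x; case: ifP => // _.
by rewrite -[leRHS](avg_cst k0 cP 1 x); apply: (avg_le k0 cP).
Qed.

Lemma stopvD A f g n x :
  stopv c A (fun y => f y + g y) n x = stopv c A f n x + stopv c A g n x.
Proof.
elim: n x => //= n IH x; case: ifP => // _.
by rewrite -avgD; apply: avg_eq => s.
Qed.

Lemma hitp_ge0 S A n x : 0 <= hitp c S A n x.
Proof. exact: stopv_ge0. Qed.

Lemma hitp_le1 S A n x : hitp c S A n x <= 1.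
Proof. by apply: stopv_le1 => y; case: (S y). Qed.

Lemma hitp_in S A n x : S x -> hitp c S A n x = 1.
Proof. by move=> Sx; rewrite /hitp stopv_out Sx // andbF. Qed.

Lemma hitp_mono S A B n x : (forall y, A y -> B y) -> hitp c S A n x <= hitp c S B n x.
Proof.
rewrite /hitp => AB; elim: n x => //= n IH x.
case: (boolP (S x)) => Sx; first by rewrite !andbF.
rewrite !andbT; case: (boolP (A x)) => [/AB -> |_]; first exact: (avg_le k0 cP).
by case: ifP => // _; apply: (avg_ge0 k0 cP) => y; apply: hitp_ge0.
Qed.

Lemma hitpS S A n x : hitp c S A n x <= hitp c S A n.+1 x.
Proof.
rewrite /hitp; elim: n x => [|n IH] x.
  rewrite /=; case: (boolP (S x)) => Sx; first by rewrite andbF.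
  rewrite andbT; case: (A x) => //.
  by apply: (avg_ge0 k0 cP) => y; case: (S y).
rewrite [leLHS]/= [leRHS]/=; case: ifP => // _; exact: (avg_le k0 cP).
Qed.

Lemma hitp_le S A n m x : (n <= m)%N -> hitp c S A n x <= hitp c S A m x.
Proof.
move/subnKC => <-; elim: (m - n)%N => [|k IH]; first by rewrite addn0.
by rewrite addnS; apply: (le_trans IH); apply: hitpS.
Qed.

Lemma hitp_comp S1 S2 A (th : R) n T x : 0 <= th <= 1 ->
  (forall y, S1 y -> th <= hitp c S2 A T y) ->
  th * hitp c S1 A n x <= hitp c S2 A (n + T) x.
Proof.
move=> /andP[th0 th1] H; elim: n x => [|n IH] x.
  have [S1x|S1x] := boolP (S1 x); first by rewrite hitp_in // mulr1 H.
  by rewrite /hitp /= (negPf S1x) mulr0 hitp_ge0.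
have [S1x|S1x] := boolP (S1 x).
  rewrite hitp_in // mulr1; apply: le_trans (H _ S1x) _; apply: hitp_le.
  exact: leq_addl.
have [S2x|S2x] := boolP (S2 x).
  by rewrite [leRHS]hitp_in // -[leRHS]mulr1 ler_pM ?hitp_ge0 ?hitp_le1.
rewrite /hitp addSn [X in th * X]/= [leRHS]/= S1x S2x !andbT.
case: ifP => Ax; last by rewrite (negPf S1x) mulr0.
by rewrite -avgM; apply: (avg_le k0 cP) => s; apply: IH.
Qed.

End Fixed.

Section Climbing.
Variables (kappa : R) (k0 : 0 < kappa).

Section Discounted.
Variables (c : pt -> step d -> R) (lam : R) (A : pred pt) (g : pt -> R).
Hypotheses (cP : conductances kappa c) (l01 : 0 <= lam <= 1).
Hypotheses (g01 : forall y, 0 <= g y <= 1) (gA : forall y, A y -> g y = 0).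
Local Notation w := (dstopv c lam A g).

Lemma dstopv_itv n x : 0 <= w n x <= 1.
Proof.
case/andP: l01 => l0 l1.
elim: n x => //= n IH x; case: ifP => // _; apply/andP; split.
  by rewrite mulr_ge0 // (avg_ge0 k0 cP) // => y; case/andP: (IH y).
rewrite -[leRHS]mulr1 ler_pM //.
  by apply: (avg_ge0 k0 cP) => y; case/andP: (IH y).
by rewrite -[leRHS](avg_cst k0 cP 1 x); apply: (avg_le k0 cP) => s; case/andP: (IH (x + dir s)).
Qed.

(** Under discounting, successive time horizons differ geometrically little, so for a large horizon
    [dstopv] is almost a fixed point and can play the part of a time-independent supersolution. *)
Lemma dstopvS_le n x : w n.+1 x <= w n x + lam ^+ n.+1.
Proof.
case/andP: l01 => l0 l1.
elim: n x => [|n IH] x.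
  rewrite /=; case: ifP => _; last by rewrite lerDl.
  rewrite expr1 -[leLHS]add0r lerD //; first by case/andP: (g01 x).
  rewrite ler_piMr // -[leRHS](avg_cst k0 cP 1 x).
  by apply: (avg_le k0 cP) => s; case/andP: (g01 (x + dir s)).
rewrite [w n.+2 x]/= [w n.+1 x]/=; case: ifP => _; last by rewrite lerDl exprn_ge0.
rewrite [lam ^+ n.+2]exprS -mulrDr ler_wpM2l //.
rewrite -[X in _ + X](avg_cst k0 cP _ x) -avgD.
by apply: (avg_le k0 cP) => s; apply: IH.
Qed.

(** Paths that stop within [n] steps have weight at most one and all others weight at most
    [lam ^+ n]; this converts the discounted estimate back into one at a finite time. *)
Lemma dstopv_stopv n m x : w m x <= stopv c A g n x + lam ^+ n.
Proof.
case/andP: l01 => l0 l1; elim: n m x => [|n IH] m x.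
  by have /andP[_ h] := dstopv_itv m x; have /andP[g0 _] := g01 x; rewrite /= expr0; lra.
case: m => [|m] /=; case: ifP => Ax; rewrite ?lerDl ?exprn_ge0 //.
  rewrite gA // addr_ge0 ?exprn_ge0 //; apply: (avg_ge0 k0 cP) => y.
  by apply: (stopv_ge0 k0 cP) => z; case/andP: (g01 z).
apply: (@le_trans _ _ (lam * (avg c (stopv c A g n) x + lam ^+ n))).
  rewrite ler_wpM2l // -[X in _ + X](avg_cst k0 cP _ x) -avgD.
  exact: (avg_le k0 cP).
rewrite mulrDr -exprS lerD2r ler_piMl //; apply: (avg_ge0 k0 cP) => y.
by apply: (stopv_ge0 k0 cP) => z; case/andP: (g01 z).
Qed.

End Discounted.

(** The discounted estimate yields [exp (- log_level) / 2], and half of it pays for the passage to a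
    finite time; [climb_time] is chosen to make that payment sufficient. *)
Definition climb_prob : R := expR (- log_level d kappa) / 4.
Definition climb_time : nat := (Num.truncn (2 / climb_prob)).+1.

Lemma climb_prob_gt0 : 0 < climb_prob.
Proof. by rewrite divr_gt0 ?expR_gt0. Qed.

Lemma climb_timeP : 2 <= climb_prob * climb_time%:R.
Proof.
have p0 : 0 <= 2 / climb_prob by rewrite divr_ge0 // ltW // climb_prob_gt0.
have /andP[_ h] := truncn_itv p0.
by rewrite mulrC -ler_pdivrMr ?climb_prob_gt0 // ltW.
Qed.

Lemma climb_prob_lt1 : climb_prob < 1.
Proof.
rewrite /climb_prob ltr_pdivrMr // mul1r.
apply: (@le_lt_trans _ _ 1); last by rewrite ltr1n.
rewrite -expR0 ler_expR oppr_le0 /log_level addr_ge0 // divr_ge0 //.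
  by rewrite !mulr_ge0 ?exprn_ge0 // invr_ge0 sqr_ge0.
by rewrite exprn_ge0 // mulr_ge0 // ltW // dg_gap_gt0.
Qed.

(** [log_bound] is applied to the discounted probability of climbing by [rho], with discount [1 - t]
    and [t = 1 / (2 * rho^2)], which makes it a supersolution with source [rho^-2]. A small [s] is
    added because the logarithm needs a positive function. *)
Lemma climb0 c rho : conductances kappa c -> (0 < rho)%N ->
  climb_prob <= hitp c (fun y => rho%:Z <= height y) (fun y => (nrm y <= 4 * rho)%N)
                  (climb_time * rho ^ 2) 0.
Proof.
move=> cP r0; have rp : (0 : R) < rho%:R by rewrite ltr0n.
pose t : R := (2 * rho%:R ^+ 2)^-1.
have r2 : 1 <= rho%:R ^+ 2 :> R by rewrite expr_ge1 // ler1n.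
have t0 : 0 < t by rewrite invr_gt0 mulr_gt0 // exprn_gt0.
have t1 : t <= 2^-1 by rewrite /t invfM; apply: ler_piMr;
    [rewrite invr_ge0 | rewrite invf_le1 // exprn_gt0].
pose lam := 1 - t; have l01 : 0 <= lam <= 1 by rewrite /lam; apply/andP; split; lra.
pose S y := rho%:Z <= height y; pose Q y := (nrm y <= 4 * rho)%N.
pose A y := Q y && ~~ S y; pose g y : R := (S y)%:R.
have g01 y : 0 <= g y <= 1 by rewrite /g; case: (S y); rewrite /= ?lexx ?ler01.
have gA y : A y -> g y = 0 by rewrite /A /g => /andP[_ /negPf ->].
pose e := expR (- log_level d kappa); have e0 : 0 < e by apply: expR_gt0.
pose s := e / 2; have s0 : 0 < s by rewrite divr_gt0.
(* The horizon [T] is long enough for its defect to be at most [s * t], exactly what discounting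
   takes off the added [s]: [lam * s + s * t = s]. *)
have [T lT] : exists T, lam ^+ T <= s * t.
  pose T := (Num.truncn ((s * t ^+ 2)^-1)).+1; exists T.
  have st : 0 < s * t ^+ 2 by rewrite mulr_gt0 // exprn_gt0.
  have /andP[_ hT] := truncn_itv (ltW (etrans (invr_gt0 (s * t ^+ 2)) st)).
  have B := @bernoulli_le t T; rewrite -/lam in B.
  have Tt : (s * t ^+ 2)^-1 * t <= 1 + T%:R * t.
    by rewrite ler_wpDl // ler_wpM2r ?ltW.
  have Tt' : 1 <= s * t * (1 + T%:R * t).
    have := ler_wpM2l (ltW (mulr_gt0 s0 t0)) Tt.
    by rewrite (_ : s * t * ((s * t ^+ 2)^-1 * t) = 1) //; field; rewrite !gt_eqF.
  have pT : 0 < 1 + T%:R * t by rewrite ltr_pwDl // mulr_ge0 // ltW.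
  rewrite -(ler_pM2r pT); apply: le_trans Tt'; apply: B; apply/andP; split; lra.
pose w := dstopv c lam A g; have w01 := @dstopv_itv c lam A g cP l01 g01.
pose m x := Num.min 1 (w T x + s).
have m01 x : 0 < m x <= 1.
  by rewrite /m lt_min ltr01 /= ge_min lexx /= andbT ltr_wpDl //; case/andP: (w01 T x).
have mS x : S x -> m x = 1.
  move=> Sx; rewrite /m /w dstopv_out; last by rewrite /A Sx andbF.
  by rewrite min_l // /g Sx lerDl ltW.
have msup x : (nrm x <= 3 * rho)%N -> avg c m x <= (1 + rho%:R ^- 2) * m x.
  move=> nx; have tE : rho%:R ^- 2 = 2 * t by rewrite /t; field; rewrite gt_eqF.
  have av1 : avg c m x <= 1.
    rewrite -[leRHS](avg_cst k0 cP 1 x); apply: (avg_le k0 cP) => s'.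
    by case/andP: (m01 (x + dir s')).
  have [m1|m1] := leP 1 (w T x + s).
    by rewrite /m min_l // mulr1 tE; lra.
  have Sx : ~~ S x.
    apply/negP => Sx; move: m1; rewrite /w dstopv_out ?/A ?Sx ?andbF // /g Sx ltNge.
    by rewrite lerDl ltW.
  have Ax : A x by rewrite /A Sx andbT /Q (leq_trans nx) // leq_mul2r orbT.
  have E : lam * avg c m x <= m x.
    rewrite [m x]min_r ?(ltW m1) //.
    have := @dstopvS_le c lam A g cP l01 g01 T x; rewrite [dstopv _ _ _ _ _.+1 _]/= Ax -/w => h.
    have av : avg c m x <= avg c (w T) x + s.
      rewrite -[X in _ + X](avg_cst k0 cP s x) -avgD; apply: (avg_le k0 cP) => s'.
      by rewrite /m ge_min lexx orbT.
    have := ler_wpM2l (proj1 (andP l01)) av; rewrite mulrDr.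
    have : lam ^+ T.+1 <= s * t.
      by apply: le_trans lT; rewrite exprS ler_piMl ?exprn_ge0 //; case/andP: l01.
    by rewrite /lam in h *; lra.
  have mx0 : 0 < m x by case/andP: (m01 x).
  have av0 : 0 <= avg c m x by apply: (avg_ge0 k0 cP) => y; apply/ltW; case/andP: (m01 y).
  rewrite tE; apply: (@le_trans _ _ ((1 + 2 * t) * (lam * avg c m x))).
    rewrite mulrA ler_peMl // /lam.
    have -> : (1 + 2 * t) * (1 - t) = 1 + t * (1 - 2 * t) by ring.
    by rewrite lerDl mulr_ge0 ?(ltW t0) //; lra.
  by rewrite ler_wpM2l // addr_ge0 // mulr_ge0 // ltW.
have lb := log_bound k0 cP r0 m01 (erefl (rho%:R ^- 2)) msup mS.
have w0 : e / 2 <= w T 0.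
  move: lb; rewrite -/e /m le_min => /andP[_]; rewrite /s; lra.
(* For [n = climb_time * rho^2] the product [n * t] is [climb_time / 2], and Bernoulli gives
   [lam ^+ n <= 1 / (1 + climb_time / 2)]. *)
have ln n : n%:R * t = climb_time%:R / 2 -> lam ^+ n <= e / 4.
  move=> nt; have ct := climb_timeP.
  have t01 : 0 <= t <= 1 by apply/andP; split; lra.
  have pn : 0 < 1 + n%:R * t by rewrite ltr_pwDl // mulr_ge0 // ltW.
  rewrite -(ler_pM2r pn); apply: le_trans (bernoulli_le n t01) _.
  rewrite -/climb_prob nt; move: ct climb_prob_gt0.
  by move: climb_prob (climb_time%:R) => p C; lra.
have {}ln := ln (climb_time * rho ^ 2)%N.
move: ln; set n := (climb_time * rho ^ 2)%N => ln.
have nt : n%:R * t = climb_time%:R / 2.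
  by rewrite /n natrM natrX /t; move: climb_time%:R => C; field; rewrite gt_eqF.
have {ln nt} := ln nt; move: n => n ln.
have := @dstopv_stopv c lam A g cP l01 g01 gA n T 0.
rewrite -/w => dd; apply: (@le_trans _ _ (w T 0 - lam ^+ n)); last by rewrite lerBlDr.
rewrite /climb_prob -/e; move: w0 ln; move: (w T 0) (lam ^+ n) => W L.
by move: (e) => e'; lra.
Qed.

Lemma climb c rho x : conductances kappa c -> (0 < rho)%N ->
  climb_prob <= hitp c (fun y => height x + rho%:Z <= height y)
     (fun y => (nrm (y - x) <= 4 * rho)%N) (climb_time * rho ^ 2) x.
Proof.
move=> cP r0; have := climb0 (conductances_shift x cP) r0.
set T := (climb_time * rho ^ 2)%N.
have := @stopv_shift c x (fun y => (nrm (y - x)%R <= 4 * rho)%N &&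
  ~~ (height x + rho%:Z <= height y)%R)
  (fun y => (height x + rho%:Z <= height y)%R%:R) T 0.
rewrite addr0 /hitp => <- /le_trans; apply.
apply: le_of_eq; apply: eq_stopv => y /=.
  by rewrite heightD lerD2l addrC addKr.
by rewrite heightD lerD2l.
Qed.

End Climbing.

Lemma uphalf_bounds H : (1 < H)%N -> [/\ (0 < uphalf H)%N /\ (uphalf H < H)%N,
  (H <= 2 * uphalf H)%N & (3 * uphalf H <= 2 * H)%N].
Proof. by move=> H1; split; [split|..]; lia. Qed.

Lemma double_height (H H' : nat) (h : int) : (H <= 2 * H')%N -> (0 < H')%N ->
  H'%:Z <= h -> 0 < h /\ H%:Z <= 2 * h.
Proof. by lia. Qed.

(** Budget for one step of the induction over scales. Passing to [uphalf H <= 2 * H / 3] allows [m]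
    to grow by an eighth: the space budget shrinks to [9/8 * 2/3 = 3/4] and the time budget to
    [9/8 * 4/9 = 1/2]. What is left accommodates [j >= m] attempts to leave the slab of height [H],
    each costing [4 * H + 1] in space and [C * H^2] in time. *)
Lemma scale_split (C H m sp j m' : nat) : sp = (8 * (5 + C))%N ->
  j = (8 * (m %/ 4))%N -> m' = (m + m %/ 8)%N -> (1 < H)%N -> (8 <= m)%N ->
  [/\ (sp * m' * uphalf H + 1 + j * (4 * H + 1) <= sp * m * H)%N,
      (sp * m' * uphalf H ^ 2 + j * (C * H ^ 2) <= sp * m * H ^ 2)%N & (m <= j)%N].
Proof.
move=> spE jE m'E H1 m8; have [[hH1 hH2] hH3 hH4] := uphalf_bounds H1.
set H' := uphalf H in hH1 hH2 hH3 hH4 *.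
have sp1 : (j * 5 <= sp * (m %/ 4))%N by nia.
have sp2 : (j * C <= sp * (m %/ 4))%N by nia.
have mm4 : (4 * (m %/ 4) <= m)%N by lia.
have mm8 : (8 * m' <= 9 * m)%N by lia.
split; last by lia.
  have a1 : (4 * (sp * m' * H') <= 3 * (sp * m * H))%N.
    have : (8 * m' * (3 * H') <= 9 * m * (2 * H))%N by rewrite leq_mul.
    by have := leq0n sp; nia.
  have a2 : (1 + j * (4 * H + 1) <= j * 5 * H)%N by nia.
  have a3 : (j * 5 * H <= sp * (m %/ 4) * H)%N by rewrite leq_mul2r sp1 orbT.
  have a4 : (4 * (sp * (m %/ 4) * H) <= sp * m * H)%N.
    by have := leq_mul (leqnn (sp * H)) mm4; nia.
  lia.
have b0 : (9 * (H' ^ 2) <= 4 * H ^ 2)%N by have := leq_mul hH4 hH4; nia.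
have a1 : (2 * (sp * m' * H' ^ 2) <= sp * m * H ^ 2)%N.
  have : (8 * m' * (9 * H' ^ 2) <= 9 * m * (4 * H ^ 2))%N by rewrite leq_mul.
  by nia.
have a3 : (j * (C * H ^ 2) <= sp * (m %/ 4) * H ^ 2)%N.
  by rewrite mulnA leq_mul2r sp2 orbT.
have a4 : (4 * (sp * (m %/ 4) * H ^ 2) <= sp * m * H ^ 2)%N.
  by have := leq_mul (leqnn (sp * H ^ 2)) mm4; nia.
lia.
Qed.

Section Slab.
Variables (kappa : R) (k0 : 0 < kappa) (c : pt -> step d -> R).
Hypothesis cP : conductances kappa c.
Local Notation eta := (climb_prob kappa).
Local Notation C := (climb_time kappa).

Definition inslab (b : int) (H : nat) y := b < height y < b + H%:Z.

(** The walk is also stopped on leaving the ball about [x0], and it then counts as lingering if it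
    is still in the slab; so a walk that does not linger has left the slab without going far. *)
Definition linger b H (M : nat) x0 n z : R :=
  stopv c (fun y => inslab b H y && (nrm (y - x0)%R <= M)%N)
    (fun y => (inslab b H y)%:R) n z.

Lemma linger_ge0 b H M x0 n z : 0 <= linger b H M x0 n z.
Proof. by apply: (stopv_ge0 k0 cP). Qed.

Lemma linger_le1 b H M x0 n z : linger b H M x0 n z <= 1.
Proof. by apply: (stopv_le1 k0 cP) => y; case: inslab. Qed.

(** From any position in the slab, a climb by [H] leaves it, takes time [C * H^2] and stays within
    distance [4 * H], with probability at least [eta]; after a failure the attempt is repeated. The
    [+ 1] in the radius is the step that leaves the ball of a failed attempt. *)
Lemma linger_exit b H M x0 j N z : (0 < H)%N ->
  (nrm (z - x0)%R + j * (4 * H + 1) <= M)%N -> (j * (C * H ^ 2) <= N)%N ->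
  linger b H M x0 N z <= (1 - eta) ^+ j.
Proof.
move=> H0; elim: j N z => [|j IH] N z; first by rewrite expr0 linger_le1.
rewrite (mulSn j (4 * H + 1)) (mulSn j (C * H ^ 2)) => zM CN.
have q0 : 0 <= (1 - eta) ^+ j by rewrite exprn_ge0 // subr_ge0 ltW // climb_prob_lt1.
set q := (1 - eta) ^+ j in q0.
have [hz|hz] := leP (height z) b.
  rewrite /linger stopv_out; last by rewrite /inslab ltNge hz.
  by rewrite /inslab ltNge hz /= exprn_ge0 // subr_ge0 ltW // climb_prob_lt1.
pose T := (C * H ^ 2)%N; pose N0 := (N - T)%N.
have TN : (T <= N)%N by apply: leq_trans CN; apply: leq_addr.
have NE : N = (N0 + T)%N by rewrite /N0 subnK.
have jN0 : (j * (C * H ^ 2) <= N0)%N by rewrite /N0 leq_subRL.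
pose h n y := hitp c (fun y => height z + H%:Z <= height y)
     (fun y => (nrm (y - z)%R <= 4 * H)%N) n y.
have key n y : (nrm (y - z)%R <= 4 * H + 1)%N ->
    linger b H M x0 (N0 + n) y <= q * (1 - h n y).
  elim: n y => [|n IHn] y nyz.
    have ny : (nrm (y - x0)%R + j * (4 * H + 1) <= M)%N.
      have := nrm_tri y z x0; lia.
    have [Sy|Sy] := boolP (height z + H%:Z <= height y).
      rewrite /h hitp_in // subrr mulr0 /linger stopv_out /inslab.
        by rewrite [height y < _]ltNge (_ : b + _ <= _) ?andbF //; lia.
      by rewrite [height y < _]ltNge (_ : b + _ <= _) ?andbF //; lia.
    rewrite /h /hitp /= (negPf Sy) subr0 mulr1.
    by apply: IH => //; rewrite addn0.
  have ny : (nrm (y - x0)%R + j * (4 * H + 1) <= M)%N.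
    have := nrm_tri y z x0; lia.
  have [Sy|Sy] := boolP (height z + H%:Z <= height y).
    rewrite /h hitp_in // subrr mulr0 /linger stopv_out /inslab.
      by rewrite [height y < _]ltNge (_ : b + _ <= _) ?andbF //; lia.
    by rewrite [height y < _]ltNge (_ : b + _ <= _) ?andbF //; lia.
  have [ny4|ny4] := leqP (nrm (y - z)%R) (4 * H); last first.
    rewrite /h /hitp stopv_out; last by rewrite leqNgt ny4.
    rewrite (negPf Sy) subr0 mulr1.
    by apply: IH => //; apply: leq_trans jN0 (leq_addr _ _).
  have [sy|sy] := boolP (inslab b H y); last first.
    rewrite /linger stopv_out ?(negPf sy) // mulr_ge0 // subr_ge0.
    exact: (hitp_le1 k0 cP).
  rewrite /linger addnS /= sy (_ : (nrm _ <= M)%N); last by lia.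
  rewrite /h /hitp /= Sy ny4 /=.
  rewrite -(avg1B k0 cP) -avgM.
  apply: (avg_le k0 cP) => s; apply: IHn.
  by have := nrm_stepB y s z; lia.
have := key T z; rewrite subrr nrm0 -NE => /(_ isT) /le_trans; apply.
rewrite exprS mulrC ler_wpM2r // lerB //.
exact: (climb k0 z cP H0).
Qed.

Definition rise H n y : R :=
  hitp c (fun y => H%:Z <= height y) (fun y => 0 < height y) n y.

Definition rise_prob : R := Num.min eta (kappa ^+ 2 / (2 * D)).

Lemma rise_prob_gt0 : 0 < rise_prob.
Proof.
by rewrite lt_min climb_prob_gt0 divr_gt0 ?exprn_gt0 ?mulr_gt0 ?ltr0n.
Qed.

Lemma rise_prob_le1 : rise_prob <= 1.
Proof. by rewrite ge_min ltW ?orbT // climb_prob_lt1. Qed.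

(** From height at least [5], a climb by a fifth of the height stays within four fifths of it and
    cannot touch zero; below that, a single upward step is already a definite fraction of the
    height. *)
Lemma rise_some z : 0 < height z -> exists rho : nat,
  [/\ (0 < rho)%N, height z <= 10 * rho%:Z, rho%:Z <= height z &
    rise_prob <= hitp c (fun y => height z + rho%:Z <= height y)
      (fun y => 0 < height y) (C * rho ^ 2) z].
Proof.
move=> hz; have [h5|h5] := leP 5 (height z).
  pose rho := (`|height z| %/ 5)%N; exists rho.
  have [r1 r2 r3] : [/\ (0 < rho)%N, height z <= 10 * rho%:Z & 5 * rho%:Z <= height z].
    by rewrite /rho; split; lia.
  split=> //; first by lia.
  apply: (@le_trans _ _ eta); first by rewrite ge_min lexx.
  apply: le_trans (climb k0 z cP r1) _; apply: (hitp_mono k0 cP) => y.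
  have := height_nrm y z; lia.
exists 1%N; split=> //; try lia.
apply: (@le_trans _ _ (hitp c (fun y => height z + 1%N%:Z <= height y)
      (fun y => 0 < height y) 1 z)); last by apply: (hitp_le k0 cP).
rewrite /hitp /= hz ifT /=; last by lia.
apply: (@le_trans _ _ (tprob c z (up d))).
  apply: le_trans (tprob_lb k0 cP z (up d)); by rewrite ge_min lexx orbT.
rewrite /avg (bigD1 (up d)) //= heightD height_up lexx mulr1 lerDl.
by apply: sumr_ge0 => s _; rewrite mulr_ge0 ?(tprob_ge0 k0 cP).
Qed.

(** Each application of [rise_some] gains at least a tenth of the initial height, so ten of them
    double it. *)
Lemma rise_double H y : 0 < height y -> H%:Z <= 2 * height y ->
  rise_prob ^+ 10 <= rise H (10 * (C * H ^ 2)) y.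
Proof.
move=> hy hH; have p01 : 0 <= rise_prob <= 1.
  by rewrite rise_prob_le1 ltW // rise_prob_gt0.
have pi i : 0 <= rise_prob ^+ i <= 1.
  by case/andP: p01 => p0 p1; rewrite exprn_ge0 // exprn_ile1.
suff key i z : height y <= height z ->
    10 * (H%:Z - height z) <= i%:Z * height y ->
    rise_prob ^+ i <= rise H (i * (C * H ^ 2)) z by apply: key; lia.
elim: i z => [|i IH] z yz hi.
  by rewrite expr0 /rise hitp_in //; lia.
have [Hz|Hz] := leP H%:Z (height z); first by rewrite /rise hitp_in //; case/andP: (pi i.+1).
have [|rho [r0 r1 r2 r3]] := @rise_some z; first by lia.
rewrite mulSn addnC exprS /rise.
apply: (@le_trans _ _ (rise_prob ^+ i * hitp c (fun w => height z + rho%:Z <= height w)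
      (fun w => 0 < height w) (C * rho ^ 2) z)).
  by rewrite mulrC ler_wpM2l //; case/andP: (pi i).
apply: (@le_trans _ _ (hitp c (fun w => H%:Z <= height w) (fun w => 0 < height w)
   (C * rho ^ 2 + i * (C * H ^ 2)) z)).
  apply: (hitp_comp k0 cP) => // w hw; apply: IH; first by lia.
  have iS : i.+1%:Z = i%:Z + 1 by lia.
  move: hi; rewrite iS (mulrDl i%:Z) mul1r.
  move: (i%:Z * height y : int) => ih; lia.
apply: (hitp_le k0 cP); rewrite addnC leq_add2l leq_mul2l leq_exp2r //.
by apply/orP; right; lia.
Qed.

Definition spread : nat := (8 * (5 + C))%N.

(** [rise_prob ^+ 10] is the price of doubling the height, and [2] counts the two ways of lingering,
    before half the height is reached and after; [rise_start] makes [(1 - eta) ^+ (m %/ 8)] absorb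
    this constant. *)
Definition rise_const : R := 2 / rise_prob ^+ 10.

Definition rise_start : nat :=
  (8 * (Num.truncn (rise_const / eta)).+1)%N.

Lemma rise_start_pow m : (rise_start <= m)%N -> rise_const * (1 - eta) ^+ (m %/ 8) <= 1.
Proof.
move=> mm; have e0 := climb_prob_gt0 kappa; have e1 := climb_prob_lt1 k0.
have rc : 0 < rise_const by rewrite divr_gt0 // exprn_gt0 // rise_prob_gt0.
set n := (m %/ 8)%N; have B := @bernoulli_le eta n.
have en : rise_const <= n%:R * eta.
  rewrite -ler_pdivrMr //; have /andP[_ h] := truncn_itv (ltW (divr_gt0 rc e0)).
  apply: (le_trans (ltW h)); by rewrite ler_nat /n leq_divRL // mulnC.
apply: le_trans (B _); last by rewrite !ltW.
rewrite mulrC ler_wpM2l ?exprn_ge0 ?subr_ge0 ?(ltW e1) //.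
by apply: (le_trans en); rewrite lerDr.
Qed.

(* Induction on [H] along [H -> uphalf H]. *)
Lemma linger_rise H m x : (0 < H)%N -> height x = 1 -> (rise_start <= m)%N ->
  exists N, linger 0 H (spread * m * H) x (spread * m * H ^ 2) x <=
    rise_const * (1 - eta) ^+ m * rise H N x.
Proof.
have e0 := climb_prob_gt0 kappa; have e1 := climb_prob_lt1 k0.
have q01 : 0 <= 1 - eta <= 1 by apply/andP; split; lra.
have qn n : 0 <= (1 - eta) ^+ n by case/andP: q01 => ? _; rewrite exprn_ge0.
have qle n k : (n <= k)%N -> (1 - eta) ^+ k <= (1 - eta) ^+ n.
  by case/andP: q01 => ? ? nk; rewrite ler_wiXn2l.
have pr0 : 0 < rise_prob ^+ 10 by rewrite exprn_gt0 // rise_prob_gt0.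
have rc : 0 < rise_const by rewrite divr_gt0.
have [n] := ubnP H; elim: n H m => // n IH H m Hn H0 hx mm.
have [H1|H1] := leqP H 1.
  have out : inslab 0 H x = false by rewrite /inslab hx; lia.
  exists 0%N; rewrite /linger stopv_out ?out //=.
  apply: mulr_ge0; last exact: (hitp_ge0 k0 cP).
  by apply: mulr_ge0; [exact: ltW | exact: qn].
have m8 : (8 <= m)%N by apply: leq_trans mm; rewrite /rise_start leq_pmulr.
pose H' := uphalf H; pose m' := (m + m %/ 8)%N.
have [[hH1 hH2] hH3 hH4] := uphalf_bounds H1; rewrite -/H' in hH1 hH2 hH3 hH4.
have hn : (H' < n)%N by apply: leq_trans hH2 _.
have [N' hN'] := IH H' m' hn hH1 hx (leq_trans mm (leq_addr _ _)).
have b := rise_start_pow mm; clear IH mm.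
pose N1 := (spread * m' * H' ^ 2)%N; pose N2 := (spread * m * H ^ 2 - N1)%N.
pose j := (8 * (m %/ 4))%N.
have [c1 c2 mj] := @scale_split C H m spread j m' erefl erefl erefl H1 m8.
rewrite -/H' -/N1 in c1 c2.
have c3 : (j * (C * H ^ 2) <= N2)%N by rewrite /N2 leq_subRL // (leq_trans _ c2) ?leq_addr.
have hHH : H'%:Z < H%:Z by rewrite ltz_nat.
have far k y : (nrm (y - x)%R <= spread * m' * H' + 1)%N ->
    linger 0 H (spread * m * H) x (N2 + k) y <= (1 - eta) ^+ m.
  move=> ny; apply: le_trans (qle _ _ mj); apply: linger_exit => //.
    by apply: leq_trans c1; rewrite leq_add2r.
  by apply: leq_trans c3 (leq_addr _ _).
(* Either the walk lingers below the half height [H'], or it reaches [H'] without touching zero and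
   only then lingers, with at least [N2] steps left; at that moment it is still close to [x], so
   [far] applies. *)
have key k y : (nrm (y - x)%R <= spread * m' * H' + 1)%N ->
    linger 0 H (spread * m * H) x (N2 + k) y <=
    linger 0 H' (spread * m' * H') x k y + (1 - eta) ^+ m * rise H' k y.
  elim: k y => [|k IHk] y ny.
    have [h0|h0] := leP (height y) 0.
      rewrite [leLHS]/linger stopv_out /inslab ltNge h0 //=.
      by rewrite addr_ge0 ?linger_ge0 // mulr_ge0 // (hitp_ge0 k0 cP).
    have [hH|hH] := leP H'%:Z (height y).
      rewrite /rise hitp_in // mulr1 -[leLHS]add0r lerD ?linger_ge0 //.
      exact: far.
    rewrite -[leLHS]addr0 lerD // ?mulr_ge0 ?(hitp_ge0 k0 cP) //.
    by rewrite [leRHS]/linger /= /inslab h0 add0r hH linger_le1.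
  have [h0|h0] := leP (height y) 0.
    rewrite [leLHS]/linger stopv_out /inslab ltNge h0 //=.
    by rewrite addr_ge0 ?linger_ge0 // mulr_ge0 // (hitp_ge0 k0 cP).
  have [hH|hH] := leP H'%:Z (height y).
    rewrite /rise hitp_in // mulr1 -[leLHS]add0r lerD ?linger_ge0 //.
    exact: far.
  have [ny'|ny'] := leqP (nrm (y - x)%R) (spread * m' * H'); last first.
    rewrite -[leLHS]addr0 lerD // ?mulr_ge0 ?(hitp_ge0 k0 cP) //.
    rewrite [leRHS]/linger stopv_out; last by rewrite leqNgt ny' andbF.
    by rewrite /inslab h0 add0r hH linger_le1.
  rewrite /linger addnS /= /inslab !add0r h0 hH (lt_trans hH hHH).
  rewrite ny' (_ : (nrm _ <= spread * m * H)%N) /=; last first.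
    by apply: leq_trans ny' _; apply: leq_trans c1; rewrite -addnA leq_addr.
  rewrite /rise /hitp /= h0 -ltNge hH /= -avgM -avgD.
  apply: (avg_le k0 cP) => s; have := IHk (y + dir s).
  rewrite /linger /inslab !add0r /rise /hitp; apply.
  by apply: leq_trans (nrm_stepB y s x) _; rewrite addn1 ltnS.
exists (maxn N' N1 + 10 * (C * H ^ 2))%N.
have := key N1 x; rewrite subrr nrm0 /N2 subnK; last by apply: leq_trans c2; apply: leq_addr.
move=> /(_ isT) /le_trans; apply.
have r1 : rise H' N' x <= rise H' (maxn N' N1) x.
  by apply: (hitp_le k0 cP); apply: leq_maxl.
have r2 : rise H' N1 x <= rise H' (maxn N' N1) x.
  by apply: (hitp_le k0 cP); apply: leq_maxr.
have r3 : rise_prob ^+ 10 * rise H' (maxn N' N1) x <=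
    rise H (maxn N' N1 + 10 * (C * H ^ 2)) x.
  apply: (hitp_comp k0 cP).
    by rewrite ltW // exprn_ile1 // ?rise_prob_le1 // ltW // rise_prob_gt0.
  by move=> y hy; have [] := double_height hH3 hH1 hy; apply: rise_double.
set P' := rise H' (maxn N' N1) x in r1 r2 r3.
have P0 : 0 <= P' by apply: (hitp_ge0 k0 cP).
apply: (@le_trans _ _ (rise_const * (1 - eta) ^+ m' * P' + (1 - eta) ^+ m * P')).
  rewrite lerD // ?ler_wpM2l //; apply: (le_trans hN').
  by rewrite ler_wpM2l // mulr_ge0 // ltW.
(* This is what the increase from [m] to [m'] buys: the extra factor [(1 - eta) ^+ (m %/ 8)] cancels
   [rise_const], so the constant does not accumulate over the scales. *)
have E : rise_const * (1 - eta) ^+ m' * P' <= (1 - eta) ^+ m * P'.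
  rewrite ler_wpM2r // /m' exprD mulrCA ler_piMr //.
apply: (@le_trans _ _ (2 * ((1 - eta) ^+ m * P'))); first lra.
rewrite /rise_const [leRHS](_ : _ = 2 * ((1 - eta) ^+ m *
   ((rise_prob ^+ 10)^-1 * rise H (maxn N' N1 + 10 * (C * H ^ 2)) x))); last by ring.
rewrite ler_pM2l // ler_wpM2l // ler_pdivlMl //.
Qed.

End Slab.
End Stopping.

From mathcomp Require Import all_classical all_reals all_analysis.
From mathcomp Require Import measurable_realfun.
Import numFieldNormedType.Exports.
Local Open Scope classical_set_scope.
Local Open Scope ring_scope.
Local Notation mcomp F := (@measurableT_comp _ _ _ _ _ _ F).

(** * Real limits, expectations of bounded measurable functions, level sets *)

Section RealSequences.
Variable R : realType.

Lemma cvgn_epsP (u : nat -> R) (l : R) : u @ \oo --> l <->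
  forall e, 0 < e -> exists N, forall n, (N <= n)%N -> `|u n - l| <= e.
Proof.
split=> [/cvgrPdist_le H e e0|H].
  have [N _ HN] := H e e0; exists N => n Nn; rewrite distrC; exact: HN.
apply/cvgrPdist_le => e e0; have [N HN] := H e e0; exists N => // n /= Nn.
by rewrite distrC; apply: HN.
Qed.

Lemma inv_nat_small (e : R) : 0 < e -> exists N : nat, forall n, (N <= n)%N ->
  n.+1%:R^-1 <= e.
Proof.
move=> e0; exists (Num.truncn e^-1) => n Nn.
have /andP[_ h] : (Num.truncn e^-1)%:R <= e^-1 < (Num.truncn e^-1).+1%:R.
  by rewrite truncn_itv // invr_ge0 ltW.
rewrite -[e]invrK lef_pV2 ?posrE ?invr_gt0 ?ltr0n //.
by apply: (le_trans (ltW h)); rewrite ler_nat ltnS.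
Qed.

End RealSequences.

Section Expectation.
Context {dT : measure_display} {T : measurableType dT} {R : realType}.
Variable P : probability T R.
Implicit Types f g h : T -> R.

Definition bmf f := measurable_fun setT f /\ exists M, forall x, `|f x| <= M.

Lemma bmf_integrable f : bmf f -> P.-integrable setT (EFin \o f).
Proof.
move=> [mf [M fM]]; apply: measurable_bounded_integrable => //.
  by rewrite (le_lt_trans (probability_le1 P measurableT)) // ltry.
exists M; split; first exact: num_real.
by move=> x Mx y _; apply: le_trans (fM y) (ltW Mx).
Qed.

Lemma bmf_cst (a : R) : bmf (fun=> a).
Proof. by split; [exact: measurable_cst | exists `|a|]. Qed.

Lemma bmfD f g : bmf f -> bmf g -> bmf (fun x => f x + g x).
Proof.
move=> [mf [M fM]] [mg [M' gM]]; split; first exact: measurable_funD.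
by exists (M + M') => x; apply: (le_trans (ler_normD _ _)); apply: lerD.
Qed.

Lemma bmfM f g : bmf f -> bmf g -> bmf (fun x => f x * g x).
Proof.
move=> [mf [M fM]] [mg [M' gM]]; split; first exact: measurable_funM.
by exists (M * M') => x; rewrite normrM ler_pM.
Qed.

Lemma bmfZ a f : bmf f -> bmf (fun x => a * f x).
Proof. by move=> bf; apply: bmfM => //; apply: bmf_cst. Qed.

Lemma bmfN f : bmf f -> bmf (fun x => - f x).
Proof.
move=> [mf [M fM]]; split; first exact: measurableT_comp.
by exists M => x; rewrite normrN.
Qed.

Lemma bmfB f g : bmf f -> bmf g -> bmf (fun x => f x - g x).
Proof. by move=> bf bg; apply: bmfD => //; apply: bmfN. Qed.

Lemma bmf_indic (A : set T) : measurable A -> bmf (\1_A : T -> R).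
Proof.
move=> mA; split; first exact: measurable_indic.
by exists 1 => x; rewrite indicE; case: (x \in A); rewrite ?normr1 ?normr0.
Qed.

Lemma expect_le f g : bmf f -> bmf g -> (forall x, f x <= g x) ->
  \int[P]_x f x <= \int[P]_x g x.
Proof. by move=> bf bg fg; apply: le_Rintegral => //; apply: bmf_integrable. Qed.

Lemma expect_cst a : \int[P]_x a = a :> R.
Proof.
rewrite Rintegral_cst // [X in fine X](_ : _ = 1%E) ?mulr1 //.
exact: probability_setT.
Qed.

Lemma expectD f g : bmf f -> bmf g ->
  \int[P]_x (f x + g x) = \int[P]_x f x + \int[P]_x g x.
Proof. by move=> bf bg; apply: RintegralD => //; apply: bmf_integrable. Qed.

Lemma expectB f g : bmf f -> bmf g ->
  \int[P]_x (f x - g x) = \int[P]_x f x - \int[P]_x g x.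
Proof. by move=> bf bg; apply: RintegralB => //; apply: bmf_integrable. Qed.

Lemma expectZ a f : bmf f -> \int[P]_x (a * f x) = a * \int[P]_x f x.
Proof. by move=> bf; apply: RintegralZl => //; apply: bmf_integrable. Qed.

Lemma expect_indic (A : set T) : measurable A ->
  \int[P]_x (\1_A x : R) = fine (P A).
Proof. by move=> mA; rewrite /Rintegral integral_indic // setIT. Qed.

Lemma expect_ge0 f : (forall x, 0 <= f x) -> 0 <= \int[P]_x f x.
Proof. by move=> f0; apply: Rintegral_ge0. Qed.

Lemma expect_abs M f : bmf f -> (forall x, `|f x| <= M) -> `|\int[P]_x f x| <= M.
Proof.
move=> bf fM; rewrite ler_norml; apply/andP; split.
  rewrite -(expect_cst (- M)); apply: expect_le => //; first exact: bmf_cst.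
  by move=> x; have := fM x; rewrite ler_norml => /andP[].
rewrite -[leRHS](expect_cst M); apply: expect_le => //; first exact: bmf_cst.
by move=> x; have := fM x; rewrite ler_norml => /andP[].
Qed.

Lemma expect_dist f g h : bmf f -> bmf g -> bmf h ->
  (forall x, `|f x - g x| <= h x) ->
  `|\int[P]_x f x - \int[P]_x g x| <= \int[P]_x h x.
Proof.
move=> bf bg bh fgh; rewrite -expectB //.
apply: le_trans (le_normr_Rintegral _ _) _ => //; first exact: bmf_integrable (bmfB bf bg).
have [mfg [M fgM]] := bmfB bf bg.
apply: expect_le => //; split; first exact: measurableT_comp.
by exists M => x; rewrite normr_id.
Qed.

Lemma pr_ge0 (A : set T) : 0 <= fine (P A).
Proof. exact: fine_ge0. Qed.

Lemma pr_fin (A : set T) : measurable A -> P A = (fine (P A))%:E.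
Proof. by move=> mA; rewrite fineK // fin_num_measure. Qed.

Lemma pr_le (A B : set T) : measurable A -> measurable B -> A `<=` B ->
  fine (P A) <= fine (P B).
Proof.
move=> mA mB AB; apply: fine_le; rewrite ?fin_num_measure //.
by apply: le_measure; rewrite ?inE.
Qed.

Let ae_cvg (u : nat -> T -> R) f : (\forall x \ae P, u ^~ x @ \oo --> f x) ->
  \forall x \ae P, setT x -> (u n x)%:E @[n --> \oo] --> (f x)%:E.
Proof.
apply: filterS => x ux _; apply: cvg_EFin; last exact: ux.
by near=> n.
Unshelve. all: by end_near.
Qed.

Let ae_dom (u : nat -> T -> R) M : (forall n x, `|u n x| <= M) ->
  \forall x \ae P, forall n, setT x ->
    (`|(u n x)%:E| <= (EFin \o (cst M : T -> R)) x)%E.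
Proof. by move=> uM; apply: aeW => x n _; rewrite /= lee_fin. Qed.

Lemma ae_mono (A B : T -> Prop) : (forall x, A x -> B x) ->
  (\forall x \ae P, A x) -> \forall x \ae P, B x.
Proof. by move=> AB; apply: filterS. Qed.

Lemma ae_and (A B : T -> Prop) : (\forall x \ae P, A x) ->
  (\forall x \ae P, B x) -> \forall x \ae P, A x /\ B x.
Proof. by move=> pA pB; apply: filterI. Qed.

Lemma expect_sum (I : Type) (r : seq I) (F : I -> T -> R) : (forall i, bmf (F i)) ->
  bmf (fun x => \sum_(i <- r) F i x) /\
  \int[P]_x (\sum_(i <- r) F i x) = \sum_(i <- r) \int[P]_x F i x.
Proof.
move=> bF; elim: r => [|i r [IH1 IH2]].
  have E : (fun x => \sum_(i <- [::]) F i x) = fun=> 0.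
    by apply/funext => x; rewrite big_nil.
  by rewrite E big_nil expect_cst; split => //; apply: bmf_cst.
have E : (fun x => \sum_(j <- i :: r) F j x) = fun x => F i x + \sum_(j <- r) F j x.
  by apply/funext => x; rewrite big_cons.
by rewrite E big_cons expectD // IH2; split => //; apply: bmfD.
Qed.

Lemma expect_dominated (u : nat -> T -> R) f M :
  (forall n, measurable_fun setT (u n)) -> measurable_fun setT f ->
  (forall n x, `|u n x| <= M) ->
  (\forall x \ae P, u ^~ x @ \oo --> f x) ->
  (fun n => \int[P]_x u n x) @ \oo --> \int[P]_x f x.
Proof.
move=> mu mf uM cvu.
have M0 : 0 <= M by apply: le_trans (uM 0%N point).
have ic : P.-integrable setT (EFin \o (cst M : T -> R)).
  exact: (bmf_integrable (bmf_cst M)).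
have H := @dominated_convergence _ _ _ P setT measurableT
  (fun n x => (u n x)%:E) (fun x => (f x)%:E) (EFin \o cst M).
have mf' : measurable_fun setT (fun x => (f x)%:E) by apply/measurable_EFinP.
have fi : P.-integrable setT (fun x => (f x)%:E).
  by have [] := H (fun n => (measurable_EFinP _ _).2 (mu n)) mf' (ae_cvg cvu) ic (ae_dom uM).
have cv : (\int[P]_x (u n x)%:E)%E @[n --> \oo] --> (\int[P]_x (f x)%:E)%E.
  by have [] := H (fun n => (measurable_EFinP _ _).2 (mu n)) mf' (ae_cvg cvu) ic (ae_dom uM).
by apply: fine_cvg; rewrite /Rintegral fineK //; apply: integrable_fin_num.
Qed.

End Expectation.

Section LevelSets.
Context {dT : measure_display} {T : measurableType dT} {R : realType}.
Variables f g : T -> R.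
Hypotheses (mf : measurable_fun setT f) (mg : measurable_fun setT g).

Lemma measurable_lt : measurable [set x | f x < g x].
Proof.
have mgf : measurable_fun setT (fun x => g x - f x) by exact: measurable_funB.
rewrite (_ : [set x | _] = setT `&` (fun x => g x - f x) @^-1` `]0, +oo[); first exact: mgf.
by rewrite setTI; apply/seteqP; split => x; rewrite /= in_itv /= andbT subr_gt0.
Qed.

Lemma measurable_eq : measurable [set x | f x = g x].
Proof.
have mgf : measurable_fun setT (fun x => g x - f x) by exact: measurable_funB.
rewrite (_ : [set x | _] = setT `&` (fun x => g x - f x) @^-1` [set 0]); first exact: mgf.
by rewrite setTI; apply/seteqP; split => x /= => [->|/eqP]; rewrite ?subrr // subr_eq0 => /eqP.
Qed.
End LevelSets.

Lemma measurable_le {dT : measure_display} {T : measurableType dT} {R : realType} (f g : T -> R) :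
  measurable_fun setT f -> measurable_fun setT g -> measurable [set x | f x <= g x].
Proof.
move=> mf mg; rewrite (_ : [set x | _] = ~` [set x | g x < f x]).
  by apply: measurableC; exact: measurable_lt.
by apply/seteqP; split => x /=; rewrite leNgt => /negP.
Qed.

Lemma bmf_bool {dT : measure_display} {T : measurableType dT} (R : realType) (b : T -> bool) :
  measurable [set o | b o] -> bmf (fun o => (b o)%:R : R).
Proof.
move=> mb; have -> : (fun o => (b o)%:R : R) = \1_[set o | b o].
  apply/funext => o; rewrite indicE; case: (boolP (b o)) => h; first by rewrite mem_set.
  by rewrite memNset //; exact/negP.
exact: bmf_indic.
Qed.

Lemma bmf_comp {d1 d2 : measure_display} {T1 : measurableType d1} {T2 : measurableType d2}
    (R : realType) (F : T2 -> R) (f : T1 -> T2) :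
  bmf F -> measurable_fun setT f -> bmf (fun x => F (f x)).
Proof. by move=> [mF [M FM]] mf; split; [exact: (measurableT_comp mF) | exists M]. Qed.

Lemma affine_itv {R : realFieldType} (r t : R) : 0 <= r <= 1 -> 0 <= t <= 1 -> r <= r + t * (1 - r) <= 1.
Proof.
move=> /andP[r0 r1] /andP[t0 t1]; have q0 : 0 <= 1 - r by rewrite subr_ge0.
by rewrite lerDl mulr_ge0 //= -lerBrDl ler_piMl.
Qed.

(** * The path space: Lipschitz functionals, separability, approximation from below *)

Section Paths.
Variables (R : realType).

Lemma clip_time (t : I01 R) : clip (time t) = t.
Proof.
apply: val_inj => /=; have /andP[t0 t1] := time_itv t.
by rewrite -/(time t) min_l // max_r.
Qed.

Lemma time_clip (u : R) : 0 <= u <= 1 -> time (clip u) = u.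
Proof. by move=> /andP[u0 u1]; rewrite /time /= min_l // max_r. Qed.

Lemma time_clip_dist (u : R) (t : I01 R) : `|time (clip u) - time t| <= `|u - time t|.
Proof.
have /andP[t0 t1] := time_itv t; move: (time t) t0 t1 => v v0 v1.
rewrite /time /=; have [u0|u0] := leP u 0.
  rewrite min_l ?max_l //; last by rewrite (le_trans u0).
  by rewrite sub0r normrN ger0_norm // distrC ger0_norm; lra.
have [u1|u1] := leP u 1.
  by rewrite max_r // ltW.
by rewrite max_r // ger0_norm ?subr_ge0 // ger0_norm; lra.
Qed.

Section Normed.
Variable V : normedModType R.
Implicit Types w : C01 V.

Lemma path_continuous w : continuous (fun t => w t).
Proof. exact: cts_fun. Qed.

Let real_path w : continuous (fun u : R => w (clip u)).
Proof.
move=> u; apply: (@continuous_comp _ _ _ (@clip R) w).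
  exact: clip_continuous.
exact: path_continuous.
Qed.

Lemma path_bounded w : exists M, forall t, `|w t| <= M.
Proof.
have cn : continuous (fun u : R => `|w (clip u)|).
  move=> u; apply: (@continuous_comp _ _ _ (fun u => w (clip u)) (@Num.norm _ V)).
    exact: real_path.
  exact: norm_continuous.
have [c _ H] := EVT_max (@ler01 R) (continuous_subspaceT cn).
exists `|w (clip c)| => t; rewrite -(clip_time t); apply: H.
by rewrite in_itv; exact: time_itv.
Qed.

Lemma path_unif w (e : R) : 0 < e -> exists2 dl : R, 0 < dl &
  forall s t, `|time s - time t| <= dl -> `|w s - w t| <= e.
Proof.
move=> e0.
have cov : near_covering `[0%R : R, 1%R] by apply/compact_near_coveringP/segment_compact.
pose P (dl x : R) := forall y : R, `|x - y| < dl -> `|w (clip x) - w (clip y)| <= e.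
have H x : `[0%R : R, 1%R]%classic x -> \forall x' \near x & dl \near 0^'+, P dl x'.
  move=> _; have e2 : 0 < e / 2 by rewrite divr_gt0.
  have /cvgrPdist_le/(_ _ e2) := @real_path w x.
  move=> /nbhs_ballP[r /= r0 Hr]; have r2 : 0 < r / 2 by rewrite divr_gt0.
  exists (ball x (r / 2), [set dl | dl < r / 2]); first split => /=.
  - exact: nbhsx_ballx.
  - exact: nbhs_right_lt.
  move=> [x' dl] /= [xx' dlr] y x'y.
  have h1 : `|w (clip x) - w (clip x')| <= e / 2.
    by apply: Hr; apply: le_ball xx'; rewrite ler_pdivrMr // ler_peMr ?ler1n // ltW.
  have h2 : `|w (clip x) - w (clip y)| <= e / 2.
    apply: Hr; rewrite /ball /= (splitr r); move: xx'; rewrite /ball /= => xx'.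
    rewrite -(subrK x' x) -addrA; apply: le_lt_trans (ler_normD _ _) _.
    by rewrite ltrD // (lt_trans x'y).
  rewrite (splitr e) -(subrK (w (clip x)) (w (clip x'))) -addrA.
  by apply: le_trans (ler_normD _ _) _; rewrite lerD // distrC.
have nP := cov R (0^'+) P (@filter_filter _ _ (at_right_proper_filter (0 : R))) H.
have pf := at_right_proper_filter (0 : R).
have [dl [Pdl dl0]] := @filter_ex _ _ pf _ (@filterI _ _ (@filter_filter _ _ pf) _ _ nP (nbhs_right_gt (0 : R))).
exists (dl / 2); first by rewrite divr_gt0.
move=> s t st; rewrite -(clip_time s) -(clip_time t); apply: Pdl.
  by rewrite /= in_itv; exact: time_itv.
by apply: le_lt_trans st _; rewrite ltr_pdivrMr // ltr_pMr ?ltr1n.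
Qed.

Lemma nbhs_c01P w (A : set (C01 V)) : nbhs w A <->
  exists2 e, 0 < e & forall w', (forall t, `|w t - w' t| < e) -> A w'.
Proof.
rewrite -nbhs_ballE; split=> [[e e0 H]|[e e0 H]].
  exists e => // w' ww'; apply: H.
  have ww2 : forall t, ball (w t) e (w' t) by move=> t; rewrite -ball_normE; apply: ww'.
  exact: ww2.
exists e => // w' ww'; apply: H => t.
have ww2 : ball (w t) e (w' t) := ww' t.
by rewrite -ball_normE in ww2.
Qed.

Definition lipf (L : R) (f : C01 V -> R) := forall w w' e,
  (forall t, `|w t - w' t| <= e) -> `|f w - f w'| <= L * e.

Lemma lipf_continuous L f : lipf L f -> continuous f.
Proof.
have FF := fun w : C01 V => @nbhs_filter (C01 V) w.
move=> fL w; apply/(@cvgrPdist_le _ _ _ _ (FF w)) => e e0; apply/nbhs_c01P.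
have L0 : 0 < `|L| + 1 by rewrite ltr_wpDl.
exists (e / (`|L| + 1)); first by rewrite divr_gt0.
move=> w' ww'; apply: (@le_trans _ _ (L * (e / (`|L| + 1)))).
  by apply: fL => t; apply: ltW.
rewrite mulrCA ler_piMr ?(ltW e0) // ler_pdivrMr // mul1r.
by apply: le_trans (ler_norm _) _; rewrite lerDl.
Qed.

Lemma lipf_cst a : lipf 0 (fun=> a).
Proof. by move=> w w' e _; rewrite subrr normr0 mul0r. Qed.

Lemma sup_lipf (I : Type) (J : set I) (phi : I -> C01 V -> R) L : J !=set0 ->
  (forall w, exists M, forall i, J i -> phi i w <= M) ->
  (forall i, J i -> lipf L (phi i)) ->
  lipf L (fun w => sup [set phi i w | i in J]).
Proof.
move=> [j Jj] bd phiL.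
have hs w : has_sup [set phi i w | i in J].
  split; first by exists (phi j w), j.
  by have [M HM] := bd w; exists M => _ [i Ji <-]; apply: HM.
have half w w' e : (forall t, `|w t - w' t| <= e) ->
    sup [set phi i w | i in J] <= sup [set phi i w' | i in J] + L * e.
  move=> ww'; apply: ge_sup; first by case: (hs w).
  move=> _ [i Ji <-]; have := phiL i Ji w w' e ww'.
  rewrite ler_norml => /andP[_]; rewrite lerBlDl => /le_trans; apply.
  rewrite lerD2r; apply: sup_upper_bound => //; by exists i.
move=> w w' e ww'; rewrite ler_norml; apply/andP; split.
  by rewrite lerBrDl lerBlDr; apply: half => t; rewrite distrC.
by rewrite lerBlDl; apply: half.
Qed.

Definition dst w w' : R := sup [set `|w t - w' t| | t in [set: I01 R]].

Let bounded_dist w w' : exists M, forall t, setT t -> `|w t - w' t| <= M.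
Proof.
have [M HM] := path_bounded w; have [M' HM'] := path_bounded w'.
by exists (M + M') => t _; apply: le_trans (ler_normB _ _) _; apply: lerD.
Qed.

Lemma dst_ub w w' t : `|w t - w' t| <= dst w w'.
Proof.
apply: sup_upper_bound; last by exists t.
split; first by exists `|w t - w' t|, t.
by have [M HM] := bounded_dist w w'; exists M => _ [s _ <-]; apply: HM.
Qed.

Lemma dst_le w w' e : (forall t, `|w t - w' t| <= e) -> dst w w' <= e.
Proof.
move=> H; apply: ge_sup; last by move=> _ [t _ <-].
by exists `|w (clip 0) - w' (clip 0)|, (clip 0).
Qed.

Lemma dst_ge0 w w' : 0 <= dst w w'.
Proof. exact: le_trans (normr_ge0 _) (dst_ub w w' (clip 0)). Qed.

Lemma dst_lipf y : lipf 1 (dst^~ y).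
Proof.
apply: sup_lipf; first by exists (clip 0).
  by move=> w; apply: bounded_dist.
move=> t _ w w' e ww'; rewrite mul1r; apply: le_trans (ww' t).
apply: le_trans (ler_dist_dist _ _) _.
by rewrite opprB addrA subrK.
Qed.

Definition blip (f : C01 V -> R) :=
  (exists L, lipf L f) /\ exists M, forall w, `|f w| <= M.

Lemma lipf_le L L' f : L <= L' -> lipf L f -> lipf L' f.
Proof.
move=> LL fL w w' e ww'; apply: le_trans (fL _ _ _ ww') _; rewrite ler_wpM2r //.
exact: le_trans (normr_ge0 _) (ww' (clip 0)).
Qed.

Lemma lipfD L L' f g : lipf L f -> lipf L' g -> lipf (L + L') (fun w => f w + g w).
Proof.
move=> fL gL w w' e ww'; rewrite opprD addrACA mulrDl.
by apply: le_trans (ler_normD _ _) _; apply: lerD; [exact: fL | exact: gL].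
Qed.

Lemma lipf_comp L K f (h : R -> R) : 0 <= K ->
  (forall x y, `|h x - h y| <= K * `|x - y|) -> lipf L f -> lipf (K * L) (h \o f).
Proof.
move=> K0 hK fL w w' e ww' /=; apply: le_trans (hK _ _) _.
by rewrite -mulrA ler_wpM2l //; apply: fL.
Qed.

Lemma lipf_max L f g : lipf L f -> lipf L g -> lipf L (fun w => Num.max (f w) (g w)).
Proof.
move=> fL gL w w' e ww'; have := fL _ _ _ ww'; have := gL _ _ _ ww'.
rewrite !ler_norml => /andP[g1 g2] /andP[f1 f2].
rewrite /Num.max; case: ltP => h1; case: ltP => h2; apply/andP; split; lra.
Qed.

Lemma blip_max f g : blip f -> blip g -> blip (fun w => Num.max (f w) (g w)).
Proof.
move=> [[L fL] [M fM]] [[L' gL] [M' gM]]; split.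
  exists (Num.max L L'); apply: lipf_max.
    by apply: lipf_le fL; rewrite le_max lexx.
  by apply: lipf_le gL; rewrite le_max lexx orbT.
exists (Num.max M M') => w; rewrite /Num.max.
have := fM w; have := gM w; case: ltP => h; case: ltP => h'; lra.
Qed.

Lemma blipN f : blip f -> blip (fun w => - f w).
Proof.
move=> [[L fL] [M fM]]; split; last by exists M => w; rewrite normrN.
by exists L => w w' e ww'; rewrite -opprD normrN; apply: fL.
Qed.

Lemma blipD f g : blip f -> blip g -> blip (fun w => f w + g w).
Proof.
move=> [[L fL] [M fM]] [[L' gL] [M' gM]]; split.
  by exists (L + L'); apply: lipfD.
by exists (M + M') => w; apply: le_trans (ler_normD _ _) _; apply: lerD.
Qed.

Lemma blipM f g : blip f -> blip g -> blip (fun w => f w * g w).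
Proof.
move=> [[L fL] [M fM]] [[L' gL] [M' gM]]; split; last first.
  by exists (M * M') => w; rewrite normrM ler_pM.
exists (M * `|L'| + M' * `|L|) => w w' e ww'.
have -> : f w * g w - f w' * g w' = f w * (g w - g w') + g w' * (f w - f w') by ring.
have e0 : 0 <= e := le_trans (normr_ge0 _) (ww' (clip 0)).
apply: le_trans (ler_normD _ _) _; rewrite mulrDl !normrM -!mulrA lerD // ler_pM //.
  by apply: le_trans (gL _ _ _ ww') _; rewrite ler_wpM2r // ler_norm.
by apply: le_trans (fL _ _ _ ww') _; rewrite ler_wpM2r // ler_norm.
Qed.

Lemma continuous_borel (f : C01 V -> R) : continuous f ->
  measurable_fun setT (f : borel (C01 V) -> R).
Proof.
move=> cf; apply: (measurability _ (RGenOInfty.measurableE R)) => _ [_ [a ->] <-].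
rewrite setTI; apply: sub_sigma_algebra.
by apply: open_comp; [move=> w _; exact: cf | exact: interval_open].
Qed.

Lemma blip_bmf f : blip f -> bmf (f : borel (C01 V) -> R).
Proof.
move=> [[L fL] bd]; split; last exact: bd.
by apply: continuous_borel; apply: lipf_continuous fL.
Qed.

End Normed.

Lemma rv_norm_le m (x : 'rV[R]_m) e : 0 <= e -> (forall i, `|x 0 i| <= e) ->
  `|x| <= e.
Proof.
move=> e0 H; rewrite /Num.norm /= mx_normrE; apply: bigmax_le => // -[i j] _.
by rewrite ord1.
Qed.

Lemma rv_coord_le m (x : 'rV[R]_m) i : `|x 0 i| <= `|x|.
Proof.
rewrite {2}/Num.norm /= mx_normrE.
exact: (le_bigmax 0 (fun ij : 'I_1 * 'I_m => `|x ij.1 ij.2|) (0, i)).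
Qed.

Section LatticePaths.
Variable m : nat.
Local Notation C := (C01 'rV[R]_m).
Implicit Types w : C.

Definition zpath n (X : trajectory m) : C := mkcts (@Zpath_continuous R m n X).

(** Sampling a path on the time grid and rounding to the lattice [n^(-1/2) Z^m] shows that rescaled
    lattice polygons are dense; they depend on finitely many integers, which makes the path space
    separable. *)
Definition rnd n w (k : nat) : 'rV[int]_m :=
  \row_i Num.floor (Num.sqrt n%:R * w (clip (k%:R / n%:R)) 0 i).

Lemma rnd_close n w k : (0 < n)%N ->
  `|(Num.sqrt n%:R)^-1 *: intr_vec R (rnd n w k) - w (clip (k%:R / n%:R))| <=
  (Num.sqrt n%:R)^-1.
Proof.
move=> n0; have sn : 0 < Num.sqrt n%:R :> R by rewrite sqrtr_gt0 ltr0n.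
apply: rv_norm_le => [|i]; first by rewrite invr_ge0 ltW.
rewrite !mxE; set v := w _ 0 i.
have /andP[f1 f2] := floor_itv (Num.sqrt n%:R * v).
set z := (Num.floor _)%:~R in f1 *.
rewrite -[leRHS]mulr1 -{1}(mulKf (lt0r_neq0 sn) v) -mulrBr normrM.
rewrite ger0_norm ?invr_ge0 ?(ltW sn) // ler_pM2l ?invr_gt0 //.
by move: f2; rewrite intrD -/z ler_norml => f2; apply/andP; split; lra.
Qed.

Lemma zpath_interp n (X : trajectory m) (t : I01 R) : exists k (th : R),
  [/\ 0 <= th <= 1, (k <= n)%N, zpath n X t =
    (1 - th) *: ((Num.sqrt n%:R)^-1 *: intr_vec R (X k)) +
     th *: ((Num.sqrt n%:R)^-1 *: intr_vec R (X k.+1)),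
    `|n%:R * time t - k%:R| <= 1 & `|n%:R * time t - k.+1%:R| <= 1].
Proof.
have /andP[t0 t1] := time_itv t.
set u := n%:R * time t; have u0 : 0 <= u by rewrite mulr_ge0.
have /andP[k1 k2] : (Num.truncn u)%:R <= u < (Num.truncn u).+1%:R by rewrite truncn_itv.
set k := Num.truncn u in k1 k2.
exists k, (u - k%:R); rewrite -natr1 in k2 *; split.
- by apply/andP; split; lra.
- rewrite -ltnS -(ltr_nat R); apply: le_lt_trans k1 _.
  by rewrite -natr1 ltr_pwDr // /u ler_piMr.
- rewrite -[LHS]/(Zpath n X t) /Zpath /polygonal -/u -/k.
  by apply/rowP => i; rewrite !mxE; ring.
- by rewrite ger0_norm; lra.
by rewrite distrC ger0_norm; lra.
Qed.

Lemma zpath_dense w e : 0 < e -> exists N, forall n, (N <= n)%N ->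
  forall t, `|w t - zpath n.+1 (rnd n.+1 w) t| <= e.
Proof.
move=> e0; have e2 : 0 < e / 2 by rewrite divr_gt0.
have [dl dl0 wdl] := path_unif w e2.
have [N1 HN1] := inv_nat_small dl0.
have [N2 HN2] := inv_nat_small (exprn_gt0 2 e2).
exists (maxn N1 N2) => n; rewrite geq_max => /andP[n1 n2] t.
have [k [th [/andP[th0 th1] kn -> d1 d2]]] := zpath_interp n.+1 (rnd n.+1 w) t.
have np : 0 < n.+1%:R :> R by rewrite ltr0n.
have sq : (Num.sqrt n.+1%:R)^-1 <= e / 2 :> R.
  rewrite -(@ler_pXn2r _ 2) ?nnegrE ?invr_ge0 ?sqrtr_ge0 ?(ltW e2) //.
  by rewrite exprVn sqr_sqrtr ?ler0n // HN2.
have near j : `|n.+1%:R * time t - j%:R| <= 1 ->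
    `|w t - (Num.sqrt n.+1%:R)^-1 *: intr_vec R (rnd n.+1 w j)| <= e.
  move=> dj; rewrite -(subrK (w (clip (j%:R / n.+1%:R))) (w t)) -addrA (splitr e).
  apply: le_trans (ler_normD _ _) _; apply: lerD.
    apply: wdl; rewrite distrC; apply: le_trans (time_clip_dist _ _) _.
    apply: le_trans (HN1 _ n1); rewrite distrC.
    have -> : time t - j%:R / n.+1%:R = (n.+1%:R * time t - j%:R) / n.+1%:R.
      by rewrite mulrBl mulrAC divff ?mul1r ?gt_eqF.
    by rewrite normrM [`|_^-1|]gtr0_norm ?invr_gt0 // ler_piMl // invr_ge0 ltW.
  by rewrite distrC; apply: le_trans (rnd_close _ _ _) sq.
set A := _ *: intr_vec R _; set B := _ *: intr_vec R _.
have -> : w t - ((1 - th) *: A + th *: B) = (1 - th) *: (w t - A) + th *: (w t - B).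
  by apply/rowP => i; rewrite !mxE; ring.
apply: le_trans (ler_normD _ _) _.
rewrite !normrZ (ger0_norm th0) ger0_norm ?subr_ge0 //.
have -> : e = (1 - th) * e + th * e by ring.
by apply: lerD; rewrite ler_wpM2l ?subr_ge0 // near.
Qed.

Definition code := (nat * seq 'rV[int]_m)%type.

Definition decode (c : code) : C := zpath c.1 (fun k => nth 0 c.2 k).

Lemma zpath_prefix n (X Y : trajectory m) :
  (forall k, (k <= n.+1)%N -> X k = Y k) -> zpath n X = zpath n Y.
Proof.
move=> XY; apply/continuousEP => t /=; rewrite /Zpath /polygonal; congr (_ *: _).
have /andP[t0 t1] := time_itv t.
have kn : (Num.truncn (n%:R * time t) <= n)%N.
  rewrite -ltnS truncn_lt_nat ?mulr_ge0 //.
  by rewrite (@le_lt_trans _ _ n%:R) ?ltr_nat // ler_piMr.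
by rewrite !XY // ltnW.
Qed.

Lemma decode_dense w e : 0 < e -> exists c, forall t, `|w t - decode c t| <= e.
Proof.
move=> e0; have [N H] := zpath_dense w e0.
exists (N.+1, [seq rnd N.+1 w k | k <- iota 0 N.+3]) => t.
rewrite (_ : decode _ = zpath N.+1 (rnd N.+1 w)); first exact: H.
apply: zpath_prefix => k kN.
by rewrite (nth_map 0%N) ?size_iota ?ltnS // nth_iota.
Qed.

Lemma near_dist (u v p p' r e : R) : `|u - p| <= r -> `|v - u| <= e / 2 ->
  `|p' - p| <= e / 2 -> `|v - p'| <= r + e.
Proof.
rewrite !ler_norml => /andP[? ?] /andP[? ?] /andP[? ?].
by apply/andP; split; lra.
Qed.

Section Measurability.
Context {dT : measure_display} {T : measurableType dT}.

(** An open set is a countable union of closed balls around decoded paths, and by continuity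
    membership in such a ball is tested on the grids [q N k] alone. So evaluations generate the
    Borel sets of the uniform topology. *)
Lemma measurable_path (X : T -> C) :
  (forall t i, measurable_fun setT (fun o => X o t 0 i)) ->
  measurable_fun setT (X : T -> borel C).
Proof.
move=> mX; apply: (@measurability _ _ T (borel C) setT X (@open C) (erefl _)) => _ [U oU <-].
rewrite setTI.
pose r (k : nat) : R := k.+1%:R^-1.
pose q (N k : nat) : I01 R := clip (k%:R / N.+1%:R).
pose F (ck : code * nat) : set T := [set o |
  (forall w, (forall t, `|w t - decode ck.1 t| <= r ck.2) -> U w) /\
  forall N k i, `|X o (q N k) 0 i - decode ck.1 (q N k) 0 i| <= r ck.2].
have r0 k : 0 < r k by rewrite invr_gt0.
have -> : X @^-1` U = \bigcup_ck F ck.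
  apply/seteqP; split => [x /= UX | x [[c k] _ [HU Hq]]]; last first.
    apply: HU => t; apply: rv_norm_le => [|i]; first exact: ltW.
    apply/ler_addgt0Pr => e e0; have e2 : 0 < e / 2 by rewrite divr_gt0.
    have [d1 d10 H1] := path_unif (X x) e2.
    have [d2 d20 H2] := path_unif (decode c) e2.
    have dm : 0 < Num.min d1 d2 by rewrite lt_min d10.
    have [N HN] := inv_nat_small dm.
    pose j := Num.truncn (N.+1%:R * time t).
    have tq : `|time t - time (q N j)| <= Num.min d1 d2.
      rewrite distrC; apply: le_trans (time_clip_dist _ _) _.
      apply: le_trans (HN N (leqnn _)); have np : 0 < N.+1%:R :> R by rewrite ltr0n.
      have -> : j%:R / N.+1%:R - time t = (j%:R - N.+1%:R * time t) / N.+1%:R.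
        by rewrite mulrBl mulrAC divff ?mul1r ?gt_eqF.
      rewrite normrM [`|_^-1|]gtr0_norm ?invr_gt0 // ler_piMl ?invr_ge0 ?(ltW np) //.
      have /andP[t0 t1] := time_itv t.
      have /andP[k1 k2] : j%:R <= N.+1%:R * time t < j.+1%:R.
        by rewrite truncn_itv // mulr_ge0.
      by rewrite distrC ger0_norm; move: k1 k2; rewrite -natr1; lra.
    have h1 : `|X x t - X x (q N j)| <= e / 2.
      by apply: H1; apply: le_trans tq _; rewrite ge_min lexx.
    have h2 : `|decode c t - decode c (q N j)| <= e / 2.
      by apply: H2; apply: le_trans tq _; rewrite ge_min lexx orbT.
    have := Hq N j i; have := rv_coord_le (X x t - X x (q N j)) i.
    have := rv_coord_le (decode c t - decode c (q N j)) i.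
    rewrite !mxE => a1 a2 a3.
    exact: near_dist a3 (le_trans a2 h1) (le_trans a1 h2).
  have [e e0 He] : exists2 e, 0 < e & forall w', (forall t, `|X x t - w' t| < e) -> U w'.
    by apply/nbhs_c01P; apply: open_nbhs_nbhs; split.
  have e3 : 0 < e / 3 by rewrite divr_gt0.
  have [k Hk] := inv_nat_small e3.
  have [c Hc] := decode_dense (X x) (r0 k).
  exists (c, k) => //; split => [w Hw|N j i] /=.
    apply: He => t; rewrite -(subrK (decode c t) (X x t)) -addrA.
    apply: le_lt_trans (ler_normD _ _) _; rewrite [X in _ + X]distrC.
    by have := Hc t; have := Hw t; have := Hk k (leqnn _); rewrite /= -/(r k); lra.
  by have := rv_coord_le (X x (q N j) - decode c (q N j)) i; rewrite !mxE => /le_trans; apply.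
apply: countable_bigcupT_measurable => [|[c k]]; first exact: countableP.
have [HU|nU] := pselect (forall w, (forall t, `|w t - decode c t| <= r k) -> U w); last first.
  by rewrite (_ : F _ = set0) //; apply/seteqP; split => // o [].
rewrite (_ : F _ = ~` \bigcup_(z : nat * nat * 'I_m) ~` [set o |
    `|X o (q z.1.1 z.1.2) 0 z.2 - decode c (q z.1.1 z.1.2) 0 z.2| <= r k]).
  apply/measurableC/countable_bigcupT_measurable => [|z]; first exact: countableP.
  apply: measurableC.
  apply: measurable_le; last exact: measurable_cst.
  apply: (mcomp (@Num.norm R R)); first exact: normr_measurable.
  by apply: measurable_funB; [exact: mX | exact: measurable_cst].
rewrite setC_bigcup; apply/seteqP; split => o /=.
  by move=> [_ H] z _; rewrite /= => nz; apply: nz; apply: H.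
move=> H; split => // N j i; apply: contrapT => nH.
by apply: (H (N, j, i)).
Qed.

Lemma measurable_eval (X : T -> C) : measurable_fun setT (X : T -> borel C) ->
  forall t i, measurable_fun setT (fun o => X o t 0 i).
Proof.
move=> mX t i; have ev : lipf 1 (fun w : C => w t 0 i).
  move=> w w' e ww'; rewrite mul1r; apply: le_trans (ww' t).
  by have := rv_coord_le (w t - w' t) i; rewrite !mxE.
apply: (mcomp (fun w : borel C => w t 0 i)) => //.
exact: continuous_borel (lipf_continuous ev).
Qed.

End Measurability.

Lemma far_half (dl A B eta : R) :
  dl <= A + B -> A <= eta -> eta <= dl / 2 -> dl / 2 <= B.
Proof. lra. Qed.

Lemma bump_far (q k dl M e Gw Gw' B : R) : Gw <= M -> - M <= Gw' -> 0 < e ->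
  q < Gw - e / 4 -> 4 * M <= k * dl -> k * (dl / 2) <= k * B -> q - k * B <= Gw'.
Proof. by move: (k * B) => kB; lra. Qed.

Lemma bump_near (q kB e Gw Gw' : R) : q < Gw - e / 4 -> Gw - Gw' <= e / 4 ->
  0 <= kB -> q - kB <= Gw'.
Proof. lra. Qed.

Lemma bump_center (q kB e Gw : R) : Gw - e / 2 < q -> kB <= e / 2 ->
  Gw - e <= q - kB.
Proof. lra. Qed.

(* Codes for the finite maxima of functions [q - k * dst w y], [q] rational and [y]
   in a countable dense set: they approximate every bounded function from below at its
   continuity points. *)
Definition bcode := (code * rat * nat)%type.
Definition fcode := (nat * seq bcode)%type.

Definition cone (b : bcode) w : R := ratr b.1.2 - b.2%:R * dst w (decode b.1.1).

Definition fam (c : fcode) w : R :=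
  foldr (fun b a => Num.max (Num.max (- c.1%:R) (cone b w)) a) (- c.1%:R) c.2.

Lemma blip_cone b (a : R) : blip (fun w => Num.max a (cone b w)).
Proof.
have Lb : lipf b.2%:R (cone b).
  move=> w w' e ww'; have h := @dst_lipf _ (decode b.1.1) w w' e ww'.
  have -> : cone b w - cone b w' =
      b.2%:R * (dst w' (decode b.1.1) - dst w (decode b.1.1)).
    by rewrite /cone mulrBr opprB addrC addrA subrK.
  by rewrite normrM ger0_norm // distrC ler_wpM2l // (le_trans h) // mul1r.
split; first by exists b.2%:R; apply: lipf_max => //; apply: lipf_le (lipf_cst a).
exists (`|a| + `|ratr b.1.2|) => w.
have ub : cone b w <= ratr b.1.2 by rewrite /cone gerBl mulr_ge0 // dst_ge0.
have := ler_norm a; have := ler_norm (- a); have := ler_norm (ratr b.1.2 : R).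
rewrite normrN /Num.max; case: ltP => h; rewrite ler_norml => h1 h2 h3.
  by apply/andP; split; have := normr_ge0 (ratr b.1.2 : R); lra.
by apply/andP; split; have := normr_ge0 (ratr b.1.2 : R); lra.
Qed.

Lemma blip_cst (a : R) : @blip 'rV[R]_m (fun=> a).
Proof. by split; [exists 0; apply: lipf_cst | exists `|a|]. Qed.

Lemma blip_fam c : blip (fam c).
Proof.
case: c => M l; rewrite /fam /=; elim: l => [|b l IH] /=; first exact: blip_cst.
by apply: blip_max => //; apply: blip_cone.
Qed.

Lemma fam_le (M : nat) l w (a : R) : - M%:R <= a ->
  (forall b, b \in l -> cone b w <= a) -> fam (M, l) w <= a.
Proof.
move=> Ma; rewrite /fam /=; elim: l => [|b l IH] //= H.
rewrite !ge_max Ma H ?mem_head //=; apply: IH => b' b'l.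
by apply: H; rewrite inE b'l orbT.
Qed.

Lemma fam_ge (M : nat) l w b : b \in l -> cone b w <= fam (M, l) w.
Proof.
rewrite /fam /=; elim: l => //= b' l IH; rewrite inE => /orP[/eqP <-|/IH h].
  by rewrite !le_max lexx orbT.
by rewrite le_max h orbT.
Qed.

Lemma fam_geN (M : nat) l w : - M%:R <= fam (M, l) w.
Proof. by rewrite /fam /=; case: l => //= b l; rewrite !le_max lexx. Qed.

Definition cont_at (G : C -> R) w := forall e, 0 < e -> exists2 dl : R, 0 < dl &
  forall w', (forall t, `|w t - w' t| <= dl) -> `|G w - G w'| <= e.

(** A steep cone with apex slightly below [G w]: near [w] continuity keeps [G] above the apex, and
    farther away the slope [k] has brought the cone down to [- M]. Rational height, integer slope
    and a decoded centre make the family countable. *)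
Lemma bump_below (M : nat) (G : C -> R) w e : (forall w, `|G w| <= M%:R) ->
  cont_at G w -> 0 < e ->
  exists b, (forall w, cone b w <= Num.max (- M%:R) (cone b w)) /\
    (forall w', Num.max (- M%:R) (cone b w') <= G w') /\ G w - e <= cone b w.
Proof.
move=> GM cG e0; have e4 : 0 < e / 4 by rewrite divr_gt0.
have [dl dl0 Hdl] := cG _ e4.
have e24 : G w - e / 2 < G w - e / 4 by lra.
have [q] := rat_in_itvoo e24.
rewrite in_itv /= => /andP[q1 q2].
have [k kp kdl] : exists2 k : nat, 0 < k%:R :> R & 4 * M%:R <= k%:R * dl.
  exists (Num.truncn (4 * M%:R / dl)).+1; first by rewrite ltr0n.
  rewrite -ler_pdivrMr //; apply: ltW.
  have : 0 <= 4 * M%:R / dl by rewrite divr_ge0 ?mulr_ge0 // ltW.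
  by move=> h; have /andP[_] := truncn_itv h.
have [eta [eta0 eta1 eta2]] : exists eta, [/\ 0 < eta, eta <= dl / 2 & k%:R * eta <= e / 2].
  exists (Num.min (dl / 2) (e / (2 * k%:R))); split.
  - by rewrite lt_min !divr_gt0 // mulr_gt0.
  - by rewrite ge_min lexx.
  - apply: (@le_trans _ _ (k%:R * (e / (2 * k%:R)))).
      by rewrite ler_wpM2l ?(ltW kp) // ge_min lexx orbT.
    by apply: le_of_eq; field; rewrite gt_eqF.
have [c Hc] := decode_dense w eta0.
exists ((c, q), k); split; first by move=> w'; rewrite le_max lexx orbT.
have dwc : dst w (decode c) <= eta by apply: dst_le.
split; last first.
  apply: bump_center q1 _ => /=.
  by apply: le_trans eta2; rewrite ler_wpM2l // ltW.
move=> w'; have GMw' := GM w'; rewrite ler_norml in GMw'.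
rewrite ge_max; case/andP: GMw' => -> _ /=.
have d0 := dst_ge0 w' (decode c).
have [near|/existsNP[t /negP]] := pselect (forall t, `|w t - w' t| <= dl).
  have := Hdl w' near; rewrite ler_norml => /andP[_ h].
  by apply: bump_near q2 h _; rewrite mulr_ge0 // ltW.
rewrite -ltNge => far; have GMw := GM w; rewrite ler_norml in GMw.
have GMw' := GM w'; rewrite ler_norml in GMw'.
have h1 : dl <= dst w (decode c) + dst w' (decode c).
  apply: le_trans (ltW far) _; rewrite -(subrK (decode c t) (w t)) -addrA.
  apply: le_trans (ler_normD _ _) _; rewrite lerD ?dst_ub // distrC; exact: dst_ub.
have h2 : dl / 2 <= dst w' (decode c).
  exact: far_half h1 dwc eta1.
case/andP: GMw => _ g2; case/andP: GMw' => g1 _.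
exact: bump_far g2 g1 e0 q2 kdl (ler_wpM2l (ltW kp) h2).
Qed.

(** Maxima of more and more admissible cones increase to [G] at its continuity points, and dominated
    convergence does the rest. Because [fam] is countable, almost sure statements about its members
    hold outside one null set. *)
Lemma approx_below (nu : probability (borel C) R) (M : nat) (G : C -> R) (tol : R) :
  measurable_fun setT (G : borel C -> R) -> (forall w, `|G w| <= M%:R) ->
  (\forall w \ae nu, cont_at G w) -> 0 < tol ->
  exists c, (forall w, fam c w <= G w) /\
    \int[nu]_w G w <= \int[nu]_w fam c w + tol.
Proof.
move=> mG GM cG tol0.
pose ok (b : bcode) := `[< forall w, Num.max (- M%:R) (cone b w) <= G w >].
pose l N := [seq b <- pmap (@unpickle bcode) (iota 0 N) | ok b].
pose g N := fam (M, l N).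
have gG N w : g N w <= G w.
  apply: fam_le; first by have := GM w; rewrite ler_norml => /andP[].
  move=> b; rewrite mem_filter => /andP[/asboolP /(_ w) h _].
  by apply: le_trans h; rewrite le_max lexx orbT.
have cv : (fun N => \int[nu]_w g N w) @ \oo --> \int[nu]_w G w.
  apply: (@expect_dominated _ _ _ nu g G M%:R) => //.
  - by move=> N; case: (blip_bmf (blip_fam (M, l N))).
  - move=> N w; rewrite ler_norml fam_geN /=; apply: le_trans (gG N w) _.
    by have := GM w; rewrite ler_norml => /andP[].
  apply: ae_mono cG => w cw; apply/cvgn_epsP => e e0.
  have [b [_ [b2 b3]]] := bump_below GM cw e0.
  exists (pickle b).+1 => N bN; rewrite distrC ger0_norm ?subr_ge0 // lerBlDr -lerBlDl.
  apply: le_trans b3 _; apply: fam_ge; rewrite mem_filter.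
  apply/andP; split; first exact/asboolP.
  by rewrite mem_pmap; apply/mapP; exists (pickle b); rewrite ?pickleK // mem_iota.
have [N HN] := (cvgn_epsP _ _).1 cv _ tol0.
exists (M, l N); split; first exact: gG.
by have := HN N (leqnn _); rewrite -/(g N) ler_norml => /andP[h _]; lra.
Qed.

End LatticePaths.
End Paths.

(** * Expectations over finite walk paths and the Markov property *)

Section PathExpectation.
Variables (R : realType) (d : nat).
Local Notation pt := 'rV[int]_d.+1.
Implicit Types (c : pt -> step d -> R) (x y z : pt) (pre : seq pt).

(** The mean of a function of the whole walk over its next [n] steps, given the sites [pre] visited
    so far. The default in [last] matters only for an empty prefix. *)
Fixpoint pexp c n pre (F : seq pt -> R) : R :=
  if n is k.+1 then
    avg c (fun y => pexp c k (rcons pre y) F) (last 0 pre)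
  else F pre.

Lemma pexpS c n pre F : pexp c n.+1 pre F =
  avg c (fun y => pexp c n (rcons pre y) F) (last 0 pre).
Proof. by []. Qed.

Lemma eq_pexp c n pre (F G : seq pt -> R) :
  (forall s, size s = (size pre + n)%N -> take (size pre) s = pre -> F s = G s) ->
  pexp c n pre F = pexp c n pre G.
Proof.
elim: n pre => [|n IH] pre FG /=; first by apply: FG; rewrite ?addn0 ?take_size.
apply: avg_eq => s; apply: IH => t st tt.
rewrite size_rcons in st tt; apply: FG; first by rewrite st addSnnS.
have E : take (size pre) (rcons pre (last 0 pre + dir s)) = pre.
  by rewrite -cats1 take_cat ltnn subnn cats0.
by rewrite -[RHS]E -tt take_takel.
Qed.

Lemma pexp_cat c m n pre F :
  pexp c (m + n) pre F = pexp c m pre (fun s => pexp c n s F).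
Proof. by elim: m pre => //= m IH pre; apply: avg_eq => s. Qed.

Section Fixed.
Variables (kappa : R) (k0 : 0 < kappa) (c : pt -> step d -> R).
Hypothesis cP : conductances kappa c.

Lemma pexp_le n pre F G : (forall s, F s <= G s) -> pexp c n pre F <= pexp c n pre G.
Proof.
by move=> FG; elim: n pre => //= n IH pre; apply: (avg_le k0 cP) => s.
Qed.

Lemma pexp_le_in n pre F G :
  (forall s, size s = (size pre + n)%N -> take (size pre) s = pre -> F s <= G s) ->
  pexp c n pre F <= pexp c n pre G.
Proof.
move=> FG; have FE : pexp c n pre F = pexp c n pre (fun s => Num.min (F s) (G s)).
  by apply: eq_pexp => s ss ts; rewrite min_l // FG.
by rewrite FE; apply: pexp_le => s; rewrite ge_min lexx orbT.
Qed.

Lemma pexp_cst n pre a : pexp c n pre (fun=> a) = a.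
Proof.
elim: n pre => //= n IH pre; rewrite -[RHS](avg_cst k0 cP a (last 0 pre)).
exact: avg_eq.
Qed.

Lemma pexpD n pre F G :
  pexp c n pre (fun s => F s + G s) = pexp c n pre F + pexp c n pre G.
Proof. by elim: n pre => //= n IH pre; rewrite -avgD; apply: avg_eq => s. Qed.

Lemma pexpZ n pre a F : pexp c n pre (fun s => a * F s) = a * pexp c n pre F.
Proof. by elim: n pre => //= n IH pre; rewrite -avgM; apply: avg_eq => s. Qed.

Lemma pexpB n pre F G :
  pexp c n pre (fun s => F s - G s) = pexp c n pre F - pexp c n pre G.
Proof.
rewrite -mulN1r -pexpZ -pexpD; apply: eq_pexp => s _ _; by rewrite mulN1r.
Qed.

Lemma pexp_sum n pre (I : Type) (r : seq I) (F : I -> seq pt -> R) :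
  pexp c n pre (fun s => \sum_(i <- r) F i s) = \sum_(i <- r) pexp c n pre (F i).
Proof.
elim: r => [|i r IH].
  by rewrite big_nil -[RHS](pexp_cst n pre 0); apply: eq_pexp => s _ _; rewrite big_nil.
by rewrite big_cons -IH -pexpD; apply: eq_pexp => s _ _; rewrite big_cons.
Qed.

Lemma pexp_ge0 n pre F : (forall s, 0 <= F s) -> 0 <= pexp c n pre F.
Proof. by move=> F0; rewrite -(pexp_cst n pre 0); apply: pexp_le. Qed.

Lemma pexp_dist n pre F G H : (forall s, `|F s - G s| <= H s) ->
  `|pexp c n pre F - pexp c n pre G| <= pexp c n pre H.
Proof.
move=> FGH; rewrite ler_norml -pexpB; apply/andP; split.
  rewrite -[X in - X]mul1r -mulNr -pexpZ; apply: pexp_le => s.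
  by have := FGH s; rewrite ler_norml mulN1r => /andP[].
by apply: pexp_le => s; have := FGH s; rewrite ler_norml => /andP[].
Qed.

Lemma pexp_dist_in n pre F G H :
  (forall s, size s = (size pre + n)%N -> take (size pre) s = pre ->
     `|F s - G s| <= H s) ->
  `|pexp c n pre F - pexp c n pre G| <= pexp c n pre H.
Proof.
move=> FGH; apply: (@le_trans _ _ (pexp c n pre (fun s => `|F s - G s|))).
  exact: pexp_dist.
exact: pexp_le_in.
Qed.

Lemma pexp_markov n pre z F :
  pexp c n (rcons pre z) F = pexp c n [:: z] (fun s => F (pre ++ s)).
Proof.
have gen s : s != [::] -> pexp c n (pre ++ s) F = pexp c n s (fun s => F (pre ++ s)).
  elim: n s => //= n IH s s0; rewrite last_cat.
  have -> : last (last 0 pre) s = last 0 s by case: s s0.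
  apply: avg_eq => t; rewrite rcons_cat; apply: IH.
  by rewrite -size_eq0 size_rcons.
by rewrite -cats1; apply: gen.
Qed.

(** This is what lets walks stopped at different times be compared over a common number of steps. *)
Lemma pexp_extend n m pre F :
  (forall s t, size s = (size pre + n)%N -> F (s ++ t) = F s) ->
  pexp c (n + m) pre F = pexp c n pre F.
Proof.
move=> FE; rewrite pexp_cat; apply: eq_pexp => s ss _.
transitivity (pexp c m s (fun=> F s)); last exact: pexp_cst.
apply: eq_pexp => t st tt; rewrite -(cat_take_drop (size s) t) tt; exact: FE.
Qed.

End Fixed.

Lemma pexp_shift c n pre x0 F : pre != [::] ->
  pexp (fun y => c (x0 + y)) n pre F =
  pexp c n [seq x0 + y | y <- pre] (fun s => F [seq y - x0 | y <- s]).
Proof.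
elim: n pre => [|n IH] pre p0 /=.
  congr F; rewrite -map_comp -[LHS]map_id; apply: eq_map => y /=.
  by rewrite addrC addKr.
have -> : last 0 [seq x0 + y | y <- pre] = x0 + last 0 pre.
  by case: pre p0 => //= y pre _; rewrite last_map.
rewrite -avg_shift; apply: avg_eq => s; rewrite IH ?map_rcons //.
by rewrite -size_eq0 size_rcons.
Qed.

End PathExpectation.

(** * Integrals under the quenched law as finite path sums *)

Section QuenchedLaw.
Variables (R : realType) (d : nat).
Local Notation pt := 'rV[int]_d.+1.

Definition cond_of (w : env R d.+1) (x : pt) (s : step d) : R :=
  conductance w x (x + dir s).

Lemma conductance_sym (w : env R d.+1) x y : conductance w x y = conductance w y x.
Proof. by apply: eq_bigr => i _; rewrite addrC. Qed.

Lemma neighbourP (x y : pt) : reflect (exists s, y = x + dir s) (neighbour x y).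
Proof.
apply: (iffP existsP) => [[i /orP[]/eqP ->]|[[i []] ->]].
- by exists (i, true).
- by exists (i, false).
- by exists i; rewrite eqxx.
- by exists i; rewrite /dir /= eqxx orbT.
Qed.

Lemma neighbour_dir (x : pt) s : neighbour x (x + dir s).
Proof. by apply/neighbourP; exists s. Qed.

Lemma dir_inj : injective (@dir d).
Proof.
move=> [i b] [j b'] E; have {}E k : ((dir (i, b)) ord0 k : int) = dir (j, b') ord0 k.
  by rewrite E.
have := E i; have := E j; rewrite /dir /=.
case: b E => E; case: b' E => E; rewrite !mxE !eqxx /=; case: eqVneq => [->|] //.
Qed.

Lemma pi_envE (w : env R d.+1) x : pi_env w x = cweight (cond_of w) x.
Proof. by rewrite /cweight sum_step. Qed.

Lemma transitionE (w : env R d.+1) x s :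
  transition w x (x + dir s) = tprob (cond_of w) x s.
Proof. by rewrite /transition neighbour_dir pi_envE. Qed.

Variables (w : env R d.+1) (Q : probability (trajectory_space d.+1) R) (x0 : pt).
Hypotheses (QL : quenched_law w x0 Q).
Variables (kappa : R) (k0 : 0 < kappa) (cP : conductances kappa (cond_of w)).

Definition cyl (pre : seq pt) : set (trajectory_space d.+1) :=
  [set X | forall k, (k < size pre)%N -> X k = nth 0 pre k].

Lemma measurable_cyl pre : measurable (cyl pre).
Proof.
apply: (@measurable_prefix d.+1 (size pre)
  (fun X => forall k, (k < size pre)%N -> X k = nth 0 pre k)) => X Y XY H k kp.
by rewrite -XY ?H // ltnW.
Qed.

Lemma Q_step pre s : pre != [::] ->
  Q (cyl (rcons pre (last 0 pre + dir s))) =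
  (Q (cyl pre) * (tprob (cond_of w) (last 0 pre) s)%:E)%E.
Proof.
case: pre => // x p _; set pre := x :: p; set y := last 0 pre + dir s.
pose t : trajectory d.+1 := fun k => nth 0 (rcons pre y) k.
have [_ /(_ (size p) t)] := QL.
have E1 : cyl (rcons pre y) = [set X | forall k, (k <= (size p).+1)%N -> X k = t k].
  have sz : size (rcons pre y) = (size p).+2 by rewrite size_rcons.
  by rewrite /cyl sz.
have E2 : cyl pre = [set X | forall k, (k <= size p)%N -> X k = t k].
  apply/seteqP; split => X H k kp; have := H k kp; rewrite /t nth_rcons.
    by rewrite ltnS kp.
  by rewrite /pre /= ltnS in kp *; rewrite kp.
rewrite E1 E2 => ->; congr (_ * _%:E)%E.
have -> : t (size p) = last 0 pre.
  by rewrite /t nth_rcons (_ : (size p < size pre)%N = true) ?ltnSn // -[last 0 pre]nth_last.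
have -> : t (size p).+1 = y by rewrite /t nth_rcons /= ltnn eqxx.
exact: transitionE.
Qed.

(** [Q] prescribes cylinder probabilities only. The difference [h] between the indicator of a
    cylinder and those of its nearest-neighbour continuations is nonnegative with integral zero, so
    trajectories with forbidden jumps can be ignored and the claim follows one step at a time. *)
Lemma cyl_split n pre (phi : trajectory d.+1 -> R) (G : seq pt -> R) :
  pre != [::] ->
  (forall X s, size s = (size pre + n)%N -> cyl s X -> phi X = G s) ->
  (exists M : R, forall X, `|phi X| <= M) ->
  measurable_fun setT (phi : trajectory_space d.+1 -> R) ->
  \int[Q]_X (\1_(cyl pre) X * phi X) =
    fine (Q (cyl pre)) * pexp (cond_of w) n pre G.
Proof.
move=> p0 phiG [M phiM] mphi.
have bphi : bmf (phi : trajectory_space d.+1 -> R) by split=> //; exists M.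
have bI s : bmf (\1_(cyl s) : trajectory_space d.+1 -> R).
  by apply: bmf_indic; exact: measurable_cyl.
elim: n pre p0 phiG => [|n IH] pre p0 phiG.
  rewrite /= (@eq_Rintegral _ _ _ _ _ (fun X => G pre * \1_(cyl pre) X)).
    by rewrite expectZ; [rewrite expect_indic; [rewrite mulrC | exact: measurable_cyl] | exact: bI].
  move=> X _; rewrite indicE; case: (boolP (X \in cyl pre)); rewrite ?mulr0 ?mul0r //.
  by rewrite inE => cX; rewrite mul1r mulr1; apply: phiG; rewrite ?addn0.
pose Y s := cyl (rcons pre (last 0 pre + dir s)).
have one (X : trajectory_space d.+1) s t : Y s X -> Y t X -> s = t.
  move=> Xs Xt; have := Xs (size pre); have := Xt (size pre).
  rewrite !size_rcons ltnSn !nth_rcons ltnn eqxx.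
  by move=> /(_ isT) -> /(_ isT) /addrI /dir_inj.
have sY s X : Y s X -> cyl pre X.
  move=> H k kp; have := H k; rewrite size_rcons nth_rcons kp; apply.
  exact: ltnW.
pose h (X : trajectory_space d.+1) : R := \1_(cyl pre) X - \sum_s \1_(Y s) X.
have [bS ES] := @expect_sum _ _ R Q _ (index_enum (step d)) (fun s => \1_(Y s))
  (fun s => bI _).
have h0 X : 0 <= h X.
  rewrite /h subr_ge0; have [[s Ys]|nY] := pselect (exists s, Y s X); last first.
    by rewrite big1 ?indicE // => s _; rewrite indicE memNset // => Ys; apply: nY; exists s.
  rewrite (bigD1 s) //= big1 ?addr0; last first.
    move=> t ts; rewrite indicE memNset // => Yt.
    by rewrite (one _ _ _ Ys Yt) eqxx in ts.
  by rewrite !indicE !mem_set //; apply: sY Ys.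
have QY s : fine (Q (Y s)) = fine (Q (cyl pre)) * tprob (cond_of w) (last 0 pre) s.
  rewrite /Y Q_step // fineM // fin_num_measure //; exact: measurable_cyl.
have Eh : \int[Q]_X h X = 0.
  rewrite expectB // ES expect_indic; last exact: measurable_cyl.
  rewrite (eq_bigr (fun s => fine (Q (cyl pre)) * tprob (cond_of w) (last 0 pre) s)).
    by rewrite -mulr_sumr (tprob_sum k0 cP) mulr1 subrr.
  by move=> s _; rewrite expect_indic ?QY //; exact: measurable_cyl.
have bh : bmf h by apply: bmfB.
have [bS2 ES2] := @expect_sum _ _ R Q _ (index_enum (step d))
  (fun s X => \1_(Y s) X * phi X) (fun s => bmfM (bI _) bphi).
have -> : \int[Q]_X (\1_(cyl pre) X * phi X) =
    \int[Q]_X \sum_s \1_(Y s) X * phi X.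
  apply/eqP; rewrite -subr_eq0 -normr_le0.
  apply: le_trans (expect_dist Q (bmfM (bI pre) bphi) bS2 (bmfZ M bh) _) _.
    move=> X; rewrite -mulr_suml -mulrBl -/(h X) normrM (ger0_norm (h0 X)) mulrC.
    by rewrite ler_wpM2r.
  by rewrite expectZ // Eh mulr0.
rewrite ES2 pexpS /avg mulr_sumr; apply: eq_bigr => s _.
rewrite -/(Y s) IH ?QY ?mulrA //; first by rewrite -size_eq0 size_rcons.
by move=> X t; rewrite size_rcons addSnnS; apply: phiG.
Qed.

Lemma pexp_integral n (phi : trajectory d.+1 -> R) (G : seq pt -> R) :
  (forall X s, size s = n.+1 -> cyl s X -> phi X = G s) ->
  (exists M : R, forall X, `|phi X| <= M) ->
  measurable_fun setT (phi : trajectory_space d.+1 -> R) ->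
  \int[Q]_X phi X = pexp (cond_of w) n [:: x0] G.
Proof.
move=> phiG bM mphi; have bphi : bmf (phi : trajectory_space d.+1 -> R) by split.
have Q1 : Q (cyl [:: x0]) = 1%E.
  have [<- _] := QL; congr (Q _); apply/seteqP; split => X H; first exact: (H 0%N).
  by case.
have := @cyl_split n [:: x0] phi G isT _ bM mphi; rewrite Q1 mul1r => <- //.
have bI : bmf (\1_(cyl [:: x0]) : trajectory_space d.+1 -> R).
  by apply: bmf_indic; exact: measurable_cyl.
case: bM => M phiM; apply/eqP; rewrite -subr_eq0 -normr_le0.
pose h (X : trajectory_space d.+1) : R := 1 - \1_(cyl [:: x0]) X.
have bh : bmf h by apply: bmfB => //; apply: bmf_cst.
apply: le_trans (expect_dist Q bphi (bmfM bI bphi) (bmfZ M bh) _) _.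
  move=> X; rewrite -{1}[phi X]mul1r -mulrBl -/(h X) normrM mulrC ler_pM // /h.
  by rewrite indicE; case: (X \in _); rewrite ?subrr ?subr0 ?normr0 ?normr1.
rewrite expectZ // /h expectB ?expect_cst //; last exact: bmf_cst.
by rewrite expect_indic ?Q1 ?subrr ?mulr0 //; exact: measurable_cyl.
Qed.

End QuenchedLaw.

Lemma ae_count (dT : measure_display) (T : measurableType dT) (R : realType)
    (P : probability T R) (I : countType) (A : I -> T -> Prop) :
  (forall i, {ae P, forall w, A i w}) -> {ae P, forall w, forall i, A i w}.
Proof.
move=> H; pose B n w := if @unpickle I n is Some i then A i w else True.
have : {ae P, forall w, forall n, B n w}.
  apply: ae_foralln => n; rewrite /B; case: unpickle => [i|]; first exact: H.
  exact: aeW.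
by apply: ae_mono => w Bw i; have := Bw (pickle i); rewrite /B pickleK.
Qed.

(** * A covering lemma and the maximal inequality for stationary environments *)

Section Covering.
Variables (R : realType) (d : nat).
Local Notation pt := 'rV[int]_d.+1.

Definition near_count (A : seq pt) (x : pt) (r : nat) : nat :=
  count (fun a => (nrm (a - x)%R <= r)%N) A.

Lemma near_count_le (S : seq pt) x r : uniq S ->
  (near_count S x r <= (r + r).+1 ^ d.+1)%N.
Proof.
move=> uS; rewrite /near_count -size_filter -size_box.
rewrite -(size_map (fun y => y - x)); apply: uniq_leq_size.
  by rewrite map_inj_uniq ?filter_uniq //; exact: addIr.
by move=> y /mapP[z]; rewrite mem_filter mem_box => /andP[h _] ->.
Qed.

(* Greedy selection of the largest balls, in the style of Vitali. *)
Lemma vitali_count (S A : seq pt) (rad : pt -> nat) (lam : R) : 0 < lam ->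
  uniq S -> (forall x, x \in S ->
    lam * ((rad x + rad x).+1 ^ d.+1)%:R < (near_count A x (rad x))%:R) ->
  lam * (size S)%:R <= 2 ^+ d.+1 * (size A)%:R.
Proof.
move=> lam0; have [n] := ubnP (size S); elim: n S A => // n IH S A Sn uS HS.
have [->|[x0 x0S]] : S = [::] \/ exists x, x \in S.
  by case: (S) => [|x s]; [left | right; exists x; rewrite mem_head].
  by rewrite mulr0 mulr_ge0 // exprn_ge0.
have [x xS xmax] : exists2 x, x \in S & forall y, y \in S -> (rad y <= rad x)%N.
  have gen (s : seq pt) z : exists2 x, x \in z :: s &
      forall y, y \in z :: s -> (rad y <= rad x)%N.
    elim: s z => [|z' s IHs] z.
      by exists z; rewrite ?mem_head // => y; rewrite mem_seq1 => /eqP ->.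
    have [x xs H] := IHs z'; have [h|h] := leqP (rad x) (rad z).
      exists z; rewrite ?mem_head // => y; rewrite inE => /orP[/eqP ->//|/H hy].
      exact: leq_trans hy h.
    exists x; first by rewrite inE xs orbT.
    by move=> y; rewrite inE => /orP[/eqP ->|/H //]; exact: ltnW.
  by case: (S) x0S => // z s _; apply: gen.
pose far (y : pt) := (rad x + rad y < nrm (y - x)%R)%N.
pose S' := [seq y <- S | far y].
pose A' := [seq a <- A | ~~ (nrm (a - x)%R <= rad x)%N].
have nx : ~~ far x by rewrite /far subrr nrm0 ltn0.
have sS' : (size S' < size S)%N.
  rewrite /S' size_filter -(count_predC far S) -[X in (X < _)%N]addn0 ltn_add2l.
  by rewrite -has_count; apply/hasP; exists x.
have IHS : lam * (size S')%:R <= 2 ^+ d.+1 * (size A')%:R.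
  apply: IH; [by apply: leq_trans sS' _ | exact: filter_uniq |].
  move=> y; rewrite mem_filter => /andP[fy yS]; apply: lt_le_trans (HS y yS) _.
  rewrite ler_nat /near_count /A' count_filter; apply: sub_count => a /= h.
  rewrite h /= -ltnNge; rewrite /far in fy.
  have := nrmD (y - a) (a - x); rewrite addrA subrK [nrm (y - a)]nrmC.
  by move: (nrm (a - y)) (nrm (a - x)) (nrm (y - x)) h fy => *; lia.
have sA : size A = (size A' + near_count A x (rad x))%N.
  by rewrite /A' size_filter addnC -(count_predC (fun a => (nrm (a - x)%R <= rad x)%N) A).
have sSS : (size S <= size S' + 2 ^ d.+1 * (rad x + rad x).+1 ^ d.+1)%N.
  rewrite /S' size_filter -(count_predC far S) leq_add2l.
  apply: (@leq_trans (near_count S x (rad x + rad x))).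
    rewrite /near_count -!size_filter; apply: uniq_leq_size; first exact: filter_uniq.
    move=> y; rewrite !mem_filter => /andP[fy yS]; rewrite yS andbT.
    by move: fy; rewrite /= /far -leqNgt => /leq_trans; apply; rewrite leq_add2l xmax.
  apply: leq_trans (near_count_le _ _ uS) _.
  by rewrite -expnMn leq_exp2r //; lia.
have h1 : lam * (size S)%:R <=
    lam * (size S')%:R + 2 ^+ d.+1 * (lam * ((rad x + rad x).+1 ^ d.+1)%:R).
  rewrite mulrCA -mulrDr ler_wpM2l ?(ltW lam0) // -natrX -natrM -natrD ler_nat.
  exact: sSS.
rewrite sA natrD mulrDr; apply: (le_trans h1); apply: lerD => //.
by rewrite ler_wpM2l ?exprn_ge0 // ltW // HS.
Qed.

End Covering.

Section Maximal.
Variables (R : realType) (d : nat).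
Local Notation pt := 'rV[int]_d.+1.
Variables (P : probability (env_space R d.+1) R) (hstat : stationary P).

Lemma env_shiftD (x y : pt) (w : env R d.+1) :
  env_shift x (env_shift y w) = env_shift (x + y : pt) w.
Proof. by apply/funext => -[b i]; rewrite /env_shift /= addrA. Qed.

Lemma measurable_env_coord (b : edge d.+1) :
  measurable_fun setT (fun w : env_space R d.+1 => w b : R).
Proof.
by move=> _ A mA; rewrite setTI; apply: sub_sigma_algebra; exists b, A.
Qed.

Lemma measurable_env_shift (z : pt) :
  measurable_fun setT (env_shift z : env_space R d.+1 -> env_space R d.+1).
Proof.
apply: (@measurability _ _ (env_space R d.+1) (env_space R d.+1) setT _
  (@env_cylinders R d.+1) (erefl _)) => _ [_ [b [A [mA ->]]] <-].
rewrite setTI -[X in measurable X]setTI.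
exact: (measurable_env_coord (b.1 + z, b.2) measurableT mA).
Qed.

Lemma measurable_shift_preimage z (A : set (env_space R d.+1)) : measurable A ->
  measurable (env_shift z @^-1` A : set (env_space R d.+1)).
Proof. by move=> mA; rewrite -[X in measurable X]setTI; apply: measurable_env_shift. Qed.

Lemma ae_shift (A : env R d.+1 -> Prop) : {ae P, forall w, A w} ->
  {ae P, forall w, forall z, A (env_shift z w)}.
Proof.
move=> [N [mN N0 AN]]; apply: (@ae_count _ _ _ P pt (fun z w => A (env_shift z w))) => z.
exists (env_shift z @^-1` N : set (env_space R d.+1)); split.
- exact: measurable_shift_preimage.
- by rewrite hstat.
by move=> w nA; apply: AN.
Qed.

Definition bad_count (B : set (env_space R d.+1)) (w : env R d.+1) (r : nat) : nat :=
  count (fun x : pt => `[< B (env_shift x w) >]) (box d r).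

Lemma bad_countE B w r :
  (bad_count B w r)%:R = \sum_(x <- box d r) \1_B (env_shift x w : env_space R d.+1) :> R.
Proof.
rewrite /bad_count -sum1_count natr_sum big_mkcond /=; apply: eq_bigr => x _.
rewrite indicE; case: asboolP => h; first by rewrite mem_set.
by rewrite memNset.
Qed.

Section OneSet.
Variables (B : set (env_space R d.+1)) (mB : measurable B) (lam : R).
Hypothesis lam0 : 0 < lam.

Let dense r := [set w : env_space R d.+1 |
  lam * ((r + r).+1 ^ d.+1)%:R < (bad_count B w r)%:R].

Let mI x : measurable_fun setT
  (fun w : env_space R d.+1 => \1_B (env_shift x w : env_space R d.+1) : R).
Proof.
apply: (mcomp (\1_B : env_space R d.+1 -> R)).
  exact: measurable_indic.
exact: measurable_env_shift.
Qed.

Let measurable_dense r : measurable (dense r).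
Proof.
have mf : measurable_fun setT (fun w : env_space R d.+1 => (bad_count B w r)%:R : R).
  rewrite (_ : (fun w => _) = (fun w : env_space R d.+1 =>
    \sum_(x <- box d r) \1_B (env_shift x w : env_space R d.+1))).
    by apply: measurable_sum => x; exact: mI.
  by apply/funext => w; exact: bad_countE.
rewrite (_ : dense r = setT `&` (fun w => (bad_count B w r)%:R : R) @^-1`
   `]lam * ((r + r).+1 ^ d.+1)%:R, +oo[); first exact: mf.
by apply/seteqP; split => w; rewrite /= in_itv /= andbT; [split | case].
Qed.

Let some_dense N := \bigcup_(r in `I_N.+1) dense r.

Let measurable_some N : measurable (some_dense N).
Proof. by apply: bigcup_measurable. Qed.

(** Transference: the covering lemma is applied to each environment in a finite box, and by
    stationarity the mean number of translates lying in an event is the volume times its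
    probability. One factor [2 ^+ d.+1] comes from the covering, the other from the larger box that
    contains all the balls. *)
Lemma maximal_finite N : lam * fine (P (some_dense N)) <= 4 ^+ d.+1 * fine (P B).
Proof.
pose A w : seq pt := [seq x <- box d (N + N) | `[< B (env_shift x w) >]].
pose S w : seq pt := [seq x <- box d N | `[< some_dense N (env_shift x w) >]].
have pt1 w : lam * (size (S w))%:R <= 2 ^+ d.+1 * (size (A w))%:R.
  have ex x : x \in S w -> exists r, (r <= N)%N /\ dense r (env_shift x w).
    by rewrite mem_filter => /andP[/asboolP[r rN dr] _]; exists r.
  have [rad Hrad] : exists rad : pt -> nat, forall x, x \in S w ->
      (rad x <= N)%N /\ dense (rad x) (env_shift x w).
    have /choice[rad H] : forall x, exists r, x \in S w ->
        (r <= N)%N /\ dense r (env_shift x w).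
      move=> x; case: (boolP (x \in S w)) => xS; last by exists 0%N.
      by have [r Hr] := ex x xS; exists r.
    by exists rad.
  apply: (@vitali_count R d (S w) (A w) rad) => //.
    by rewrite filter_uniq ?box_uniq.
  move=> x xS; have [rN] := Hrad x xS; rewrite /dense /= => /lt_le_trans; apply.
  have xN : (nrm x <= N)%N by move: xS; rewrite mem_filter mem_box => /andP[].
  rewrite ler_nat /bad_count /near_count -!size_filter -(size_map (fun y => y + x)).
  apply: uniq_leq_size.
    by rewrite map_inj_uniq ?filter_uniq ?box_uniq //; exact: addIr.
  move=> y /mapP[z]; rewrite !mem_filter !mem_box env_shiftD => /andP[Bz zr] ->.
  rewrite addrK zr Bz /=; apply: leq_trans (nrmD _ _) _.
  by rewrite leq_add // (leq_trans zr).
have sum_meas (C : set (env_space R d.+1)) n : measurable C ->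
    bmf (fun w : env_space R d.+1 => \sum_(x <- box d n) \1_C (env_shift x w : env_space R d.+1) : R) /\
    \int[P]_w (\sum_(x <- box d n) \1_C (env_shift x w : env_space R d.+1) : R) =
    (size (box d n))%:R * fine (P C).
  move=> mC; have bC x : bmf (fun w : env_space R d.+1 =>
      \1_C (env_shift x w : env_space R d.+1) : R).
    have h : bmf (\1_(env_shift x @^-1` C : set (env_space R d.+1)) :
        env_space R d.+1 -> R) := bmf_indic (measurable_shift_preimage x mC).
    exact: h.
  have [b1 b2] := @expect_sum _ _ R P _ (box d n) _ bC; split => //.
  rewrite b2 -sum1_size natr_sum mulr_suml; apply: eq_bigr => x _; rewrite mul1r.
  transitivity (\int[P]_w (\1_(env_shift x @^-1` C) w : R)); first by [].
  by rewrite expect_indic ?hstat //; exact: measurable_shift_preimage.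
have [bS ES] := sum_meas _ N (measurable_some N).
have [bA EA] := sum_meas _ (N + N)%N mB.
have szE (C : set (env_space R d.+1)) n w :
    (size [seq x <- box d n | `[< C (env_shift x w) >]])%:R =
    \sum_(x <- box d n) \1_C (env_shift x w : env_space R d.+1) :> R.
  by rewrite size_filter; exact: bad_countE.
have : lam * ((size (box d N))%:R * fine (P (some_dense N))) <=
    2 ^+ d.+1 * ((size (box d (N + N)))%:R * fine (P B)).
  rewrite -ES -EA -!expectZ //; apply: expect_le; try exact: bmfZ.
  by move=> w; rewrite -!szE; apply: pt1.
have bp : (0 : R) < (size (box d N))%:R by rewrite size_box ltr0n expn_gt0.
have bb : (size (box d (N + N)))%:R <= 2 ^+ d.+1 * (size (box d N))%:R :> R.
  by rewrite !size_box -!natrX -natrM ler_nat -expnMn leq_exp2r //; lia.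
move=> h; rewrite -(ler_pM2l bp) mulrCA; apply: (le_trans h).
apply: (@le_trans _ _ (2 ^+ d.+1 * (2 ^+ d.+1 * (size (box d N))%:R * fine (P B)))).
  by rewrite ler_wpM2l ?exprn_ge0 // ler_wpM2r // pr_ge0.
have -> : (4 : R) ^+ d.+1 = 2 ^+ d.+1 * 2 ^+ d.+1 by rewrite -exprMn; congr (_ ^+ _); ring.
by apply: le_of_eq; ring.
Qed.

Lemma maximal_ineq :
  measurable (\bigcup_r dense r) /\ lam * fine (P (\bigcup_r dense r)) <= 4 ^+ d.+1 * fine (P B).
Proof.
have mU : measurable (\bigcup_r dense r) by apply: bigcupT_measurable.
split=> //; have E : \bigcup_N some_dense N = \bigcup_r dense r.
  apply/seteqP; split => w [r _ h]; first by case: h => k _ dk; exists k.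
  by exists r => //; exists r => //=.
have := @nondecreasing_cvg_mu _ _ _ P some_dense measurable_some.
rewrite E => /(_ mU) cv; have {}cv : fine (P (some_dense n)) @[n --> \oo] -->
   fine (P (\bigcup_r dense r)).
  apply: fine_cvg; rewrite fineK ?fin_num_measure //; apply: cv => n m nm.
  by apply/subsetPset => w [r rn dr]; exists r => //=; exact: leq_trans rn _.
have {}cv : lam * fine (P (some_dense n)) @[n --> \oo] -->
   lam * fine (P (\bigcup_r dense r)) by apply: cvgM => //; exact: cvg_cst.
by apply: (cvgr_to_le cv); near=> n; exact: maximal_finite.
Unshelve. all: by end_near. Qed.

End OneSet.

(** The maximal inequality controls all radii at once, and its bound tends to zero with the
    probability of [B m]; almost every environment therefore escapes at least one of the exceptional
    sets. *)
Lemma good_density (B : nat -> set (env_space R d.+1)) :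
  (forall m, measurable (B m)) -> (fine (P (B m)) @[m --> \oo] --> (0 : R)) ->
  forall lam : R, 0 < lam -> {ae P, forall w : env R d.+1, exists m, forall r,
    (bad_count (B m) w r)%:R <= lam * ((r + r).+1 ^ d.+1)%:R}.
Proof.
move=> mB B0 lam lam0.
pose N m := \bigcup_r [set w : env_space R d.+1 |
  lam * ((r + r).+1 ^ d.+1)%:R < (bad_count (B m) w r)%:R].
have mN m : measurable (N m) by have [] := maximal_ineq (mB m) lam0.
exists (\bigcap_m N m); split; first exact: bigcapT_measurable.
  have fN : P (\bigcap_m N m) \is a fin_num by apply: fin_num_measure; exact: bigcapT_measurable.
  rewrite -(fineK fN); congr (_%:E); apply/eqP; rewrite eq_le pr_ge0 andbT.
  apply/ler_addgt0Pl => e e0; rewrite addr0.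
  have e1 : 0 < lam * e / 4 ^+ d.+1 by rewrite divr_gt0 ?mulr_gt0 ?exprn_gt0.
  have /cvgn_epsP /(_ _ e1) [m /(_ m (leqnn m))] := B0.
  rewrite subr0 ger0_norm ?pr_ge0 // => Bm.
  have [_ h] := maximal_ineq (mB m) lam0.
  apply: (@le_trans _ _ (fine (P (N m)))).
    by apply: pr_le => //; [exact: bigcapT_measurable | move=> w; apply].
  rewrite -(ler_pM2l lam0); apply: le_trans h _.
  by rewrite mulrC -ler_pdivlMr ?exprn_gt0.
move=> w nw m _; apply: contrapT => nN; apply: nw; exists m => r.
by rewrite leNgt; apply/negP => h; apply: nN; exists r.
Qed.

End Maximal.

(** * The modulus of continuity as a functional *)

Section Modulus.
Variables (R : realType) (V : normedModType R).
Local Notation C := (C01 V).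
Implicit Types (w : C) (dl : R).

Definition mdl dl w : R :=
  sup [set `|w p.1 - w p.2| | p in [set p : I01 R * I01 R |
    `|time p.1 - time p.2| <= dl]].

Lemma mdl_has_sup dl w : 0 <= dl -> has_sup [set `|w p.1 - w p.2| |
  p in [set p : I01 R * I01 R | `|time p.1 - time p.2| <= dl]].
Proof.
move=> dl0; split.
  by exists `|w (clip 0) - w (clip 0)|, (clip 0, clip 0) => //=; rewrite subrr normr0.
have [M HM] := path_bounded w; exists (M + M) => _ [[s t] _ <-] /=.
by apply: le_trans (ler_normB _ _) _; apply: lerD.
Qed.

Lemma mdl_ub dl w s t : `|time s - time t| <= dl -> `|w s - w t| <= mdl dl w.
Proof.
move=> h; have dl0 : 0 <= dl by apply: le_trans h; exact: normr_ge0.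
by apply: ub_le_sup; [exact: (mdl_has_sup w dl0).2 | exists (s, t)].
Qed.

Lemma mdl_le dl w b : 0 <= dl ->
  (forall s t, `|time s - time t| <= dl -> `|w s - w t| <= b) -> mdl dl w <= b.
Proof.
move=> dl0 H; apply: ge_sup; first exact: (mdl_has_sup w dl0).1.
by move=> _ [[s t] h <-]; exact: H.
Qed.

Lemma mdl_ge0 dl w : 0 <= dl -> 0 <= mdl dl w.
Proof.
move=> dl0; rewrite -(normr0 V) -(subrr (w (clip 0))); apply: mdl_ub.
by rewrite subrr normr0.
Qed.

Lemma mdl_lipf dl : 0 <= dl -> lipf 2 (mdl dl).
Proof.
move=> dl0; apply: sup_lipf.
- by exists (clip 0, clip 0) => /=; rewrite subrr normr0.
- move=> w; have [M HM] := path_bounded w; exists (M + M) => -[s t] _ /=.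
  by apply: le_trans (ler_normB _ _) _; apply: lerD.
move=> [s t] _ w w' e H /=; apply: le_trans (ler_dist_dist _ _) _.
have -> : w s - w t - (w' s - w' t) = w s - w' s - (w t - w' t).
  by rewrite !opprB addrACA [RHS]addrACA [- w t + _]addrC.
apply: le_trans (ler_normB _ _) _.
have h1 := H s; have h2 := H t; rewrite mulr_natl mulr2n.
by apply: lerD.
Qed.

(** The truncation at [1] makes the modulus a bounded Lipschitz functional, to which the invariance
    principle applies. *)
Definition osc dl w : R := Num.min 1 (mdl dl w).

Lemma osc_itv dl w : 0 <= dl -> 0 <= osc dl w <= 1.
Proof. by move=> dl0; rewrite le_min ler01 mdl_ge0 //= ge_min lexx. Qed.

Lemma blip_osc dl : 0 <= dl -> blip (osc dl).
Proof.
move=> dl0; split; last first.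
  by exists 1 => w; have /andP[a b] := osc_itv w dl0; rewrite ger0_norm.
exists (1 * 2); apply: (@lipf_comp _ _ _ 1 _ (fun x => Num.min 1 x)) => //; last exact: mdl_lipf.
by move=> x y; rewrite mul1r; case: (leP 1 x); case: (leP 1 y) => hy hx;
  rewrite ?subrr ?normr0 // ?ler_norml; (try apply/andP; try split);
  case: (lerP 0 (x - y)) => h; rewrite ?(ger0_norm h) ?(ltr0_norm h); lra.
Qed.

Lemma osc_small (W : probability (borel C) R) e : 0 < e ->
  exists2 dl, 0 < dl & \int[W]_w osc dl w <= e.
Proof.
move=> e0; pose u (k : nat) w := osc k.+1%:R^-1 w.
have u0 k : 0 <= k.+1%:R^-1 :> R by rewrite invr_ge0.
have cv : (fun n => \int[W]_w u n w) @ \oo --> (\int[W]_w (0 : R) : R).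
  apply: (@expect_dominated _ (borel C) R W u (fun=> 0) 1) => [k||k w|].
- by have [] := blip_bmf (blip_osc (u0 k)).
- exact: measurable_cst.
- by have /andP[a b] := osc_itv w (u0 k); rewrite ger0_norm.
- apply: aeW => w; apply/cvgn_epsP => r r0; have [dl dl0 H] := path_unif w r0.
  have [N HN] := inv_nat_small dl0; exists N => n Nn; rewrite subr0.
  have /andP[a b] := osc_itv w (u0 n); rewrite ger0_norm // ge_min; apply/orP; right.
  apply: mdl_le => // s t h; apply: H; apply: le_trans h _; exact: HN.
move: cv => /cvgn_epsP /(_ _ e0) [N /(_ N (leqnn N))]; rewrite expect_cst subr0 => h.
by exists N.+1%:R^-1; [rewrite invr_gt0 ltr0n | exact: le_trans (ler_norm _) h].
Qed.

End Modulus.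

(** * Rescaled lattice paths under shifts of the time origin *)

Section RescaledPaths.
Variables (R : realType) (d : nat) (D : {linear 'rV[R]_d.+1 -> 'rV[R]_d.+1}).
Local Notation pt := 'rV[int]_d.+1.
Local Notation C := (C01 'rV[R]_d.+1).
Implicit Types (X Y V : trajectory d.+1) (x z : pt) (t : I01 R).

Definition opn : R := \sum_i `|D (delta_mx 0 i)|.

Lemma opn_ge0 : 0 <= opn. Proof. by apply: sumr_ge0. Qed.

Lemma opnP (v : 'rV[R]_d.+1) : `|D v| <= opn * `|v|.
Proof.
rewrite {1}(row_sum_delta v) linear_sum; apply: le_trans (ler_norm_sum _ _ _) _.
rewrite mulr_suml; apply: ler_sum => i _; rewrite linearZ normrZ mulrC.
by rewrite ler_wpM2l // rv_coord_le.
Qed.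

Lemma intr_vecB x y : intr_vec R (x - y : pt) = intr_vec R x - intr_vec R y.
Proof. by apply/rowP => i; rewrite !mxE rmorphB. Qed.

Lemma intr_vec_nrm x : `|intr_vec R x| <= (nrm x)%:R.
Proof.
apply: rv_norm_le => // i; rewrite mxE -intr_norm.
have := nrm_coord x i; rewrite -(ler_nat R) => h.
by apply: le_trans h; rewrite -[X in _ <= X]mulrz_nat natz -abszE.
Qed.

Definition dz n X : C := DZ D n X.

Definition dpt n x : 'rV[R]_d.+1 := D ((Num.sqrt n%:R)^-1 *: intr_vec R x).

Lemma dptB n x y : dpt n (x - y) = dpt n x - dpt n y.
Proof. by rewrite /dpt intr_vecB scalerBr linearB. Qed.

Lemma dpt0 n : dpt n 0 = 0.
Proof. by rewrite -(subrr (0 : pt)) dptB subrr. Qed.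

Lemma dpt_le n x : `|dpt n x| <= opn * ((nrm x)%:R / Num.sqrt n%:R).
Proof.
apply: le_trans (opnP _) _; rewrite ler_wpM2l ?opn_ge0 // normrZ mulrC.
rewrite ger0_norm ?invr_ge0 ?sqrtr_ge0 // ler_wpM2r ?invr_ge0 ?sqrtr_ge0 //.
exact: intr_vec_nrm.
Qed.

Lemma dzB n X Y t : dz n X t - dz n Y t = dz n (fun k => X k - Y k) t.
Proof.
rewrite /dz /DZ /= -linearB; congr (D _).
rewrite /Zpath -scalerBr; congr (_ *: _); rewrite /polygonal !intr_vecB.
by apply/rowP => i; rewrite !mxE; ring.
Qed.

Lemma dz_interp n V t : (0 < n)%N -> exists k (th : R), [/\ 0 <= th <= 1,
  (k <= n)%N, (k < n)%N \/ th = 0, n%:R * time t = k%:R + th &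
  dz n V t = (1 - th) *: dpt n (V k) + th *: dpt n (V k.+1)].
Proof.
move=> n0; have /andP[t0 t1] := time_itv t; pose u := n%:R * time t.
have u0 : 0 <= u by rewrite mulr_ge0.
have un : u <= n%:R by rewrite ler_piMr.
have /andP[mu um] : (Num.truncn u)%:R <= u < (Num.truncn u).+1%:R by rewrite truncn_itv.
exists (Num.truncn u), (u - (Num.truncn u)%:R).
have kn : (Num.truncn u <= n)%N by rewrite -(ler_nat R) (le_trans mu).
split=> //.
- by rewrite subr_ge0 mu /= lerBlDr addrC natr1 ltW.
- move: kn; rewrite leq_eqVlt => /orP[/eqP E|]; [right | by left].
  by apply/eqP; rewrite subr_eq0 eq_le mu andbT E.
- by rewrite addrCA subrr addr0.
rewrite /dz /DZ /= /dpt -!linearZ -linearD; congr (D _).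
rewrite /Zpath /polygonal -/u; set a := u - _.
by apply/rowP => i; rewrite !mxE; ring.
Qed.

Lemma dz_bound n V b t : (0 < n)%N -> (forall k, (k <= n)%N -> `|dpt n (V k)| <= b) ->
  `|dz n V t| <= b.
Proof.
move=> n0 H; have [k [th [/andP[th0 th1] kn kth _ ->]]] := dz_interp V t n0.
case: kth => [kn'|->]; last by rewrite subr0 scale1r scale0r addr0 H.
apply: le_trans (ler_normD _ _) _; rewrite !normrZ.
rewrite (ger0_norm th0) (@ger0_norm _ (1 - th)) ?subr_ge0 //.
have h1 := H k kn; have h2 := H k.+1 kn'.
apply: (@le_trans _ _ ((1 - th) * b + th * b)); last by rewrite -mulrDl subrK mul1r.
by apply: lerD; rewrite ler_wpM2l ?subr_ge0.
Qed.

Lemma dz_dist n X Y b t : (0 < n)%N ->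
  (forall k, (k <= n)%N -> `|dpt n (X k) - dpt n (Y k)| <= b) ->
  `|dz n X t - dz n Y t| <= b.
Proof. by move=> n0 H; rewrite dzB; apply: dz_bound => // k kn; rewrite dptB H. Qed.

Lemma dz_prefix n X Y : (0 < n)%N -> (forall k, (k <= n)%N -> X k = Y k) ->
  dz n X = dz n Y.
Proof.
move=> n0 H; apply/continuousEP => t; apply/eqP; rewrite -subr_eq0 -normr_le0.
by apply: dz_dist => // k kn; rewrite H // subrr normr0.
Qed.

Lemma dz_at n V k : (0 < n)%N -> (k <= n)%N ->
  dz n V (clip (k%:R / n%:R)) = dpt n (V k).
Proof.
move=> n0 kn; have n1 : (0 : R) < n%:R by rewrite ltr0n.
have E : n%:R * time (clip (k%:R / n%:R)) = k%:R :> R.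
  rewrite time_clip; first by rewrite mulrC divfK // gt_eqF.
  by rewrite divr_ge0 //= ler_pdivrMr // mul1r ler_nat.
change (D (Zpath n V (clip (k%:R / n%:R))) = dpt n (V k)).
by rewrite /Zpath E /polygonal natrK subrr scale0r addr0.
Qed.

Lemma grid_dist n j k : (0 < n)%N -> (j <= k <= n)%N ->
  `|time (clip (j%:R / n%:R : R)) - time (clip (k%:R / n%:R))| <= (k - j)%:R / n%:R.
Proof.
move=> n0 /andP[jk kn]; have n1 : (0 : R) < n%:R by rewrite ltr0n.
have I i : (i <= n)%N -> 0 <= (i%:R / n%:R : R) <= 1.
  by move=> h; rewrite divr_ge0 //= ler_pdivrMr // mul1r ler_nat.
rewrite !time_clip ?I //; last exact: leq_trans jk kn.
by rewrite distrC -mulrBl -natrB // ger0_norm // divr_ge0.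
Qed.

(** Discarding the first [T] steps costs at most their distance from the start, in rescaled units,
    plus the modulus of the remaining path over the time [T / n]. *)
Lemma dz_shift n X Y T r dl t : (0 < n)%N -> (T <= n)%N -> T%:R / n%:R <= dl ->
  (forall k, (k <= T)%N -> (nrm (X k - X 0%N)%R <= r)%N) ->
  (forall k, Y k = X (T + k)%N - X T) ->
  `|dz n (fun k => X k - X 0%N) t - dz n Y t| <=
  opn * (r%:R / Num.sqrt n%:R) + mdl dl (dz n Y).
Proof.
move=> n0 Tn Tdl Hr YE.
have s0 : 0 <= (Num.sqrt n%:R)^-1 :> R by rewrite invr_ge0 sqrtr_ge0.
have b1 k : (k <= T)%N -> `|dpt n (X k - X 0%N)| <= opn * (r%:R / Num.sqrt n%:R).
  move=> kT; apply: le_trans (dpt_le _ _) _.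
  by rewrite ler_wpM2l ?opn_ge0 // ler_wpM2r // ler_nat Hr.
have b2 j k : (j <= k <= n)%N -> (k - j <= T)%N ->
    `|dpt n (Y j) - dpt n (Y k)| <= mdl dl (dz n Y).
  move=> /andP[jk kn] kj; rewrite -!dz_at //; last exact: leq_trans jk kn.
  apply: mdl_ub; apply: le_trans (grid_dist n0 _) _; first by rewrite jk.
  by apply: le_trans Tdl; rewrite ler_wpM2r ?invr_ge0 // ler_nat.
apply: dz_dist => // k kn; have [kT|Tk] := leqP k T.
  have -> : dpt n (X k - X 0%N) - dpt n (Y k) =
      dpt n (X k - X 0%N) + (dpt n (Y 0%N) - dpt n (Y k)).
    by rewrite (YE 0%N) addn0 subrr dpt0 sub0r.
  apply: le_trans (ler_normD _ _) _; apply: lerD; first exact: b1.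
  by apply: b2; rewrite ?subn0.
have -> : dpt n (X k - X 0%N) - dpt n (Y k) =
    dpt n (X T - X 0%N) + (dpt n (Y (k - T)%N) - dpt n (Y k)).
  rewrite !YE subnKC; last exact: ltnW.
  by rewrite addrA; congr (_ - _); rewrite !dptB [RHS]addrC addrA subrK.
apply: le_trans (ler_normD _ _) _; apply: lerD; first exact: b1.
by apply: b2; rewrite ?leq_subr ?kn // subKn // ltnW.
Qed.

Lemma lip_osc (g : C -> R) (L M b dl : R) (w w' : C) : 0 <= L -> 0 <= b -> 0 <= dl ->
  lipf L g -> (forall u, `|g u| <= M) ->
  (forall t, `|w t - w' t| <= b + mdl dl w') ->
  `|g w - g w'| <= L * b + (L + 2 * M) * osc dl w'.
Proof.
move=> L0 b0 dl0 gL gM H; have M0 : 0 <= M by apply: le_trans (gM w); exact: normr_ge0.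
have [h|h] := leP (mdl dl w') 1.
  apply: le_trans (gL _ _ _ H) _; rewrite /osc min_r // mulrDr lerD2l.
  by rewrite ler_wpM2r ?mdl_ge0 // lerDl mulr_ge0.
rewrite /osc min_l ?(ltW h) // mulr1; apply: le_trans (ler_normB _ _) _.
have := gM w; have := gM w'; have : 0 <= L * b by rewrite mulr_ge0.
lra.
Qed.

End RescaledPaths.

(** * Comparison of a starting point with the first good point met by the walk *)

Section Hitting.
Variables (R : realType) (d : nat) (D : {linear 'rV[R]_d.+1 -> 'rV[R]_d.+1}).
Local Notation pt := 'rV[int]_d.+1.
Local Notation C := (C01 'rV[R]_d.+1).
Variables (kappa : R) (k0 : 0 < kappa) (c : pt -> step d -> R).
Hypothesis cP : conductances kappa c.
Implicit Types (p pre : seq pt) (x y z : pt) (K : R) (N : nat).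

Definition recen (x : pt) (s : seq pt) : trajectory d.+1 := fun k => nth 0 s k - x.

(** The expectation that the invariance principle compares with a Wiener integral, for the walk
    started at [x] and recentred there. *)
Definition clt c (g : C -> R) n (x : pt) : R :=
  pexp c n [:: x] (fun s => g (dz D n (recen x s))).

Lemma pexp_abs n pre (F : seq pt -> R) M : (forall s, `|F s| <= M) ->
  `|pexp c n pre F| <= M.
Proof.
move=> FM; have := @pexp_dist _ _ _ k0 _ cP n pre F (fun=> 0) (fun=> M).
rewrite !(pexp_cst k0 cP) subr0; apply => s; by rewrite subr0.
Qed.

Lemma avg_dist (f h : pt -> R) a b m z :
  (forall s, `|f (z + dir s) - a| <= b + m * h (z + dir s)) ->
  `|avg c f z - a| <= b + m * avg c h z.
Proof.
move=> H; have E e : avg c (fun y => a + e * (b + m * h y)) z = a + e * (b + m * avg c h z).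
  by rewrite (avgD c) (avg_cst k0 cP) avgM avgD (avg_cst k0 cP) avgM.
have hL : a + (-1) * (b + m * avg c h z) <= avg c f z.
  rewrite -E; apply: (avg_le k0 cP) => s.
  by have := H s; rewrite ler_norml => /andP[h1 _]; rewrite mulN1r -lerBrDl.
have hR : avg c f z <= a + 1 * (b + m * avg c h z).
  rewrite -E; apply: (avg_le k0 cP) => s.
  by have := H s; rewrite ler_norml => /andP[_ h1]; rewrite mul1r -lerBlDl.
by rewrite ler_norml; apply/andP; split; lra.
Qed.

Lemma clt_extend (g : C -> R) n m x : (0 < n)%N ->
  pexp c (n + m) [:: x] (fun s => g (dz D n (recen x s))) = clt c g n x.
Proof.
move=> n0; apply: (pexp_extend k0 cP) => s t ss; congr g; apply: dz_prefix => // k kn.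
by rewrite /recen nth_cat ss add1n ltnS kn.
Qed.

Section Compare.
Variables (g : C -> R) (L M : R) (n N : nat) (x : pt) (r : nat) (dl tau tau' a : R).
Variable bad : pred pt.
Hypotheses (n0 : (0 < n)%N) (Nn : (N <= n)%N) (Ndl : N%:R / n%:R <= dl).
Hypotheses (L0 : 0 <= L) (gL : lipf L g) (gM : forall w, `|g w| <= M) (aM : `|a| <= M).
Hypotheses (tau0 : 0 <= tau) (tau'0 : 0 <= tau').
Hypothesis good : forall z, ~~ bad z -> (nrm (z - x)%R <= r)%N ->
  `|clt c g n z - a| <= tau /\ clt c (osc dl) n z <= tau'.

Let b := opn D * (r%:R / Num.sqrt n%:R).
Let err := tau + (L * b + (L + 2 * M) * tau').
Let F s := g (dz D n (recen x s)).

Let M0 : 0 <= M. Proof. by apply: le_trans aM; exact: normr_ge0. Qed.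
Let dl0 : 0 <= dl. Proof. by apply: le_trans Ndl; rewrite divr_ge0. Qed.
Let b0 : 0 <= b. Proof. by rewrite mulr_ge0 ?opn_ge0 // divr_ge0 ?sqrtr_ge0. Qed.
Let err0 : 0 <= err.
Proof. by rewrite !addr_ge0 // mulr_ge0 // addr_ge0 // mulr_ge0. Qed.

Lemma good_hit j p z : (size p <= N)%N -> (forall y, y \in p -> (nrm (y - x)%R <= r)%N) ->
  (nrm (z - x)%R <= r)%N -> head z p = x -> ~~ bad z ->
  `|pexp c (j + n) (rcons p z) F - a| <= err.
Proof.
move=> pN pr zr hp bz; have [h1 h2] := good bz zr; rewrite pexp_markov addnC.
pose G s := g (dz D n (recen z s)).
pose H s := L * b + (L + 2 * M) * osc dl (dz D n (recen z s)).
have EG : pexp c (n + j) [:: z] G = clt c g n z by exact: clt_extend.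
have EH : pexp c (n + j) [:: z] H = L * b + (L + 2 * M) * clt c (osc dl) n z.
  rewrite -(clt_extend (osc dl) j z n0) -pexpZ.
  by rewrite -[X in _ = X + _](pexp_cst k0 cP (n + j) [:: z] (L * b)) -pexpD.
have h3 : `|pexp c (n + j) [:: z] (fun s => F (p ++ s)) - clt c g n z| <=
    L * b + (L + 2 * M) * clt c (osc dl) n z.
  rewrite -EG -EH; apply: (pexp_dist_in k0 cP) => s ss ts.
  have sz : nth 0 s 0 = z by case: s ss ts => //= y s _ [].
  pose X : trajectory d.+1 := fun k => nth 0 (p ++ s) k.
  have XT k : X (size p + k)%N = nth 0 s k.
    by rewrite /X nth_cat ltnNge leq_addr /= addKn.
  have X0 : X 0%N = x by rewrite -hp /X; case: (p) => [|y q] //=.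
  rewrite /F /G; apply: lip_osc => // t.
  have -> : dz D n (recen x (p ++ s)) = dz D n (fun k => X k - X 0%N) by rewrite X0.
  apply: (@dz_shift _ _ _ _ _ _ (size p)) => //.
  - exact: leq_trans Nn.
  - by apply: le_trans Ndl; rewrite ler_wpM2r ?invr_ge0 // ler_nat.
  - move=> k kp; rewrite X0; case: (ltngtP k (size p)) kp => // [kp _|-> _].
      by rewrite /X nth_cat kp; apply: pr; exact: mem_nth.
    by rewrite -[size p]addn0 XT sz.
  by move=> k; rewrite XT -[in X (size p)](addn0 (size p)) XT sz.
have h4 : (L + 2 * M) * clt c (osc dl) n z <= (L + 2 * M) * tau'.
  by rewrite ler_wpM2l // addr_ge0 // mulr_ge0.
rewrite /err; apply: le_trans (ler_distD (clt c g n z) _ _) _; rewrite addrC.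
apply: lerD => //; apply: le_trans h3 _; by rewrite lerD2l.
Qed.

Lemma hit_compare : `|clt c g n x - a| <= err + 2 * M *
  stopv c (fun y => bad y && (nrm (y - x)%R <= r)%N)
    (fun y => (bad y || (r < nrm (y - x)%R)%N)%:R) N x.
Proof.
set A := fun y => _ && _; set h := fun y => _%:R.
have triv m pre : `|pexp c m pre F - a| <= err + 2 * M * 1.
  apply: le_trans (ler_normB _ _) _.
  have : `|pexp c m pre F| <= M by apply: pexp_abs => s; apply: gM.
  have := aM; have := err0; lra.
have claim j p z : (size p + j)%N = N -> (forall y, y \in p -> (nrm (y - x)%R <= r)%N) ->
    head z p = x -> `|pexp c (j + n) (rcons p z) F - a| <= err + 2 * M * stopv c A h j z.
  elim: j p z => [|j IH] p z pj pr hp.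
    rewrite /= /h; case: (boolP (bad z)) => bz /=; first exact: triv.
    case: (ltnP r (nrm (z - x)%R)) => zr; first exact: triv.
    by rewrite mulr0 addr0; apply: good_hit => //; rewrite -pj addn0.
  case: (boolP (A z)) => Az.
    rewrite addSn pexpS last_rcons /= Az; apply: avg_dist => s; apply: IH.
    - by rewrite size_rcons addSn -addnS.
    - by move=> y; rewrite mem_rcons inE => /orP[/eqP ->|/pr //]; case/andP: Az.
    - by move: hp; case: (p).
  have tr := triv (j.+1 + n)%N (rcons p z).
  rewrite stopv_out // /h; move: Az; rewrite /A.
  case: (ltnP r (nrm (z - x)%R)) => zr; first by move=> _; rewrite orbT; exact: tr.
  rewrite andbT orbF => bz; rewrite (negPf bz) mulr0 addr0; apply: good_hit => //.
  by rewrite -pj leq_addr.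
have -> : clt c g n x = pexp c (N + n) (rcons [::] x) F.
  by rewrite addnC (clt_extend g).
exact: claim.
Qed.

End Compare.

Section Reach.
Variables (x : pt) (r : nat) (bad : pred pt).
Local Notation A := (fun y : pt => bad y && (nrm (y - x)%R <= r)%N).
Local Notation far := (fun y : pt => ((r < nrm (y - x)%R)%N%:R : R)).

Lemma stopv_far_mono n y : stopv c A far n y <= stopv c A far n.+1 y.
Proof.
elim: n y => [|n IH] y.
  rewrite /=; case: ifP => // /andP[_ yr]; rewrite ltnNge yr /=.
  by apply: (avg_ge0 k0 cP) => z; rewrite ler0n.
rewrite [in leLHS]/= [in leRHS]/=; case: ifP => // _.
by apply: (avg_le k0 cP) => s; exact: IH.
Qed.

(** As a function of the starting point, the probability of leaving the ball through bad points
    increases with the horizon, so it is a subsolution in the ball, and it vanishes at good points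
    there. Few bad points thus mean a small quadratic mean, which [local_max] with zero source turns
    into a bound at the centre. *)
Lemma reach_far N K : (0 < r)%N -> 0 < K ->
  bsum r (fun y => (bad (x + y))%:R) <=
    dg_gap d kappa ^+ d.+1 / 8 * K ^+ 2 * r%:R ^+ d.+1 ->
  stopv c A far N x <= K.
Proof.
move=> r0 K0 Hb; pose v := stopv c A far N.
have v0 y : 0 <= v y by apply: (stopv_ge0 k0 cP) => z; rewrite ler0n.
have v1 y : v y <= 1 by apply: (stopv_le1 k0 cP) => z; rewrite lern1 leq_b1.
apply: (@local_max R d kappa k0 c v x r 0 K) => //.
- by rewrite mul0r ltW.
- move=> y yr vy; rewrite addr0; case: (boolP (bad y)) => by_; last first.
    by move: vy; rewrite /v stopv_out ?(negPf by_) // ltnNge yr ltxx.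
  by have := stopv_far_mono N y; rewrite [X in _ <= X]/= by_ yr.
apply: le_trans Hb; rewrite /bsum !big_seq; apply: ler_sum => y; rewrite mem_box => yr.
have yx : (nrm (x + y - x)%R <= r)%N by rewrite addrC addKr.
case: (boolP (bad (x + y))) => by_; first by rewrite expr_le1 // v0.
by rewrite /v stopv_out ?(negPf by_) // ltnNge yx expr0n.
Qed.

Lemma reach_linger b H Mm N : (forall y, A y -> inslab b H y && (nrm (y - x)%R <= Mm)%N) ->
  stopv c A (fun y => (A y)%:R) N x <= linger c b H Mm x N x.
Proof.
move=> HA; rewrite /linger.
set B := fun y => inslab b H y && _; set h := fun y => (inslab b H y)%:R.
have h0 y : 0 <= h y by rewrite ler0n.
have gen n y : stopv c A (fun y => (A y)%:R) n y <= stopv c B h n y.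
  elim: n y => [|n IH] y.
    rewrite /=; case: (boolP (A y)) => Ay; last exact: h0.
    by have /andP[e _] := HA _ Ay; rewrite /h e.
  case: (boolP (A y)) => Ay.
    by rewrite /= Ay /B HA //; apply: (avg_le k0 cP) => s; apply: IH.
  by rewrite [leLHS]stopv_out // (negPf Ay); apply: (stopv_ge0 k0 cP).
exact: gen.
Qed.

(** Failure means leaving the ball or staying among its bad points for all [N] steps; the ball lies
    in a slab, where a long stay is governed by [linger]. *)
Lemma reach_bound b H Mm N K : (0 < r)%N -> 0 < K ->
  bsum r (fun y => (bad (x + y))%:R) <=
    dg_gap d kappa ^+ d.+1 / 8 * K ^+ 2 * r%:R ^+ d.+1 ->
  (forall y, (nrm (y - x)%R <= r)%N -> inslab b H y && (nrm (y - x)%R <= Mm)%N) ->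
  stopv c A (fun y => (bad y || (r < nrm (y - x)%R)%N)%:R) N x <=
  K + linger c b H Mm x N x.
Proof.
move=> r0 K0 Hb HA.
apply: (@le_trans _ _ (stopv c A (fun y => far y + (A y)%:R) N x)).
  apply: (stopv_le k0 cP) => y; case: (bad y) => /=; last by rewrite addr0.
  by case: leqP => _; rewrite ?add0r ?addr0.
rewrite stopvD; apply: lerD; first exact: reach_far.
by apply: reach_linger => y /andP[_ /HA].
Qed.

End Reach.
End Hitting.

(** * The invariance principle, uniformly in the starting point *)

Section UniformCLT.
Variables (R : realType) (d : nat) (D : {linear 'rV[R]_d.+1 -> 'rV[R]_d.+1}).
Local Notation pt := 'rV[int]_d.+1.
Local Notation C := (C01 'rV[R]_d.+1).
Local Notation E := (env_space R d.+1).

Section EnvironmentMeasurability.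
Implicit Types (w : env R d.+1) (x y z : pt).

Lemma measurable_inv (dT : measure_display) (T : measurableType dT) (f : T -> R) :
  measurable_fun setT f -> measurable_fun setT (fun t => (f t)^-1).
Proof.
move=> mf; have -> : (fun t => (f t)^-1) = (fun t => f t * ((f t * f t) `^ (- 1))).
  apply/funext => x; rewrite powR_inv1; last by rewrite -expr2 sqr_ge0.
  have [->|fx] := eqVneq (f x) 0; first by rewrite mul0r invr0.
  by rewrite invfM mulrA divff // mul1r.
apply: measurable_funM => //.
apply: (mcomp (@powR R ^~ (- 1))); first exact: measurable_powR.
exact: measurable_funM.
Qed.

Lemma conductance_shift w z x y :
  conductance (env_shift z w) x y = conductance w (x + z : pt) (y + z : pt).
Proof.
apply: eq_bigr => i _; have e (a b : pt) :
    (b + z == a + z + unitv i) = (b == a + unitv i).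
  by rewrite addrAC (inj_eq (addIr z)).
by rewrite !e.
Qed.

Lemma cond_of_shift w z : cond_of (env_shift z w) = fun y => cond_of w (z + y).
Proof.
apply/funext => y; apply/funext => s; rewrite /cond_of conductance_shift.
by rewrite addrAC [z + y]addrC.
Qed.

Lemma cond_of_conductances (kappa : R) w :
  (forall z y, neighbour (0 : pt) y ->
     kappa < conductance (env_shift z w) 0 y < kappa^-1) ->
  conductances kappa (cond_of w).
Proof.
move=> H; split=> [x s|x s].
  have := H x (dir s); rewrite conductance_shift add0r [dir s + x]addrC.
  rewrite -[X in neighbour 0 X]add0r neighbour_dir => /(_ isT) /andP[h1 h2].
  by rewrite /cond_of !ltW.
rewrite /cond_of conductance_sym; congr conductance.
have -> : dir (flip s) = - dir s.
  by case: s => i []; rewrite /dir /= ?opprK.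
by rewrite addrK.
Qed.

Lemma measurable_cond x s : measurable_fun setT (fun w : E => cond_of w x s : R).
Proof.
apply: measurable_sum => i; apply: measurable_funD.
  by case: (_ == _); [exact: measurable_env_coord | exact: measurable_cst].
by case: (_ == _); [exact: measurable_env_coord | exact: measurable_cst].
Qed.

Lemma measurable_pexp n pre (F : seq pt -> R) :
  measurable_fun setT (fun w : E => pexp (cond_of w) n pre F : R).
Proof.
elim: n pre => [|n IH] pre; first exact: measurable_cst.
apply: measurable_sum => s; apply: measurable_funM; last exact: IH.
apply: measurable_funM; first exact: measurable_cond.
by apply: measurable_inv; apply: measurable_sum => t; exact: measurable_cond.
Qed.

Lemma clt_shift w (g : C -> R) n z : (0 < n)%N ->
  clt D (cond_of w) g n z = clt D (cond_of (env_shift z w)) g n 0.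
Proof.
move=> n0; rewrite /clt cond_of_shift pexp_shift //= addr0.
apply: eq_pexp => s ss _; congr g; apply: dz_prefix => // k kn.
by rewrite /recen (nth_map 0) ?subr0 // ss ltnS.
Qed.

Lemma clt_law w Q (kappa : R) (g : C -> R) n : 0 < kappa -> conductances kappa (cond_of w) ->
  quenched_law w 0 Q -> blip g -> (0 < n)%N ->
  clt D (cond_of w) g n 0 = \int[Q]_X g (DZ D n X).
Proof.
move=> k0 cP QL bg n0.
rewrite /clt -(@pexp_integral R d w Q 0 QL kappa k0 cP n (fun X => g (DZ D n X))
  (fun s => g (dz D n (recen 0 s)))) //.
- move=> X s ss Xs; congr g; apply: dz_prefix => // k kn.
  by rewrite /recen subr0; apply: Xs; rewrite ss ltnS.
- by case: bg => _ [M HM]; exists M => X; apply: HM.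
apply: (mcomp (g : borel C -> R)); first by case: (blip_bmf bg).
exact: measurable_DZ.
Qed.

Lemma clt_lim w Q (kappa : R) (W : probability (borel C) R) (g : C -> R) : 0 < kappa ->
  conductances kappa (cond_of w) -> quenched_law w 0 Q ->
  weak_cvg (fun n => distribution Q (DZ D n)) W -> blip g ->
  (fun n => clt D (cond_of w) g n.+1 0) @ \oo --> \int[W]_x g x.
Proof.
move=> k0 cP QL cv bg; have [[L lg] [M gM]] := bg.
have := cv g (lipf_continuous lg) (ex_intro _ M gM).
have [mg _] := blip_bmf bg.
have iW : (\int[W]_x (g x)%:E)%E = (\int[W]_x g x)%:E.
  rewrite /Rintegral fineK //; apply: integrable_fin_num => //.
  exact: (bmf_integrable W (blip_bmf bg)).
rewrite iW => /fine_cvg cv'.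
have {}cv' : (fun n => clt D (cond_of w) g n 0) @ \oo --> \int[W]_x g x.
  apply: cvg_trans cv'; apply: near_eq_cvg; near=> n.
  have n0 : (0 < n)%N by near: n; exists 1%N.
  rewrite (clt_law k0 cP QL bg n0) /= /Rintegral; congr fine.
  rewrite integral_distribution //; first exact/measurable_EFinP.
  apply: (@bmf_integrable _ _ _ Q (fun X => g (DZ D n X))).
  exact: (bmf_comp (blip_bmf bg) (@measurable_DZ R d.+1 D n)).
by move: cv'; rewrite -(cvg_shiftS _).
Unshelve. all: by end_near. Qed.

(** Failure at some scale beyond [m], not at a single scale: the sets decrease with [m], and
    avoiding one of them gives the estimates for all large [n] at once. *)
Definition bad_set (g : C -> R) (a tau dl tau' : R) (m : nat) : set E :=
  [set w | exists n, (m <= n)%N /\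
     (tau < `|clt D (cond_of w) g n.+1 0 - a| \/
      tau' < clt D (cond_of w) (osc dl) n.+1 0)].

Lemma measurable_bad g a tau dl tau' m : measurable (bad_set g a tau dl tau' m).
Proof.
pose U n : set E := [set w | tau < `|clt D (cond_of w) g n.+1 0 - a|] `|`
  [set w | tau' < clt D (cond_of w) (osc dl) n.+1 0].
have mU n : measurable (U n).
  apply: measurableU; apply: measurable_lt; [exact: measurable_cst | | exact: measurable_cst |]; last exact: measurable_pexp.
  apply: (mcomp (fun u : R => `|u|)); first exact: normr_measurable.
  by apply: measurable_funB; [exact: measurable_pexp | exact: measurable_cst].
have -> : bad_set g a tau dl tau' m = \bigcup_(n in [set n | (m <= n)%N]) U n.
  apply/seteqP; split => w; first by move=> [n [mn h]]; exists n.
  by move=> [n mn h]; exists n.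
exact: bigcup_measurable.
Qed.

Lemma bad_prob (P : probability E R) (g : C -> R) (a tau dl tau' : R) : 0 < tau -> 0 < tau' ->
  {ae P, forall w : env R d.+1,
    (fun n => clt D (cond_of w) g n.+1 0) @ \oo --> a /\
    exists2 b : R, b < tau' & (fun n => clt D (cond_of w) (osc dl) n.+1 0) @ \oo --> b} ->
  fine (P (bad_set g a tau dl tau' m)) @[m --> \oo] --> (0 : R).
Proof.
move=> tau0 tau'0 H; have mB := measurable_bad g a tau dl tau'.
have cv : (fun m => \int[P]_w (\1_(bad_set g a tau dl tau' m) w : R)) @ \oo -->
    (\int[P]_w (0 : R) : R).
  apply: (@expect_dominated _ E R P (fun m => \1_(bad_set g a tau dl tau' m)) (fun=> 0) 1).
  - by move=> n; exact: measurable_indic.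
  - exact: measurable_cst.
  - by move=> n w; rewrite indicE; case: (_ \in _); rewrite ?normr1 ?normr0.
  apply: ae_mono H => w [/cvgn_epsP H1 [b bt /cvgn_epsP H2]].
  have [N1 h1] := H1 _ tau0; have [N2 h2] := H2 (tau' - b) ltac:(by rewrite subr_gt0).
  apply/cvgn_epsP => e e0; exists (maxn N1 N2) => m; rewrite geq_max => /andP[m1 m2].
  rewrite indicE memNset ?subrr ?normr0 ?(ltW e0) // => -[n [mn]].
  case=> [|h]; first by rewrite ltNge h1 // (leq_trans m1).
  have := h2 n (leq_trans m2 mn); rewrite ler_norml lerBlDr subrK => /andP[_].
  by rewrite leNgt h.
rewrite expect_cst in cv.
rewrite (_ : (fun m => _) = (fun m => \int[P]_w (\1_(bad_set g a tau dl tau' m) w : R))) //.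
by apply/funext => m; rewrite expect_indic.
Qed.

End EnvironmentMeasurability.

Lemma two_sided (u v e : R) : -1 * u - e <= -1 * v -> u - e <= v -> - e <= v - u <= e.
Proof. by move=> h1 h2; apply/andP; split; lra. Qed.

Lemma slab_in (hx hy : int) (r : nat) : (`|hy - hx| <= r)%N ->
  hx - r.+1%:Z < hy < hx - r.+1%:Z + (2 * r + 2)%N%:Z.
Proof. lia. Qed.

Lemma slab_sq r : (0 < r)%N -> ((2 * r + 2) ^ 2 <= 16 * r ^ 2)%N.
Proof.
move=> r0; have h : (2 * r + 2 <= 4 * r)%N by lia.
by rewrite (_ : 16 = 4 ^ 2)%N // -expnMn leq_exp2r.
Qed.

Lemma power_small (t K : R) : 0 < t < 1 -> 0 < K -> exists j : nat, (1 - t) ^+ j <= K.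
Proof.
move=> /andP[t0 t1] K0; have p0 : 0 < K * t by rewrite mulr_gt0.
have [j jK] : exists j : nat, K^-1 <= j%:R * t.
  have [j hj] : exists j : nat, (K * t)^-1 < j%:R.
    by exists (Num.truncn (K * t)^-1).+1; have /andP[] := truncn_itv (ltW (eqbRL (invr_gt0 _) p0)).
  exists j; move/ltW: hj; rewrite -(ler_pM2r t0); apply: le_trans.
  by rewrite invfM mulrVK // unitfE gt_eqF.
have t01 : 0 <= t <= 1 by rewrite !ltW.
exists j; have h := bernoulli_le j t01.
have a0 : 0 <= (1 - t) ^+ j by rewrite exprn_ge0 // subr_ge0 ltW.
have : (1 - t) ^+ j * K^-1 <= 1.
  apply: le_trans h; rewrite ler_wpM2l //; apply: le_trans jK _; lra.
by rewrite ler_pdivrMr // mul1r.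
Qed.

Lemma count_box_shift (p : pred pt) (x : pt) (r : nat) :
  (count (fun y : pt => p (x + y)%R) (box d r) <= count p (box d (nrm x + r)))%N.
Proof.
rewrite -!size_filter -(size_map (fun y => x + y)); apply: uniq_leq_size.
  by rewrite map_inj_uniq ?filter_uniq ?box_uniq //; exact: addrI.
move=> z /mapP[y]; rewrite !mem_filter !mem_box => /andP[py yr] ->; rewrite py /=.
by apply: leq_trans (nrmD _ _) _; rewrite leq_add2l.
Qed.

Lemma time_budget (r s eta n J q : R) : 0 <= r -> r <= eta * s -> s ^+ 2 = n ->
  0 < eta -> eta <= 1 -> 16 * J * eta <= q -> 0 <= J -> J * (16 * r ^+ 2) <= q * n.
Proof.
move=> r0 rs sn e0 e1 Jq J0.
have n0 : 0 <= n by rewrite -sn sqr_ge0.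
have h1 : r ^+ 2 <= eta * n.
  apply: (@le_trans _ _ ((eta * s) ^+ 2)); first by rewrite lerXn2r // nnegrE // (le_trans r0).
  by rewrite exprMn sn ler_wpM2r // expr2 ler_piMl // ltW.
apply: (@le_trans _ _ (J * (16 * (eta * n)))).
  by rewrite ler_wpM2l // ler_wpM2l.
by rewrite (_ : _ * _ = 16 * J * eta * n) ?ler_wpM2r //; ring.
Qed.

Lemma box_budget (x r s eta K : R) : 0 <= K -> x <= K * s -> 1 <= r -> eta * s <= 2 * r ->
  0 < eta -> eta <= 1 -> x + r + (x + r) + 1 <= 6 * (K + 1) / eta * r.
Proof.
move=> K0 xs r1 es e0 e1; have s2 : s <= 2 * r / eta by rewrite ler_pdivlMr // mulrC.
have h1 : x <= K * (2 * r / eta) by apply: le_trans xs _; rewrite ler_wpM2l.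
have h2 : r <= r / eta by rewrite ler_peMr ?invf_ge1 //; lra.
have -> : 6 * (K + 1) / eta * r = 6 * (K * (r / eta)) + 6 * (r / eta) by ring.
have h3 : x <= 2 * (K * (r / eta)) by apply: le_trans h1 _; apply: le_of_eq; ring.
have h4 : 0 <= K * (r / eta) by rewrite mulr_ge0 // divr_ge0 //; lra.
lra.
Qed.

Variables (P : probability E R) (hstat : stationary P) (W : probability (borel C) R).
Variables (kappa : R) (k0 : 0 < kappa).
Hypothesis hcond : {ae P, forall w : env R d.+1, conductances kappa (cond_of w)}.
Hypothesis hclt : {ae P, forall w : env R d.+1, forall g, blip g ->
  (fun n => clt D (cond_of w) g n.+1 0) @ \oo --> \int[W]_x g x}.

(** By [good_density], sites from which the invariance principle sets in late have small density in
    every ball about the origin. A walk started within [K * sqrt n], observed in a ball of radius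
    about [eta * sqrt n], therefore meets a good site with probability close to one, in a time short
    compared with [n]. *)
Lemma uclt_fixed (g : C -> R) (K : nat) (tol : R) : blip g -> 0 < tol ->
  {ae P, forall w : env R d.+1, exists n0, forall n, (n0 <= n)%N -> forall x : pt,
    (nrm x)%:R <= K%:R * Num.sqrt n%:R :> R ->
    `|clt D (cond_of w) g n x - \int[W]_u g u| <= tol}.
Proof.
move=> bg tol0; have [[L' lg'] [M' gM']] := bg.
have [L [L0 lg]] : exists L, 0 <= L /\ lipf L g.
  exists (Num.max 0 L'); split; first by rewrite le_max lexx.
  by apply: lipf_le lg'; rewrite le_max lexx orbT.
have [M [M1 gM]] : exists M, 1 <= M /\ forall u, `|g u| <= M.
  exists (Num.max 1 M'); split; first by rewrite le_max lexx.
  by move=> u; rewrite le_max gM' orbT.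
set a := \int[W]_u g u.
have aM : `|a| <= M by apply: expect_abs => //; exact: blip_bmf.
have M0 : 0 < M by lra.
(* Five contributions: the error at a good site, the spatial shift, the modulus, and twice
   [2 * M * K0], for leaving the ball and for lingering in it. *)
pose t5 := tol / 5; have t50 : 0 < t5 by rewrite divr_gt0.
have LM0 : 0 < L + 2 * M by lra.
have [tau' [tau'0 Etau']] : exists tau', 0 < tau' /\ (L + 2 * M) * tau' = t5.
  by exists (t5 / (L + 2 * M)); rewrite divr_gt0 // mulrC divfK ?gt_eqF.
have [K0 [K00 EK0]] : exists K0, 0 < K0 /\ 2 * M * K0 = t5.
  by exists (t5 / (2 * M)); rewrite divr_gt0 ?mulr_gt0 // mulrC divfK ?gt_eqF ?mulr_gt0.
have [dl dl0 Hdl] := osc_small W (divr_gt0 tau'0 (ltr0Sn R 1)).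
have cp01 : 0 < climb_prob d kappa < 1 by rewrite climb_prob_gt0 ?climb_prob_lt1.
have [j Hj] := power_small cp01 K00.
have [CT ECT] : exists k, k = climb_time d kappa by eexists.
(* [eta] fixes the radius of the ball in units of [sqrt n]; it is small enough for [j] attempts to
   leave the slab to fit into a fraction [dl] of the time, and for the spatial shift to be
   negligible. *)
have [eta [eta0 eta1 Heta1 [Heta2 Heta3]]] : exists eta, [/\ 0 < eta, eta <= 1,
    16 * (j * CT)%:R * eta <= 1 & 16 * (j * CT)%:R * eta <= dl /\
    L * (opn D * eta) <= t5].
  set J : R := (j * CT)%:R; have J0 : 0 <= J by rewrite ler0n.
  have LD0 : 0 <= L * opn D by rewrite mulr_ge0 ?opn_ge0.
  pose den := 16 * J + L * opn D + 1; have den0 : 0 < den by rewrite /den; lra.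
  pose num := Num.min 1 (Num.min dl t5).
  have num0 : 0 < num by rewrite !lt_min ltr01 dl0.
  have n1 : num <= 1 by rewrite ge_min lexx.
  have n2 : num <= dl by rewrite !ge_min lexx orbT.
  have n3 : num <= t5 by rewrite !ge_min lexx !orbT.
  have q (u : R) : 0 <= u -> u <= den -> u * (num / den) <= num.
    by move=> u0 ud; rewrite mulrCA ler_piMr ?(ltW num0) // ler_pdivrMr // mul1r.
  have h1 : 16 * J * (num / den) <= num by apply: q; rewrite /den; lra.
  exists (num / den); split; rewrite ?divr_gt0 //.
  - by apply: le_trans n1; rewrite -[leLHS]mul1r; apply: q; rewrite /den; lra.
  - exact: le_trans n1.
  split; first exact: le_trans n2.
  by rewrite mulrA; apply: le_trans n3; apply: q => //; rewrite /den; lra.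
(* The box about the origin that contains the ball about [x] has side at most [Q * r], so density
   [lam] in it bounds the bad sites near [x] by a small multiple of [r ^ d.+1]. *)
pose Q := 6 * (K%:R + 1) / eta; have Q0 : 0 < Q by rewrite divr_gt0 // mulr_gt0 // ltr_wpDl.
have gap0 : 0 < dg_gap d kappa by exact: dg_gap_gt0.
have [lam [lam0 Elam]] : exists lam, 0 < lam /\
    lam * Q ^+ d.+1 = dg_gap d kappa ^+ d.+1 / 8 * K0 ^+ 2.
  exists (dg_gap d kappa ^+ d.+1 / 8 * K0 ^+ 2 / Q ^+ d.+1).
  rewrite divfK ?gt_eqF ?exprn_gt0 //; split=> //.
  by rewrite divr_gt0 ?exprn_gt0 // mulr_gt0 ?exprn_gt0 // divr_gt0 // exprn_gt0.
pose B m := bad_set g a t5 dl tau' m.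
have PB : fine (P (B m)) @[m --> \oo] --> (0 : R).
  apply: bad_prob => //; apply: ae_mono hclt => w H; split; first exact: H.
  exists (\int[W]_u osc dl u); last by apply: H; apply: blip_osc; exact: ltW.
  by apply: le_lt_trans Hdl _; lra.
have mB m : measurable (B m) by exact: measurable_bad.
apply: ae_mono (ae_and hcond (good_density hstat mB PB lam0)) => w [cP [m Hm]].
have [n1 Hn1] : exists n1 : nat, eta^-1 ^+ 2 <= n1%:R.
  exists (Num.truncn (eta^-1 ^+ 2)).+1.
  by have /andP[_ /ltW] := truncn_itv (sqr_ge0 eta^-1).
exists (maxn m.+1 n1) => n; rewrite geq_max => /andP[mn n1n] x xK.
have n0 : (0 < n)%N by exact: leq_trans mn.
have [s [s0 s2 Es]] : exists s : R, [/\ 0 < s, s ^+ 2 = n%:R & Num.sqrt n%:R = s].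
  by exists (Num.sqrt n%:R); rewrite sqrtr_gt0 ltr0n sqr_sqrtr.
rewrite Es in xK.
have es1 : 1 <= eta * s.
  rewrite -ler_pdivrMl // mulr1; rewrite -(@ler_pXn2r _ 2) ?nnegrE ?(ltW s0) ?invr_ge0 ?(ltW eta0) //.
  by rewrite s2; apply: le_trans Hn1 _; rewrite ler_nat.
have [r [r0 re er]] : exists r : nat, [/\ (0 < r)%N, r%:R <= eta * s & eta * s <= 2 * r%:R].
  have /andP[h1 h2] := truncn_itv (le_trans ler01 es1).
  exists (Num.truncn (eta * s)); split=> //; first by rewrite truncn_gt0.
  have : (1 : R) <= (Num.truncn (eta * s))%:R by rewrite ler1n truncn_gt0.
  by rewrite -natr1 in h2; lra.
have r1 : 1 <= r%:R :> R by rewrite ler1n.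
pose N := (j * (CT * (2 * r + 2) ^ 2))%N.
have NJ : (N%:R : R) <= (j * CT)%:R * (16 * r%:R ^+ 2).
  rewrite /N mulnA natrM ler_wpM2l ?ler0n //.
  rewrite (_ : 16 * r%:R ^+ 2 = (16 * r ^ 2)%:R); last by rewrite natrM natrX.
  by rewrite ler_nat; exact: slab_sq.
have Nn1 q : 16 * (j * CT)%:R * eta <= q -> (N%:R : R) <= q * n%:R.
  move=> h; apply: le_trans NJ _; exact: (@time_budget r%:R s eta).
have Nn : (N <= n)%N by rewrite -(ler_nat R) -[X in _ <= X]mul1r; apply: Nn1.
have Ndl : (N%:R : R) / n%:R <= dl by rewrite ler_pdivrMr ?ltr0n //; apply: Nn1.
pose bad : pred pt := fun z => `[< B m (env_shift z w) >].
have good (z : pt) : ~~ bad z -> (nrm (z - x)%R <= r)%N ->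
    `|clt D (cond_of w) g n z - a| <= t5 /\ clt D (cond_of w) (osc dl) n z <= tau'.
  move=> /asboolPn nB _; rewrite (clt_shift w g z n0) (clt_shift w (osc dl) z n0).
  have En : n = n.-1.+1 by rewrite prednK.
  split; rewrite leNgt; apply/negP => h; apply: nB; exists n.-1; rewrite -En.
    by split; [rewrite -ltnS -En | left].
  by split; [rewrite -ltnS -En | right].
have := @hit_compare R d D kappa k0 _ cP g L M n N x r dl t5 tau' a bad n0 Nn Ndl
  L0 lg gM aM (ltW t50) (ltW tau'0) good.
move=> /le_trans; apply; rewrite Es.
pose Mm := (r + j * (4 * (2 * r + 2) + 1))%N.
have hcount : bsum r (fun y : pt => (bad (x + y))%:R) <=
    dg_gap d kappa ^+ d.+1 / 8 * K0 ^+ 2 * r%:R ^+ d.+1.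
  apply: (@le_trans _ _ (bad_count (B m) w (nrm x + r))%:R).
    rewrite /bsum /bad_count; apply: (@le_trans _ _ (count (fun y : pt => bad (x + y)) (box d r))%:R).
      rewrite -sum1_count natr_sum [X in _ <= X]big_mkcond /=; apply: ler_sum => y _.
      by case: (bad _).
    by rewrite ler_nat; exact: count_box_shift.
  apply: le_trans (Hm _) _; rewrite -Elam -mulrA ler_wpM2l ?(ltW lam0) // -exprMn natrX.
  rewrite lerXn2r ?nnegrE ?ler0n ?mulr_ge0 ?invr_ge0 ?(ltW eta0) ?(ltW Q0) //.
  rewrite -natr1 !natrD; apply: (box_budget (s := s)) => //; exact: ler0n.
have hslab (y : pt) : (nrm (y - x)%R <= r)%N ->
    inslab (height x - (r.+1)%:Z) (2 * r + 2)%N y && (nrm (y - x)%R <= Mm)%N.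
  move=> yr; rewrite (leq_trans yr) ?leq_addr // andbT /inslab.
  exact: slab_in (leq_trans (height_nrm y x) yr).
have hb := @reach_bound R d kappa k0 _ cP x r bad (height x - (r.+1)%:Z) (2 * r + 2)%N Mm N K0
  r0 K00 hcount hslab.
have hl : linger (cond_of w) (height x - (r.+1)%:Z) (2 * r + 2)%N Mm x N x <= K0.
  apply: le_trans Hj; apply: (linger_exit k0 cP); first by rewrite addn2.
  - by rewrite subrr nrm0 /Mm add0n leq_addl.
  - by rewrite /N ECT.
have hL : L * (opn D * (r%:R / s)) <= t5.
  apply: le_trans Heta3; rewrite ler_wpM2l // ler_wpM2l ?opn_ge0 //.
  by rewrite ler_pdivrMr.
rewrite Etau'; set u := stopv _ _ _ _ _ in hb *.
have h5 : 2 * M * u <= 2 * M * (K0 + K0).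
  by rewrite ler_wpM2l ?mulr_ge0 ?(ltW M0) //; apply: le_trans hb _; rewrite lerD2l.
rewrite mulrDr EK0 in h5; rewrite /t5 in h5 hL *.
lra.
Qed.

Lemma uclt_blip (g : C -> R) : blip g ->
  {ae P, forall w : env R d.+1, forall (K tol : R), 0 < tol ->
    exists n0, forall n, (n0 <= n)%N -> forall x : pt,
    (nrm x)%:R <= K * Num.sqrt n%:R :> R ->
    `|clt D (cond_of w) g n x - \int[W]_u g u| <= tol}.
Proof.
move=> bg; have H (i : nat * nat) : {ae P, forall w : env R d.+1, exists n0,
    forall n, (n0 <= n)%N -> forall x : pt,
    (nrm x)%:R <= i.1%:R * Num.sqrt n%:R :> R ->
    `|clt D (cond_of w) g n x - \int[W]_u g u| <= i.2.+1%:R^-1}.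
  by apply: uclt_fixed => //; rewrite invr_gt0 ltr0n.
apply: ae_mono (ae_count H) => w Hw K tol tol0.
have [i2 Hi2] := inv_nat_small tol0.
have [i1 Hi1] : exists i1 : nat, K <= i1%:R.
  exists (Num.truncn `|K|).+1; have /andP[_ /ltW] := truncn_itv (normr_ge0 K).
  by apply: le_trans; exact: ler_norm.
have [n0 Hn0] := Hw (i1, i2); exists n0 => n nn x xK.
apply: le_trans (Hi2 i2 (leqnn _)); apply: Hn0 => //; apply: le_trans xK _.
by rewrite ler_wpM2r ?sqrtr_ge0.
Qed.

(** The functional is quantified inside, for a fixed environment, and may be discontinuous on a
    Wiener-null set: later functionals involve constants chosen afterwards and the last zero of the
    path. *)
Definition uniform_clt (c : pt -> step d -> R) : Prop :=
  forall (G : C -> R) (M K tol : R),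
    measurable_fun setT (G : borel C -> R) -> (forall u, `|G u| <= M) ->
    (\forall u \ae W, cont_at G u) -> 0 < tol ->
    exists n0, forall n, (n0 <= n)%N -> forall x : pt,
      (nrm x)%:R <= K * Num.sqrt n%:R :> R ->
      `|clt D c G n x - \int[W]_u G u| <= tol.

(** Lower bounds come from members of [fam] below the functional, upper bounds from the same
    argument for [- G]. *)
Lemma uclt : {ae P, forall w : env R d.+1, uniform_clt (cond_of w)}.
Proof.
have H (i : fcode d.+1) := uclt_blip (blip_fam R i).
apply: ae_mono (ae_and hcond (ae_count H)) => w [cP Hw] G M K tol mG GM cG tol0.
have [N HN] : exists N : nat, forall u, `|G u| <= N%:R.
  exists (Num.truncn `|M|).+1 => u; apply: le_trans (GM u) _.
  have /andP[_ /ltW] := truncn_itv (normr_ge0 M); apply: le_trans; exact: ler_norm.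
have t0 : 0 < tol / 2 by rewrite divr_gt0.
have low (F : C -> R) : measurable_fun setT (F : borel C -> R) ->
    (forall u, `|F u| <= N%:R) -> (\forall u \ae W, cont_at F u) ->
    exists n0, forall n, (n0 <= n)%N -> forall x : pt,
      (nrm x)%:R <= K * Num.sqrt n%:R :> R ->
      \int[W]_u F u - tol <= clt D (cond_of w) F n x.
  move=> mF FN cF; have [e [le_e int_e]] := approx_below mF FN cF t0.
  have [n0 Hn0] := Hw e K (tol / 2) t0; exists n0 => n nn x xK.
  have := Hn0 n nn x xK; rewrite ler_norml lerBrDl => /andP[h _].
  have h2 : clt D (cond_of w) (@fam R d.+1 e) n x <= clt D (cond_of w) F n x.
    by apply: (pexp_le k0 cP) => s; exact: le_e.
  lra.
have [n1 Hn1] := low G mG HN cG.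
have mN : measurable_fun setT ((fun u => - G u) : borel C -> R).
  by apply: measurableT_comp mG.
have cN : \forall u \ae W, cont_at (fun u => - G u) u.
  apply: ae_mono cG => u cu e e0; have [r r0 Hr] := cu e e0; exists r => // u' h.
  by rewrite -opprD normrN; exact: Hr.
have NN (u : C) : `|- G u| <= N%:R by rewrite normrN.
have [n2 Hn2] := low (fun u => - G u) mN NN cN.
exists (maxn n1 n2) => n; rewrite geq_max => /andP[h1 h2] x xK.
have bG : bmf (G : borel C -> R) by split => //; exists N%:R.
have EN : (fun u => - G u) = (fun u => (-1) * G u) by apply/funext => u; rewrite mulN1r.
have := Hn1 n h1 x xK; have := Hn2 n h2 x xK.
rewrite EN expectZ // /clt pexpZ -/(clt D (cond_of w) G n x) ler_norml.
exact: two_sided.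
Qed.

End UniformCLT.

Lemma min1_lip (R : realDomainType) (x y : R) :
  `|Num.min 1 x - Num.min 1 y| <= `|x - y|.
Proof.
by case: (leP 1 x); case: (leP 1 y) => hy hx; rewrite ?subrr ?normr0 //;
  rewrite ler_norml; apply/andP; split; case: (lerP 0 (x - y)) => h;
  rewrite ?(ger0_norm h) ?(ltr0_norm h); lra.
Qed.

(** * Laws determined by intervals and by finite rectangles *)

Section SameLaw.
Variable R : realType.

Lemma measR_ext d1 d2 (T1 : measurableType d1) (T2 : measurableType d2)
    (P1 : probability T1 R) (P2 : probability T2 R) (X1 : T1 -> R) (X2 : T2 -> R) :
  measurable_fun setT X1 -> measurable_fun setT X2 ->
  (forall a b : R, a < b -> P1 (X1 @^-1` `]a, b]%classic) = P2 (X2 @^-1` `]a, b]%classic)) ->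
  forall A, measurable A -> P1 (X1 @^-1` A) = P2 (X2 @^-1` A).
Proof.
move=> m1 m2 H A mA.
pose Y1 : {mfun T1 >-> R} := HB.pack X1 (isMeasurableFun.Build _ _ _ _ X1 m1).
pose Y2 : {mfun T2 >-> R} := HB.pack X2 (isMeasurableFun.Build _ _ _ _ X2 m2).
have mG (B : set R) : @measurable _ (ocitv_type R) B -> measurable B.
  by move=> mB; exact: sub_sigma_algebra.
apply: (@g_sigma_algebra_measure_unique _ R R
  (@measurable _ (ocitv_type R) : set (set R)) _
  (fun n => `](- n%:R), n%:R]%classic) _ _ (distribution P1 Y1) (distribution P2 Y2)) => //.
- by move=> n; exists (- n%:R, n%:R).
- apply/seteqP; split => // x _; exists (Num.truncn `|x|).+1 => //=.
  have /andP[_ h] := truncn_itv (normr_ge0 x).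
  by rewrite in_itv /=; have := ler_norm x; have := ler_norm (- x); rewrite normrN => *;
    apply/andP; split; lra.
- by move=> B B' mB mB'; exact: (@measurableI _ (ocitv_type R)).
- move=> B [[a b] _ <-] /=; have [ab|ba] := ltP a b; first exact: H.
  by rewrite set_itv_ge ?measure0 // bnd_simp -leNgt.
by move=> n; rewrite ltey_eq fin_num_measure.
Qed.

Lemma same_law_expect d1 d2 d3 (T1 : measurableType d1) (T2 : measurableType d2)
    (S : measurableType d3) (P1 : probability T1 R) (P2 : probability T2 R)
    (X1 : T1 -> S) (X2 : T2 -> S) : measurable_fun setT X1 -> measurable_fun setT X2 ->
  (forall A, measurable A -> P1 (X1 @^-1` A) = P2 (X2 @^-1` A)) ->
  forall F : S -> R, bmf F -> \int[P1]_o F (X1 o) = \int[P2]_o F (X2 o).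
Proof.
move=> m1 m2 H F [mF [M FM]].
pose Y1 : {mfun T1 >-> S} := HB.pack X1 (isMeasurableFun.Build _ _ _ _ X1 m1).
pose Y2 : {mfun T2 >-> S} := HB.pack X2 (isMeasurableFun.Build _ _ _ _ X2 m2).
have mE : measurable_fun setT (EFin \o F) by exact/measurable_EFinP.
rewrite /Rintegral; congr fine.
have i1 : P1.-integrable setT ((EFin \o F) \o Y1).
  by apply: (@bmf_integrable _ _ _ P1 (F \o X1)); split;
    [exact: measurableT_comp | exists M => o; exact: FM].
have i2 : P2.-integrable setT ((EFin \o F) \o Y2).
  by apply: (@bmf_integrable _ _ _ P2 (F \o X2)); split;
    [exact: measurableT_comp | exists M => o; exact: FM].
have e1 := integral_distribution mE i1; have e2 := integral_distribution mE i2.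
transitivity (\int[distribution P1 Y1]_y (EFin \o F) y)%E; first by rewrite e1.
transitivity (\int[distribution P2 Y2]_y (EFin \o F) y)%E; last by rewrite e2.
by apply: eq_measure_integral => A mA _; exact: H.
Qed.

End SameLaw.

Section Rectangles.
Variables (R : realType) (J : finType).

Definition rects : set (set (J -> R)) :=
  [set C | exists2 A : J -> set R, (forall j, measurable (A j)) &
    C = [set x | forall j, A j (x j)]].

Definition vspace := g_sigma_algebraType rects.

Lemma measurable_vcoord (j : J) : measurable_fun setT (fun x : vspace => x j : R).
Proof.
move=> _ A mA; rewrite setTI; apply: sub_sigma_algebra.
exists (fun i => if i == j then A else setT) => [i|]; first by case: ifP.
apply/seteqP; split => x /= H; last by have := H j; rewrite eqxx.
by move=> i; case: eqVneq => [->|].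
Qed.

Lemma measurable_forall d (T : measurableType d) (A : J -> set T) :
  (forall j, measurable (A j)) -> measurable [set o | forall j, A j o].
Proof.
move=> mA; rewrite (_ : [set o | _] = \bigcap_(j in [set: J]) A j).
  by apply: fin_bigcap_measurable.
by apply/seteqP; split => [t H j _|t H j]; apply: H.
Qed.

Lemma measurable_vec d (T : measurableType d) (X : T -> vspace) :
  (forall j, measurable_fun setT (fun o => X o j : R)) -> measurable_fun setT X.
Proof.
move=> mX; apply: (@measurability _ _ T vspace setT X rects (erefl _)) => _ [_ [A mA ->] <-].
rewrite setTI; apply: measurable_forall => j.
by rewrite -[X in measurable X]setTI; apply: mX.
Qed.

Lemma vec_law d1 d2 (T1 : measurableType d1) (T2 : measurableType d2)
    (P1 : probability T1 R) (P2 : probability T2 R)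
    (X1 : T1 -> vspace) (X2 : T2 -> vspace) :
  (forall j, measurable_fun setT (fun o => X1 o j : R)) ->
  (forall j, measurable_fun setT (fun o => X2 o j : R)) ->
  (forall A : J -> set R, (forall j, measurable (A j)) ->
    P1 [set o | forall j, A j (X1 o j)] = P2 [set o | forall j, A j (X2 o j)]) ->
  forall U, measurable U -> P1 (X1 @^-1` U) = P2 (X2 @^-1` U).
Proof.
move=> /measurable_vec m1 /measurable_vec m2 H U mU.
pose Y1 : {mfun T1 >-> vspace} := HB.pack X1 (isMeasurableFun.Build _ _ _ _ X1 m1).
pose Y2 : {mfun T2 >-> vspace} := HB.pack X2 (isMeasurableFun.Build _ _ _ _ X2 m2).
apply: (@g_sigma_algebra_measure_unique _ R vspace rects _ (fun=> setT) _ _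
  (distribution P1 Y1) (distribution P2 Y2)) => //.
- by move=> B mB; exact: sub_sigma_algebra.
- by move=> n; exists (fun=> setT) => //; apply/seteqP; split.
- by apply/seteqP; split => // x _; exists 0%N.
- move=> _ _ [A mA ->] [B mB ->]; exists (fun j => A j `&` B j) => [j|].
    exact: measurableI.
  by apply/seteqP; split => x /=; [move=> [a b] j | move=> H'; split => j; case: (H' j)].
- by move=> _ [A mA ->]; exact: H.
have h : distribution P1 Y1 setT = 1%E by exact: probability_setT.
by move=> _; exact: (eq_ind_r (fun z => (z < +oo)%E) (ltry 1) h).
Qed.

Lemma vec_expect d1 d2 (T1 : measurableType d1) (T2 : measurableType d2)
    (P1 : probability T1 R) (P2 : probability T2 R)
    (X1 : T1 -> vspace) (X2 : T2 -> vspace) :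
  (forall j, measurable_fun setT (fun o => X1 o j : R)) ->
  (forall j, measurable_fun setT (fun o => X2 o j : R)) ->
  (forall A : J -> set R, (forall j, measurable (A j)) ->
    P1 [set o | forall j, A j (X1 o j)] = P2 [set o | forall j, A j (X2 o j)]) ->
  forall F : vspace -> R, bmf F -> \int[P1]_o F (X1 o) = \int[P2]_o F (X2 o).
Proof.
move=> m1 m2 H; apply: same_law_expect.
- exact: measurable_vec.
- exact: measurable_vec.
exact: vec_law.
Qed.

End Rectangles.

(** * Gaussian scaling, symmetry and tail estimates *)

Section Normal.
Variable R : realType.
Local Notation mu := (@lebesgue_measure R).
Implicit Types (s a b x : R).

Lemma measurable_normal s A : measurable_fun A (EFin \o normal_pdf (0 : R) s).
Proof. by apply/measurable_EFinP; apply: measurable_funTS; exact: measurable_normal_pdf. Qed.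

Lemma normal_oc s a b : normal_prob 0 s `]a, b]%classic = normal_prob 0 s `[a, b]%classic.
Proof.
by rewrite /normal_prob integral_itv_obnd_cbnd //; exact: measurable_normal.
Qed.

Lemma normal_pdf_scale s a x : 0 < a -> 0 < s ->
  normal_pdf 0 (a * s) (a * x) * a = normal_pdf 0 s x.
Proof.
move=> a0 s0; have as0 : a * s != 0 by rewrite mulf_neq0 // gt_eqF.
rewrite !normal_pdfE ?(gt_eqF s0) // /normal_fun /normal_peak.
have -> : - (a * x - 0) ^+ 2 / ((a * s) ^+ 2 *+ 2) = - (x - 0) ^+ 2 / (s ^+ 2 *+ 2).
  by field; rewrite !gt_eqF.
have -> : Num.sqrt ((a * s) ^+ 2 * pi *+ 2) = a * Num.sqrt (s ^+ 2 * pi *+ 2).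
  rewrite exprMn -mulrA -mulrnAr sqrtrM ?sqr_ge0 // sqrtr_sqr ger0_norm // ltW //.
have q0 : Num.sqrt (s ^+ 2 * pi *+ 2) != 0.
  by rewrite gt_eqF // sqrtr_gt0 mulrn_wgt0 // mulr_gt0 ?exprn_gt0 ?pi_gt0.
move: q0; set q := Num.sqrt _; set e := expR _ => q0.
by field; rewrite q0 gt_eqF.
Qed.

Lemma normal_scale s a : 0 < a -> 0 < s -> forall A, measurable A ->
  normal_prob 0 (a * s) A = normal_prob 0 s [set x | A (a * x)].
Proof.
move=> a0 s0; have ma0 : measurable_fun setT (fun x : R => a * x) by exact: measurable_funM.
move=> A mA.
have K := @measR_ext R _ _ (measurableTypeR R) (measurableTypeR R) (normal_prob 0 (a * s))
  (normal_prob 0 s) id (fun x : R => a * x) (@measurable_id _ _ setT) ma0.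
refine (K _ A mA) => u v uv; rewrite preimage_id.
have -> : (fun x : R => a * x) @^-1` `]u, v]%classic = `]u / a, v / a]%classic.
  apply/seteqP; split => x /=; rewrite !in_itv /= ltr_pdivrMr // ler_pdivlMr //.
    by rewrite mulrC.
  by rewrite mulrC.
change (normal_prob 0 (a * s) `]u, v]%classic = normal_prob 0 s `]u / a, v / a]%classic).
rewrite !normal_oc /normal_prob.
have dF x : is_derive x 1 (fun y : R => a * y) a.
  by have := @is_deriveM _ _ _ _ _ _ _ _ (is_derive_cst a x 1) (is_derive_id x 1);
     rewrite /= scaler0 addr0 /GRing.scale /= mulr1.
have F' : (fun y : R => a * y)^`()%classic = cst a.
  by apply/funext => x; rewrite derive1E; apply: derive_val.
have cF : continuous (fun y : R => a * y).
  by move=> x; apply: cvgM; [exact: cvg_cst | exact: cvg_id].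
have ua : a * (u / a) = u by rewrite mulrCA divff ?mulr1 // gt_eqF.
have va : a * (v / a) = v by rewrite mulrCA divff ?mulr1 // gt_eqF.
have H := @integration_by_substitution_increasing R (fun y => a * y)
  (normal_pdf 0 (a * s)) (u / a) (v / a).
rewrite ua va F' in H; rewrite H.
- apply: eq_integral => x _; congr (_%:E).
  by rewrite -(normal_pdf_scale x a0 s0).
- by rewrite ler_pM2r ?invr_gt0 // ltW.
- by move=> x y _ _ xy; rewrite ltr_pM2l.
- by move=> x _; exact: cvg_cst.
- exact: is_cvg_cst.
- exact: is_cvg_cst.
- split; [by move=> x _; exact: ex_derive| |].
    by apply: cvg_at_right_filter; exact: cF.
  by apply: cvg_at_left_filter; exact: cF.
by apply: continuous_subspaceT; apply: continuous_normal_pdf; rewrite mulf_neq0 ?gt_eqF.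
Qed.

Lemma normal_opp s : 0 < s -> forall A, measurable A ->
  normal_prob 0 s A = normal_prob 0 s [set x | A (- x)].
Proof.
move=> s0; have ma0 : measurable_fun setT (fun x : R => - x) by exact: oppr_measurable.
move=> A mA.
have K := @measR_ext R _ _ (measurableTypeR R) (measurableTypeR R) (normal_prob 0 s)
  (normal_prob 0 s) id (fun x : R => - x) (@measurable_id _ _ setT) ma0.
refine (K _ A mA) => u v uv; rewrite preimage_id.
have -> : (fun x : R => - x) @^-1` `]u, v]%classic = `[- v, - u[%classic.
  by apply/seteqP; split => x /=; rewrite !in_itv /= ltrNr lerNl andbC.
change (normal_prob 0 s `]u, v]%classic = normal_prob 0 s `[- v, - u[%classic).
rewrite normal_oc /normal_prob integral_itv_bndo_bndc; last exact: measurable_normal.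
have := @integration_by_substitution_oppr R (normal_pdf 0 s) (- v) (- u).
rewrite !opprK lerN2 => H; rewrite H; [|exact: ltW|].
  apply: eq_integral => x _; congr (_%:E).
  by rewrite /= !normal_pdfE ?gt_eqF // /normal_fun !subr0 sqrrN.
by apply: continuous_subspaceT; apply: continuous_normal_pdf; rewrite gt_eqF.
Qed.

Lemma normal_peak1 : normal_peak (1 : R) <= 1.
Proof.
rewrite /normal_peak invf_le1.
  rewrite -[X in X <= _]sqrtr1 ler_sqrt expr1n mul1r; have := @pi_ge2 R; rewrite mulr2n; lra.
by rewrite sqrtr_gt0 expr1n mul1r mulrn_wgt0 // pi_gt0.
Qed.

Lemma itv_measure a b : a <= b -> mu `[a, b]%classic = (b - a)%R%:E.
Proof.
move=> ab; rewrite lebesgue_measure_itv /= lte_fin; case: ltP => // ba.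
by have -> : b = a; [lra | rewrite subrr].
Qed.

Lemma normal_itv_le a b : a <= b ->
  (normal_prob 0 1 `[a, b]%classic <= (b - a)%R%:E)%E.
Proof.
move=> ab; rewrite /normal_prob.
apply: (@le_trans _ _ (\int[mu]_(x in `[a, b]%classic) (cst 1%:E x))%E).
  apply: ge0_le_integral => //.
  - by move=> x _; rewrite lee_fin normal_pdf_ge0.
  - exact: measurable_normal.
  - by move=> x _; rewrite lee_fin (le_trans (normal_pdf_ub _ _ _)) ?oner_neq0 ?normal_peak1.
have h : (1%:E * mu `[a, b]%classic <= (b - a)%R%:E)%E.
  by rewrite itv_measure // mul1e.
by rewrite integral_cst.
Qed.

Definition normal_low : R := 2 * normal_pdf 0 1 1.

Lemma normal_low_gt0 : 0 < normal_low.
Proof.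
rewrite mulr_gt0 // normal_pdfE ?oner_neq0 // mulr_gt0 ?expR_gt0 //.
by apply: normal_peak_gt0; exact: oner_neq0.
Qed.

Lemma normal_itv_ge b : 0 <= b <= 1 ->
  ((normal_low * b)%R%:E <= normal_prob 0 1 `[(- b)%R, b]%classic)%E.
Proof.
move=> /andP[b0 b1]; rewrite /normal_prob.
apply: (@le_trans _ _ (\int[mu]_(x in `[(- b)%R, b]%classic) (cst (normal_pdf 0 1 1)%:E x))%E).
  have h : ((normal_low * b)%R%:E <= (normal_pdf 0 1 1)%:E * mu `[(- b)%R, b]%classic)%E.
    rewrite itv_measure; last by lra.
    by rewrite -EFinM lee_fin /normal_low; apply: le_of_eq; ring.
  by rewrite integral_cst.
apply: ge0_le_integral => //.
- by move=> x _; rewrite lee_fin normal_pdf_ge0.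
- exact: measurable_normal.
move=> x /=; rewrite in_itv /= lee_fin => /andP[x1 x2].
rewrite !normal_pdfE ?oner_neq0 // ler_wpM2l ?normal_peak_ge0 // ler_expR !subr0.
rewrite ler_pM2r; last by rewrite invr_gt0 mulrn_wgt0 // expr1n.
rewrite lerN2 expr1n -[x ^+ 2]real_normK ?num_real // expr_le1 // ler_norml.
by apply/andP; split; lra.
Qed.

Lemma normal_set1 s x : normal_prob 0 s [set x] = 0%E.
Proof. by rewrite /normal_prob integral_set1. Qed.

(** Comparison with the density of standard deviation [2]: the ratio of the two is [2 * exp (- u)]
    with [u = 3 * x^2 / 8], and [exp u >= u^2 / 4]. A fourth power suffices, since it only has to
    beat a union bound over [n] blocks of scale [n^(-1/2)]. *)
Lemma normal_tail y : 0 < y ->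
  ((normal_prob 0 1 `]y, +oo[%classic : \bar R) <= (64 / y ^+ 4)%R%:E)%E.
Proof.
move=> y0.
have p2 : normal_peak (1 : R) = 2 * normal_peak 2.
  rewrite /normal_peak (_ : (2 : R) ^+ 2 * pi *+ 2 = 2 ^+ 2 * (1 ^+ 2 * pi *+ 2)); last by ring.
  rewrite [in RHS]sqrtrM ?sqr_ge0 // sqrtr_sqr ger0_norm // invfM mulrA divff ?mul1r //.
have key x : y <= x -> normal_pdf 0 1 x <= 64 / y ^+ 4 * normal_pdf 0 2 x.
  move=> yx; rewrite !normal_pdfE ?oner_neq0 ?pnatr_eq0 // p2 /normal_fun !subr0.
  have y4 : 0 < y ^+ 4 by rewrite exprn_gt0.
  set u := 3 / 8 * x ^+ 2.
  have -> : expR (- x ^+ 2 / (1 ^+ 2 *+ 2)) = expR (- u) * expR (- x ^+ 2 / (2 ^+ 2 *+ 2)).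
    by rewrite -expRD; congr expR; rewrite /u; field.
  have x0 : 0 < x by exact: lt_le_trans yx.
  have u0 : 0 < u by rewrite /u mulr_gt0 // exprn_gt0.
  have h1 : u ^+ 2 / 4 <= expR u.
    have h := @expR_ge1Dx R (u / 2).
    have -> : expR u = expR (u / 2) ^+ 2 by rewrite expr2 -expRD; congr expR; field.
    apply: (@le_trans _ _ ((u / 2) ^+ 2)); first by rewrite expr_div_n -natrX.
    by rewrite lerXn2r ?nnegrE ?expR_ge0 ?divr_ge0 // ?(ltW u0) //; lra.
  have h2 : expR (- u) <= 32 / y ^+ 4.
    have u2 : y ^+ 4 / 32 <= u ^+ 2 / 4.
      have hy : y ^+ 4 <= x ^+ 4.
        by apply: lerXn2r => //; rewrite nnegrE ltW.
      rewrite (_ : u ^+ 2 / 4 = 9 / 256 * x ^+ 4); last by rewrite /u; field.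
      have hx : 0 <= x ^+ 4 by rewrite exprn_ge0 // ltW.
      lra.
    rewrite expRN -[32 / _]invf_div lef_pV2 ?posrE ?expR_gt0 ?divr_gt0 //.
    exact: le_trans u2 h1.
  have : 0 <= normal_peak 2 * expR (- x ^+ 2 / (2 ^+ 2 *+ 2)).
    by rewrite mulr_ge0 ?normal_peak_ge0 ?expR_ge0.
  move=> h3; rewrite [leLHS](_ : _ = 2 * expR (- u) * (normal_peak 2 * expR (- x ^+ 2 / (2 ^+ 2 *+ 2)))).
    by rewrite ler_wpM2r //; lra.
  by ring.
rewrite /normal_prob.
apply: (@le_trans _ _ (\int[mu]_(x in `]y, +oo[%classic) ((64 / y ^+ 4)%R%:E * (normal_pdf 0 2 x)%:E))%E).
  apply: ge0_le_integral => //.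
  - by move=> x _; rewrite lee_fin normal_pdf_ge0.
  - exact: measurable_normal.
  - by apply: emeasurable_funM; [exact: measurable_cst | exact: measurable_normal].
  - by move=> x /=; rewrite in_itv /= andbT => /ltW h; rewrite -EFinM lee_fin key.
have c0 : (0 <= (64 / y ^+ 4)%R%:E)%E by rewrite lee_fin divr_ge0 // exprn_ge0 // ltW.
have p0 x : (0 <= (normal_pdf 0 2 x)%:E)%E by rewrite lee_fin normal_pdf_ge0.
rewrite (_ : (\int[mu]_(x in _) _)%E = ((64 / y ^+ 4)%R%:E *
    \int[mu]_(x in `]y, +oo[%classic) (normal_pdf 0 2 x)%:E)%E); last first.
  by apply: ge0_integralZl => //; exact: measurable_normal.
rewrite -[leRHS]mule1; apply: lee_wpmul2l => //.
rewrite -(integral_normal_pdf 0 2); apply: ge0_subset_integral => //; exact: measurable_normal.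
Qed.

Lemma measurable_scaling a (A : set R) : measurable A -> measurable [set x | A (a * x)].
Proof.
move=> mA; rewrite -[X in measurable X]setTI.
by apply: (measurable_funM (measurable_cst a) (@measurable_id _ _ setT)).
Qed.
End Normal.

(** * Brownian paths: interpolation from grid increments, uniqueness in law, rescaling *)

Section Brownian.
Variables (R : realType) (k : nat).
Local Notation C := (C01 'rV[R]_k).
Local Notation J N := ('I_k * 'I_N)%type.
Implicit Types (w : C) (t s : I01 R) (N : nat).

Definition gt N (j : nat) : I01 R := clip (j%:R / N%:R).

Definition inc N w : vspace R (J N) :=
  fun ij => w (gt N ij.2.+1) 0 ij.1 - w (gt N ij.2) 0 ij.1.

Arguments inc N w : clear implicits.

Lemma time_gt N j : (0 < N)%N -> (j <= N)%N -> time (gt N j) = j%:R / N%:R.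
Proof.
move=> N0 jN; apply: time_clip; rewrite divr_ge0 //=.
by rewrite ler_pdivrMr ?ltr0n // mul1r ler_nat.
Qed.

(** The polygon with increments [x] on the uniform grid, written as a sum of ramps so that
    continuity in time and linearity in [x] are visible. *)
Definition poly_fun N (x : vspace R (J N)) t : 'rV[R]_k :=
  \sum_(j < N) Num.max 0 (Num.min (N%:R * time t - j%:R) 1) *: \row_i x (i, j).

Lemma poly_continuous N (x : vspace R (J N)) : continuous (poly_fun x).
Proof.
pose g (u : R) : 'rV[R]_k :=
  \sum_(j < N) Num.max 0 (Num.min (N%:R * u - j%:R) 1) *: \row_i x (i, j).
have cg : continuous g.
  move=> u; apply: cvg_big => [|j _]; first exact: add_continuous.
  apply: cvgZr_tmp.
  have kc : continuous (fun u : R => N%:R * u - j%:R).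
    move=> v; apply: cvgB; last exact: cvg_cst.
    by apply: cvgM; [exact: cvg_cst | exact: cvg_id].
  exact: (continuous_comp_fun kc (@clamp_continuous R)).
exact: (continuous_comp_fun (@time_continuous R) cg).
Qed.

Definition poly N (x : vspace R (J N)) : C := mkcts (@poly_continuous N x).

Lemma measurable_poly N : measurable_fun setT (@poly N : vspace R (J N) -> borel C).
Proof.
apply: measurable_path => t i.
rewrite (_ : (fun x => _) = (fun x : vspace R (J N) => \sum_(j < N)
    Num.max 0 (Num.min (N%:R * time t - j%:R) 1) * x (i, j))).
  apply: measurable_sum => j; apply: measurable_funM; first exact: measurable_cst.
  exact: measurable_vcoord.
apply/funext => x; rewrite /= /poly_fun summxE; apply: eq_bigr => j _.
by rewrite !mxE.
Qed.

Lemma poly_close N w t : (0 < N)%N -> w (clip 0) = 0 ->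
  `|poly (inc N w) t - w t| <= mdl N%:R^-1 w.
Proof.
move=> N0 w0; have n1 : (0 : R) < N%:R by rewrite ltr0n.
pose x j := w (gt N j); pose u := N%:R * time t.
have /andP[t0 t1] := time_itv t.
have u0 : 0 <= u by rewrite mulr_ge0.
have uN : u <= N%:R by rewrite ler_piMr.
have -> : poly (inc N w) t = polygonal x u.
  rewrite (@polygonalE _ _ _ N) ?u0 // {1}/x /gt mul0r w0 add0r big_ord_recr /=.
  have -> : Num.max 0 (Num.min (u - N%:R) 1) = 0 by rewrite max_l // ge_min subr_le0 uN.
  rewrite scale0r addr0.
  rewrite /poly_fun; apply: eq_bigr => j _; congr (_ *: _).
  by apply/rowP => i; rewrite !mxE.
have near j : `|u - j%:R| <= 1 -> `|x j - w t| <= mdl N%:R^-1 w.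
  move=> h; apply: mdl_ub; apply: le_trans (time_clip_dist _ _) _.
  have -> : time t = u / N%:R by rewrite /u mulrAC divff ?mul1r ?gt_eqF.
  rewrite -mulrBl normrM distrC [X in _ * X]ger0_norm ?invr_ge0 //.
  by rewrite ler_piMl ?invr_ge0.
rewrite /polygonal; set m := Num.truncn u.
have /andP[mu um] : m%:R <= u < m.+1%:R by rewrite /m truncn_itv.
set th := u - m%:R; have th0 : 0 <= th by rewrite subr_ge0.
have th1 : th <= 1 by rewrite lerBlDr addrC natr1 ltW.
have h1 : `|x m - w t| <= mdl N%:R^-1 w by apply: near; rewrite ger0_norm.
have h2 : `|x m.+1 - w t| <= mdl N%:R^-1 w.
  by apply: near; rewrite -natr1 opprD addrA -/th ler_norml; apply/andP; split; lra.
have -> : x m + th *: (x m.+1 - x m) - w t =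
    (1 - th) *: (x m - w t) + th *: (x m.+1 - w t).
  by apply/rowP => i; rewrite !mxE; ring.
apply: le_trans (ler_normD _ _) _; rewrite !normrZ (ger0_norm th0) ger0_norm ?subr_ge0 //.
have q0 : 0 <= 1 - th by rewrite subr_ge0.
have := ler_wpM2l q0 h1; have := ler_wpM2l th0 h2; lra.
Qed.

Section OneProcess.
Context {dT : measure_display} {T : measurableType dT}.

Definition brownian (P : probability T R) (Y : T -> C) : Prop :=
  (forall t i, measurable_fun setT (fun o => Y o t 0 i)) /\
  standard_BM P (fun i t o => Y o t 0 i).

Lemma ae_prob1 (P : probability T R) (A : set T) : measurable A -> P A = 1%E ->
  {ae P, forall o, A o}.
Proof.
move=> mA PA; exists (~` A); split; first exact: measurableC.
  by rewrite probability_setC // PA subee.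
by move=> o; apply: contra_not => h.
Qed.

Variables (P : probability T R) (Y : T -> C).
Hypothesis bY : brownian P Y.

Lemma brownian_rect N (A : J N.+1 -> set R) : (forall ij, measurable (A ij)) ->
  P [set o | forall ij, A ij (inc N.+1 (Y o) ij)] =
  (\prod_ij normal_prob 0 (Num.sqrt N.+1%:R^-1) (A ij))%E.
Proof.
case: bY => mY [_ ind law] mA; pose t (i : 'I_N.+2) := gt N.+1 i.
have tlt (i j : 'I_N.+2) : (i < j)%N -> time (t i) < time (t j).
  move=> ij; rewrite !time_gt -1?ltnS ?ltn_ord //.
  by rewrite ltr_pM2r ?invr_gt0 ?ltr0n // ltr_nat.
have := ind _ t tlt A mA; rewrite /inc /= => ->; apply: eq_bigr => -[i j] _ /=.
have E : time (t (lift ord0 j)) - time (t (widen_ord (leqnSn N.+1) j)) = N.+1%:R^-1.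
  have h1 : (j.+1 <= N.+1)%N := ltn_ord j.
  have -> : t (lift ord0 j) = gt N.+1 j.+1 by [].
  have -> : t (widen_ord (leqnSn N.+1) j) = gt N.+1 j by [].
  rewrite (time_gt (ltn0Sn N) h1) (time_gt (ltn0Sn N) (ltnW h1)).
  by rewrite -mulrBl -natrB ?subSnn ?mul1r.
have jl : (widen_ord (leqnSn N.+1) j < lift ord0 j)%N by exact: ltnSn.
have := @law i (t (widen_ord (leqnSn N.+1) j)) (t (lift ord0 j)) (tlt _ _ jl) _ (mA (i, j)).
by rewrite E => <-.
Qed.

Lemma brownian_coord_rect N i (A : 'I_N.+1 -> set R) : (forall j, measurable (A j)) ->
  P [set o | forall j, A j (inc N.+1 (Y o) (i, j))] =
  (\prod_j normal_prob 0 (Num.sqrt N.+1%:R^-1) (A j))%E.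
Proof.
move=> mA; pose B (ij : J N.+1) := if ij.1 == i then A ij.2 else setT.
have mB ij : measurable (B ij) by rewrite /B; case: ifP.
have := brownian_rect mB.
have -> : [set o | forall ij, B ij (inc N.+1 (Y o) ij)] =
    [set o | forall j, A j (inc N.+1 (Y o) (i, j))].
  apply/seteqP; split => u /= H => [j|[i' j]]; first by have := H (i, j); rewrite /B eqxx.
  by rewrite /B /=; case: eqVneq => [->|].
move=> ->; rewrite -(pair_bigA _ (fun i' j => normal_prob 0 (Num.sqrt N.+1%:R^-1) (B (i', j)))) /=.
rewrite (bigD1 i) //= [X in (_ * X)%E]big1 ?mule1; first by apply: eq_bigr => j _; rewrite /B eqxx.
move=> i' ii'; apply: big1 => j _; rewrite /B (negPf ii').
exact: (@probability_setT _ (measurableTypeR R) R (normal_prob 0 (Num.sqrt N.+1%:R^-1))).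
Qed.

End OneProcess.

Section GridBrownian.
Context {dT : measure_display} {T : measurableType dT}.

(* Only the increments along the uniform grids are prescribed: this is enough to
   determine the law, and easier to check than [brownian]. *)
Definition gbm (P : probability T R) (Y : T -> C) : Prop :=
  [/\ forall t i, measurable_fun setT (fun o => Y o t 0 i),
      P [set o | forall i, Y o (clip 0) 0 i = 0] = 1%E
    & forall N (A : J N.+1 -> set R), (forall ij, measurable (A ij)) ->
        P [set o | forall ij, A ij (inc N.+1 (Y o) ij)] =
        (\prod_ij normal_prob 0 (Num.sqrt N.+1%:R^-1) (A ij))%E].

Lemma brownian_gbm (P : probability T R) (Y : T -> C) : brownian P Y -> gbm P Y.
Proof.
move=> bY; have [mY [Y0 _ _]] := bY; split => // N A mA; exact: brownian_rect.
Qed.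

Section Gbm.
Variables (P : probability T R) (Y : T -> C).
Hypothesis bY : gbm P Y.

Lemma gbm_measurable : measurable_fun setT (Y : T -> borel C).
Proof. by apply: measurable_path => t i; case: bY. Qed.

Lemma gbm_start : {ae P, forall o, Y o (clip 0) = 0}.
Proof.
have [mY Y0 _] := bY.
have mA : measurable [set o | forall i, Y o (clip 0) 0 i = 0].
  apply: (@measurable_forall 'I_k _ T (fun i => [set o | Y o (clip 0) 0 i = 0])) => i.
  by rewrite -[X in measurable X]setTI; exact: (mY (clip 0) i measurableT [set 0]).
apply: ae_mono (ae_prob1 mA Y0) => o Yo; apply/rowP => i; by rewrite mxE.
Qed.

Lemma gbm_incr s t i : measurable_fun setT (fun o => Y o t 0 i - Y o s 0 i).
Proof. by have [mY _ _] := bY; exact: measurable_funB. Qed.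
End Gbm.

Section Brownian.
Variables (P : probability T R) (Y : T -> C).
Hypothesis bY : brownian P Y.

Lemma brownian_measurable : measurable_fun setT (Y : T -> borel C).
Proof. exact: gbm_measurable (brownian_gbm bY). Qed.

Lemma brownian_start : {ae P, forall o, Y o (clip 0) = 0}.
Proof. exact: gbm_start (brownian_gbm bY). Qed.

Lemma measurable_incr s t i : measurable_fun setT (fun o => Y o t 0 i - Y o s 0 i).
Proof. exact: gbm_incr (brownian_gbm bY) _ _ _. Qed.
End Brownian.
End GridBrownian.

Section Uniqueness.
Context {d1 d2 : measure_display} {T1 : measurableType d1} {T2 : measurableType d2}.
Variables (P1 : probability T1 R) (P2 : probability T2 R) (Y1 : T1 -> C) (Y2 : T2 -> C).
Hypotheses (b1 : gbm P1 Y1) (b2 : gbm P2 Y2).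

Lemma poly_expect_cvg {d} {T : measurableType d} (P : probability T R) (Y : T -> C) (F : C -> R) :
  gbm P Y -> blip F ->
  (fun N => \int[P]_o F (poly (inc N.+1 (Y o)))) @ \oo --> \int[P]_o F (Y o).
Proof.
move=> bY bF; have [[L lF] [M FM]] := bF; have [mF _] := blip_bmf bF.
have lF' : lipf (Num.max 0 L) F by apply: lipf_le lF; rewrite le_max lexx orbT.
have L0 : 0 <= Num.max 0 L by rewrite le_max lexx.
move: (Num.max 0 L) lF' L0 => L' lF' L0.
apply: (@expect_dominated _ T R P (fun N o => F (poly (inc N.+1 (Y o)))) (fun o => F (Y o)) M).
- move=> N; apply: (mcomp (F : borel C -> R)) => //.
  apply: (mcomp (@poly N.+1 : vspace R (J N.+1) -> borel C)).
    exact: measurable_poly.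
  by apply: measurable_vec => ij; apply: gbm_incr bY _ _ _.
- by apply: (mcomp (F : borel C -> R)) => //; exact: (gbm_measurable bY).
- by move=> N o; exact: FM.
apply: ae_mono (gbm_start bY) => o Y0; apply/cvgn_epsP => e e0.
have e1 : 0 < e / (L' + 1) by rewrite divr_gt0 // ltr_wpDl.
have [dl dl0 Hdl] := path_unif (Y o) e1; have [N HN] := inv_nat_small dl0.
exists N => n Nn; apply: (@le_trans _ _ (L' * (e / (L' + 1)))).
  apply: lF' => t; apply: le_trans (poly_close _ _ Y0) _ => //.
  apply: mdl_le => [|s t' h]; first by rewrite invr_ge0.
  by apply: Hdl; apply: le_trans h _; exact: HN.
by rewrite mulrCA ler_piMr ?(ltW e0) // ler_pdivrMr ?mul1r ?lerDl // ltr_wpDl.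
Qed.

Lemma gbm_expect_blip (F : C -> R) : blip F ->
  \int[P1]_o F (Y1 o) = \int[P2]_o F (Y2 o).
Proof.
move=> bF; have c1 := poly_expect_cvg b1 bF; have c2 := poly_expect_cvg b2 bF.
have E N : \int[P1]_o F (poly (inc N.+1 (Y1 o))) = \int[P2]_o F (poly (inc N.+1 (Y2 o))).
  apply: (@vec_expect R _ _ _ _ _ P1 P2 (fun o => inc N.+1 (Y1 o)) (fun o => inc N.+1 (Y2 o))
    _ _ _ (fun x => F (poly x))).
  - by move=> ij; apply: gbm_incr b1 _ _ _.
  - by move=> ij; apply: gbm_incr b2 _ _ _.
  - by move=> A mA; case: b1 => _ _ ->//; case: b2 => _ _ ->.
  have [mF [M FM]] := blip_bmf bF; split; last by exists M => x; exact: FM.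
  apply: (mcomp (F : borel C -> R)) => //; exact: measurable_poly.
have {}c1 : (fun N => \int[P2]_o F (poly (inc N.+1 (Y2 o)))) @ \oo --> \int[P1]_o F (Y1 o).
  by move: c1; under eq_fun do rewrite E.
exact: (cvg_unique _ c1 c2).
Qed.

(** Grid increments determine the mean of every bounded Lipschitz functional, through interpolation
    on finer and finer grids. Open sets generate the Borel sets, and their indicators are limits of
    Lipschitz functions of the distance to the complement. *)
Lemma gbm_law (A : set (borel C)) : measurable A -> P1 (Y1 @^-1` A) = P2 (Y2 @^-1` A).
Proof.
have law dd (T : measurableType dd) (P : probability T R) (Y : T -> C) : gbm P Y ->
    exists W : probability (borel C) R, forall B, W B = P (Y @^-1` B).
  move=> /gbm_measurable mY; pose Y' : T -> borel C := Y.
  pose Z : {mfun T >-> borel C} := HB.pack Y' (isMeasurableFun.Build _ _ _ _ Y' mY).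
  by exists (distribution P Z).
have [W1 E1] := law _ _ _ _ b1; have [W2 E2] := law _ _ _ _ b2.
move=> mA; rewrite -E1 -E2.
apply: (@g_sigma_algebra_measure_unique _ R (borel C) (@open C) _ (fun=> setT) _ _ W1 W2) => //.
- by move=> B oB; exact: sub_sigma_algebra.
- by move=> n; exact: openT.
- by apply/seteqP; split => // x _; exists 0%N.
- by move=> U V oU oV; exact: openI.
- move=> U oU; have [->|[w0 Uw0]] : U = setT \/ exists w0, ~ U w0.
  + by apply: contrapT => /not_orP[h1 h2]; apply: h1; apply/seteqP; split => // w _;
      apply: contrapT => nU; apply: h2; exists w.
  + by transitivity (1%E : \bar R); [exact: probability_setT | symmetry; exact: probability_setT].
  (* Minus the distance to the complement of [U]. An empty complement was treated apart, because the
     supremum would then take its default value. *)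
  pose sp w := sup [set - dst w w' | w' in ~` U].
  have hub w : has_ubound [set - dst w w' | w' in ~` U].
    by exists 0 => _ [w' _ <-]; rewrite oppr_le0 dst_ge0.
  have spl : lipf 1 sp.
    apply: sup_lipf; first by exists w0.
    - by move=> w; exists 0 => w' _; rewrite oppr_le0 dst_ge0.
    move=> w' _ u v e H; have := @dst_lipf _ _ w' u v e H.
    by rewrite -opprD normrN.
  pose F (n : nat) w := Num.min 1 (n%:R * - sp w).
  have sp0 w : sp w <= 0.
    apply: ge_sup; first by exists (- dst w w0), w0.
    by move=> _ [w' _ <-]; rewrite oppr_le0 dst_ge0.
  have F01 n w : 0 <= F n w <= 1.
    by rewrite le_min ler01 /= ge_min lexx /= mulr_ge0 // oppr_ge0.
  have bF n : blip (F n).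
    split; last by exists 1 => w; have /andP[a b] := F01 n w; rewrite ger0_norm.
    exists (n%:R * 1); apply: (@lipf_comp _ _ _ n%:R sp (fun x => Num.min 1 (n%:R * - x))) => // x y.
    rewrite -[n%:R in leRHS]ger0_norm // -normrM mulrBr.
    set p := n%:R * x; set q := n%:R * y; rewrite !mulrN -/p -/q.
    rewrite (_ : p - q = - q - - p); last by rewrite opprK addrC.
    by rewrite distrC; exact: min1_lip.
  have mU dd (T : measurableType dd) (P : probability T R) (Y : T -> C) :
      gbm P Y -> measurable (Y @^-1` U).
    move=> /gbm_measurable mY; rewrite -[X in measurable X]setTI.
    by apply: mY => //; exact: sub_sigma_algebra.
  have cv dd (T : measurableType dd) (P : probability T R) (Y : T -> C) :
      gbm P Y -> (fun n => \int[P]_o F n (Y o)) @ \oo --> fine (P (Y @^-1` U)).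
    move=> bY; have mY := gbm_measurable bY.
    rewrite -(expect_indic P (mU _ _ _ _ bY)).
    apply: (@expect_dominated _ T R P (fun n o => F n (Y o)) (\1_(Y @^-1` U)) 1).
    - move=> n; apply: (mcomp (F n : borel C -> R)) => //.
      by have [] := blip_bmf (bF n).
    - exact: measurable_indic (mU _ _ _ _ bY).
    - by move=> n o; have /andP[a b] := F01 n (Y o); rewrite ger0_norm.
    apply: aeW => o; rewrite indicE; have [Uo|nU] := pselect (U (Y o)); last first.
      rewrite memNset //; have -> : (fun n => F n (Y o)) = (fun=> 0).
        apply/funext => n; rewrite /F; have -> : sp (Y o) = 0.
          apply/eqP; rewrite eq_le sp0 /=; apply: ub_le_sup => //; exists (Y o) => //.
          by apply/eqP; rewrite oppr_eq0 eq_le dst_ge0 andbT dst_le // => t; rewrite subrr normr0.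
        by rewrite oppr0 mulr0 min_r.
      exact: cvg_cst.
    rewrite mem_set //.
    have [e e0 He] : exists2 e, 0 < e & forall w', (forall t, `|Y o t - w' t| < e) -> U w'.
      by apply/nbhs_c01P; exact: open_nbhs_nbhs.
    have spe : sp (Y o) <= - e.
      apply: ge_sup; first by exists (- dst (Y o) w0), w0.
      move=> _ [w' nUw' <-]; rewrite lerN2 leNgt; apply/negP => h; apply: nUw'.
      by apply: He => t; apply: le_lt_trans h; exact: dst_ub.
    apply/cvgn_epsP => r r0; have [N hN] := inv_nat_small e0; exists N.+1 => n Nn.
    rewrite /F min_l ?subrr ?normr0 ?(ltW r0) //.
    have h1 := hN N (leqnn N); rewrite -[leLHS](@mulVf _ e) ?gt_eqF //.
    apply: ler_pM; rewrite ?invr_ge0 ?(ltW e0) //; last lra.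
    apply: (@le_trans _ _ N.+1%:R); last by rewrite ler_nat.
    by rewrite -[leRHS]invrK lef_pV2 ?posrE ?invr_gt0.
  transitivity (P1 (Y1 @^-1` U)); first exact: E1.
  transitivity (P2 (Y2 @^-1` U)); last by symmetry; exact: E2.
  rewrite (@pr_fin _ _ _ P1 _ (mU _ _ _ _ b1)) (@pr_fin _ _ _ P2 _ (mU _ _ _ _ b2)); congr (_%:E).
  have c1 := cv _ _ _ _ b1; have c2 := cv _ _ _ _ b2.
  have {}c1 : (fun n => \int[P2]_o F n (Y2 o)) @ \oo --> fine (P1 (Y1 @^-1` U)).
    by move: c1; under eq_fun do rewrite (gbm_expect_blip (bF _)).
  exact: (cvg_unique _ c1 c2).
move=> n; have h : W1 setT = 1%E by exact: probability_setT.
exact: (eq_ind_r (fun z => (z < +oo)%E) (ltry 1) h).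
Qed.

Lemma gbm_expect (G : borel C -> R) : bmf G ->
  \int[P1]_o G (Y1 o) = \int[P2]_o G (Y2 o).
Proof.
apply: same_law_expect; [exact: gbm_measurable b1 | exact: gbm_measurable b2 |].
exact: gbm_law.
Qed.

End Uniqueness.

Lemma brownian_expect {d1 d2 : measure_display} {T1 : measurableType d1}
    {T2 : measurableType d2} (P1 : probability T1 R) (P2 : probability T2 R)
    (Y1 : T1 -> C) (Y2 : T2 -> C) (b1 : brownian P1 Y1) (b2 : brownian P2 Y2)
    (G : borel C -> R) : bmf G -> \int[P1]_o G (Y1 o) = \int[P2]_o G (Y2 o).
Proof. by apply: gbm_expect; exact: brownian_gbm. Qed.

Lemma normal_scale_abs (s a : R) : a != 0 -> 0 < s -> forall A, measurable A ->
  normal_prob 0 (`|a| * s) A = normal_prob 0 s [set x | A (a * x)].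
Proof.
move=> a0 s0 A mA; have [ap|an] := ltP 0 a.
  by rewrite (ger0_norm (ltW ap)); exact: normal_scale.
have an' : 0 < - a by rewrite oppr_gt0 lt_neqAle a0.
have mB : measurable [set x | A (- a * x)] by exact: measurable_scaling.
rewrite (ler0_norm an) (normal_scale an' s0 mA) (normal_opp s0 mB).
by congr (normal_prob _ _ _); apply/seteqP; split => x /=; rewrite mulrNN.
Qed.

(** Only increments enter, so an affine change of time and a factor [a] are harmless once [|a|]
    restores the variance; the sign of [a] is free, which provides reflections too. *)
Lemma brownian_block {dT : measure_display} {T : measurableType dT} (P : probability T R)
    (Y Y' : T -> C) (u v a : R) : brownian P Y -> 0 <= u < v -> v <= 1 ->
  `|a| * Num.sqrt (v - u) = 1 ->
  P [set o | forall i, Y' o (clip 0) 0 i = 0] = 1%E ->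
  (forall t i, measurable_fun setT (fun o => Y' o t 0 i)) ->
  (forall s t i o, time s < time t -> Y' o t 0 i - Y' o s 0 i =
    a * (Y o (clip (u + time t * (v - u))) 0 i - Y o (clip (u + time s * (v - u))) 0 i)) ->
  brownian P Y'.
Proof.
move=> [mY [_ ind law]] /andP[u0 uv] v1 aE Y'0 mY' incE; split=> //.
have vu0 : 0 < v - u by rewrite subr_gt0.
have a0 : a != 0 by apply/eqP => a0; move: aE; rewrite a0 normr0 mul0r => /eqP; rewrite eq_sym oner_eq0.
pose sh (t : I01 R) : I01 R := clip (u + time t * (v - u)).
have tsh t : time (sh t) = u + time t * (v - u).
  have /andP[t0 t1] := time_itv t; apply: time_clip; apply/andP; split.
    by rewrite addr_ge0 // mulr_ge0 // ltW.
  apply: le_trans v1; rewrite -[leRHS](subrK u) addrC lerD2r ler_piMl // ltW //.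
have shlt s t : time s < time t -> time (sh s) < time (sh t).
  by move=> st; rewrite !tsh ltrD2l ltr_pM2r.
split=> // [m t tlt A mA|i s t st A mA].
  have := ind m (fun i => sh (t i)) (fun i j ij => shlt _ _ (tlt i j ij))
    (fun ij => [set x | A ij (a * x)]) (fun ij => measurable_scaling a (mA ij)).
  have lt_ij (j : 'I_m) : time (t (widen_ord (leqnSn m) j)) < time (t (lift ord0 j)).
    by apply: tlt; rewrite /= /bump /= add1n.
  move=> E; transitivity (P [set w | forall ij : 'I_k * 'I_m,
    [set x | A ij (a * x)] (Y w (sh (t (lift ord0 ij.2))) 0 ij.1 -
       Y w (sh (t (widen_ord (leqnSn m) ij.2))) 0 ij.1)]).
    congr (P _); apply/seteqP; split => o /= H ij; have := H ij; rewrite incE //; exact: lt_ij.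
  rewrite E; apply: eq_bigr => ij _; congr (P _); apply/seteqP; split => o /=;
    rewrite incE //; exact: lt_ij.
transitivity (P [set w | [set x | A (a * x)] (Y w (sh t) 0 i - Y w (sh s) 0 i)]).
  by congr (P _); apply/seteqP; split => o /=; rewrite incE.
rewrite (law i (sh s) (sh t) (shlt _ _ st) _ (measurable_scaling a mA)).
have E : time (sh t) - time (sh s) = (time t - time s) * (v - u).
  by rewrite !tsh; ring.
have ts0 : 0 < time t - time s by rewrite subr_gt0.
have s0 : 0 < Num.sqrt ((time t - time s) * (v - u)) by rewrite sqrtr_gt0 mulr_gt0.
rewrite E -(normal_scale_abs a0 s0 mA); congr (normal_prob _ _ _).
by rewrite (sqrtrM _ (ltW ts0)) mulrCA aE mulr1.
Qed.

End Brownian.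
Arguments inc {R k} N w.

(** * The reflection principle for walks with symmetric Gaussian increments *)

Section Reflection.
Variables (R : realType) (n : nat).
Local Notation V := (vspace R 'I_n).
Implicit Types (x : V) (m : nat).

Definition psum m x : R := \sum_(j < n | (j < m)%N) x j.

Definition flip_from m x : V := fun j => if (j < m)%N then x j else - x j.

Lemma psum_flip m j x : (j <= m)%N -> psum j (flip_from m x) = psum j x.
Proof.
move=> jm; apply: eq_bigr => i ij; rewrite /flip_from; case: ifP => // /negbT.
by rewrite -leqNgt leqNgt (leq_trans ij).
Qed.

Lemma psum_rest m j x : (m <= j)%N ->
  psum j x - psum m x = \sum_(i < n | (i < j)%N && ~~ (i < m)%N) x i.
Proof.
move=> mj; rewrite /psum (bigID (fun i : 'I_n => (i < m)%N)) /=.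
rewrite (eq_bigl (fun i : 'I_n => (i < m)%N)); last first.
  by move=> i /=; case: (ltnP i m) => im; rewrite ?andbT ?andbF // (leq_trans im).
by rewrite addrC addrK.
Qed.

Lemma psum_flip_rest m j x : (m <= j)%N ->
  psum j (flip_from m x) - psum m (flip_from m x) = - (psum j x - psum m x).
Proof.
move=> mj; rewrite !psum_rest // -sumrN; apply: eq_bigr => i /andP[_ im].
by rewrite /flip_from (negPf im).
Qed.

Lemma measurable_psum m : measurable_fun setT (psum m : V -> R).
Proof.
rewrite (_ : psum m = fun x => \sum_(j < n) (if (j < m)%N then x j else 0)); last first.
  by apply/funext => x; rewrite /psum big_mkcond.
apply: measurable_sum => j; case: (j < m)%N; last exact: measurable_cst.
exact: measurable_vcoord.
Qed.

Variable a : R.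

Definition hit m x : bool := (a <= psum m x) && [forall j : 'I_m, psum j x < a].

Lemma hit_uniq m m' x : hit m x -> hit m' x -> m = m'.
Proof.
move=> /andP[h1 /forallP h2] /andP[h1' /forallP h2'].
apply/eqP; case: ltngtP => // lt.
  by have := h2' (Ordinal lt); rewrite /= ltNge h1.
by have := h2 (Ordinal lt); rewrite /= ltNge h1'.
Qed.

Lemma hit_ex m x : a <= psum m x -> exists2 m', (m' <= m)%N & hit m' x.
Proof.
move=> am; have ex : exists m', a <= psum m' x by exists m.
case: (ex_minnP ex) => m' am' min; exists m'; first exact: min.
rewrite /hit am' /=; apply/forallP => j; rewrite ltNge; apply/negP => /min.
by rewrite leqNgt ltn_ord.
Qed.

Lemma sum_hit_le (b : nat -> bool) (c : bool) x :
  (forall m, (m <= n)%N -> hit m x -> b m -> c) ->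
  \sum_(m < n.+1) (hit m x && b m)%:R <= c%:R :> R.
Proof.
move=> H; have [[m /andP[hm bm]]|nex] := pselect (exists m : 'I_n.+1, hit m x && b m).
  have mn : (m <= n)%N by rewrite -ltnS ltn_ord.
  rewrite (bigD1 m) //= big1 ?addr0; last first.
    move=> m' m'm; case: (boolP (hit m' x)) => //= h; case/eqP: m'm.
    by apply: val_inj; exact: hit_uniq h hm.
  by rewrite hm bm (H m).
rewrite big1 ?ler0n // => m _; case: (boolP (_ && _)) => // h.
by case: nex; exists m.
Qed.

Lemma one_le_sum (f : 'I_n.+1 -> bool) (j : 'I_n.+1) : f j -> 1 <= \sum_(i < n.+1) (f i)%:R :> R.
Proof.
move=> fm; rewrite (bigD1 j) //= fm lerDl; apply: sumr_ge0 => i _; exact: ler0n.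
Qed.

Definition reach x : bool := [exists m : 'I_n.+1, a <= psum m x].

Definition jump (e : R) x : bool := [exists j, e < x j].

Context {dT : measure_display} {T : measurableType dT}.
Variables (P : probability T R) (xi : T -> V) (s : R).
Hypotheses (s0 : 0 < s) (mxi : forall j, measurable_fun setT (fun o => xi o j : R)).
Hypothesis xi_law : forall A : 'I_n -> set R, (forall j, measurable (A j)) ->
  P [set o | forall j, A j (xi o j)] = (\prod_j normal_prob 0 s (A j))%E.

Lemma measurable_hit m : measurable [set x : V | hit m x].
Proof.
rewrite (_ : [set x | _] = [set x : V | a <= psum m x] `&`
   [set x | forall j : 'I_m, psum j x < a]).
  apply: measurableI; first by apply: measurable_le; [exact: measurable_cst | exact: measurable_psum].
  apply: (@measurable_forall _ _ _ (fun j : 'I_m => [set x : V | psum j x < a])) => j.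
  by apply: measurable_lt; [exact: measurable_psum | exact: measurable_cst].
by apply/seteqP; split => x /=; [move=> /andP[h1 /forallP h2] | move=> [h1 h2]; rewrite /hit h1; apply/forallP].
Qed.

Lemma measurable_reach : measurable [set x : V | reach x].
Proof.
rewrite (_ : [set x | _] = \bigcup_(m in [set: 'I_n.+1]) [set x : V | a <= psum m x]).
  apply: fin_bigcup_measurable => // m _.
  by apply: measurable_le; [exact: measurable_cst | exact: measurable_psum].
by apply/seteqP; split => x /=; [move=> /existsP[m h]; exists m | move=> [m _ h]; apply/existsP; exists m].
Qed.

Lemma measurable_jump e : measurable [set x : V | jump e x].
Proof.
rewrite (_ : [set x | _] = \bigcup_(j in [set: 'I_n]) [set x : V | e < x j]).
  apply: fin_bigcup_measurable => // j _.
  by apply: measurable_lt; [exact: measurable_cst | exact: measurable_vcoord].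
by apply/seteqP; split => x /=; [move=> /existsP[m h]; exists m | move=> [m _ h]; apply/existsP; exists m].
Qed.

Lemma flip_expect m (F : V -> R) : bmf F ->
  \int[P]_o F (xi o) = \int[P]_o F (flip_from m (xi o)).
Proof.
have mfl j : measurable_fun setT (fun o => flip_from m (xi o) j : R).
  rewrite /flip_from; case: (j < m)%N; first exact: mxi.
  by apply: (measurableT_comp (@oppr_measurable R setT)).
apply: (@vec_expect _ _ _ _ _ _ P P xi (fun o => flip_from m (xi o))) => // A mA.
pose B (j : 'I_n) := if (j < m)%N then A j else [set y | A j (- y)].
have mB j : measurable (B j).
  rewrite /B; case: ifP => // _; rewrite -[X in measurable X]setTI.
  exact: (@oppr_measurable R setT).
transitivity (P [set o | forall j, B j (xi o j)]).
  rewrite !xi_law //; apply: eq_bigr => j _; rewrite /B; case: ifP => // _.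
  exact: (normal_opp s0 (mA j)).
congr (P _); apply/seteqP; split => o /= H j; have := H j;
  by rewrite /B /flip_from; case: ifP.
Qed.

Let bmfb (b : V -> bool) : measurable [set x | b x] -> bmf (fun o => (b (xi o))%:R : R).
Proof. by move=> mb; apply: (bmf_comp (bmf_bool R mb)); exact: measurable_vec. Qed.

(** Mirror images in the reflection principle: after the first passage at step [m], a final
    displacement below [- e] or above [e]. The event [l] may record what is decided by step [m]. *)
Definition dive (l : nat -> V -> bool) (e : R) m x : bool :=
  hit m x && (l m x && (psum n x - psum m x < - e)).

Definition rebound (l : nat -> V -> bool) (e : R) m x : bool :=
  hit m x && (l m x && (e < psum n x - psum m x)).

(** Flipping the signs of the increments after step [m] preserves their law, leaves the first
    passage at [m] untouched and exchanges the two events. *)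
Lemma dive_rebound (l : nat -> V -> bool) (e : R) : (forall m, measurable [set x | l m x]) ->
  (forall m x, l m (flip_from m x) = l m x) ->
  [/\ bmf (fun o => \sum_(m < n.+1) (dive l e m (xi o))%:R : R),
      bmf (fun o => \sum_(m < n.+1) (rebound l e m (xi o))%:R : R)
    & \int[P]_o (\sum_(m < n.+1) (dive l e m (xi o))%:R : R) =
      \int[P]_o (\sum_(m < n.+1) (rebound l e m (xi o))%:R : R) :> R].
Proof.
move=> ml lf; have mc (r : R) : measurable_fun setT (fun _ : V => r) by exact: measurable_cst.
have mrest m : measurable_fun setT (fun x : V => psum n x - psum m x).
  by apply: measurable_funB; exact: measurable_psum.
have mhl (b : V -> bool) m : measurable [set x | b x] ->
    measurable [set x | hit m x && (l m x && b x)].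
  move=> mb; rewrite (_ : [set x | _] = [set x : V | hit m x] `&` ([set x | l m x] `&` [set x | b x])).
    by apply: measurableI; [exact: measurable_hit | exact: measurableI].
  by apply/seteqP; split => x /=; [move=> /andP[h /andP[]] | move=> [-> [-> ->]]].
have mdn m : measurable [set x : V | dive l e m x] by apply: mhl; exact: measurable_lt.
have mup m : measurable [set x : V | rebound l e m x] by apply: mhl; exact: measurable_lt.
have [bS1 ES1] := @expect_sum _ T R P _ (index_enum 'I_n.+1)
  (fun (m : 'I_n.+1) o => (dive l e m (xi o))%:R) (fun m : 'I_n.+1 => bmfb (mdn m)).
have [bS2 ES2] := @expect_sum _ T R P _ (index_enum 'I_n.+1)
  (fun (m : 'I_n.+1) o => (rebound l e m (xi o))%:R) (fun m : 'I_n.+1 => bmfb (mup m)).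
split => //; rewrite ES1 ES2; apply: eq_bigr => m _.
rewrite (flip_expect m (bmf_bool R (mdn m))); apply: eq_Rintegral => o _; congr (_%:R).
have mle_n : (m <= n)%N by rewrite -ltnS ltn_ord.
rewrite /dive /rebound psum_flip_rest // ltrN2 lf; congr (nat_of_bool (_ && _)).
rewrite /hit psum_flip //; congr (_ && _); apply: eq_forallb => j.
by rewrite psum_flip // ltnW.
Qed.

Lemma reflect_le : \int[P]_o ((reach (xi o))%:R : R) <=
  2 * \int[P]_o ((a <= psum n (xi o))%R%:R : R) :> R.
Proof.
pose l (m : nat) (x : V) := true.
have [m|//|bS1 bS2 e1] := @dive_rebound l 0.
  by rewrite (_ : [set x | _] = setT) //; apply/seteqP.
have mn1 : measurable [set x : V | a <= psum n x].
  by apply: measurable_le; [exact: measurable_cst | exact: measurable_psum].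
have mex := measurable_reach.
have h1 : \int[P]_o ((reach (xi o))%:R : R) <=
    \int[P]_o ((a <= psum n (xi o))%R%:R + \sum_(m < n.+1) (dive l 0 m (xi o))%:R : R) :> R.
  apply: expect_le; [exact: bmfb mex | exact: bmfD (bmfb mn1) bS1 |] => o /=.
  have sge : 0 <= \sum_(m < n.+1) (dive l 0 m (xi o))%:R :> R by apply: sumr_ge0 => m _; rewrite ler0n.
  case: (boolP (reach (xi o))) => [/existsP[m am]|_]; last by rewrite addr_ge0 // ler0n.
  case: (leP a (psum n (xi o))) => an /=; first by rewrite lerDl.
  have [m' m'm hm'] := hit_ex am; rewrite add0r.
  have m'n : (m' < n.+1)%N by apply: leq_ltn_trans m'm (ltn_ord m).
  suff h : (1 : R) <= \sum_(i < n.+1) (dive l 0 i (xi o))%:R by exact: h.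
  apply: (@one_le_sum (fun i : 'I_n.+1 => dive l 0 i (xi o)) (Ordinal m'n)).
  by rewrite /dive hm' /= oppr0 subr_lt0; case/andP: hm' => h _; exact: lt_le_trans h.
have h2 : \int[P]_o (\sum_(m < n.+1) (rebound l 0 m (xi o))%:R : R) <= \int[P]_o ((a <= psum n (xi o))%R%:R : R) :> R.
  apply: expect_le => //; first exact: bmfb mn1.
  move=> o; apply: (@sum_hit_le (fun m => 0 < psum n (xi o) - psum m (xi o))) => m mn hm; rewrite subr_gt0 => /ltW; apply: le_trans.
  by case/andP: hm.
rewrite expectD ?e1 in h1; [|exact: bmfb mn1|exact: bS1].
lra.
Qed.

(** Unless some increment exceeds [e], the first passage overshoots [a] by at most [e]. A walk
    ending above [a + 2 * e] then rebounds by more than [e], and its mirror image has reached [a]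
    but ends below it; the two events are disjoint, whence the factor [2]. *)
Lemma reflect_ge (e : R) : 0 < a -> 0 <= e ->
  2 * (\int[P]_o ((a + 2 * e < psum n (xi o))%R%:R : R) -
       \int[P]_o ((jump e (xi o))%:R : R)) <=
  \int[P]_o ((reach (xi o))%:R : R) :> R.
Proof.
move=> a0 e0.
pose low m x := psum m x <= a + e.
have [m|m x|bS1 bS2 e1] := @dive_rebound low e.
- by apply: measurable_le; [exact: measurable_psum | exact: measurable_cst].
- by rewrite /low psum_flip.
have mex := measurable_reach.
have mj := measurable_jump e.
have mbig : measurable [set x : V | a + 2 * e < psum n x].
  by apply: measurable_lt; [exact: measurable_cst | exact: measurable_psum].
have h1 : \int[P]_o ((a + 2 * e < psum n (xi o))%R%:R - (jump e (xi o))%:R : R) <=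
    \int[P]_o (\sum_(m < n.+1) (rebound low e m (xi o))%:R : R) :> R.
  apply: expect_le => [||o]; [exact: bmfB (bmfb mbig) (bmfb mj) | exact: bS2 |].
  have sge : 0 <= \sum_(m < n.+1) (rebound low e m (xi o))%:R :> R by apply: sumr_ge0 => m _; rewrite ler0n.
  case: (boolP (jump e (xi o))) => [_|/existsPn nj].
    by apply: le_trans sge; rewrite subr_le0 lern1 leq_b1.
  case: (ltP (a + 2 * e) (psum n (xi o))) => big /=; last by rewrite subr0.
  have an : a <= psum n (xi o) by lra.
  have [m mn hm] := hit_ex an; have m'n : (m < n.+1)%N by [].
  rewrite subr0; suff h : (1 : R) <= \sum_(i < n.+1) (rebound low e i (xi o))%:R by exact: h.
  apply: (@one_le_sum (fun i : 'I_n.+1 => rebound low e i (xi o)) (Ordinal m'n)).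
  have lowm : psum m (xi o) <= a + e.
    case: m mn hm {m'n} => [|m] mn hm.
      by rewrite /psum big1 //; lra.
    have /andP[_ /forallP /(_ ord_max) /= hlt] := hm.
    have -> : psum m.+1 (xi o) = psum m (xi o) + (psum m.+1 (xi o) - psum m (xi o)) by lra.
    rewrite psum_rest // (bigD1 (Ordinal mn)) /=; last by rewrite ltnSn ltnn.
    rewrite big1 ?addr0; last first.
      move=> i /andP[/andP[i1 i2] i3]; case/eqP: i3; apply: val_inj => /=.
      by apply/eqP; rewrite eqn_leq -ltnS i1 leqNgt i2.
    by have := nj (Ordinal mn); rewrite -leNgt; lra.
  by rewrite /rebound hm /low lowm /=; lra.
have h2 : \int[P]_o ((a + 2 * e < psum n (xi o))%R%:R + \sum_(m < n.+1) (dive low e m (xi o))%:R : R) <=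
    \int[P]_o ((reach (xi o))%:R : R) :> R.
  apply: expect_le => [||o]; [exact: bmfD (bmfb mbig) bS1 | exact: bmfb mex |].
  have := @sum_hit_le (fun m => low m (xi o) && (psum n (xi o) - psum m (xi o) < - e))
    (reach (xi o) && (psum n (xi o) < a)) (xi o) _.
  move=> sl; apply: (@le_trans _ _ ((a + 2 * e < psum n (xi o))%R%:R +
     (reach (xi o) && (psum n (xi o) < a))%R%:R)).
    rewrite lerD2l; apply: sl => m mn hm /andP[lowm dm]; apply/andP; split; last first.
      by rewrite /low in lowm; lra.
    by apply/existsP; exists (Ordinal (mn : (m < n.+1)%N)); case/andP: hm.
  case: (ltP (a + 2 * e) (psum n (xi o))) => big /=.
    have an : a <= psum n (xi o) by lra.
    rewrite [psum n _ < a]ltNge an andbF addr0.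
    by rewrite (_ : reach (xi o) = true) //; apply/existsP; exists ord_max.
  by case: (reach _); case: (_ < a); rewrite /= ?mulr0n ?mulr1n; lra.
rewrite expectB in h1; [|exact: bmfb mbig|exact: bmfb mj].
rewrite expectD ?e1 in h2; [|exact: bmfb mbig|exact: bS1].
have y0 : 0 <= \int[P]_o ((jump e (xi o))%:R : R) :> R.
  by apply: expect_ge0 => o; exact: ler0n.
lra.
Qed.

End Reflection.

(** * The Gaussian tail as a real function *)

Section NormalTail.
Variable R : realType.
Local Notation N := (normal_prob (0 : R) 1).

Definition ntail (b : R) : R := fine (N `]b, +oo[%classic).

Lemma normal_fin (A : set R) : measurable A -> N A = (fine (N A))%:E.
Proof. by move=> mA; exact: (@pr_fin _ (measurableTypeR R) R (normal_prob 0 1) A mA). Qed.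

Lemma ntail_c b : N `[b, +oo[%classic = N `]b, +oo[%classic.
Proof.
by rewrite /normal_prob integral_itv_obnd_cbnd //; exact: measurable_normal.
Qed.

Lemma ntail_le y : 0 < y -> ntail y <= 64 / y ^+ 4.
Proof.
move=> y0; have := normal_tail y0.
by rewrite [X in (X <= _)%E -> _]normal_fin // lee_fin.
Qed.

Lemma ntail_diff b b' : b' <= b -> ntail b' - ntail b <= b - b'.
Proof.
move=> bb; have E : `]b', +oo[%classic = `]b', b]%classic `|` `]b, +oo[%classic :> set R.
  apply/seteqP; split => x /=; rewrite !in_itv /= !andbT.
    by move=> h; case: (leP x b) => h'; [left; rewrite h | right].
  by case=> [/andP[]|] //; exact: le_lt_trans.
have D : N `]b', +oo[%classic = (N `]b', b]%classic + N `]b, +oo[%classic)%E.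
  rewrite E; apply: (@measureU _ R (measurableTypeR R) (normal_prob 0 1)) => //.
  apply/seteqP; split => // x /= [] ; rewrite !in_itv /= andbT => /andP[_ h1] h2.
  by have := le_lt_trans h1 h2; rewrite ltxx.
have L := normal_itv_le bb; rewrite -normal_oc in L.
move: D L; rewrite (normal_fin (A := `]b', b]%classic)) // /ntail.
rewrite (normal_fin (A := `]b', +oo[%classic)) // (normal_fin (A := `]b, +oo[%classic)) //.
by rewrite -EFinD lee_fin /= => -[->]; lra.
Qed.

Lemma ntail_mid b : 0 <= b <= 1 -> normal_low R * b <= 1 - 2 * ntail b.
Proof.
move=> b01; have /andP[b0 _] := b01; have L := normal_itv_ge b01.
have Sy : N `]-oo, (- b)%R[%classic = N `]b, +oo[%classic.
  rewrite (normal_opp ltr01) //; congr (normal_prob _ _ _); apply/seteqP.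
  by split => x /=; rewrite !in_itv /= andbT ltrNr opprK.
have E : [set: R] = `]-oo, (- b)%R[%classic `|` (`[(- b)%R, b]%classic `|` `]b, +oo[%classic).
  apply/seteqP; split => // x _ /=; rewrite !in_itv /= !andbT.
  by case: (ltP x (- b)) => h1; [left | right; case: (leP x b) => h2; [left | right]].
have T1 : N setT = 1%E by exact: (@probability_setT _ (measurableTypeR R) R (normal_prob 0 1)).
have D : N setT = (N `]-oo, (- b)%R[%classic + (N `[(- b)%R, b]%classic + N `]b, +oo[%classic))%E.
  rewrite E (@measureU _ R (measurableTypeR R) (normal_prob 0 1)) //.
  - congr (_ + _)%E; apply: (@measureU _ R (measurableTypeR R) (normal_prob 0 1)) => //.
    apply/seteqP; split => // x /= []; rewrite !in_itv /= andbT => /andP[_ h1] h2.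
    by have := le_lt_trans h1 h2; rewrite ltxx.
  - by apply: measurableU.
  apply/seteqP; split => // x /= []; rewrite !in_itv /= andbT => h1 [/andP[h2 _]|h2].
    by have := le_lt_trans h2 h1; rewrite ltxx.
  have bb : (b : R) < - b := lt_trans h2 h1.
  by move: b0 bb; clear; move=> b0 bb; lra.
move: D L; rewrite T1 Sy (normal_fin (A := `[(- b)%R, b]%classic)) //.
rewrite (normal_fin (A := `]b, +oo[%classic)) // -!EFinD lee_fin => -[E1] h.
by rewrite /ntail; lra.
Qed.

End NormalTail.

(** * Rescaled blocks of a path and their maxima *)

Section Blocks.
Variables (R : realType) (k : nat).
Local Notation C := (C01 'rV[R]_k).
Implicit Types (w : C) (t s : I01 R) (a u v : R).

(** The piece of the path over [[u, v]], started at zero, stretched to unit time and multiplied by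
    [a]; with [|a| = (v - u)^(-1/2)] it is again Brownian, and a negative [a] turns minima into
    maxima. *)
Definition blk_fun a u v w t : 'rV[R]_k :=
  a *: (w (clip (u + time t * (v - u))) - w (clip u)).

Lemma blk_continuous a u v w : continuous (blk_fun a u v w).
Proof.
have ca : continuous (fun x : R => u + x * (v - u)).
  move=> x; apply: cvgD; first exact: cvg_cst.
  by apply: cvgM; [exact: cvg_id | exact: cvg_cst].
have cw := continuous_comp_fun (continuous_comp_fun ca (@clip_continuous R)) (@cts_fun _ _ w).
have cn : continuous (fun x : R => a *: (w (clip (u + x * (v - u))) - w (clip u))).
  by move=> x; apply: cvgZl_tmp; apply: cvgB; [exact: cw | exact: cvg_cst].
exact: (continuous_comp_fun (@time_continuous R) cn).
Qed.

Definition blk a u v w : C := mkcts (@blk_continuous a u v w).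

Lemma blkE a u v w t i : blk a u v w t 0 i =
  a * (w (clip (u + time t * (v - u))) 0 i - w (clip u) 0 i).
Proof. by rewrite /= /blk_fun !mxE. Qed.

Lemma blk_lipf a u v (f : C -> R) L : 0 <= L -> lipf L f ->
  lipf (L * (2 * `|a|)) (fun w => f (blk a u v w)).
Proof.
move=> L0 lf w w' e H; rewrite -mulrA; apply: lf => t.
rewrite /= /blk_fun -scalerBr normrZ; set p := clip _; set q := clip u.
have -> : w p - w q - (w' p - w' q) = w p - w' p - (w q - w' q).
  by rewrite !opprB addrACA [RHS]addrACA [- w q + _]addrC.
rewrite mulrAC mulrC; apply: ler_wpM2r => //; apply: le_trans (ler_normB _ _) _.
by rewrite mulr_natl mulr2n; apply: lerD.
Qed.

Definition topd i w : R := sup [set w t 0 i - w (clip 0) 0 i | t in [set: I01 R]].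

Lemma topd_has_sup i w : has_sup [set w t 0 i - w (clip 0) 0 i | t in [set: I01 R]].
Proof.
split; first by exists (w (clip 0) 0 i - w (clip 0) 0 i), (clip 0).
have [M HM] := path_bounded w; exists (M + M) => _ [t _ <-].
apply: le_trans (ler_norm _) _; apply: le_trans (ler_normB _ _) _.
by apply: lerD; apply: le_trans (rv_coord_le _ _) _.
Qed.

Lemma topd_ub i w t : w t 0 i - w (clip 0) 0 i <= topd i w.
Proof. by apply: ub_le_sup; [exact: (topd_has_sup i w).2 | exists t]. Qed.

Lemma topd_le i w b : (forall t, w t 0 i - w (clip 0) 0 i <= b) -> topd i w <= b.
Proof.
by move=> H; apply: ge_sup; [exact: (topd_has_sup i w).1 | move=> _ [t _ <-]].
Qed.

Lemma topd_lipf i : lipf 2 (topd i).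
Proof.
apply: sup_lipf; first by exists (clip 0).
  move=> w; exists (topd i w) => t _; exact: topd_ub.
move=> t _ w w' e H.
have -> : w t 0 i - w (clip 0) 0 i - (w' t 0 i - w' (clip 0) 0 i) =
    (w t 0 i - w' t 0 i) - (w (clip 0) 0 i - w' (clip 0) 0 i) by lra.
apply: le_trans (ler_normB _ _) _; rewrite mulr_natl mulr2n.
have c s : `|w s 0 i - w' s 0 i| <= e.
  by have := rv_coord_le (w s - w' s) i; rewrite !mxE => h; apply: le_trans h (H s).
exact: lerD.
Qed.

Lemma brownian_blk {dT : measure_display} {T : measurableType dT} (P : probability T R)
    (Y : T -> C) a u v : brownian P Y -> 0 <= u < v -> v <= 1 ->
  `|a| * Num.sqrt (v - u) = 1 -> brownian P (fun o => blk a u v (Y o)).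
Proof.
move=> bY uv v1 aE; apply: (brownian_block bY uv v1 aE).
- rewrite (_ : [set o | _] = setT); first exact: probability_setT.
  apply/seteqP; split => // o _ i; rewrite blkE time_clip ?lexx ?ler01 //.
  by rewrite mul0r addr0 subrr mulr0.
- move=> t i; rewrite (_ : (fun o => _) = (fun o => a *
      (Y o (clip (u + time t * (v - u))) 0 i - Y o (clip u) 0 i))).
    by apply: measurable_funM; [exact: measurable_cst | exact: measurable_incr bY _ _ _].
  by apply/funext => o; rewrite blkE.
by move=> s t i o st; rewrite !blkE; ring.
Qed.

End Blocks.

(** * Brownian maxima and the tail of the Brownian modulus of continuity *)

Section WienerEstimates.
Variables (R : realType) (k : nat).
Local Notation C := (C01 'rV[R]_k).
Variables (W : probability (borel C) R) (hW : wiener_measure W).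
Implicit Types (w : C) (i : 'I_k).

Lemma wiener_brownian : brownian W (fun w : borel C => w : C).
Proof.
split=> // t i; apply: (@measurable_eval R k _ (borel C) (fun w => w : C)).
exact: measurable_id.
Qed.

Lemma blk_expect (G : borel C -> R) a u v : 0 <= u < v -> v <= 1 ->
  `|a| * Num.sqrt (v - u) = 1 -> bmf G ->
  \int[W]_w G (blk a u v w) = \int[W]_w G w.
Proof.
move=> uv v1 aE; exact: (brownian_expect (brownian_blk wiener_brownian uv v1 aE) wiener_brownian).
Qed.

Definition grid_inc i n (w : borel C) : vspace R 'I_n.+1 := fun j => inc n.+1 w (i, j).
Arguments grid_inc i n w : clear implicits.

Let mxi i n j : measurable_fun setT (fun w : borel C => grid_inc i n w j : R).
Proof. exact: measurable_incr wiener_brownian _ _ _. Qed.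

Let xi_law i n :=  brownian_coord_rect (N := n) wiener_brownian i.

Lemma psum_inc i n m w : (m <= n.+1)%N ->
  psum m (grid_inc i n w) = w (gt R n.+1 m) 0 i - w (clip 0) 0 i.
Proof.
elim: m => [|m IH] mn.
  by rewrite /psum big1 // /gt mul0r subrr.
have := @psum_rest R n.+1 m m.+1 (grid_inc i n w) (leqnSn m).
rewrite (bigD1 (Ordinal mn)) /=; last by rewrite ltnSn ltnn.
rewrite big1 ?addr0; last first.
  move=> j /andP[/andP[i1 i2] i3]; case/eqP: i3; apply: val_inj => /=.
  by apply/eqP; rewrite eqn_leq -ltnS i1 leqNgt i2.
rewrite IH; last exact: ltnW.
by rewrite /grid_inc /inc /=; lra.
Qed.

Lemma wiener_tail i (b : R) :
  \int[W]_w ((b < w (clip 1) 0 i - w (clip 0) 0 i)%R%:R : R) = ntail b.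
Proof.
case: hW => _ _ law; have t01 : time (clip (0 : R)) < time (clip 1).
  by rewrite !time_clip ?ltr01 ?lexx ?ler01.
have := law i _ _ t01 `]b, +oo[%classic (measurable_itv _).
rewrite !time_clip ?lexx ?ler01 // subr0 sqrtr1 /ntail => <-.
have mS : measurable [set w : borel C | b < w (clip 1) 0 i - w (clip 0) 0 i].
  by apply: measurable_lt; [exact: measurable_cst | exact: (measurable_incr wiener_brownian)].
rewrite (_ : [set w | _] = [set w : borel C | b < w (clip 1) 0 i - w (clip 0) 0 i]).
  rewrite -(expect_indic W mS); apply: eq_Rintegral => w _; rewrite indicE.
  case: ltP => h; first by rewrite mem_set.
  by rewrite memNset //= ltNge h.
by apply/seteqP; split => w /=; rewrite in_itv /= andbT.
Qed.

Lemma wiener_tail_c i (b : R) :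
  \int[W]_w ((b <= w (clip 1) 0 i - w (clip 0) 0 i)%R%:R : R) = ntail b.
Proof.
case: hW => _ _ law; have t01 : time (clip (0 : R)) < time (clip 1).
  by rewrite !time_clip ?ltr01 ?lexx ?ler01.
have := law i _ _ t01 `[b, +oo[%classic (measurable_itv _).
rewrite !time_clip ?lexx ?ler01 // subr0 sqrtr1 ntail_c /ntail => <-.
have mS : measurable [set w : borel C | b <= w (clip 1) 0 i - w (clip 0) 0 i].
  by apply: measurable_le; [exact: measurable_cst | exact: (measurable_incr wiener_brownian)].
rewrite (_ : [set w | _] = [set w : borel C | b <= w (clip 1) 0 i - w (clip 0) 0 i]).
  rewrite -(expect_indic W mS); apply: eq_Rintegral => w _; rewrite indicE.
  case: leP => h; first by rewrite mem_set.
  by rewrite memNset //= leNgt h.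
by apply/seteqP; split => w /=; rewrite in_itv /= andbT.
Qed.

Lemma measurable_topd i : measurable_fun setT (topd i : borel C -> R).
Proof. by apply: continuous_borel; exact: lipf_continuous (@topd_lipf R k i). Qed.

Lemma gt1 n : gt R n.+1 n.+1 = clip 1.
Proof. by rewrite /gt divff // pnatr_eq0. Qed.

Lemma sqrt_inv_gt0 n : 0 < Num.sqrt (n.+1%:R^-1 : R).
Proof. by rewrite sqrtr_gt0 invr_gt0 ltr0n. Qed.

Lemma bmf_clamp_top i (b e : R) : bmf (fun w : borel C => clamp01 ((topd i w - b) / e)).
Proof.
split; last by exists 1 => w; have /andP[x y] := clamp01_itv ((topd i w - b) / e); rewrite ger0_norm.
have -> : (fun w : borel C => clamp01 ((topd i w - b) / e)) =
    (fun w : borel C => Num.max 0 (Num.min 1 ((topd i w - b) / e))) by [].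
apply: measurable_maxr; first exact: measurable_cst.
apply: measurable_minr; first exact: measurable_cst.
apply: measurable_funM; last exact: measurable_cst.
by apply: measurable_funB; [exact: measurable_topd | exact: measurable_cst].
Qed.

Lemma bmf_reach i (b : R) n : bmf (fun w : borel C => (reach b (grid_inc i n w))%:R : R).
Proof.
apply: (bmf_comp (bmf_bool R (measurable_reach (n := n.+1) b))).
by apply: measurable_vec => j; exact: mxi.
Qed.

(** Reflection for the walk of grid increments, then a limit over grids: when the maximum exceeds
    [b], the walk on a fine enough grid reaches [b]. The clamp replaces an indicator because the
    invariance principle will be applied to Lipschitz functionals. *)
Lemma top_upper i (b e : R) : 0 < e ->
  \int[W]_w clamp01 ((topd i w - b) / e) <= 2 * ntail b.
Proof.
move=> e0; apply/ler_addgt0Pl => r r0.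
have bcl := bmf_clamp_top i b e.
pose re n (w : borel C) : R := (reach b (grid_inc i n w))%:R.
have bre n : bmf (re n) by exact: bmf_reach.
pose u n (w : borel C) := Num.max 0 (clamp01 ((topd i w - b) / e) - re n w).
have u01 n w : 0 <= u n w <= 1.
  have /andP[x y] := clamp01_itv ((topd i w - b) / e).
  have z : 0 <= re n w by rewrite ler0n.
  by rewrite le_max lexx /= ge_max ler01 /=; lra.
have bu n : bmf (u n).
  split; last by exists 1 => w; have /andP[x y] := u01 n w; rewrite ger0_norm.
  apply: measurable_maxr; first exact: measurable_cst.
  by apply: measurable_funB; [case: bcl | case: (bre n)].
have cu : (fun n => \int[W]_w u n w) @ \oo --> (\int[W]_w (0 : R) : R).
  apply: (@expect_dominated _ (borel C) R W u (fun=> 0) 1).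
  - by move=> n; case: (bu n).
  - exact: measurable_cst.
  - by move=> n w; have /andP[x y] := u01 n w; rewrite ger0_norm.
  apply: aeW => w; apply/cvgn_epsP => q q0.
  have [h|h] := leP (topd i w) b.
    exists 0%N => n _; rewrite subr0 /u clamp01_eq0; last first.
      by rewrite pmulr_lle0 ?invr_gt0 // subr_le0.
    by rewrite sub0r max_l ?oppr_le0 ?ler0n // normr0 ltW.
  have [t ht] : exists t, b < w t 0 i - w (clip 0) 0 i.
    apply: contrapT => nex; move: h; rewrite ltNge topd_le // => t.
    by rewrite leNgt; apply/negP => h; apply: nex; exists t.
  have g0 : 0 < w t 0 i - w (clip 0) 0 i - b by rewrite subr_gt0.
  have [dl dl0 Hdl] := path_unif w g0; have [N HN] := inv_nat_small dl0.
  exists N => n Nn; rewrite subr0 /u (_ : re n w = 1).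
    have /andP[x y] := clamp01_itv ((topd i w - b) / e).
    by rewrite max_l ?subr_le0 // normr0 ltW.
  rewrite /re (_ : reach b _ = true) //; apply/existsP.
  have /andP[t0 t1] := time_itv t.
  have x0 : 0 <= n.+1%:R * time t by rewrite mulr_ge0.
  have /andP[m1 m2] := truncn_itv x0.
  have mn : (Num.truncn (n.+1%:R * time t) < n.+2)%N.
    by rewrite ltnS -(ler_nat R) (le_trans m1) // ler_piMr.
  exists (Ordinal mn); rewrite /= psum_inc //.
  move: (Num.truncn _) m1 m2 mn => m m1 m2 mn.
  have := Hdl t (gt R n.+1 m); rewrite time_gt // => /(_ _) hh.
  have /hh {}hh : `|time t - m%:R / n.+1%:R| <= dl.
    apply: le_trans (HN n Nn); have -> : time t - m%:R / n.+1%:R = (n.+1%:R * time t - m%:R) / n.+1%:R.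
      by rewrite mulrBl mulrAC divff ?mul1r // pnatr_eq0.
    rewrite ger0_norm ?divr_ge0 ?subr_ge0 // ler_piMl ?invr_ge0 //.
    by rewrite lerBlDr addrC natr1 ltW.
  have := rv_coord_le (w t - w (gt R n.+1 m)) i; rewrite !mxE => h3.
  have := le_trans h3 hh; rewrite ler_norml => /andP[_ h4]; lra.
move: cu; rewrite expect_cst => /cvgn_epsP /(_ _ r0) [N /(_ N (leqnn N))].
rewrite subr0 => /(le_trans (ler_norm _)) hu.
have h1 : \int[W]_w clamp01 ((topd i w - b) / e) <= \int[W]_w (re N w + u N w).
  apply: expect_le => //; first exact: bmfD.
  by move=> w; rewrite -lerBlDl le_max lexx orbT.
have h2 := @reflect_le R N.+1 b _ (borel C) W (grid_inc i N) _ (sqrt_inv_gt0 N) (@mxi i N) (@xi_law i N).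
have h3 : \int[W]_w ((b <= psum N.+1 (grid_inc i N w))%R%:R : R) = ntail b.
  rewrite -(wiener_tail_c i b); apply: eq_Rintegral => w _.
  by rewrite psum_inc // gt1.
rewrite expectD // in h1; rewrite h3 in h2; rewrite /re in h1; lra.
Qed.

Lemma reflect_close (t J S r S' : R) : 2 * (t - J) <= S' -> J <= r / 2 -> S' <= S ->
  2 * t <= r + S.
Proof. by move=> *; lra. Qed.

(** The grid walk reaches [b] only if the path does, and large increments are ruled out through the
    truncated modulus, whose mean is small on fine grids. *)
Lemma top_lower i (b e : R) : 0 < b -> 0 < e <= 1 ->
  2 * ntail (b + 2 * e) <= \int[W]_w ((b <= topd i w)%R%:R : R).
Proof.
move=> b0 /andP[e0 e1]; apply/ler_addgt0Pl => r r0.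
have mS : measurable [set w : borel C | b <= topd i w].
  by apply: measurable_le; [exact: measurable_cst | exact: measurable_topd].
have bS := bmf_bool R mS.
pose re n (w : borel C) : R := (reach b (grid_inc i n w))%:R.
have bre n : bmf (re n) by exact: bmf_reach.
pose ju n (w : borel C) : R := (jump e (grid_inc i n w))%:R.
have bju n : bmf (ju n).
  apply: (bmf_comp (bmf_bool R (measurable_jump (n := n.+1) e))).
  by apply: measurable_vec => j; exact: mxi.
have h1 n : \int[W]_w re n w <= \int[W]_w ((b <= topd i w)%R%:R : R).
  apply: expect_le => // w; rewrite ler_nat /reach.
  case: (boolP [exists m, _]) => //= /existsP[m].
  rewrite psum_inc; last by rewrite -ltnS ltn_ord.
  by move=> h; rewrite (le_trans h (topd_ub _ _ _)).
have re0 : 0 < r * e / 2 by rewrite divr_gt0 ?mulr_gt0.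
have [dl dl0 Hdl] := osc_small W re0; have [N HN] := inv_nat_small dl0.
have h2 : \int[W]_w ju N w <= r / 2.
  apply: (@le_trans _ _ (\int[W]_w (e^-1 * osc dl w))).
    apply: expect_le => //.
      by apply: bmfZ; apply: blip_bmf; apply: blip_osc; exact: ltW.
    move=> w; rewrite /ju /jump; case: (boolP [exists j, _]) => [/existsP[j hj]|_]; last first.
      by have /andP[x y] := osc_itv w (ltW dl0); rewrite mulr_ge0 // invr_ge0 ltW.
    rewrite mulrC ler_pdivlMr // mul1r le_min e1 /=; apply: le_trans (ltW hj) _.
    rewrite /grid_inc /inc /=; apply: le_trans (ler_norm _) _.
    have := rv_coord_le (w (gt R N.+1 j.+1) - w (gt R N.+1 j)) i; rewrite !mxE => h3.
    apply: le_trans h3 _; apply: mdl_ub; apply: le_trans (HN N (leqnn N)).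
    rewrite !time_gt //; last exact: ltnW (ltn_ord j).
    by rewrite -mulrBl -natrB // subSnn mul1r ger0_norm ?invr_ge0.
  rewrite expectZ; last by apply: blip_bmf; apply: blip_osc; exact: ltW.
  rewrite mulrC ler_pdivrMr //; apply: le_trans Hdl _; lra.
have h3 := @reflect_ge R N.+1 b _ (borel C) W (grid_inc i N) _ (sqrt_inv_gt0 N) (@mxi i N) (@xi_law i N) e b0 (ltW e0).
have h4 : \int[W]_w ((b + 2 * e < psum N.+1 (grid_inc i N w))%R%:R : R) = ntail (b + 2 * e).
  rewrite -(wiener_tail i (b + 2 * e)); apply: eq_Rintegral => w _.
  by rewrite psum_inc // gt1.
rewrite h4 in h3; exact: reflect_close h3 h2 (h1 N).
Qed.

Lemma grid_rescale (N1 j r : R) : N1 != 0 -> j / N1 + (N1 * r - j) / N1 = r.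
Proof. by move=> N0; field. Qed.

Lemma blk_at a (j n : nat) (w : C) (r : I01 R) i : (j < n.+1)%N ->
  j%:R / n.+1%:R <= time r <= j.+1%:R / n.+1%:R ->
  a * (w r 0 i - w (gt R n.+1 j) 0 i) <=
  topd i (blk a (j%:R / n.+1%:R) (j.+1%:R / n.+1%:R) w).
Proof.
move=> jn /andP[r1 r2]; have n1 : (0 : R) < n.+1%:R by rewrite ltr0n.
have dE : j.+1%:R / n.+1%:R - j%:R / n.+1%:R = n.+1%:R^-1 :> R.
  by rewrite -mulrBl -natrB ?subSnn ?mul1r.
have x01 : 0 <= n.+1%:R * time r - j%:R <= 1.
  move: r1 r2; rewrite ler_pdivrMr // ler_pdivlMr // -natr1 => r1 r2.
  by apply/andP; split; lra.
have := topd_ub i (blk a (j%:R / n.+1%:R) (j.+1%:R / n.+1%:R) w)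
  (clip (n.+1%:R * time r - j%:R)).
rewrite !blkE dE !time_clip ?x01 ?lexx ?ler01 // mul0r addr0 subrr mulr0 subr0.
have -> : j%:R / n.+1%:R + (n.+1%:R * time r - j%:R) / n.+1%:R = time r.
  by apply: grid_rescale; rewrite pnatr_eq0.
by rewrite clip_time.
Qed.

(** Two times at distance at most [1 / (n + 1)] lie in the same block or in adjacent ones, so the
    path differs between them by at most three displacements from left endpoints of blocks. *)
Lemma modulus_event (n : nat) (y : R) (w : C) : 0 < y -> y < mdl n.+1%:R^-1 w ->
  exists i (j : 'I_n.+1), exists b : bool, y / 3 * Num.sqrt n.+1%:R <=
    topd i (blk ((-1) ^+ b * Num.sqrt n.+1%:R) (j%:R / n.+1%:R) (j.+1%:R / n.+1%:R) w).
Proof.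
move=> y0 ym; have n1 : (0 : R) < n.+1%:R by rewrite ltr0n.
apply: contrapT => nex; move: ym; rewrite ltNge => /negP; apply.
set q := Num.sqrt _ in nex; have q0 : 0 < q by rewrite sqrtr_gt0.
have bnd i (j : nat) (r : I01 R) : (j < n.+1)%N ->
    j%:R / n.+1%:R <= time r <= j.+1%:R / n.+1%:R ->
    `|w r 0 i - w (gt R n.+1 j) 0 i| <= y / 3.
  move=> jn rj; rewrite leNgt; apply/negP => h; apply: nex.
  exists i, (Ordinal jn), (w r 0 i - w (gt R n.+1 j) 0 i < 0).
  apply: le_trans (blk_at _ w i jn rj).
  rewrite [leRHS]mulrAC; apply: ler_wpM2r; first exact: ltW.
  by rewrite -normrEsign ltW.
have mono (s t : I01 R) : time s <= time t -> `|time s - time t| <= n.+1%:R^-1 ->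
    forall i, `|w s 0 i - w t 0 i| <= y.
  move=> st; rewrite distrC ger0_norm ?subr_ge0 // => d1 i.
  have /andP[s0 s1] := time_itv s; have /andP[t0 t1] := time_itv t.
  pose m := minn (Num.truncn (n.+1%:R * time s)) n.
  have x0 : 0 <= n.+1%:R * time s by rewrite mulr_ge0.
  have /andP[m1 m2] := truncn_itv x0.
  have mn : (m < n.+1)%N by rewrite ltnS geq_minr.
  have sm : m%:R / n.+1%:R <= time s <= m.+1%:R / n.+1%:R.
    rewrite ler_pdivrMr // ler_pdivlMr // mulrC; apply/andP; split.
      by apply: le_trans m1; rewrite ler_nat geq_minl.
    rewrite /m; case: (leqP (Num.truncn (n.+1%:R * time s)) n) => h.
      exact: ltW.
    by rewrite mulrC ler_piMl // ltW.
  move: m mn sm => m mn sm {m1 m2}.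
  have hs := bnd i m s mn sm; have /andP[sm1 sm2] := sm.
  case: (leP (time t) (m.+1%:R / n.+1%:R)) => tm.
    have ht := bnd i m t mn; have /ht {}ht : m%:R / n.+1%:R <= time t <= m.+1%:R / n.+1%:R.
      by rewrite tm andbT (le_trans sm1).
    apply: le_trans (ler_distD (w (gt R n.+1 m) 0 i) _ _) _.
    by rewrite [X in _ + X]distrC; lra.
  have mn' : (m.+1 < n.+1)%N.
    by move: (lt_le_trans tm t1); rewrite ltr_pdivrMr // mul1r ltr_nat.
  have ht := bnd i m.+1 t mn'; have /ht {}ht : m.+1%:R / n.+1%:R <= time t <= m.+2%:R / n.+1%:R.
    rewrite (ltW tm) /=; have -> : m.+2%:R / n.+1%:R = m.+1%:R / n.+1%:R + n.+1%:R^-1 :> R.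
      by rewrite -[m.+2%:R]natr1 mulrDl mul1r.
    by apply: (@le_trans _ _ (time s + n.+1%:R^-1)); [rewrite -lerBlDl | rewrite lerD2r].
  have hg := bnd i m (gt R n.+1 m.+1) mn.
  have /hg {}hg : m%:R / n.+1%:R <= time (gt R n.+1 m.+1) <= m.+1%:R / n.+1%:R.
    by rewrite time_gt // lexx andbT ler_pM2r ?invr_gt0 // ler_nat.
  apply: le_trans (ler_distD (w (gt R n.+1 m) 0 i) _ _) _.
  have h4 := ler_distD (w (gt R n.+1 m.+1) 0 i) (w (gt R n.+1 m) 0 i) (w t 0 i).
  move: h4; rewrite [`|w (gt R n.+1 m) 0 i - w (gt R n.+1 m.+1) 0 i|]distrC.
  rewrite [`|w (gt R n.+1 m.+1) 0 i - w t 0 i|]distrC; lra.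
apply: mdl_le => [|s t h]; first by rewrite invr_ge0.
apply: rv_norm_le => [|i]; first exact: ltW.
rewrite !mxE; case: (leP (time s) (time t)) => st; first exact: mono.
by rewrite distrC; apply: mono; [exact: ltW | rewrite distrC].
Qed.

Lemma measurable_mdl (dl : R) : 0 <= dl -> measurable_fun setT (mdl dl : borel C -> R).
Proof. by move=> dl0; apply: continuous_borel; exact: lipf_continuous (mdl_lipf dl0). Qed.

(** A union bound over [n + 1] blocks, two signs and [k] coordinates. Each block is Brownian at
    scale [n^(-1/2)], so the fourth-power tail gives order [n^-2] per block and [1 / n] in all. *)
Lemma modulus_tail (n : nat) (y : R) : 0 < y ->
  \int[W]_w ((y < mdl n.+1%:R^-1 w)%R%:R : R) <= 576 ^+ 2 * k%:R / (y ^+ 4 * n.+1%:R).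
Proof.
move=> y0; have n1 : (0 : R) < n.+1%:R by rewrite ltr0n.
set q : R := Num.sqrt n.+1%:R; have q0 : 0 < q by rewrite sqrtr_gt0.
have q2 : q ^+ 2 = n.+1%:R by rewrite sqr_sqrtr // ltW.
pose c := y / 3 * q; have c0 : 0 < c by rewrite mulr_gt0 // divr_gt0.
pose f (i : 'I_k) (p : 'I_n.+1 * bool) (w : borel C) : R :=
  clamp01 ((topd i (blk ((-1) ^+ p.2 * q) (p.1%:R / n.+1%:R) (p.1.+1%:R / n.+1%:R) w) - c / 2) / (c / 2)).
have aE (p : 'I_n.+1 * bool) : `|(-1) ^+ p.2 * q| *
    Num.sqrt (p.1.+1%:R / n.+1%:R - p.1%:R / n.+1%:R) = 1.
  rewrite -mulrBl -natrB ?leqnSn // subSnn mul1r normrM normrX normrN1 expr1n mul1r.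
  by rewrite (gtr0_norm q0) sqrtrV ?(ltW n1) // divff // gt_eqF.
have uv (p : 'I_n.+1 * bool) : 0 <= (p.1%:R / n.+1%:R : R) < p.1.+1%:R / n.+1%:R.
  by rewrite divr_ge0 //= ltr_pM2r ?invr_gt0 // ltr_nat.
have v1 (p : 'I_n.+1 * bool) : (p.1.+1%:R / n.+1%:R : R) <= 1.
  by rewrite ler_pdivrMr // mul1r ler_nat.
have bf i p : bmf (f i p).
  have [m1 [M M1]] := bmf_clamp_top i (c / 2) (c / 2); split; last by exists M => w; exact: M1.
  have mb := brownian_measurable (brownian_blk wiener_brownian (uv p) (v1 p) (aE p)).
  exact: (measurableT_comp m1 mb).
have Ef i p : \int[W]_w f i p w <= 2 * (64 / (c / 2) ^+ 4).
  rewrite (blk_expect (uv p) (v1 p) (aE p) (bmf_clamp_top i (c / 2) (c / 2))).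
  apply: le_trans (top_upper i (c / 2) (divr_gt0 c0 _)) _ => //.
  by rewrite ler_wpM2l // ntail_le // divr_gt0.
have bS i := (expect_sum W (index_enum _) (fun p => bf i p)).1.
have ES i := (expect_sum W (index_enum _) (fun p => bf i p)).2.
have bSS := (expect_sum W (index_enum 'I_k) (fun i => bS i)).1.
have ESS := (expect_sum W (index_enum 'I_k) (fun i => bS i)).2.
have mS : measurable [set w : borel C | y < mdl n.+1%:R^-1 w].
  by apply: measurable_lt; [exact: measurable_cst | apply: measurable_mdl; rewrite ?invr_ge0].
apply: (@le_trans _ _ (\int[W]_w \sum_i \sum_p f i p w)).
  apply: expect_le => [||w]; [exact: bmf_bool | exact: bSS |].
  have f0 i p : 0 <= f i p w by have /andP[] := clamp01_itv ((topd i (blk ((-1) ^+ p.2 * q) (p.1%:R / n.+1%:R) (p.1.+1%:R / n.+1%:R) w) - c / 2) / (c / 2)).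
  have ss0 : 0 <= \sum_i \sum_p f i p w by apply: sumr_ge0 => i _; apply: sumr_ge0.
  case: (ltP y (mdl n.+1%:R^-1 w)) => h //=.
  have [i [j [b hb]]] := modulus_event y0 h.
  have fe : f i (j, b) w = 1.
    rewrite /f /= clamp01_eq1 // ler_pdivlMr ?divr_gt0 // mul1r lerBrDl.
    by rewrite -splitr; exact: hb.
  rewrite (bigD1 i) //= (bigD1 (j, b)) //= fe -addrA lerDl addr_ge0 //.
    exact: sumr_ge0.
  by apply: sumr_ge0 => i' _; apply: sumr_ge0.
rewrite ESS; apply: (@le_trans _ _ (\sum_(i < k) \sum_(p : 'I_n.+1 * bool) 2 * (64 / (c / 2) ^+ 4))).
  by apply: ler_sum => i _; rewrite ES; apply: ler_sum => p _; exact: Ef.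
rewrite !sumr_const card_prod card_bool !card_ord -[X in X *+ k]mulr_natl -mulr_natl natrM.
have -> : (c / 2) ^+ 4 = y ^+ 4 * n.+1%:R ^+ 2 / 36 ^+ 2.
  by rewrite -q2 /c; field.
apply: le_of_eq; field.
by rewrite !gt_eqF.
Qed.

End WienerEstimates.

(** * Lipschitz substitutes for the events of staying positive and of oscillating *)

Section Cutoffs.
Variables (R : realType) (k : nat) (i : 'I_k).
Local Notation C := (C01 'rV[R]_k).
Implicit Types (w : C) (b e s x dl : R).

Lemma blk_start a v w : blk a 0 v w (clip 0) 0 i = 0.
Proof.
rewrite blkE time_clip ?lexx ?ler01 // mul0r addr0 subrr mulr0 //.
Qed.

Lemma drop_ub a v w t :
  a * (w (clip (time t * v)) 0 i - w (clip 0) 0 i) <= topd i (blk a 0 v w).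
Proof.
have := topd_ub i (blk a 0 v w) t; rewrite blk_start subr0 blkE.
by rewrite add0r subr0.
Qed.

Lemma drop_le a v w b :
  (forall t : I01 R, a * (w (clip (time t * v)) 0 i - w (clip 0) 0 i) <= b) ->
  topd i (blk a 0 v w) <= b.
Proof.
by move=> h; apply: topd_le => t; rewrite blk_start subr0 blkE add0r subr0.
Qed.

(** [low] lies below the indicator that coordinate [i] never drops by [b]; [upp] lies above the
    indicator that it drops by at most [b * sqrt s] up to time [s]; [wig] passes from [0] to [1] as
    the modulus goes from [x / 2] to [x]. *)
Definition low b e w : R := 1 - clamp01 ((topd i (blk (-1) 0 1 w) - (b - e)) / e).
Definition upp b s e w : R :=
  1 - clamp01 ((topd i (blk (- (Num.sqrt s)^-1) 0 s w) - b) / e).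
Definition wig dl x w : R := clamp01 (2 * mdl dl w / x - 1).

Lemma clamp01_dist (u v : R) : `|clamp01 u - clamp01 v| <= 1 * `|u - v|.
Proof.
have := clamp01_lip u v; rewrite mul1r -(ler_sqrt _ (sqr_ge0 _)) !sqrtr_sqr.
by rewrite -ler_sqr ?nnegrE // !normK ?num_real.
Qed.

Lemma blip_clamp (f : C -> R) L (a : R) b : 0 <= L -> lipf L f ->
  blip (fun w => clamp01 (a * f w + b)).
Proof.
move=> L0 fL; split; last first.
  by exists 1 => w; have /andP[h1 h2] := clamp01_itv (a * f w + b); rewrite ger0_norm.
exists (1 * (`|a| * L)) => w w' e we.
rewrite (le_trans (clamp01_dist _ _)) // !mul1r.
rewrite (_ : _ - _ = a * (f w - f w')); last by ring.
by rewrite normrM -mulrA ler_wpM2l // fL.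
Qed.

Lemma blip_drop a v b e : blip (fun w => clamp01 ((topd i (blk a 0 v w) - b) / e)).
Proof.
have h := @blk_lipf R k a 0 v (topd i) 2 (ler0n R 2) (@topd_lipf R k i).
have -> : (fun w => clamp01 ((topd i (blk a 0 v w) - b) / e)) =
    fun w => clamp01 (e^-1 * topd i (blk a 0 v w) + - (b / e)).
  by apply/funext => w; congr clamp01; rewrite mulrBl mulrC.
by apply: blip_clamp h; rewrite !mulr_ge0.
Qed.

Lemma blip_low b e : blip (low b e).
Proof. by apply: blipD; [exact: blip_cst | apply: blipN; exact: blip_drop]. Qed.

Lemma blip_upp b s e : blip (upp b s e).
Proof. by apply: blipD; [exact: blip_cst | apply: blipN; exact: blip_drop]. Qed.

Lemma blip_wig dl x : 0 <= dl -> blip (wig dl x).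
Proof.
move=> dl0.
have -> : wig dl x = fun w => clamp01 (2 / x * mdl dl w + -1).
  by apply/funext => w; rewrite /wig; congr clamp01; rewrite mulrAC.
by apply: blip_clamp (mdl_lipf dl0); rewrite ler0n.
Qed.

Lemma low_itv b e w : 0 <= low b e w <= 1.
Proof.
by rewrite /low subr_ge0 lerBlDr lerDl; case/andP: (clamp01_itv
  ((topd i (blk (-1) 0 1 w) - (b - e)) / e)) => -> ->.
Qed.

Lemma upp_itv b s e w : 0 <= upp b s e w <= 1.
Proof.
by rewrite /upp subr_ge0 lerBlDr lerDl; case/andP: (clamp01_itv
  ((topd i (blk (- (Num.sqrt s)^-1) 0 s w) - b) / e)) => -> ->.
Qed.

Variables (W : probability (borel C) R) (hW : wiener_measure W).

Lemma drop_clamp_int a v b e : 0 < v <= 1 -> `|a| * Num.sqrt v = 1 ->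
  \int[W]_w clamp01 ((topd i (blk a 0 v w) - b) / e) =
  \int[W]_w clamp01 ((topd i w - b) / e).
Proof.
move=> /andP[v0 v1] av.
apply: (@blk_expect R k W hW (fun w => clamp01 ((topd i w - b) / e)) a 0 v).
- by rewrite lexx.
- by [].
- by rewrite subr0.
- exact: bmf_clamp_top.
Qed.

(** By reflection, the probability of never dropping by a small [b] is of order [b]; this linear
    lower bound is what makes survival from a small height only polynomially expensive. *)
Lemma low_int b e : 0 < e -> 0 <= b - e <= 1 ->
  normal_low R * (b - e) <= \int[W]_w low b e w.
Proof.
move=> e0 be; rewrite /low expectB; [|exact: bmf_cst|exact: blip_bmf (blip_drop _ _ _ _)].
rewrite expect_cst drop_clamp_int ?ltr01 ?lexx // ?normrN1 ?sqrtr1 ?mulr1 //.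
have := ntail_mid be; have := @top_upper R k W hW i (b - e) e e0; lra.
Qed.

Lemma upp_int b s e : 0 < b -> 0 < e <= 1 -> 0 < s <= 1 ->
  \int[W]_w upp b s e w <= 1 - 2 * ntail (b + 3 * e).
Proof.
move=> b0 e01 s01; have /andP[e0 e1] := e01; have /andP[s0 s1] := s01.
rewrite /upp expectB; [|exact: bmf_cst|exact: blip_bmf (blip_drop _ _ _ _)].
have q0 : Num.sqrt s != 0 by rewrite gt_eqF // sqrtr_gt0.
rewrite expect_cst drop_clamp_int //; last first.
  by rewrite normrN ger0_norm ?invr_ge0 ?sqrtr_ge0 // mulVf.
have be0 : 0 < b + e by lra.
have h := @top_lower R k W hW i (b + e) e be0 e01.
have h2 : \int[W]_w ((b + e <= topd i w)%R%:R : R) <=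
    \int[W]_w clamp01 ((topd i w - b) / e).
  apply: expect_le.
  - by apply: bmf_bool; apply: measurable_le; [exact: measurable_cst | exact: measurable_topd].
  - exact: bmf_clamp_top.
  - move=> w; case: (leP (b + e) (topd i w)) => bw; last first.
      by case/andP: (clamp01_itv ((topd i w - b) / e)).
    by rewrite clamp01_eq1 // ler_pdivlMr // mul1r; lra.
have -> : b + 3 * e = b + e + 2 * e by ring.
move: h h2; lra.
Qed.

(** Reflection evaluates both integrals up to a shift of the level, and the Gaussian tail has slope
    at most one; Brownian scaling makes the shortened time [s] disappear. *)
Lemma upp_low_int b b' s e : 0 < b' -> 0 < e <= 1 -> 0 < s <= 1 -> 0 <= b - e ->
  b - e <= b' + 3 * e ->
  \int[W]_w (upp b' s e w - low b e w) <= 2 * (b' - b + 4 * e).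
Proof.
move=> b0 e01 s01 be bb; have /andP[e0 e1] := e01.
rewrite expectB; [|exact: blip_bmf (blip_upp _ _ _)|exact: blip_bmf (blip_low _ _)].
have h1 := upp_int b0 e01 s01.
have : 1 - 2 * ntail (b - e) <= \int[W]_w low b e w.
  rewrite /low expectB; [|exact: bmf_cst|exact: blip_bmf (blip_drop _ _ _ _)].
  rewrite expect_cst drop_clamp_int ?ltr01 ?lexx // ?normrN1 ?sqrtr1 ?mulr1 //.
  have := @top_upper R k W hW i (b - e) e e0; lra.
have := ntail_diff bb; move: h1; lra.
Qed.

Lemma wig_int (n : nat) x : 0 < x ->
  \int[W]_w wig n.+1%:R^-1 x w <= 16 * 576 ^+ 2 * k%:R / x ^+ 4 / n.+1%:R.
Proof.
move=> x0; have x2 : 0 < x / 2 by rewrite divr_gt0.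
have d0 : (0 : R) <= n.+1%:R^-1 by rewrite invr_ge0.
apply: (@le_trans _ _ (\int[W]_w ((x / 2 < mdl n.+1%:R^-1 w)%R%:R : R))).
  apply: expect_le.
  - exact: blip_bmf (blip_wig _ d0).
  - by apply: bmf_bool; apply: measurable_lt; [exact: measurable_cst | exact: measurable_mdl].
  - move=> w; rewrite /wig; case: ltP => h /=.
      by case/andP: (clamp01_itv (2 * mdl n.+1%:R^-1 w / x - 1)).
    rewrite clamp01_eq0 // subr_le0 ler_pdivrMr // mul1r.
    by move: h; rewrite ler_pdivlMr // mulrC.
rewrite (le_trans (modulus_tail hW n x2)) //; apply: le_of_eq.
have xn : x != 0 by rewrite gt_eqF.
have -> : (x / 2) ^+ 4 = x ^+ 4 / 16 by field.
by rewrite !invfM invrK; ring.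
Qed.
End Cutoffs.

Lemma drop_height (u v : int) (H : nat) : 0 < v -> v = u + H%:Z -> - H%:Z <= u.
Proof. lia. Qed.

Lemma linger_le (R : realFieldType) (q h suc l : R) : 0 <= q -> q <= 2^-1 -> 0 <= h ->
  l <= q * h -> h <= suc + l -> l <= 2 * q * suc.
Proof.
move=> q0 q2 h0 lh hs.
have h1 : q * h <= 2^-1 * h by rewrite ler_wpM2r.
have h2 : h <= 2 * suc by lra.
have := ler_wpM2l q0 h2; rewrite mulrA [q * 2]mulrC; exact: le_trans.
Qed.

(** * Survival from height zero, split at the exit from a slab *)

Section Survival.
Variables (R : realType) (d : nat) (D : {linear 'rV[R]_d.+1 -> 'rV[R]_d.+1}).
Local Notation pt := 'rV[int]_d.+1.
Local Notation C := (C01 'rV[R]_d.+1).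
Variables (kappa : R) (k0 : 0 < kappa) (c : pt -> step d -> R).
Hypothesis cP : conductances kappa c.
Implicit Types (p s : seq pt) (x y z : pt) (n : nat).

(** The site at index [0] is exempt, since the walk may start on the boundary at height zero. *)
Definition alive n s : bool := [forall k : 'I_n, 0 < height (nth 0 s k.+1)].
Definition surv n x : R := pexp c n [:: x] (fun s => (alive n s)%:R).
Lemma alive_cat n s t : size s = n.+1 -> alive n (s ++ t) = alive n s.
Proof.
by move=> sn; apply: eq_forallb => i; rewrite nth_cat sn ltnS ltn_ord.
Qed.

Section Induction.
Variables (n T H Mb r : nat) (y x1 : pt) (f : seq pt -> R) (a M rho p0 : R).
Hypotheses (Tn : (T.+1 <= n)%N) (xy : (nrm (x1 - y)%R <= 1)%N) (rM : r = (Mb + 2)%N).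
Hypotheses (M0 : 0 <= M) (fM : forall s, `|f s| <= 2 * M * (alive n s)%:R).
Hypotheses (rho0 : 0 <= rho) (p00 : 0 <= p0).
Let Lam s : R := (alive n s)%:R.
Definition clear p : Prop := [/\ nth 0 p 0 = y,
  forall k, (0 < k < size p)%N -> 0 < height (nth 0 p k) &
  forall k, (k < size p)%N -> (nrm (nth 0 p k - y)%R <= r)%N].
Hypothesis hgood : forall p z j, (0 < size p <= T.+1)%N -> clear p ->
  (nrm (z - y)%R <= r)%N -> height z = H%:Z ->
  p0 <= pexp c (j + n) (rcons p z) Lam /\
  `|pexp c (j + n) (rcons p z) f| <= rho * pexp c (j + n) (rcons p z) Lam.
Local Notation A := (fun z => inslab 0 H z && (nrm (z - x1)%R <= Mb)%N).

Lemma surv_dead p z j : (0 < size p <= n)%N -> height z <= 0 ->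
  pexp c (j + n) (rcons p z) Lam = 0 /\ pexp c (j + n) (rcons p z) f = 0.
Proof.
move=> /andP[p1 pn] hz.
have dead s : take (size (rcons p z)) s = rcons p z -> alive n s = false.
  move=> ts; apply/negP => /forallP al.
  have pn' : ((size p).-1 < n)%N by rewrite prednK.
  have := al (Ordinal pn'); rewrite /= prednK //.
  rewrite -(@nth_take (size (rcons p z))) ?size_rcons // -(size_rcons p z) ts.
  by rewrite nth_rcons ltnn eqxx ltNge hz.
split.
  rewrite -(pexp_cst k0 cP (j + n) (rcons p z) 0); apply: eq_pexp => s _ ts.
  by rewrite /Lam dead.
rewrite -(pexp_cst k0 cP (j + n) (rcons p z) 0); apply: eq_pexp => s _ ts.
by apply/eqP; rewrite -normr_le0; have := fM s; rewrite (dead _ ts) mulr0.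
Qed.

Lemma surv_trivial p j : `|pexp c j p f| <= 2 * M * pexp c j p Lam /\
  0 <= pexp c j p Lam <= 1.
Proof.
split; last first.
  apply/andP; split; first by apply: (pexp_ge0 k0 cP) => s; rewrite ler0n.
  by rewrite -[leRHS](pexp_cst k0 cP j p 1); apply: (pexp_le k0 cP) => s; rewrite lern1 leq_b1.
have := @pexp_dist _ _ _ k0 c cP j p f (fun=> 0) (fun s => 2 * M * Lam s).
rewrite (pexp_cst k0 cP) subr0 pexpZ //; apply => s; rewrite subr0; exact: fM.
Qed.

Hypothesis H0 : (0 < H)%N.

Lemma surv_stop j p z : (size p <= T.+1)%N -> (0 < size p)%N -> clear p ->
  (nrm (z - y)%R <= r)%N -> height z <= H%:Z -> ~~ A z \/ j = 0%N ->
  p0 * stopv c A (fun z => (H%:Z <= height z)%R%:R) j z <=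
    pexp c (j + n) (rcons p z) Lam /\
  `|pexp c (j + n) (rcons p z) f| <=
    rho * pexp c (j + n) (rcons p z) Lam + 2 * M * linger c 0 H Mb x1 j z.
Proof.
move=> sp p1 cp rz hz Az.
have E g : stopv c A g j z = g z by case: Az => [Az|->//]; exact: stopv_out.
have [trv /andP[L0 L1]] := surv_trivial (rcons p z) (j + n).
have M2 : 0 <= 2 * M by rewrite mulr_ge0.
rewrite /linger !E; case: (leP (height z) 0) => z0.
  have pn : (0 < size p <= n)%N by rewrite p1 (leq_trans sp).
  have [-> ->] := surv_dead j pn z0.
  rewrite normr0 mulr0 add0r mulr_ge0 //; split => //.
  by rewrite (_ : (H%:Z <= height z) = false) ?mulr0 //; apply/negbTE; rewrite -ltNge; lia.
move: hz; rewrite le_eqVlt => /orP[/eqP hz|hz].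
  have pT : (0 < size p <= T.+1)%N by rewrite p1.
  have [h1 h2] := hgood j pT cp rz hz.
  rewrite hz lexx mulr1; split => //; apply: le_trans h2 _.
  by rewrite lerDl mulr_ge0.
rewrite (_ : (H%:Z <= height z) = false) ?mulr0; last by apply/negbTE; rewrite -ltNge.
split => //.
have -> : inslab 0 H z by rewrite /inslab z0 add0r.
rewrite mulr1; apply: le_trans trv _; rewrite -[leLHS]add0r; apply: lerD.
  exact: mulr_ge0.
by rewrite ler_piMr.
Qed.

(** First-step analysis up to the exit from the slab. At height zero the walk is dead and [f]
    vanishes, at height [H] the hypothesis [hgood] takes over, and what remains is lingering, paid
    with [2 * M]. *)
Lemma surv_ind j p z : (size p + j = T.+1)%N -> (0 < size p)%N -> clear p ->
  (nrm (z - y)%R <= r)%N -> height z <= H%:Z ->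
  p0 * stopv c A (fun z => (H%:Z <= height z)%R%:R) j z <=
    pexp c (j + n) (rcons p z) Lam /\
  `|pexp c (j + n) (rcons p z) f| <=
    rho * pexp c (j + n) (rcons p z) Lam + 2 * M * linger c 0 H Mb x1 j z.
Proof.
elim: j p z => [|j IH] p z sp p1 cp rz hz.
  by apply: surv_stop => //; [rewrite -sp addn0 | right].
case Az : (A z); last by apply: surv_stop; rewrite ?Az //; [rewrite -sp leq_addr | left].
have /andP[/andP[z0 zH] zM] := Az; rewrite add0r in zH.
have cp' : clear (rcons p z).
  have [c1 c2 c3] := cp; split; first by rewrite nth_rcons p1.
    move=> k; rewrite size_rcons ltnS nth_rcons => /andP[k1].
    by case: ltngtP => // h _; apply: c2; rewrite k1.
  by move=> k; rewrite size_rcons ltnS nth_rcons; case: ltngtP => // h _; exact: c3.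
have step (s : step d) : p0 * stopv c A (fun z => (H%:Z <= height z)%R%:R) j (z + dir s) <=
    pexp c (j + n) (rcons (rcons p z) (z + dir s)) Lam /\
  `|pexp c (j + n) (rcons (rcons p z) (z + dir s)) f| <=
    rho * pexp c (j + n) (rcons (rcons p z) (z + dir s)) Lam +
      2 * M * linger c 0 H Mb x1 j (z + dir s).
  apply: IH => //; rewrite ?size_rcons //; first by rewrite -sp addSnnS.
    apply: leq_trans (nrm_tri _ x1 _) _; rewrite rM.
    have := nrm_stepB z s x1; move: zM xy; lia.
  by rewrite heightD; have := height_dir s; move: zH; lia.
rewrite addSn !pexpS !last_rcons; split.
  rewrite /= Az -avgM; apply: (avg_le k0 cP) => s; exact: (step s).1.
rewrite /linger /= Az -/(linger c 0 H Mb x1 j).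
have h := @avg_dist _ _ _ k0 c cP (fun y => pexp c (j + n) (rcons (rcons p z) y) f)
  (fun y => rho * pexp c (j + n) (rcons (rcons p z) y) Lam +
     2 * M * linger c 0 H Mb x1 j y) 0 0 1 z.
rewrite subr0 add0r mul1r avgD !avgM in h; apply: h => s.
by rewrite subr0 add0r mul1r; exact: (step s).2.
Qed.

Lemma rise_split N j z : rise c H N z <=
  stopv c A (fun z => (H%:Z <= height z)%R%:R) j z + linger c 0 H Mb x1 j z.
Proof.
rewrite /linger -stopvD.
have base N' z' : rise c H N' z' <= (H%:Z <= height z')%R%:R + (inslab 0 H z')%R%:R.
  case: (leP (height z') 0) => z0.
    rewrite /rise /hitp stopv_out; last by rewrite negb_and -leNgt z0.
    by rewrite lerDl ler0n.
  case: (leP H%:Z (height z')) => zH.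
    by apply: le_trans (hitp_le1 k0 cP _ _ _ _) _; rewrite lerDl ler0n.
  by rewrite add0r /inslab z0 add0r zH; exact: (hitp_le1 k0 cP).
elim: j N z => [|j IH] N z /=; first exact: base.
case: ifP => Az; last exact: base.
have /andP[/andP[z0 zH] _] := Az; rewrite add0r in zH.
case: N => [|N].
  rewrite /rise /hitp /= (_ : (H%:Z <= height z) = false); last by apply/negbTE; rewrite -ltNge.
  apply: (avg_ge0 k0 cP) => u.
  by apply: (stopv_ge0 k0 cP) => v; rewrite addr_ge0.
rewrite /rise /hitp /= z0 (_ : (H%:Z <= height z) = false); last by apply/negbTE; rewrite -ltNge.
apply: (avg_le k0 cP) => s; exact: IH.
Qed.
End Induction.

(** From [l <= q * h] and [h <= suc + l] with [q <= 1 / 2] follows [l <= 2 * q * suc], and [suc] is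
    at most the survival probability divided by [p0]. So lingering, too, is bounded by a multiple of
    survival, and the whole error is relative. The extra step in [T.+1] leads from height zero to
    height one. *)
Lemma surv_compare (n T H m r : nat) (y : pt) (f : seq pt -> R) (M rho p0 : R) :
  (T.+1 <= n)%N -> T = (spread d kappa * m * H ^ 2)%N ->
  r = (spread d kappa * m * H + 2)%N -> (0 < H)%N -> 0 <= M ->
  (forall s, `|f s| <= 2 * M * (alive n s)%:R) ->
  (forall s t, size s = n.+1 -> f (s ++ t) = f s) -> 0 <= rho -> 0 < p0 ->
  (rise_start d kappa <= m)%N -> rise_const d kappa * (1 - climb_prob d kappa) ^+ m <= 2^-1 ->
  (forall p z j, (0 < size p <= T.+1)%N -> clear r y p ->
    (nrm (z - y)%R <= r)%N -> height z = H%:Z ->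
    p0 <= pexp c (j + n) (rcons p z) (fun s => (alive n s)%:R) /\
    `|pexp c (j + n) (rcons p z) f| <=
      rho * pexp c (j + n) (rcons p z) (fun s => (alive n s)%:R)) ->
  height y = 0 ->
  `|pexp c n [:: y] f| <=
    (rho + 4 * M * (rise_const d kappa * (1 - climb_prob d kappa) ^+ m) / p0) * surv n y.
Proof.
move=> Tn TE rE H0 M0 fM fext rho0 p00 mS; set q := _ * _ => q2 hgood hy.
have q0 : 0 <= q.
  rewrite mulr_ge0 ?exprn_ge0 //; last by rewrite subr_ge0 ltW // climb_prob_lt1.
  by rewrite divr_ge0 // exprn_ge0 // ltW // rise_prob_gt0.
have B0 : 0 <= rho + 4 * M * q / p0.
  rewrite addr_ge0 // divr_ge0 ?(ltW p00) // mulr_ge0 //; exact: mulr_ge0.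
rewrite /surv -(@pexp_extend _ _ _ k0 c cP n T.+1 [:: y] f) //.
rewrite -(@pexp_extend _ _ _ k0 c cP n T.+1 [:: y] (fun s => (alive n s)%:R)); last first.
  by move=> s t; rewrite add1n => /alive_cat ->.
rewrite addnC addSn !pexpS /=.
have h := @avg_dist _ _ _ k0 c cP (fun x => pexp c (T + n) [:: y; x] f)
  (fun x => pexp c (T + n) [:: y; x] (fun s => (alive n s)%:R)) 0 0 (rho + 4 * M * q / p0) y.
rewrite subr0 add0r in h; apply: h => s; rewrite subr0 add0r; set x := y + dir s.
have cy : clear r y [:: y].
  by split => // [[|k]//|[|k]//] _ /=; rewrite subrr nrm0.
case: (leP (height x) 0) => hx.
  have pn : (0 < size [:: y] <= n)%N by rewrite /=; apply: leq_trans Tn.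
  have [E1 E2] : pexp c (T + n) (rcons [:: y] x) (fun s => (alive n s)%:R : R) = 0 /\
      pexp c (T + n) (rcons [:: y] x) f = 0 by eapply surv_dead; eassumption.
  by rewrite -[[:: y; x]]/(rcons [:: y] x) E1 E2 normr0 mulr0.
have hx1 : height x = 1.
  by move: hx; rewrite /x heightD hy add0r; have := height_dir s; lia.
have xy : (nrm (x - y)%R <= 1)%N.
  by have := nrm_stepB y s y; rewrite subrr nrm0.
have hxH : height x <= H%:Z by rewrite hx1; lia.
have xr : (nrm (x - y)%R <= r)%N by rewrite (leq_trans xy) // rE; lia.
have [h1 h2] : p0 * stopv c (fun z => inslab 0 H z && (nrm (z - x)%R <= spread d kappa * m * H)%N)
      (fun z => (H%:Z <= height z)%R%:R) T x <=
      pexp c (T + n) (rcons [:: y] x) (fun s => (alive n s)%:R) /\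
    `|pexp c (T + n) (rcons [:: y] x) f| <=
      rho * pexp c (T + n) (rcons [:: y] x) (fun s => (alive n s)%:R) +
      2 * M * linger c 0 H (spread d kappa * m * H)%N x T x.
  by eapply surv_ind; try eassumption; [exact: ltW | | ].
move: h1 h2; rewrite -[rcons [:: y] x]/[:: y; x].
set lam := pexp _ _ _ _; set suc := stopv _ _ _ _ _ => h1 h2.
have [N hl] := linger_rise k0 cP H0 hx1 mS; rewrite -TE -/q in hl.
have hr : rise c H N x <= suc + linger c 0 H (spread d kappa * m * H)%N x T x.
  by eapply rise_split; eassumption.
have hh : 0 <= rise c H N x by exact: (hitp_ge0 k0 cP).
move: hl hr h2; set l := linger _ _ _ _ _ _ _; set h := rise _ _ _ _ => hl hr h2.
have l2 : l <= 2 * q * suc by exact: (linger_le q0 q2 hh hl hr).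
have sl : suc <= lam / p0 by rewrite ler_pdivlMr // mulrC.
apply: le_trans h2 _; rewrite [leRHS]mulrDl lerD2l.
apply: (@le_trans _ _ (2 * M * (2 * q * (lam / p0)))).
  rewrite ler_wpM2l ?mulr_ge0 //; apply: le_trans l2 _.
  by rewrite ler_wpM2l // mulr_ge0.
by apply: le_of_eq; ring.
Qed.
End Survival.

(** * Estimates from the moment when height [H] is reached *)

Section AtHit.
Variables (R : realType) (d : nat) (D : {linear 'rV[R]_d.+1 -> 'rV[R]_d.+1}).
Local Notation pt := 'rV[int]_d.+1.
Local Notation C := (C01 'rV[R]_d.+1).
Variables (g : R) (F : C -> R) (L M : R) (n r H : nat) (dl x b b' e a : R).
Variables (p : seq pt) (y z : pt).
Hypotheses (Dh : forall v : 'rV[R]_d.+1, D v 0 0 = g * v 0 0) (g0 : 0 < g).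
Hypotheses (n0 : (0 < n)%N) (dl01 : 0 <= dl < 1) (pn : (size p)%:R <= dl * n%:R).
Hypotheses (p1 : (0 < size p)%N) (cp : clear r y p) (rz : (nrm (z - y)%R <= r)%N).
Hypotheses (hz : height z = H%:Z) (L0 : 0 <= L) (gF : lipf L F).
Hypotheses (FM : forall w, `|F w| <= M) (aM : `|a| <= M) (e0 : 0 < e) (x0 : 0 < x).
Hypotheses (bH : b <= g * (H%:R / Num.sqrt n%:R)).
Hypotheses (bH' : g * (H%:R / Num.sqrt n%:R) <= Num.sqrt (1 - dl) * b').
Implicit Types s : seq pt.
Let wz s : C := dz D n (recen z s).
Let wy s : C := dz D n (recen y (p ++ s)).

Lemma dpt_height (v : pt) :
  dpt D n v 0 0 = g * ((height v)%:~R / Num.sqrt n%:R).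
Proof. by rewrite /dpt Dh !mxE mulrC [in RHS]mulrC; congr (_ * _); rewrite mulrC. Qed.

Lemma dz_start (V : trajectory d.+1) : V 0%N = 0 -> dz D n V (clip 0) = 0.
Proof.
move=> V0; have := dz_at D V n0 (leq0n n); rewrite mul0r => ->.
by rewrite V0 dpt0.
Qed.

Lemma sq0 : 0 < Num.sqrt (n%:R : R). Proof. by rewrite sqrtr_gt0 ltr0n. Qed.

Lemma size_le : (size p <= n)%N.
Proof.
rewrite -(ler_nat R); apply: le_trans pn _; have /andP[_ h] := dl01.
by rewrite ler_piMl // ltW.
Qed.

Lemma low_alive s : nth 0 s 0 = z ->
  low ord0 b e (wz s) <= (alive n (p ++ s))%:R.
Proof.
move=> s0; case: (ltP (topd ord0 (blk (-1) 0 1 (wz s))) b) => tb; last first.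
  rewrite /low clamp01_eq1 ?subrr // ler_pdivlMr // mul1r; lra.
suff -> : alive n (p ++ s) by case/andP: (low_itv ord0 b e (wz s)).
have [c1 c2 c3] := cp.
apply/forallP => k; rewrite nth_cat; case: ltnP => kp; first exact: c2.
set i := (k.+1 - size p)%N; have iN : (i <= n)%N.
  by rewrite /i; apply: leq_trans (leq_subr _ _) _; exact: ltn_ord.
have := drop_ub ord0 (-1) 1 (wz s) (clip (i%:R / n%:R)).
have i01 : 0 <= (i%:R / n%:R : R) <= 1.
  by rewrite divr_ge0 //= ler_pdivrMr ?ltr0n // mul1r ler_nat.
rewrite /wz mulr1 time_clip // dz_at // dz_start; last by rewrite /recen s0 subrr.
rewrite mxE subr0 dpt_height /recen => h.
have h2 := lt_le_trans (le_lt_trans h tb) bH.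
have : 0 < height (nth 0 s i - z) + H%:Z.
  rewrite -(ltr0z R) intrD; move: h2; rewrite mulN1r -mulrN ltr_pM2l //.
  by rewrite -mulNr ltr_pM2r ?invr_gt0 ?sq0 // => h2; rewrite addrC -ltrBlDr sub0r.
by rewrite -hz -heightD subrK.
Qed.

(** Survival is known up to time [n] only, and [size p] steps are already spent; therefore the
    cutoff looks at the window [[0, 1 - dl]], and [b'] has to allow for the rescaling by
    [sqrt (1 - dl)]. *)
Lemma alive_upp s : nth 0 s 0 = z -> alive n (p ++ s) ->
  upp ord0 b' (1 - dl) e (wz s) = 1.
Proof.
move=> s0 /forallP al; have /andP[dl0 dl1] := dl01.
have s1 : 0 < Num.sqrt (1 - dl) by rewrite sqrtr_gt0 subr_gt0.
have B0 : 0 <= g * (H%:R / Num.sqrt n%:R) by rewrite mulr_ge0 ?(ltW g0) // divr_ge0 ?sqrtr_ge0.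
have pos k : (size p + k <= n)%N -> - (g * (H%:R / Num.sqrt n%:R)) <= dpt D n (recen z s k) 0 0.
  move=> kn; rewrite dpt_height -mulrN ler_pM2l // -mulNr ler_pM2r ?invr_gt0 ?sq0 //.
  have pn' : ((size p + k).-1 < n)%N by rewrite prednK // ltn_addr.
  have := al (Ordinal pn'); rewrite /= prednK ?ltn_addr // nth_cat ltnNge leq_addr /= addKn.
  rewrite /recen => hk; rewrite -[H%:R]/(H%:Z%:~R) -rmorphN ler_int.
  have := heightD (nth 0 s k - z) z; rewrite subrK hz; exact: (drop_height hk).
rewrite /upp clamp01_eq0 ?subr0 // ler_pdivrMr // mul0r subr_le0.
apply: drop_le => t; have /andP[t0 t1] := time_itv t.
rewrite dz_start ?mxE ?subr0; last by rewrite /recen s0 subrr.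
set u := time t * (1 - dl).
have u01 : 0 <= u <= 1 - dl.
  rewrite /u mulr_ge0 ?subr_ge0 ?(ltW dl1) //= ler_piMl // subr_ge0 ltW //.
have /andP[u0 u1] := u01.
have [k [th [/andP[th0 th1] kn _ uE ->]]] := dz_interp D (recen z s) (clip u) n0.
rewrite time_clip in uE; last by rewrite u0 /=; lra.
have kth : k%:R + th <= n%:R - (size p)%:R.
  rewrite -uE; apply: (@le_trans _ _ (n%:R * (1 - dl))); first by rewrite ler_wpM2l.
  by rewrite mulrBr mulr1 lerD2l lerN2 mulrC.
have kp : (size p + k <= n)%N.
  by rewrite -(ler_nat R) natrD; move: kth th0; lra.
have E : - (g * (H%:R / Num.sqrt n%:R)) <=
    ((1 - th) *: dpt D n (recen z s k) + th *: dpt D n (recen z s k.+1)) 0 0.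
  rewrite !mxE; have h1 := pos k kp.
  have [th_0|th_0] := eqVneq th 0; first by rewrite th_0 mul0r addr0 subr0 mul1r.
  have kp1 : (size p + k.+1 <= n)%N.
    rewrite addnS -(ltr_nat R) natrD; move: kth; have : 0 < th by rewrite lt_def th_0.
    lra.
  have h2 := pos _ kp1.
  have : (1 - th) * (- (g * (H%:R / Num.sqrt n%:R))) <= (1 - th) * dpt D n (recen z s k) 0 0.
    by rewrite ler_wpM2l // subr_ge0.
  have : th * (- (g * (H%:R / Num.sqrt n%:R))) <= th * dpt D n (recen z s k.+1) 0 0.
    by rewrite ler_wpM2l.
  lra.
rewrite mulNr -mulrN mulrC ler_pdivrMr // [b' * _]mulrC; apply: le_trans bH'.
by rewrite lerNl.
Qed.

Lemma path_dist s : nth 0 s 0 = z ->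
  `|F (wy s) - F (wz s)| <= L * (opn D * (r%:R / Num.sqrt n%:R) + x) +
     2 * M * wig dl x (wz s).
Proof.
move=> s0; have [c1 c2 c3] := cp; have /andP[dl0 dl1] := dl01.
have M0 : 0 <= M by apply: le_trans aM.
have close t : `|wy s t - wz s t| <= opn D * (r%:R / Num.sqrt n%:R) + mdl dl (wz s).
  pose X : trajectory d.+1 := fun k => nth 0 (p ++ s) k.
  have XT k : X (size p + k)%N = nth 0 s k.
    by rewrite /X nth_cat ltnNge leq_addr /= addKn.
  have X0 : X 0%N = y by rewrite -c1 /X nth_cat p1.
  rewrite /wy; have -> : dz D n (recen y (p ++ s)) = dz D n (fun k => X k - X 0%N).
    by rewrite X0.
  apply: (@dz_shift _ _ _ _ _ _ (size p)) => //; first exact: size_le.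
  - by rewrite ler_pdivrMr ?ltr0n.
  - move=> k kp; rewrite X0; case: (ltngtP k (size p)) kp => // [kp _|-> _].
      by rewrite /X nth_cat kp; exact: c3.
    by rewrite -[size p]addn0 XT s0.
  by move=> k; rewrite XT -[in X (size p)](addn0 (size p)) XT s0.
have W01 := clamp01_itv (2 * mdl dl (wz s) / x - 1).
have o0 : 0 <= opn D * (r%:R / Num.sqrt n%:R).
  by rewrite mulr_ge0 ?opn_ge0 // divr_ge0 ?sqrtr_ge0.
case: (leP (mdl dl (wz s)) x) => mx.
  apply: (@le_trans _ _ (L * (opn D * (r%:R / Num.sqrt n%:R) + x))).
    by apply: gF => t; apply: le_trans (close t) _; rewrite lerD2l.
  by rewrite lerDl !mulr_ge0 //; case/andP: W01.
rewrite /wig clamp01_eq1; last by rewrite lerBrDr ler_pdivlMr //; lra.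
rewrite mulr1; apply: le_trans (ler_normB _ _) _.
rewrite (_ : 2 * M = M + M); last by ring.
rewrite -[leLHS]add0r; apply: lerD; last exact: lerD.
by rewrite mulr_ge0 // addr_ge0 // ltW.
Qed.

Variables (kappa : R) (k0 : 0 < kappa) (c : pt -> step d -> R).
Hypothesis cP : conductances kappa c.
Variables (j : nat) (tol v u p0 : R).
Hypotheses (p00 : 0 < p0) (uv0 : 0 <= 2 * M * (v + u) + tol).
Hypothesis h1 : `|clt D c (fun w => low ord0 b e w * (F w - a)) n z| <= tol.
Hypothesis h2 : clt D c (wig dl x) n z <= v.
Hypothesis h3 : clt D c (fun w => upp ord0 b' (1 - dl) e w - low ord0 b e w) n z <= u.
Hypothesis h4 : p0 <= clt D c (low ord0 b e) n z.
Let Lam s : R := (alive n s)%:R.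
Let f s : R := (alive n s)%:R * (F (dz D n (recen y s)) - a).

(** The indicator of survival is squeezed between [low] and [upp], whose means the invariance
    principle provides. The resulting errors are absolute; dividing by [p0], a lower bound for
    survival from this height, makes them relative. *)
Lemma hit_bound :
  p0 <= pexp c (j + n) (rcons p z) Lam /\
  `|pexp c (j + n) (rcons p z) f| <=
    (L * (opn D * (r%:R / Num.sqrt n%:R) + x) + (2 * M * (v + u) + tol) / p0) *
    pexp c (j + n) (rcons p z) Lam.
Proof.
have M0 : 0 <= M by apply: le_trans aM.
have hd s : size s = (size [:: z] + (j + n))%N -> take (size [:: z]) s = [:: z] -> nth 0 s 0 = z.
  by case: s => //= s0 s _ [].
set rho1 := L * _; rewrite !pexp_markov; set lam := pexp c (j + n) [:: z] _.
have lp : p0 <= lam.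
  apply: le_trans h4 _; rewrite -(clt_extend D k0 cP _ j z n0) addnC.
  apply: (pexp_le_in k0 cP) => s ss ts; exact: low_alive (hd s ss ts).
have rho0 : 0 <= rho1.
  by rewrite mulr_ge0 // addr_ge0 ?(ltW x0) // mulr_ge0 ?opn_ge0 // divr_ge0 ?sqrtr_ge0.
split=> //.
have Ec G : clt D c G n z = pexp c (j + n) [:: z] (fun s => G (wz s)).
  by rewrite -(clt_extend D k0 cP _ j z n0) addnC.
have hd1 := @pexp_dist_in _ _ _ k0 c cP (j + n) [:: z] (fun s => f (p ++ s))
  (fun s => low ord0 b e (wz s) * (F (wz s) - a))
  (fun s => rho1 * Lam (p ++ s) + (2 * M * wig dl x (wz s) +
     2 * M * (upp ord0 b' (1 - dl) e (wz s) - low ord0 b e (wz s)))).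
have {hd1} : `|pexp c (j + n) [:: z] (fun s => f (p ++ s)) -
    clt D c (fun w => low ord0 b e w * (F w - a)) n z| <= rho1 * lam +
    (2 * M * clt D c (wig dl x) n z +
     2 * M * clt D c (fun w => upp ord0 b' (1 - dl) e w - low ord0 b e w) n z).
  rewrite !Ec -!pexpZ // -!pexpD //; apply: hd1 => s ss ts.
  have s0 := hd s ss ts; have lo := low_alive s0; have pd := path_dist s0.
  have /andP[lo0 lo1] := low_itv ord0 b e (wz s).
  have Fa : `|F (wz s) - a| <= 2 * M.
    by rewrite mulr2n mulrDl mul1r; apply: le_trans (ler_normB _ _) _; exact: lerD.
  have M2 : 0 <= 2 * M by rewrite mulr_ge0.
  have /andP[up0 up1] := upp_itv ord0 b' (1 - dl) e (wz s).
  have /andP[wi0 wi1] := clamp01_itv (2 * mdl dl (wz s) / x - 1).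
  rewrite -/(wig dl x (wz s)) in wi0 wi1.
  rewrite /f /Lam -/(wy s).
  case: (boolP (alive n (p ++ s))) => al; last first.
    rewrite (negbTE al) /= in lo *.
    have -> : low ord0 b e (wz s) = 0 by apply/eqP; rewrite eq_le lo lo0.
    by rewrite !mul0r subr0 normr0 mulr0 add0r subr0 addr_ge0 // mulr_ge0.
  rewrite (alive_upp s0 al) !mul1r mulr1.
  have -> : F (wy s) - a - low ord0 b e (wz s) * (F (wz s) - a) =
    (F (wy s) - F (wz s)) + (1 - low ord0 b e (wz s)) * (F (wz s) - a) by ring.
  apply: le_trans (ler_normD _ _) _; rewrite addrA; apply: lerD; first exact: pd.
  rewrite normrM ger0_norm ?subr_ge0 // mulrC.
  by rewrite ler_wpM2r // subr_ge0.
set X := pexp c (j + n) [:: z] _; set Y := clt D c _ n z => hX.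
have : `|X| <= rho1 * lam + (2 * M * (v + u) + tol).
  have := ler_normD (X - Y) Y; rewrite subrK => hh; apply: le_trans hh _.
  have a1 : 2 * M * clt D c (wig dl x) n z <= 2 * M * v by rewrite ler_wpM2l // mulr_ge0.
  have a2 : 2 * M * clt D c (fun w => upp ord0 b' (1 - dl) e w - low ord0 b e w) n z <= 2 * M * u.
    by rewrite ler_wpM2l // mulr_ge0.
  move: hX h1 a1 a2; rewrite -/Y; set t1 := 2 * M * clt _ _ _ _ _; set t2 := 2 * M * clt _ _ _ _ _.
  rewrite mulrDr; set t3 := 2 * M * v; set t4 := 2 * M * u; set t5 := rho1 * lam; lra.
move=> hX'; apply: le_trans hX' _; move: uv0; set Z := 2 * M * (v + u) + tol => Z0.
have h1p : 1 <= lam / p0 by rewrite ler_pdivlMr // mul1r.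
rewrite [leRHS]mulrDl lerD2l; have := ler_wpM2l Z0 h1p.
by rewrite mulr1 mulrA mulrAC.
Qed.
End AtHit.

(** * The choice of scales *)

Section Scales.
Variable R : realType.
Implicit Types mu sn Hr sp g : R.

(** With [H] about [mu^-4 * sn], the walk below [H] uses the time [sp * mu * H^2], of relative size
    [sp * mu^-7], and a radius of relative size [sp * mu^-3]. The condition [8 * sp <= mu] fits the
    time into the window [mu^-6], which is still small against the survival cost [mu^-4]. *)
Lemma scales mu sn Hr sp g : 2 <= mu -> 8 * sp <= mu -> 1 <= sp -> 0 < g ->
  2 * g <= mu ^+ 4 -> (g + 2) * mu ^+ 6 <= sn -> mu ^- 4 * sn <= Hr ->
  Hr <= mu ^- 4 * sn + 1 ->
  [/\ g * mu ^- 4 <= g * (Hr / sn),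
      g * (Hr / sn) <= (1 - mu ^- 6) * (g * mu ^- 4 + 2 * mu ^- 6),
      sp * mu * Hr ^+ 2 + 1 <= mu ^- 6 * sn ^+ 2
    & (sp * mu * Hr + 2) / sn <= 3 * sp / mu ^+ 3].
Proof.
move=> mu2 spm sp1 g0 gm snm H1 H2.
have mu0 : 0 < mu by lra.
have mp k : 0 < mu ^+ k by rewrite exprn_gt0.
have mn k : mu ^+ k != 0 by rewrite gt_eqF.
have i2 : mu^-1 <= 2^-1 by rewrite lef_pV2 ?posrE.
have i0 : 0 < mu^-1 by rewrite invr_gt0.
have s0 : 0 < sn by apply: lt_le_trans snm; rewrite mulr_gt0 // addr_gt0.
rewrite -!exprVn in H1 H2 *; move: i2 i0 H1 H2; set i := mu^-1 => i2 i0 H1 H2.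
have im : i * mu = 1 by rewrite mulVf ?gt_eqF.
have imk k : i ^+ k * mu ^+ k = 1 by rewrite -exprMn im expr1n.
have ip k : 0 < i ^+ k by rewrite exprn_gt0.
have i1 k : i ^+ k <= 1 by rewrite exprn_ile1 ?(ltW i0) //; lra.
have t0 : g + 2 <= i ^+ 6 * sn.
  have := ler_wpM2l (ltW (ip 6%N)) snm.
  by rewrite mulrCA imk mulr1.
have gi4 : g * i ^+ 4 <= 2^-1.
  have := ler_wpM2l (ltW (ip 4%N)) gm; rewrite imk; lra.
have i6 : i ^+ 6 <= 4^-1.
  rewrite (exprD i 4 2) (le_trans (ler_wpM2r (ltW (ip 2%N)) (i1 4%N))) // mul1r.
  have -> : (4^-1 : R) = 2^-1 ^+ 2 by rewrite exprVn; congr _^-1; ring.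
  by rewrite lerXn2r ?nnegrE ?(ltW i0) // invr_ge0.
have p4 : i ^+ 6 <= i ^+ 4 by rewrite (exprD i 4 2) ler_piMr // ltW.
have p3 : i ^+ 6 <= i ^+ 3 by rewrite (exprD i 3 3) ler_piMr // ltW.
have a4 : i ^+ 6 * sn <= i ^+ 4 * sn by rewrite ler_wpM2r // ltW.
have a3 : i ^+ 6 * sn <= i ^+ 3 * sn by rewrite ler_wpM2r // ltW.
have H3 : Hr <= 2 * (i ^+ 4 * sn) by lra.
have Hr0 : 0 <= Hr by apply: le_trans H1; rewrite mulr_ge0 // ltW.
have sn1 : 1 <= sn.
  have h : i ^+ 6 * sn <= sn by rewrite ler_piMl // ltW.
  lra.
split.
- by rewrite ler_wpM2l ?(ltW g0) // ler_pdivlMr.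
- rewrite mulrA ler_pdivrMr //.
  have h1 : g * Hr <= g * (i ^+ 4 * sn) + g.
    by rewrite -[X in _ + X]mulr1 -mulrDr ler_wpM2l // ltW.
  have h2 : i ^+ 6 * sn * (g * i ^+ 4 + 2 * i ^+ 6) <= i ^+ 6 * sn * 1.
    rewrite ler_wpM2l //; first by rewrite mulr_ge0 // ltW.
    by move: gi4 i6; set u := g * _; set v := i ^+ 6; lra.
  rewrite (_ : (1 - i ^+ 6) * (g * i ^+ 4 + 2 * i ^+ 6) * sn =
    g * (i ^+ 4 * sn) + 2 * (i ^+ 6 * sn) - i ^+ 6 * sn * (g * i ^+ 4 + 2 * i ^+ 6)); last by ring.
  move: h1 h2 t0; rewrite mulr1; set u := i ^+ 6 * sn; set v := g * (i ^+ 4 * sn).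
  set w := u * _; lra.
- have h1 : Hr ^+ 2 <= (2 * (i ^+ 4 * sn)) ^+ 2.
    by rewrite lerXn2r ?nnegrE // (le_trans Hr0).
  have h2 : sp * mu * Hr ^+ 2 <= sp * mu * (2 * (i ^+ 4 * sn)) ^+ 2.
    by rewrite ler_wpM2l // mulr_ge0 ?(ltW mu0) //; lra.
  have h3 : sp * mu * (2 * (i ^+ 4 * sn)) ^+ 2 = 4 * sp * i * (i ^+ 6 * sn ^+ 2).
    transitivity ((i * mu) * (4 * sp * i * (i ^+ 6 * sn ^+ 2))); first by ring.
    by rewrite im mul1r.
  have h4 : 4 * sp * i <= 2^-1.
    have := ler_wpM2l (ltW i0) spm; rewrite im; lra.
  have h5 : 4 * sp * i * (i ^+ 6 * sn ^+ 2) <= 2^-1 * (i ^+ 6 * sn ^+ 2).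
    by rewrite ler_wpM2r // mulr_ge0 ?sqr_ge0 // ltW.
  have h6 : 2 <= i ^+ 6 * sn ^+ 2.
    rewrite expr2 mulrA; apply: (@le_trans _ _ (i ^+ 6 * sn)); first lra.
    by rewrite ler_peMr // mulr_ge0 // ltW.
  move: h2 h3 h5 h6; set u := i ^+ 6 * sn ^+ 2; lra.
- rewrite ler_pdivrMr //.
  have h1 : sp * mu * Hr <= sp * mu * (2 * (i ^+ 4 * sn)).
    by rewrite ler_wpM2l // mulr_ge0 ?(ltW mu0) //; lra.
  have h2 : sp * mu * (2 * (i ^+ 4 * sn)) = 2 * sp * (i ^+ 3 * sn).
    transitivity ((i * mu) * (2 * sp * (i ^+ 3 * sn))); first by ring.
    by rewrite im mul1r.
  have h3 : 1 * (i ^+ 3 * sn) <= sp * (i ^+ 3 * sn).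
    by rewrite ler_wpM2r // mulr_ge0 // ltW.
  have -> : 3 * sp * i ^+ 3 * sn = 2 * sp * (i ^+ 3 * sn) + sp * (i ^+ 3 * sn) by ring.
  move: h1 h2 h3; rewrite mul1r; set u := i ^+ 3 * sn in a3 *; move: a3 t0; set w := i ^+ 6 * sn.
  set z := sp * u; set z' := 2 * sp * u; lra.
Qed.
End Scales.

Lemma scale_ranges (R : realType) (b e b' : R) : 0 < e -> e <= b / 2 -> b <= 2^-1 ->
  b' = b + 2 * e ->
  [/\ 0 <= b - e <= 1, 0 <= e < 1 /\ 0 < e <= 1, 0 < b' /\ e <= 1, 0 <= 1 - e <= 1 /\ 0 < 1 - e <= 1
    & b - e <= b' + 3 * e /\ 2 * (b' - b + 4 * e) <= 12 * e].
Proof.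
move=> e0 e1 e2 ->; split; [|split|split|split|split]; try (apply/andP; split); lra.
Qed.

Lemma eight_parts (R : realType) (a b c d e f h mu : R) : 0 <= a -> 0 <= b -> 0 <= c ->
  0 <= d -> 0 <= e -> 0 <= f -> 0 <= h -> 2 + a + b + c + d + e + f + h <= mu ->
  [/\ 2 <= mu, a <= mu, b <= mu & c <= mu] /\ [/\ d <= mu, e <= mu, f <= mu & h <= mu].
Proof. by move=> *; split; split; lra. Qed.

Lemma quarter_bound (R : realType) (a mu s : R) : 0 < s -> 0 < mu -> 4 * a / s <= mu ->
  a / mu <= s / 4.
Proof.
move=> s0 mu0; rewrite !ler_pdivrMr // => h; rewrite mulrAC ler_pdivlMr //.
by rewrite mulrC [s * mu]mulrC.
Qed.

Lemma err_split (R : realType) (M Q p mu : R) :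
  4 * M * Q / p / mu = 4 * M / p * (Q / mu).
Proof. by ring. Qed.

Lemma err_three (R : realType) (M r p mu : R) : p != 0 -> mu != 0 ->
  4 * M * r / (p / 4 * mu ^- 4) = (4 * M / (p / 4)) * (r * mu ^+ 4).
Proof. by move=> p0 m0; field; rewrite m0 p0. Qed.

Lemma err_two (R : realType) (M C1 p mu : R) : p != 0 -> mu != 0 ->
  (2 * M * ((C1 * mu ^- 6 + mu ^- 6) + (12 * mu ^- 6 + mu ^- 6)) + mu ^- 6) /
    (p / 4 * mu ^- 4) = (2 * M * (C1 + 14) + 1) / (p / 4) * mu ^- 2.
Proof. by move=> p0 m0; field; rewrite m0 p0. Qed.

Lemma quarter_sum (R : realType) (a b c mu s : R) : 0 < s -> (a + b + c) / mu <= s / 4 ->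
  a / mu + s / 4 + b / mu + c / mu <= s.
Proof. by move=> s0; rewrite !mulrDl; lra. Qed.

(** * Conditional expectations are close to one constant, uniformly at height zero *)

Section Conditional.
Variables (R : realType) (d : nat) (D : {linear 'rV[R]_d.+1 -> 'rV[R]_d.+1}).
Local Notation pt := 'rV[int]_d.+1.
Local Notation C := (C01 'rV[R]_d.+1).
Variables (W : probability (borel C) R) (hW : wiener_measure W).
Variables (kappa : R) (k0 : 0 < kappa) (c : pt -> step d -> R).
Hypotheses (cP : conductances kappa c) (hc : uniform_clt D W c).
Variables (g : R) (g0 : 0 < g).
Hypothesis Dh : forall v : 'rV[R]_d.+1, D v 0 0 = g * v 0 0.
Variables (F : C -> R) (L M : R).
Hypotheses (L0 : 0 <= L) (gF : lipf L F) (FM : forall w, `|F w| <= M).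

Lemma blip_cont_at (f : C -> R) w : blip f -> cont_at f w.
Proof.
move=> [[K fK] _] e e0; have K1 : 0 < Num.max 0 K + 1 by rewrite ltr_wpDl // le_max lexx.
exists (e / (Num.max 0 K + 1)); first exact: divr_gt0.
move=> w' ww; apply: le_trans (fK _ _ _ ww) _.
rewrite mulrCA ler_piMr ?(ltW e0) // ler_pdivrMr // mul1r.
by apply: (@le_trans _ _ (Num.max 0 K)); [rewrite le_max lexx orbT | lra].
Qed.

Lemma uclt_of_blip (f : C -> R) (K tol : R) : blip f -> 0 < tol ->
  exists n0, forall n, (n0 <= n)%N -> forall x : pt, (nrm x)%:R <= K * Num.sqrt n%:R :> R ->
    `|clt D c f n x - \int[W]_u f u| <= tol.
Proof.
move=> bf t0; have [mf [B fB]] := blip_bmf bf.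
by apply: (hc K mf fB) => //; apply: aeW => w; exact: blip_cont_at.
Qed.

Variable C0 : R.
Hypotheses (C0pos : 0 <= C0) (C0E : C0 = 16 * 576 ^+ 2 * d.+1%:R).

(** Three sources of error: the displacement before height [H] is reached; the absolute errors of
    the invariance principle divided by the survival cost; lingering divided by the same cost. *)
Definition cond_err (m : nat) (x : R) : R :=
  L * (opn D * (3 * (spread d kappa)%:R / m%:R ^+ 3) + x) +
  (2 * M * ((C0 / x ^+ 4 * m%:R ^- 6 + m%:R ^- 6) + (12 * m%:R ^- 6 + m%:R ^- 6)) +
     m%:R ^- 6) / (normal_low R * g / 4 * m%:R ^- 4) +
  4 * M * (rise_const d kappa * (1 - climb_prob d kappa) ^+ m) /
     (normal_low R * g / 4 * m%:R ^- 4).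

Let M0 : 0 <= M. Proof. by apply: le_trans (FM (cst 0 : C)). Qed.
Let nl0 := @normal_low_gt0 R.

Lemma cond_m (m : nat) (x : R) : (2 <= m)%N -> (rise_start d kappa <= m)%N ->
  (8 * spread d kappa <= m)%N -> 4 <= normal_low R * g * m%:R ^+ 2 ->
  2 <= g * m%:R ^+ 2 -> 2 * g <= m%:R ^+ 4 ->
  rise_const d kappa * (1 - climb_prob d kappa) ^+ m <= 2^-1 -> 0 < x ->
  exists2 a : R, `|a| <= M & forall K : R, exists n0, forall n, (n0 <= n)%N ->
    forall y : pt, height y = 0 -> (nrm y)%:R <= K * Num.sqrt n%:R :> R ->
    `|pexp c n [:: y] (fun s => (alive n s)%:R * (F (dz D n (recen y s)) - a))| <=
    cond_err m x * surv c n y.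
Proof.
move=> m2 mS m8 mnl mg mg4 mq x0.
set mu : R := m%:R in mnl mg mg4 *; set e := mu ^- 6; set b := g * mu ^- 4.
have mu2 : 2 <= mu by rewrite ler_nat.
have mu0 : 0 < mu by lra.
have mu3 : mu <= mu ^+ 3 by rewrite ler_eXnr //; lra.
have mp k : 0 < mu ^+ k by rewrite exprn_gt0.
have e0 : 0 < e by rewrite invr_gt0.
have E46 : mu ^- 4 = mu ^+ 2 * e.
  by rewrite /e; have mun : mu != 0 by [rewrite gt_eqF]; field.
have eb : e <= b / 2.
  rewrite /b E46; have := ler_wpM2r (ltW e0) mg; lra.
have b2 : b <= 2^-1.
  rewrite /b ler_pdivrMr //; lra.
have b0 : 0 < b by rewrite mulr_gt0 // invr_gt0.
(* [wig_int] is stated for reciprocals of positive integers. *)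
have en : e = ((m ^ 6).-1).+1%:R^-1.
  by rewrite prednK ?expn_gt0 ?(ltn_trans _ m2) // natrX.
set b' := b + 2 * e.
have [be01 [dl01 e01] [b'0 e1] [q1 ve01] [bb' u12]] := scale_ranges e0 eb b2 (erefl b').
have /andP[q10 q11] := q1.
set lw : C -> R := low ord0 b e; have blw : blip lw by exact: blip_low.
have bF : blip F by split; [exists L | exists M].
have I1 := low_int ord0 hW e0 be01; rewrite -/lw in I1.
set I0 := \int[W]_w lw w in I1.
set p0 := normal_low R * g / 4 * mu ^- 4.
have p0E : p0 = normal_low R * b / 4 by rewrite /p0 /b; ring.
have p00 : 0 < p0 by rewrite p0E divr_gt0 // mulr_gt0.
have ep : e <= p0.
  rewrite p0E /b E46; have := ler_wpM2r (ltW e0) mnl; rewrite -/mu; lra.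
(* The factor [2] leaves room for an error [e <= p0] in the invariance principle. *)
have I2 : 2 * p0 <= I0.
  apply: le_trans I1; rewrite p0E.
  have h : normal_low R * (b / 2) <= normal_low R * (b - e).
    by rewrite ler_wpM2l ?(ltW nl0) //; lra.
  apply: le_trans h; apply: le_of_eq; by field.
have I00 : 0 < I0 by lra.
(* The constant is the Wiener mean of [F] weighted by [low], a smooth conditioning on not dropping
   by [b]; with it the functional [f1] below has mean zero. *)
set a := \int[W]_w (lw w * F w) / I0.
have lw0 w : 0 <= lw w by case/andP: (low_itv ord0 b e w).
have aM : `|a| <= M.
  rewrite /a normrM normfV (gtr0_norm I00) ler_pdivrMr //.
  have h := @expect_dist _ _ _ W (fun w => lw w * F w) (fun=> 0) (fun w => M * lw w)
    (blip_bmf (blipM blw bF)) (bmf_cst 0) (bmfZ M (blip_bmf blw)).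
  rewrite expect_cst subr0 expectZ in h; last exact: blip_bmf.
  apply: h => w; rewrite subr0 normrM (ger0_norm (lw0 w)) mulrC.
  by rewrite ler_wpM2r.
exists a => // K.
set f1 : C -> R := fun w => lw w * (F w - a).
have bf1 : blip f1 by apply: blipM => //; apply: blipD => //; exact: blip_cst.
have If1 : \int[W]_w f1 w = 0.
  rewrite /f1; under eq_Rintegral do rewrite mulrBr [_ * a]mulrC.
  rewrite expectB; [|exact: blip_bmf (blipM blw bF)|exact: bmfZ (blip_bmf blw)].
  rewrite expectZ; last exact: blip_bmf.
  by rewrite /a -/I0 divfK ?subrr // gt_eqF.
set f2 : C -> R := wig e x; have bf2 : blip f2 by exact: blip_wig (ltW e0).
set f3 : C -> R := fun w => upp ord0 b' (1 - e) e w - lw w.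
have bf3 : blip f3 by apply: blipD; [exact: blip_upp | exact: blipN].
(* A walk started within [K * sqrt n] reaches height [H] within [(K + 1) * sqrt n], and the
   invariance principle is needed there. *)
have [n1 h1] := uclt_of_blip (K + 1) bf1 e0.
have [n2 h2] := uclt_of_blip (K + 1) bf2 e0.
have [n3 h3] := uclt_of_blip (K + 1) bf3 e0.
have [n4 h4] := uclt_of_blip (K + 1) blw e0.
set S := (g + 2) * mu ^+ 6.
have S0 : 0 < S by rewrite mulr_gt0 // addr_gt0.
exists (maxn (maxn n1 n2) (maxn (maxn n3 n4) (Num.truncn (S ^+ 2)).+1)) => n.
rewrite !geq_max => /andP[/andP[N1 N2] /andP[/andP[N3 N4] N5]] y hy yK.
set sn := Num.sqrt n%:R in yK *.
have snS : S <= sn.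
  rewrite -[leLHS]ger0_norm ?(ltW S0) // -sqrtr_sqr ler_wsqrtr // ltW //.
  by rewrite -truncn_lt_nat // sqr_ge0.
have sn0 : 0 < sn by apply: lt_le_trans snS.
have snE : sn ^+ 2 = n%:R by rewrite sqr_sqrtr ?ler0n.
set H := (Num.truncn (mu ^- 4 * sn)).+1.
have es0 : 0 <= mu ^- 4 * sn by rewrite mulr_ge0 ?(ltW sn0) // invr_ge0 ltW.
have /andP[Hl Hu] := truncn_itv es0.
have Hlo : mu ^- 4 * sn <= H%:R by exact: ltW.
have Hup : H%:R <= mu ^- 4 * sn + 1 by rewrite /H -natr1 lerD2r.
have sp1 : (1 : R) <= (spread d kappa)%:R by rewrite ler1n /spread.
have sp8 : 8 * (spread d kappa)%:R <= mu by rewrite -natrM ler_nat.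
have [A1 A2 A3 A4] := scales mu2 sp8 sp1 g0 mg4 snS Hlo Hup.
rewrite -/b -/e -/b' in A1 A2 A3 A4.
set T := (spread d kappa * m * H ^ 2)%N; set r := (spread d kappa * m * H + 2)%N.
have TnR : (T.+1)%:R <= e * n%:R.
  by rewrite -snE -natr1 /T 2!natrM natrX.
have n00 : (0 < n)%N by apply: leq_trans N5.
have Tn : (T.+1 <= n)%N.
  rewrite -(ler_nat R); apply: le_trans TnR _; exact: ler_piMl.
have rsn : r%:R / sn <= 3 * (spread d kappa)%:R / mu ^+ 3.
  by rewrite /r natrD 2!natrM.
have bH' : g * (H%:R / sn) <= Num.sqrt (1 - e) * b'.
  apply: le_trans A2 _; apply: ler_wpM2r; first exact: ltW.
  rewrite -[X in X <= _](ger0_norm q10) -sqrtr_sqr ler_wsqrtr // expr2.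
  exact: ler_piMr.
have fM s : `|(alive n s)%:R * (F (dz D n (recen y s)) - a)| <= 2 * M * (alive n s)%:R.
  rewrite normrM ger0_norm ?ler0n // mulrC ler_wpM2r ?ler0n //.
  by rewrite mulr2n mulrDl mul1r; apply: le_trans (ler_normB _ _) _; exact: lerD.
have fext s t : size s = n.+1 ->
    (alive n (s ++ t))%:R * (F (dz D n (recen y (s ++ t))) - a) =
    (alive n s)%:R * (F (dz D n (recen y s)) - a).
  move=> ss; rewrite alive_cat //; congr (_ * (F _ - _)); apply: dz_prefix => // k kn.
  by rewrite /recen nth_cat ss ltnS kn.
set v := C0 / x ^+ 4 * e + e; set u := 12 * e + e.
have C00 : 0 <= C0 / x ^+ 4 by rewrite divr_ge0 ?exprn_ge0 ?(ltW x0).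
have uv0 : 0 <= 2 * M * (v + u) + e.
  have Ce : 0 <= C0 / x ^+ 4 * e by exact: mulr_ge0 C00 (ltW e0).
  apply: addr_ge0 (ltW e0); apply: mulr_ge0; first exact: mulr_ge0.
  apply: addr_ge0; apply: addr_ge0 => //; try exact: ltW; exact: mulr_ge0 (ltW e0).
set rho := L * (opn D * (3 * (spread d kappa)%:R / mu ^+ 3) + x) +
  (2 * M * (v + u) + e) / p0.
have rho0 : 0 <= rho.
  rewrite addr_ge0 //; last by rewrite divr_ge0 // ltW.
  rewrite mulr_ge0 // addr_ge0 ?(ltW x0) // mulr_ge0 ?opn_ge0 // divr_ge0 //.
  exact: ltW (mp 3%N).
apply: (@surv_compare R d kappa k0 c cP n T H m r y
  (fun s => (alive n s)%:R * (F (dz D n (recen y s)) - a)) M rho p0 Tn) => //.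
move=> p z j /andP[p1 pT] cp rz hz.
have zK : (nrm z)%:R <= (K + 1) * sn.
  rewrite mulrDl mul1r; apply: (@le_trans _ _ ((nrm y)%:R + r%:R)).
    rewrite -natrD ler_nat; have := nrm_tri z y 0; rewrite !subr0 addnC => h.
    by apply: leq_trans h _; rewrite leq_add2l.
  apply: lerD => //; rewrite -[leRHS]mul1r -ler_pdivrMr //.
  apply: le_trans rsn _; rewrite ler_pdivrMr // mul1r.
  apply: le_trans mu3; apply: le_trans sp8; rewrite ler_wpM2r ?ler0n // ler_nat //.
have pn : (size p)%:R <= e * n%:R by apply: le_trans TnR; rewrite ler_nat.
have g1 : `|clt D c f1 n z| <= e by have := h1 n N1 z zK; rewrite If1 subr0.
have g2 : clt D c f2 n z <= v.
  have := h2 n N2 z zK; rewrite ler_distl => /andP[_ h].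
  apply: le_trans h _; rewrite lerD2r /f2 en C0E; exact: wig_int.
have g3 : clt D c f3 n z <= u.
  have := h3 n N3 z zK; rewrite ler_distl => /andP[_ h].
  apply: le_trans h _; rewrite lerD2r /f3.
  exact: le_trans (upp_low_int ord0 hW b'0 e01 ve01 (proj1 (andP be01)) bb') u12.
have g4 : p0 <= clt D c lw n z.
  have := h4 n N4 z zK; rewrite ler_distl => /andP[h _].
  apply: le_trans h; rewrite lerBrDr; apply: le_trans I2.
  by rewrite mulr2n mulrDl mul1r lerD2l.
have [r1 r2] := @hit_bound R d D g F L M n r H e x b b' e a p y z Dh g0 n00 dl01 pn p1
  cp rz hz L0 gF FM aM e0 x0 A1 bH' kappa k0 c cP j e v u p0 p00 uv0 g1 g2 g3 g4.
split; first exact: r1.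
apply: le_trans r2 _; apply: ler_wpM2r; first by apply: le_trans r1; exact: ltW.
rewrite /rho lerD2r; apply: ler_wpM2l => //; rewrite lerD2r; apply: ler_wpM2l rsn; exact: opn_ge0.
Qed.

(** After division by the survival cost, of order [m^-4], the cutoff errors are of order [m^-2] and
    lingering is [m^4] times a geometric term. The oscillation threshold [x] is fixed before [m], as
    its error involves [x^-4 * m^-6]. *)
Lemma cond_err_small (sigma : R) : 0 < sigma -> exists (m : nat) (x : R),
  [/\ (2 <= m)%N, (rise_start d kappa <= m)%N & (8 * spread d kappa <= m)%N] /\
  [/\ 4 <= normal_low R * g * m%:R ^+ 2, 2 <= g * m%:R ^+ 2, 2 * g <= m%:R ^+ 4,
    rise_const d kappa * (1 - climb_prob d kappa) ^+ m <= 2^-1 & 0 < x] /\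
  cond_err m x <= sigma.
Proof.
move=> s0; pose x := sigma / (4 * (L + 1)).
have x0 : 0 < x by rewrite divr_gt0 // mulr_gt0 // ltr_wpDl.
have Lx : L * x <= sigma / 4.
  have L1 : 0 < L + 1 by rewrite ltr_wpDl.
  rewrite /x mulrA ler_pdivrMr ?mulr_gt0 // (_ : sigma / 4 * (4 * (L + 1)) = L * sigma + sigma).
    by rewrite lerDl ltW.
  by field.
set p := normal_low R * g; have p0 : 0 < p by rewrite mulr_gt0.
set eta := climb_prob d kappa; have eta0 : 0 < eta by exact: climb_prob_gt0.
have eta1 : eta < 1 by exact: climb_prob_lt1.
set rc := rise_const d kappa; have rc0 : 0 <= rc.
  by rewrite divr_ge0 // exprn_ge0 // ltW // rise_prob_gt0.
have [c8 [c80 c8E]] : exists c8 : R, 0 <= c8 /\ c8 = 8 ^+ 4.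
  by exists (8 ^+ 4); split => //; apply: exprn_ge0; exact: ler0n.
have e80 : 0 <= eta ^+ 8 by apply: exprn_ge0; exact: ltW.
pose Q := rc * (8 * c8 / eta ^+ 8).
have Q0 : 0 <= Q by apply: mulr_ge0 => //; apply: divr_ge0 => //; exact: mulr_ge0 (ler0n _ _) c80.
set spr := (spread d kappa)%:R : R.
pose A1 := L * (opn D * (3 * spr)).
pose A2 := (2 * M * (C0 / x ^+ 4 + 14) + 1) / (p / 4).
pose A3 := 4 * M * Q / (p / 4).
have C00 : 0 <= C0 / x ^+ 4 by rewrite divr_ge0 ?exprn_ge0 ?(ltW x0).
have p4 : 0 < p / 4 by rewrite divr_gt0.
have A10 : 0 <= A1 by rewrite !mulr_ge0 ?opn_ge0 // ler0n.
have A20 : 0 <= A2.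
  by rewrite divr_ge0 ?(ltW p4) // addr_ge0 // mulr_ge0 ?mulr_ge0 // addr_ge0.
have A30 : 0 <= A3 by rewrite divr_ge0 ?(ltW p4) // mulr_ge0 // mulr_ge0.
pose S := 2 + (rise_start d kappa)%:R + 8 * spr + 4 / p + 2 / g + 2 * g + 2 * Q +
   4 * (A1 + A2 + A3) / sigma.
(* A multiple of [8]: Bernoulli gives [(1 - eta) ^+ j <= 1 / (j * eta)], whose eighth power
   outweighs [mu ^+ 4]. *)
pose j := (Num.truncn S).+1; pose m := (8 * j)%N; exists m, x.
have z1 : 0 <= 4 / p by rewrite divr_ge0 ?(ltW p0).
have z2 : 0 <= 2 / g by rewrite divr_ge0 ?(ltW g0).
have z3 : 0 <= 2 * g by rewrite mulr_ge0 ?(ltW g0).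
have z4 : 0 <= 4 * (A1 + A2 + A3) / sigma.
  by apply: divr_ge0 (ltW s0); apply: mulr_ge0 => //; do 2!apply: addr_ge0 => //.
have r0 : 0 <= (rise_start d kappa)%:R :> R by exact: ler0n.
have spr0 : 0 <= spr by exact: ler0n.
have S0 : 0 <= S by rewrite /S; lra.
have Sj : S < j%:R by case/andP: (truncn_itv S0).
have jm : j%:R <= m%:R :> R by rewrite ler_nat leq_pmull.
set mu : R := m%:R in jm *.
have Sm : S <= mu by exact: le_trans (ltW Sj) jm.
have spr8 : 0 <= 8 * spr by exact: mulr_ge0.
have Q2 : 0 <= 2 * Q by exact: mulr_ge0.
have [[s1 s2 s3 s4] [s5 s6 s7 s8]] := eight_parts r0 spr8 z1 z2 z3 Q2 z4 Sm.
have mu8 : mu = 8 * j%:R by rewrite /mu /m natrM.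
have mu1 : 1 <= mu by apply: le_trans s1; rewrite ler1n.
have mu0 : 0 < mu by exact: lt_le_trans ltr01 mu1.
have m12 : mu <= mu ^+ 2 by rewrite ler_eXnr.
have m14 : mu <= mu ^+ 4 by rewrite ler_eXnr.
have j1 : 1 <= j%:R :> R by rewrite ler1n.
have j0 : 0 < j%:R :> R by exact: lt_le_trans ltr01 j1.
have q8 : rc * (1 - eta) ^+ m * mu ^+ 4 <= Q / mu.
  have eta01 : 0 <= eta <= 1 by rewrite !ltW.
  have bj := bernoulli_le j eta01.
  have jn : 0 < j%:R * eta by exact: mulr_gt0.
  have e1 : (1 - eta) ^+ j <= (j%:R * eta)^-1.
    rewrite -[leRHS]mul1r ler_pdivlMr //; apply: le_trans bj.
    by rewrite ler_wpM2l ?exprn_ge0 ?subr_ge0 ?(ltW eta1) // lerDr.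
  have e2 : (1 - eta) ^+ m <= (j%:R * eta) ^- 8.
    rewrite /m mulnC exprM -exprVn lerXn2r ?nnegrE ?invr_ge0 ?(ltW jn) //.
    by rewrite exprn_ge0 // subr_ge0 ltW.
  rewrite -mulrA /Q -mulrA; apply: ler_wpM2l => //.
  apply: (@le_trans _ _ ((j%:R * eta) ^- 8 * mu ^+ 4)).
    by rewrite ler_wpM2r // exprn_ge0 // ltW.
  rewrite mu8; have en : eta != 0 by rewrite gt_eqF.
  have jn0 : (j%:R : R) != 0 by rewrite gt_eqF.
  have -> : (j%:R * eta) ^- 8 * (8 * j%:R) ^+ 4 = (c8 / eta ^+ 8) * j%:R ^- 4.
    rewrite [(8 * _) ^+ 4]exprMn -c8E; by field; rewrite jn0 en.
  have -> : 8 * c8 / eta ^+ 8 / (8 * j%:R) = (c8 / eta ^+ 8) * j%:R^-1.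
    by field; rewrite jn0 en.
  apply: ler_wpM2l; first exact: divr_ge0.
  by rewrite lef_pV2 ?posrE ?exprn_gt0 ?ler_eXnr.
have mun : mu != 0 by rewrite gt_eqF.
have qQ : rc * (1 - eta) ^+ m <= Q / mu.
  apply: le_trans q8; rewrite ler_peMr ?exprn_ege1 //.
  by rewrite mulr_ge0 // exprn_ge0 // subr_ge0 ltW.
split; [split | split; [split => // |]].
- by rewrite -(ler_nat R) -/mu.
- by rewrite -(ler_nat R) -/mu.
- by rewrite -(ler_nat R) natrM -/mu -/spr.
- rewrite -/p mulrC -ler_pdivrMr //; exact: le_trans s4 m12.
- rewrite mulrC -ler_pdivrMr //; exact: le_trans s5 m12.
- exact: le_trans s6 m14.
- by apply: le_trans qQ _; rewrite ler_pdivrMr // ler_pdivlMl.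
have h3 : 4 * M * (rc * (1 - eta) ^+ m) / (p / 4 * mu ^- 4) <= A3 / mu.
  rewrite err_three ?(gt_eqF p0) //.
  have -> : A3 / mu = (4 * M / (p / 4)) * (Q / mu) by exact: err_split.
  by apply: ler_wpM2l => //; rewrite divr_ge0 ?(ltW p4) // mulr_ge0.
have h2 : (2 * M * ((C0 / x ^+ 4 * mu ^- 6 + mu ^- 6) + (12 * mu ^- 6 + mu ^- 6)) + mu ^- 6) /
    (p / 4 * mu ^- 4) <= A2 / mu.
  rewrite err_two ?(gt_eqF p0) // -/A2.
  by rewrite ler_wpM2l // lef_pV2 ?posrE ?exprn_gt0.
have h1 : L * (opn D * (3 * spr / mu ^+ 3) + x) <= A1 / mu + sigma / 4.
  rewrite mulrDr; apply: lerD => //.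
  have -> : L * (opn D * (3 * spr / mu ^+ 3)) = A1 * mu ^- 3 by rewrite /A1 !mulrA.
  by rewrite ler_wpM2l // lef_pV2 ?posrE ?exprn_gt0 // ler_eXnr.
have h4 : (A1 + A2 + A3) / mu <= sigma / 4.
  exact: quarter_bound.
rewrite /cond_err -/p -/mu -/rc -/eta -/spr.
apply: le_trans (lerD (lerD h1 h2) h3) _; exact: quarter_sum.
Qed.

(** The order of quantifiers matters: [a] is chosen before [K], [n] and [y], so one constant serves
    all starting points at height zero and all lengths. *)
Theorem cond_est (sigma : R) : 0 < sigma -> exists2 a : R, `|a| <= M &
  forall K : R, exists n0, forall n, (n0 <= n)%N -> forall y : pt, height y = 0 ->
    (nrm y)%:R <= K * Num.sqrt n%:R :> R ->
    `|pexp c n [:: y] (fun s => (alive n s)%:R * (F (dz D n (recen y s)) - a))| <=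
    sigma * surv c n y.
Proof.
move=> s0; have [m [x [[m2 mS m8] [[m3 m4 m5 m6 x0] mE]]]] := cond_err_small s0.
have [a aM ha] := cond_m m2 mS m8 m3 m4 m5 m6 x0; exists a => // K.
have [n0 hn] := ha K; exists n0 => n nn y hy yK; apply: le_trans (hn n nn y hy yK) _.
by rewrite ler_wpM2r // /surv; apply: (pexp_ge0 k0 cP) => s; rewrite ler0n.
Qed.
End Conditional.

(** * The last zero of the first coordinate and the path after it *)

Section LastZero.
Variables (R : realType) (d : nat).
Local Notation C := (C01 'rV[R]_d.+1).
Implicit Types (w : C) (t s : I01 R).

Definition hd w (u : R) : R := w (clip u) 0 0.
(** A path without zeros has [tau w = 0], the default supremum of the empty set; this is why
    [tau_lt] assumes [0 < a]. *)
Definition tau w : R := last_zero (fun t => w t 0 0).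
Definition phi w : C := blk (Num.sqrt (1 - tau w))^-1 (tau w) 1 w.

Lemma hd_continuous w : continuous (hd w).
Proof.
apply: (@continuous_comp_fun _ _ _ (fun u : R => w (clip u)) (fun v : 'rV[R]_d.+1 => v 0 0)).
  exact: (continuous_comp_fun (@clip_continuous R) (@cts_fun _ _ w)).
exact: (@coord_continuous R 1 d.+1 0 0).
Qed.

Lemma hdE w t : hd w (time t) = w t 0 0. Proof. by rewrite /hd clip_time. Qed.

Lemma tau_has_sup w t : w t 0 0 = 0 ->
  has_sup [set time s | s in [set s | w s 0 0 = 0]].
Proof.
move=> wt; split; first by exists (time t), t.
by exists 1 => _ [s _ <-]; case/andP: (time_itv s).
Qed.

Lemma tau_ub w t : w t 0 0 = 0 -> time t <= tau w.
Proof. by move=> wt; apply: ub_le_sup; [case: (tau_has_sup wt) | exists t]. Qed.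

Lemma tau_le w a : 0 <= a -> (forall t, w t 0 0 = 0 -> time t <= a) -> tau w <= a.
Proof.
move=> a0 h; have [[t wt]|nz] := pselect (exists t, w t 0 0 = 0).
  by apply: ge_sup; [exists (time t), t | move=> _ [s ws <-]; exact: h].
rewrite /tau /last_zero (_ : [set time s | s in _] = set0) ?sup0 //.
by apply/seteqP; split => // x [s ws _]; apply: nz; exists s.
Qed.

Lemma tau_itv w : 0 <= tau w <= 1.
Proof.
apply/andP; split; last by apply: tau_le => // t _; case/andP: (time_itv t).
have [[t wt]|nz] := pselect (exists t, w t 0 0 = 0).
  by apply: le_trans (tau_ub wt); case/andP: (time_itv t).
rewrite /tau /last_zero (_ : [set time s | s in _] = set0) ?sup0 //.
by apply/seteqP; split => // x [s ws _]; apply: nz; exists s.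
Qed.

Lemma head_away w a : a <= 1 -> (forall u, a <= u <= 1 -> hd w u != 0) ->
  exists2 m, 0 < m & forall u, a <= u <= 1 -> m <= `|hd w u|.
Proof.
move=> a1 h.
have cn : {within `[a, 1], continuous (fun u => `|hd w u|)}.
  apply: continuous_subspaceT; apply: (continuous_comp_fun (@hd_continuous w)).
  exact: norm_continuous.
have [u0 u0i hu] := EVT_min a1 cn; exists `|hd w u0|.
  by rewrite normr_gt0; apply: h; move: u0i; rewrite in_itv.
by move=> u ui; apply: hu; rewrite in_itv.
Qed.

Lemma tau_lt w a : 0 < a <= 1 -> (tau w < a) <-> (forall u, a <= u <= 1 -> hd w u != 0).
Proof.
move=> /andP[a0 a1]; split => [ta u /andP[au u1]|h].
  apply/eqP => hu; have := tau_ub (hu : w (clip u) 0 0 = 0).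
  rewrite time_clip; last by rewrite u1 andbT; lra.
  by move=> ut; move: ta; rewrite ltNge (le_trans au).
have [m m0 hm] := head_away a1 h.
have cn := @hd_continuous w a.
have [e /= e0 he] : exists2 e : R, 0 < e & forall u, `|a - u| < e -> `|hd w a - hd w u| < m.
  have /cvgrPdist_lt /(_ m m0) [e /= e0 he] := cn.
  by exists e => // u; exact: he.
have ae : tau w <= Num.max 0 (a - e / 2).
  apply: tau_le; first by rewrite le_max lexx.
  move=> t wt; rewrite leNgt gt_max; apply/negP => /andP[t0 te].
  have [ta|ta] := leP a (time t).
    by have := h (time t); rewrite hdE wt eqxx ta; case/andP: (time_itv t) => _ -> /(_ isT).
  have := he (time t); rewrite hdE wt subr0 => /(_ _) H.
  have : `|hd w a| < m by apply: H; rewrite ger0_norm ?subr_ge0 ?(ltW ta) //; lra.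
  by rewrite ltNge hm // lexx.
by apply: le_lt_trans ae _; rewrite gt_max a0 /=; lra.
Qed.

Lemma tau_zero w : 0 < tau w -> hd w (tau w) = 0.
Proof.
move=> t0; apply: contrapT => nz; have t01 : 0 < tau w <= 1 by rewrite t0; case/andP: (tau_itv w).
suff : tau w < tau w by rewrite ltxx.
apply/(tau_lt w t01) => u /andP[tu u1]; apply/eqP => hu.
have := tau_ub (hu : w (clip u) 0 0 = 0); rewrite time_clip ?u1 ?(ltW (lt_le_trans t0 tu)) // => ut.
by apply: nz; rewrite (_ : tau w = u) //; apply/eqP; rewrite eq_le tu ut.
Qed.

(** The path crosses zero, rather than touching it, arbitrarily close to its last zero. A crossing
    survives small uniform perturbations and a mere contact does not; this is what makes [tau], and
    with it [phi], continuous at [w]. *)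
Definition good w : Prop := hd w 1 != 0 /\
  forall q, 0 <= q < tau w -> exists2 u, q <= u <= 1 & hd w u * hd w 1 < 0.

Lemma tau_lt1 w : hd w 1 != 0 -> tau w < 1.
Proof.
move=> h; apply/tau_lt; first by rewrite ltr01 lexx.
by move=> u u1; rewrite (_ : u = 1) //; apply/eqP; rewrite eq_le andbC.
Qed.

Lemma tau_cont w e : good w -> 0 < e -> exists2 dl, 0 < dl &
  forall w', (forall t, `|w t - w' t| <= dl) -> `|tau w - tau w'| <= e.
Proof.
move=> [w1 hq] e0.
have hdd w' dl u : (forall t, `|w t - w' t| <= dl) -> `|hd w u - hd w' u| <= dl.
  move=> h; apply: le_trans (h (clip u)).
  by have := rv_coord_le (w (clip u) - w' (clip u)) 0; rewrite !mxE.
have [d1 d10 H1] : exists2 dl, 0 < dl & forall w', (forall t, `|w t - w' t| <= dl) ->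
    tau w' <= tau w + e.
  have [te|te] := leP 1 (tau w + e).
    by exists 1 => // w' _; apply: le_trans te; case/andP: (tau_itv w').
  have a0 : 0 < tau w + e by have /andP[] := tau_itv w; lra.
  have [m m0 hm] : exists2 m, 0 < m & forall u, tau w + e <= u <= 1 -> m <= `|hd w u|.
    by apply: head_away; [exact: ltW | apply/tau_lt; [rewrite a0 ltW | lra]].
  exists (m / 2); first by rewrite divr_gt0.
  move=> w' ww; apply/ltW/tau_lt; first by rewrite a0 ltW.
  move=> u ui; rewrite -normr_gt0; have h1 := hm u ui; have h2 := hdd _ _ u ww.
  have := lerB_dist (hd w u) (hd w' u); lra.
have [d2 d20 H2] : exists2 dl, 0 < dl & forall w', (forall t, `|w t - w' t| <= dl) ->
    tau w - e <= tau w'.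
  have [te|te] := ltP (tau w - e) 0.
    by exists 1 => // w' _; apply: ltW; apply: lt_le_trans te _; case/andP: (tau_itv w').
  have [|u /andP[qu u1] uneg] := hq (tau w - e); first by rewrite te /=; lra.
  have hu : hd w u != 0 by apply/eqP => hu; move: uneg; rewrite hu mul0r ltxx.
  have mm : 0 < Num.min `|hd w u| `|hd w 1| / 2 by rewrite divr_gt0 // lt_min !normr_gt0 hu.
  exists (Num.min `|hd w u| `|hd w 1| / 2) => // w' ww.
  have h1 := hdd _ _ u ww; have h2 := hdd _ _ 1 ww.
  have m1 : Num.min `|hd w u| `|hd w 1| <= `|hd w u| by rewrite ge_min lexx.
  have m2 : Num.min `|hd w u| `|hd w 1| <= `|hd w 1| by rewrite ge_min lexx orbT.
  have [c cu hc] : exists2 c, c \in `[u, 1] & hd w' c = 0.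
    apply: IVT => //; first exact: continuous_subspaceT (@hd_continuous w').
    move: h1 h2 m1 m2; set mn := Num.min _ _.
    rewrite !ler_norml => /andP[a1 a2] /andP[b1 b2] m1 m2.
    rewrite ge_min le_max; case: (ltrgtP (hd w u) 0) uneg => su; last by rewrite su mul0r ltxx.
      rewrite nmulr_rlt0 // => s1; rewrite (ltr0_norm su) in m1; rewrite (gtr0_norm s1) in m2.
      by apply/andP; split; apply/orP; [left | right]; lra.
    rewrite pmulr_rlt0 // => s1; rewrite (gtr0_norm su) in m1; rewrite (ltr0_norm s1) in m2.
    by apply/andP; split; apply/orP; [right | left]; lra.
  move: cu; rewrite in_itv /= => /andP[uc c1].
  have := tau_ub (hc : w' (clip c) 0 0 = 0); rewrite time_clip; first by lra.
  by rewrite c1 andbT; lra.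
exists (Num.min d1 d2); first by rewrite lt_min d10.
move=> w' ww; have a1 := H1 w' _; have a2 := H2 w' _.
have {}a1 : tau w' <= tau w + e.
  by apply: a1 => t; apply: le_trans (ww t) _; rewrite ge_min lexx.
have {}a2 : tau w - e <= tau w'.
  by apply: a2 => t; apply: le_trans (ww t) _; rewrite ge_min lexx orbT.
rewrite ler_norml; apply/andP; split; lra.
Qed.

Lemma blk_dist a a' (u u' B e e' : R) w w' t : 0 <= u <= 1 -> 0 <= u' <= 1 ->
  (forall s, `|w s| <= B) -> (forall s, `|w s - w' s| <= e) ->
  (forall s s', `|time s - time s'| <= `|u - u'| -> `|w s - w s'| <= e') ->
  `|blk a u 1 w t - blk a' u' 1 w' t| <= `|a - a'| * (2 * B) + `|a'| * (2 * e + 2 * e').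
Proof.
move=> u01 u'01 wB we we'.
have /andP[t0 t1] := time_itv t.
have -> : blk a u 1 w t = a *: (w (clip (u + time t * (1 - u))) - w (clip u)) by [].
have -> : blk a' u' 1 w' t = a' *: (w' (clip (u' + time t * (1 - u'))) - w' (clip u')) by [].
set p := u + _; set p' := u' + _.
have pp : `|p - p'| <= `|u - u'|.
  rewrite /p /p' (_ : _ - _ = (1 - time t) * (u - u')); last by ring.
  by rewrite normrM ler_piMl // ger0_norm; lra.
have p01 v : 0 <= v <= 1 -> 0 <= v + time t * (1 - v) <= 1.
  move=> /[dup] v01 /affine_itv/(_ (time_itv t))/andP[h ->]; rewrite andbT.
  by apply: le_trans h; case/andP: v01.
have cl x y : 0 <= x <= 1 -> 0 <= y <= 1 -> `|x - y| <= `|u - u'| ->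
    `|w (clip x) - w' (clip y)| <= e' + e.
  move=> x01 y01 xy; apply: le_trans (ler_distD (w (clip y)) _ _) _.
  by apply: lerD => //; apply: we'; rewrite !time_clip.
have -> : a *: (w (clip p) - w (clip u)) - a' *: (w' (clip p') - w' (clip u')) =
  (a - a') *: (w (clip p) - w (clip u)) +
  a' *: ((w (clip p) - w' (clip p')) - (w (clip u) - w' (clip u'))).
  by apply/rowP => i; rewrite !mxE; ring.
apply: le_trans (ler_normD _ _) _; apply: lerD; rewrite normrZ ler_wpM2l //.
  apply: le_trans (ler_normB _ _) _; rewrite mulr2n mulrDl mul1r; exact: lerD.
apply: le_trans (ler_normB _ _) _.
rewrite (_ : 2 * e + 2 * e' = (e' + e) + (e' + e)); last by ring.
by apply: lerD; apply: cl => //; exact: p01.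
Qed.

Lemma phi_cont w e : good w -> 0 < e -> exists2 dl, 0 < dl &
  forall w', (forall t, `|w t - w' t| <= dl) -> forall t, `|phi w t - phi w' t| <= e.
Proof.
move=> gw e0; have [w1 _] := gw; have t1 := tau_lt1 w1.
have [B wB] := path_bounded w; have B0 : 0 <= B by apply: le_trans (wB (clip 0)).
pose f (x : R) := (Num.sqrt (1 - x))^-1.
have cf : {for tau w, continuous f}.
  apply: (@continuous_comp _ _ _ (fun x : R => Num.sqrt (1 - x)) (fun y => y^-1)).
    apply: (@continuous_comp _ _ _ (fun x : R => 1 - x) Num.sqrt); last exact: sqrt_continuous.
    by apply: cvgB; [exact: cvg_cst | exact: cvg_id].
  by apply: inv_continuous; rewrite gt_eqF // sqrtr_gt0 subr_gt0.
have r0 : 0 < Num.min 1 (e / 2 / (2 * B + 1)).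
  by rewrite lt_min ltr01 /= divr_gt0 ?divr_gt0 //; lra.
have [r1 r10 hr] : exists2 r : R, 0 < r & forall y, `|tau w - y| < r ->
    `|f (tau w) - f y| < Num.min 1 (e / 2 / (2 * B + 1)).
  by move/cvgrPdist_lt: cf => /(_ _ r0) [r /= r10 hr]; exists r => // y; exact: hr.
pose A := f (tau w) + 1.
have f0 y : 0 <= f y by rewrite invr_ge0 sqrtr_ge0.
have A0 : 0 < A by rewrite /A; have := f0 (tau w); lra.
have e1 : 0 < e / 2 / (4 * A) by rewrite !divr_gt0 // mulr_gt0.
have [dm dm0 hm] := path_unif w e1.
have r2 : 0 < Num.min (r1 / 2) dm by rewrite lt_min dm0 divr_gt0.
have [dl dl0 hdl] := tau_cont gw r2.
exists (Num.min dl (e / 2 / (4 * A))); first by rewrite lt_min dl0.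
move=> w' ww t.
have tt : `|tau w - tau w'| <= Num.min (r1 / 2) dm.
  by apply: hdl => s; apply: le_trans (ww s) _; rewrite ge_min lexx.
have tr : `|tau w - tau w'| < r1.
  by move: tt; rewrite le_min => /andP[h _]; lra.
have := hr _ tr; rewrite lt_min => /andP[fa fb].
have we s : `|w s - w' s| <= e / 2 / (4 * A).
  by apply: le_trans (ww s) _; rewrite ge_min lexx orbT.
have ww' s s' : `|time s - time s'| <= `|tau w - tau w'| -> `|w s - w s'| <= e / 2 / (4 * A).
  by move=> h; apply: hm; apply: le_trans h _; move: tt; rewrite le_min => /andP[].
apply: le_trans (blk_dist (f (tau w)) (f (tau w')) t (tau_itv w) (tau_itv w') wB we ww') _.
have h1 : `|f (tau w) - f (tau w')| * (2 * B) <= e / 2.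
  apply: (@le_trans _ _ (e / 2 / (2 * B + 1) * (2 * B))).
    by rewrite ler_wpM2r ?(ltW fb) // mulr_ge0.
  by rewrite mulrAC ler_pdivrMr ?ler_wpM2l //; lra.
have h2 : `|f (tau w')| <= A.
  rewrite ger0_norm // /A; move: fa; rewrite ltr_norml => /andP[fa1 fa2]; lra.
have h3 : `|f (tau w')| * (2 * (e / 2 / (4 * A)) + 2 * (e / 2 / (4 * A))) <= e / 2.
  apply: (@le_trans _ _ (A * (2 * (e / 2 / (4 * A)) + 2 * (e / 2 / (4 * A))))).
    by rewrite ler_wpM2r // addr_ge0 // mulr_ge0 // ltW.
  by apply: le_of_eq; field; rewrite gt_eqF.
by rewrite [leRHS]splitr; exact: lerD.
Qed.

Lemma end_cont_at (F : C -> R) w : blip F -> good w ->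
  cont_at (fun w => (0 < hd w 1)%R%:R * F (phi w)) w.
Proof.
move=> [[L fL] [M FM]] gw e e0; have [w1 _] := gw.
have K0 : 0 < Num.max 0 L + 1 by rewrite ltr_wpDl // le_max lexx.
have e1 : 0 < e / (Num.max 0 L + 1) by rewrite divr_gt0.
have [dl dl0 hdl] := phi_cont gw e1.
exists (Num.min dl (`|hd w 1| / 2)); first by rewrite lt_min dl0 divr_gt0 // normr_gt0.
move=> w' ww.
have h1 : `|hd w 1 - hd w' 1| <= `|hd w 1| / 2.
  apply: (@le_trans _ _ (Num.min dl (`|hd w 1| / 2))); last by rewrite ge_min lexx orbT.
  apply: le_trans (ww (clip 1)).
  by have := rv_coord_le (w (clip 1) - w' (clip 1)) 0; rewrite !mxE.
have -> : (0 < hd w' 1) = (0 < hd w 1).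
  move: h1; rewrite ler_norml => /andP[a1 a2].
  case: (ltrgtP (hd w 1) 0) w1 => // s1 _.
    by rewrite (ltr0_norm s1) in a1 a2; apply/negbTE; rewrite -leNgt; lra.
  by rewrite (gtr0_norm s1) in a1 a2; lra.
rewrite -mulrBr normrM; apply: (@le_trans _ _ (1 * `|F (phi w) - F (phi w')|)).
  by rewrite ler_wpM2r // ger0_norm ?ler0n // lern1 leq_b1.
rewrite mul1r; apply: le_trans (fL _ _ (e / (Num.max 0 L + 1)) _) _.
  by apply: hdl => t; apply: le_trans (ww t) _; rewrite ge_min lexx.
rewrite mulrCA ler_piMr ?(ltW e0) // ler_pdivrMr // mul1r.
by apply: (@le_trans _ _ (Num.max 0 L)); [rewrite le_max lexx orbT | lra].
Qed.
End LastZero.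

(** * Measurability of evaluations at random times and of the last zero *)

Section Evaluation.
Variables (R : realType) (k : nat).
Local Notation C := (C01 'rV[R]_k).
Context {dT : measure_display} {T : measurableType dT}.

Lemma measurable_clip_time (U : T -> R) : measurable_fun setT U ->
  measurable_fun setT (fun o => time (clip (U o))).
Proof.
move=> mU; apply: (measurable_maxr (measurable_cst (0 : R))).
exact: measurable_minr mU (measurable_cst (1 : R)).
Qed.

(** Through the interpolating polygons, evaluation at a random time is a limit of finite
    combinations over deterministic grid times. *)
Lemma measurable_rtime (Y : T -> C) (U : T -> R) i :
  (forall t i, measurable_fun setT (fun o => Y o t 0 i)) -> measurable_fun setT U ->
  measurable_fun setT (fun o => Y o (clip (U o)) 0 i).
Proof.
move=> mY mU.
apply: (@measurable_fun_cvg _ _ R setT (fun (N : nat) o => Y o (clip 0) 0 i +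
  \sum_(j < N.+1) Num.max 0 (Num.min (N.+1%:R * time (clip (U o)) - j%:R) 1) *
    (Y o (gt R N.+1 j.+1) 0 i - Y o (gt R N.+1 j) 0 i))).
  move=> N; apply: measurable_funD => //; apply: measurable_sum => j.
  apply: measurable_funM; last exact: measurable_funB.
  apply: (measurable_maxr (measurable_cst (0 : R))).
  apply: measurable_minr (measurable_cst (1 : R)).
  apply: measurable_funB (measurable_cst _).
  by apply: measurable_funM; [exact: measurable_cst | exact: measurable_clip_time].
move=> o _; set t := clip (U o); pose Z := blk 1 0 1 (Y o).
have Ze s j : Z s 0 j = Y o s 0 j - Y o (clip 0) 0 j.
  by rewrite /Z blkE mul1r subr0 mulr1 add0r clip_time.
have Z0 : Z (clip 0) = 0 by apply/rowP => j; rewrite Ze mxE subrr.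
have E N : Y o (clip 0) 0 i +
  \sum_(j < N.+1) Num.max 0 (Num.min (N.+1%:R * time t - j%:R) 1) *
    (Y o (gt R N.+1 j.+1) 0 i - Y o (gt R N.+1 j) 0 i) =
  Y o (clip 0) 0 i + poly (inc N.+1 Z) t 0 i.
  congr (_ + _); rewrite /= /poly_fun summxE; apply: eq_bigr => j _.
  by rewrite !mxE /inc /= !Ze opprB addrA subrK.
apply/cvgn_epsP => e e0; have [dl dl0 Hdl] := path_unif Z e0.
have [N HN] := inv_nat_small dl0; exists N => n Nn; rewrite E.
have -> : Y o (clip 0) 0 i + poly (inc n.+1 Z) t 0 i - Y o t 0 i =
    (poly (inc n.+1 Z) t - Z t) 0 i.
  by rewrite [RHS]mxE [X in _ = _ + X]mxE Ze; ring.
apply: le_trans (rv_coord_le _ _) _; apply: le_trans (poly_close _ _ Z0) _ => //.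
apply: mdl_le => [|s t' h]; first by rewrite invr_ge0.
by apply: Hdl; apply: le_trans h _; exact: HN.
Qed.
End Evaluation.

Section MeasurableLastZero.
Variables (R : realType) (d : nat).
Local Notation C := (C01 'rV[R]_d.+1).
Implicit Types (w : C).

Lemma measurable_coord (t : I01 R) i :
  measurable_fun setT (fun w : borel C => (w : C) t 0 i : R).
Proof. exact: (@measurable_eval R d.+1 _ (borel C) (fun w => w) (@measurable_id _ _ _)). Qed.

Lemma measurable_hd u : measurable_fun setT (fun w : borel C => hd w u : R).
Proof. exact: measurable_coord. Qed.

(** Minus the least modulus of the first coordinate from time [a] on: a Lipschitz functional whose
    negativity expresses [tau w < a]. *)
Definition away (a : R) w : R := sup [set - `|w t 0 0| | t in [set t | a <= time t]].

Lemma away_lipf a : a <= 1 -> lipf 1 (away a).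
Proof.
move=> a1; apply: sup_lipf.
- by exists (clip 1); rewrite /= time_clip // lexx ler01.
- by move=> w; exists 0 => t _; rewrite oppr_le0.
move=> t _ w w' e we; rewrite mul1r -opprD normrN.
apply: le_trans (ler_dist_dist _ _) _; apply: le_trans (we t).
by have := rv_coord_le (w t - w' t) 0; rewrite !mxE.
Qed.

Lemma away_lt0 a w : a <= 1 -> (away a w < 0) <-> (forall u, a <= u <= 1 -> hd w u != 0).
Proof.
move=> a1.
have hs : has_sup [set - `|w t 0 0| | t in [set t | a <= time t]].
  split; first by exists (- `|w (clip 1) 0 0|), (clip 1); rewrite //= time_clip // lexx ler01.
  by exists 0 => _ [t _ <-]; rewrite oppr_le0.
split => [h u /andP[au u1]|h].
  apply/eqP => hu; have : - `|hd w u| <= away a w.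
    apply: ub_le_sup; [by case: hs | exists (clip u) => //].
    have [u0|u0] := leP 0 u; first by rewrite /= time_clip ?u0.
    by apply: le_trans au _; apply: le_trans (ltW u0) _; case/andP: (time_itv (clip u)).
  by rewrite hu normr0 oppr0 leNgt h.
have [m m0 hm] := head_away a1 h; apply: (@le_lt_trans _ _ (- m)); last by rewrite oppr_lt0.
apply: ge_sup; first by case: hs.
move=> _ [t ta <-]; rewrite lerN2 -hdE; apply: hm.
by move: ta => /= ->; case/andP: (time_itv t).
Qed.

Lemma measurable_tau : measurable_fun setT (@tau R d : borel C -> R).
Proof.
apply: (measurability _ (RGenInftyO.measurableE R)) => _ [_ [a ->] <-]; rewrite setTI.
have -> : (@tau R d : borel C -> R) @^-1` `]-oo, a[ = [set w : borel C | tau w < a].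
  by apply/seteqP; split => w /=; rewrite in_itv.
have [a0|a0] := leP a 0.
  rewrite (_ : [set w | _] = set0) //; apply/seteqP; split => // w /=.
  by case/andP: (tau_itv w) => t0 _ ta; have := le_lt_trans t0 ta; rewrite ltNge a0.
have [a1|a1] := ltP 1 a.
  rewrite (_ : [set w | _] = setT) //; apply/seteqP; split => // w _ /=.
  by case/andP: (tau_itv w) => _ t1; exact: le_lt_trans t1 a1.
rewrite (_ : [set w | _] = [set w : borel C | away a w < 0]).
  by apply: measurable_lt => //; exact: continuous_borel (lipf_continuous (away_lipf a1)).
apply/seteqP; split => w /= h.
  by apply/(away_lt0 w a1)/tau_lt; rewrite ?a0.
by apply/tau_lt; [rewrite a0 | apply/(away_lt0 w a1)].
Qed.

Lemma measurable_phi : measurable_fun setT (@phi R d : borel C -> borel C).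
Proof.
apply: measurable_path => t i.
rewrite (_ : (fun o => _) = fun o : borel C => (Num.sqrt (1 - tau o))^-1 *
   ((o : C) (clip (tau o + time t * (1 - tau o))) 0 i - (o : C) (clip (tau o)) 0 i)); last first.
  by apply/funext => w; rewrite /phi blkE.
have m1 : measurable_fun setT (fun w : borel C => 1 - tau w : R).
  exact: measurable_funB (measurable_cst _) measurable_tau.
apply: measurable_funM.
  apply: measurable_inv; apply: (mcomp (@Num.sqrt R)) => //.
  by apply: continuous_measurable_fun; exact: sqrt_continuous.
apply: measurable_funB; apply: (@measurable_rtime R d.+1 _ (borel C) (fun w => w)) => //.
- exact: measurable_coord.
- apply: measurable_funD measurable_tau _.
  exact: measurable_funM (measurable_cst _) m1.
- exact: measurable_coord.
exact: measurable_tau.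
Qed.

Lemma measurable_pos : measurable [set w : borel C | 0 < hd w 1].
Proof.
by apply: measurable_lt; [exact: measurable_cst | exact: (measurable_hd 1)].
Qed.

Lemma bmf_end (F : C -> R) : blip F ->
  bmf (fun w : borel C => (0 < hd w 1)%R%:R * F (phi w) : R).
Proof.
move=> bF; apply: bmfM; first exact: bmf_bool measurable_pos.
exact: (bmf_comp (blip_bmf bF) measurable_phi).
Qed.
End MeasurableLastZero.

Lemma conditionalE {dT : measure_display} {T : measurableType dT} (R : realType)
    (P : probability T R) (L : set T) (mL : measurable L) (A : set T) : P L != 0%E ->
  conditional P mL A = (P (A `&` L) * (fine (P L))^-1%:E)%E.
Proof.
move=> P0; rewrite /conditional /= /mnormalize /= /mrestr setTI (negbTE P0) /=.
by rewrite (_ : (P L == +oo%E) = false) //; apply/negbTE; rewrite (pr_fin P mL).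
Qed.

(** * Almost every Brownian path crosses zero near its last zero *)

Section GoodPaths.
Variables (R : realType) (d : nat).
Local Notation C := (C01 'rV[R]_d.+1).
Variables (W : probability (borel C) R) (hW : wiener_measure W).
Implicit Types (w : C) (N : nat) (q a : R).
Let bW := wiener_brownian hW.

Lemma wiener_start : {ae W, forall w : C, w (clip 0) = 0}.
Proof. exact: (brownian_start bW). Qed.

Definition mv q w : R := hd w q - hd w 0.

Lemma measurable_mv q : measurable_fun setT (mv q : borel C -> R).
Proof. exact: measurable_funB (measurable_hd _) (measurable_hd _). Qed.

Lemma mv_atom q x : 0 < q <= 1 -> W [set w : borel C | mv q w = x] = 0%E.
Proof.
move=> /andP[q0 q1]; have [_ _ h] := hW.
have tt : time (clip (0 : R)) < time (clip q).
  by rewrite !time_clip ?lexx ?ler01 ?q1 ?(ltW q0).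
have := h 0 (clip 0) (clip q) tt [set x] (measurable_set1 x).
by rewrite normal_set1.
Qed.

Section Block.
Variables (q a : R).
Hypotheses (q01 : 0 < q < 1) (aq : `|a| * Num.sqrt (1 - q) = 1).
Let q0 : 0 < q. Proof. by case/andP: q01. Qed.
Let q1 : q < 1. Proof. by case/andP: q01. Qed.
Let bB : brownian W (fun w : borel C => blk a q 1 w).
Proof. by apply: brownian_blk bW _ _ aq; rewrite ?(ltW q0) ?q1. Qed.

(** One grid for both pieces: the step from [0] to [q], then the uniform grid of [[q, 1]]; hence
    [N.+3] times. *)
Let tm N (i : 'I_N.+3) : I01 R :=
  if (i : nat) is j.+1 then clip (q + j%:R / N.+1%:R * (1 - q)) else clip 0.

Let time_tm N (j : nat) : (j <= N.+1)%N ->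
  time (clip (q + j%:R / N.+1%:R * (1 - q))) = q + j%:R / N.+1%:R * (1 - q).
Proof.
move=> jN; have h0 : 0 <= j%:R / N.+1%:R :> R by rewrite divr_ge0.
have h1 : j%:R / N.+1%:R <= 1 :> R by rewrite ler_pdivrMr ?ltr0n // mul1r ler_nat.
have h2 : j%:R / N.+1%:R * (1 - q) <= 1 - q by rewrite ler_piMl // subr_ge0 ltW.
have h3 : 0 <= j%:R / N.+1%:R * (1 - q) by rewrite mulr_ge0 // subr_ge0 ltW.
move: h2 h3; set x := _ * (1 - q) => h2 h3.
by apply: time_clip; apply/andP; split; move: q0 h2 h3; lra.
Qed.

Let tm_lt N (i j : 'I_N.+3) : (i < j)%N -> time (tm i) < time (tm j).
Proof.
case: i j => [[|i] hi] [[|j] hj] //= ij; rewrite /tm /=.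
  rewrite time_clip ?lexx ?ler01 // time_tm; last by [].
  apply: (lt_le_trans q0); rewrite lerDl mulr_ge0 // ?divr_ge0 // subr_ge0 ltW //.
have jN : (j <= N.+1)%N by [].
have iN : (i <= N.+1)%N by apply: leq_trans jN; exact: ltnW.
rewrite (time_tm iN) (time_tm jN) ltrD2l ltr_pM2r ?subr_gt0 //.
by rewrite ltr_pM2r ?invr_gt0 ?ltr0n // ltr_nat.
Qed.

Let ev N (A : set R) (B : 'I_d.+1 * 'I_N.+1 -> set R) (ij : 'I_d.+1 * 'I_N.+2) : set R :=
  if unlift ord0 ij.2 is Some k then [set x | B (ij.1, k) (a * x)]
  else if ij.1 == ord0 then A else setT.

Let inc_blk N w i (k : 'I_N.+1) : inc N.+1 (blk a q 1 w) (i, k) =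
  a * (w (tm (lift ord0 (lift ord0 k))) 0 i - w (tm (widen_ord (leqnSn _) (lift ord0 k))) 0 i).
Proof.
rewrite /inc /= !blkE /tm /= !time_gt //; last exact: ltnW.
by rewrite /bump /= !add1n -mulrBr opprB addrA subrK.
Qed.

Let dX N (ij : 'I_d.+1 * 'I_N.+2) (w : borel C) : R :=
  (w : C) (tm (lift ord0 ij.2)) 0 ij.1 - (w : C) (tm (widen_ord (leqnSn _) ij.2)) 0 ij.1.

Let dX0 N (w : C) : @dX N (ord0, ord0) w = mv q w.
Proof. by rewrite /dX /tm /= /mv /hd mul0r mul0r addr0. Qed.

Let evP N (A : set R) B w :
  (A (mv q w) /\ forall ij : 'I_d.+1 * 'I_N.+1, B ij (inc N.+1 (blk a q 1 w) ij)) <->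
  forall ij : 'I_d.+1 * 'I_N.+2, ev A B ij
    (w (tm (lift ord0 ij.2)) 0 ij.1 - w (tm (widen_ord (leqnSn _) ij.2)) 0 ij.1).
Proof.
have E0 : w (tm (lift ord0 (ord0 : 'I_N.+2))) 0 0 -
    w (tm (widen_ord (leqnSn _) (ord0 : 'I_N.+2))) 0 0 = mv q w.
  by rewrite /tm /= /mv /hd mul0r mul0r addr0.
split => [[Aw Bw] [i j]|h]; rewrite /ev /=.
  case: unliftP => [k ->|->]; first by rewrite /= -inc_blk.
  by case: eqP => // ->; rewrite E0.
split.
  have : ev A B (ord0, ord0) (mv q w) by rewrite -E0; exact: h.
  by rewrite /ev /= unlift_none ?eqxx.
move=> [i k]; rewrite inc_blk; have := h (i, lift ord0 k).
by rewrite /ev /= liftK.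
Qed.

Lemma block_rect N (A : set R) (B : 'I_d.+1 * 'I_N.+1 -> set R) : measurable A ->
  (forall ij, measurable (B ij)) ->
  W [set w : borel C | A (mv q w) /\ forall ij, B ij (inc N.+1 (blk a q 1 w) ij)] =
  (W [set w : borel C | A (mv q w)] *
   W [set w : borel C | forall ij, B ij (inc N.+1 (blk a q 1 w) ij)])%E.
Proof.
move=> mA mB; have [_ hI _] := hW.
have mev (A' : set R) : measurable A' -> forall ij, measurable (ev A' B ij).
  move=> mA' [i j]; rewrite /ev /=; case: unliftP => [k _|_]; last by case: eqP.
  rewrite -[X in measurable X]setTI; apply: measurable_funM => //.
have main A' : measurable A' ->
  W [set w : borel C | A' (mv q w) /\ forall ij, B ij (inc N.+1 (blk a q 1 w) ij)] =
  (W [set w : borel C | A' (mv q w)] * \prod_(ij | ij != (ord0, ord0))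
    W (@dX N ij @^-1` ev setT B ij))%E.
  move=> mA'; have := hI _ (@tm N) (@tm_lt N) (ev A' B) (mev _ mA').
  rewrite (_ : [set w | forall j, _] =
    [set w : borel C | A' (mv q w) /\ forall ij, B ij (inc N.+1 (blk a q 1 w) ij)]); last first.
    by apply/seteqP; split => w /=; rewrite evP.
  move=> ->; rewrite (bigD1 (ord0, ord0)) //=; congr (_ * _)%E.
    congr (W _); apply/funext => w.
    change (ev A' B (ord0, ord0) (@dX N (ord0, ord0) w) = A' (mv q w)).
    by rewrite dX0 /ev /= unlift_none ?eqxx.
  apply: eq_bigr => -[i j] ij; congr (W (_ @^-1` _)); rewrite /ev /=.
  case: unliftP => [k //|j0]; case: eqP => // i0; by rewrite i0 j0 eqxx in ij.
rewrite main //; congr (_ * _)%E.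
have := main setT measurableT.
rewrite (_ : [set w | setT (mv q w)] = setT); last by apply/seteqP.
rewrite probability_setT mul1e => <-; congr (W _).
by apply/seteqP; split => w /=; [case | split].
Qed.

(** Conditionally on an event about the increment up to [q], the block over [[q, 1]] still has
    independent Gaussian grid increments, so uniqueness in law identifies it. *)
Lemma block_indep (A : set R) (S : set (borel C)) : measurable A -> measurable S ->
  W [set w : borel C | A (mv q w) /\ S (blk a q 1 w)] =
  (W [set w : borel C | A (mv q w)] * W [set w : borel C | S (blk a q 1 w)])%E.
Proof.
move=> mA mS; set L := [set w : borel C | A (mv q w)].
have mL : measurable L by rewrite -[L]setTI; exact: (measurable_mv q).
have mblk := brownian_measurable bB.
have mSb : measurable [set w : borel C | S (blk a q 1 w)].
  by rewrite -[X in measurable X]setTI; exact: mblk.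
have [P0|P0] := eqVneq (W L) 0%E.
  rewrite P0 mul0e; apply/eqP; rewrite eq_le measure_ge0 andbT -P0.
  apply: le_measure; rewrite ?inE //; [|by move=> w []].
  exact: measurableI.
have g1 : gbm (conditional W mL) (fun w : borel C => blk a q 1 w).
  split => [t i||N B mB].
  - by have [h _] := bB; exact: h.
  - rewrite (_ : [set o | _] = setT); first exact: probability_setT.
    by apply/seteqP; split => // w _ i; rewrite blkE time_clip ?lexx ?ler01 // mul0r addr0 subrr mulr0.
  have := block_rect mA mB; rewrite -/L => E.
  rewrite conditionalE // setIC (_ : L `&` _ =
    [set w : borel C | A (mv q w) /\ forall ij, B ij (inc N.+1 (blk a q 1 w) ij)]) // E.
  rewrite muleAC (pr_fin W mL) -EFinM mulfV ?mul1e; last first.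
    by apply: contra P0 => /eqP h; rewrite (pr_fin W mL) h.
  by have [_ _ ->] := brownian_gbm bB.
have := gbm_law g1 (brownian_gbm bB) mS.
rewrite conditionalE //; set pre := _ @^-1` S => h.
have hx (x : \bar R) : x = (W L * (x * ((fine (W L))^-1)%:E))%E.
  rewrite muleCA {1}(pr_fin W mL) -EFinM mulfV ?mule1 //.
  by apply: contra P0 => /eqP h'; rewrite (pr_fin W mL) h'.
transitivity (W (pre `&` L)); first by rewrite setIC.
transitivity (W L * W pre)%E => //.
by rewrite -h -hx.
Qed.

(** The two sides are independent and the increment [mv q] has no atoms, so the diagonal is null by
    Fubini. *)
Lemma block_top : W [set w : borel C | - a * mv q w = topd ord0 (blk a q 1 w)] = 0%E.
Proof.
have a0 : a != 0 by apply/eqP => h; move: aq; rewrite h normr0 mul0r => /esym/eqP; rewrite oner_eq0.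
have mT : measurable_fun setT (fun w : borel C => topd ord0 (blk a q 1 w) : R).
  exact: (@measurableT_comp _ _ _ _ _ _ (topd ord0 : borel C -> R) _ _ (@measurable_topd R d.+1 ord0) (brownian_measurable bB)).
have mM := measurable_mv q.
pose Z : {mfun borel C >-> R} := HB.pack (fun w : borel C => topd ord0 (blk a q 1 w) : R)
  (isMeasurableFun.Build _ _ _ _ _ mT).
pose Y : {mfun borel C >-> R} := HB.pack (mv q : borel C -> R)
  (isMeasurableFun.Build _ _ _ _ _ mM).
have mX : measurable_fun setT (fun w : borel C => (Z w, Y w)) by exact: measurable_fun_pair.
pose X : {mfun borel C >-> (R * R)%type} := HB.pack (fun w : borel C => (Z w, Y w))
  (isMeasurableFun.Build _ _ _ _ _ mX).
pose Dg : set (R * R) := [set p | - a * p.2 = p.1].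
have mDg : measurable Dg.
  by apply: measurable_eq measurable_fst; apply: measurable_funM => //; exact: measurable_snd.
have := @product_measure_unique _ _ _ _ R (distribution W Z) (distribution W Y)
  (distribution W X) _ Dg mDg.
move=> h; transitivity (distribution W X Dg).
  by congr (W _); apply/seteqP.
rewrite -h; last first.
  move=> A B mA mB.
  have mSA : measurable (topd ord0 @^-1` A : set (borel C)).
    by rewrite -[X in measurable X]setTI; exact: (@measurable_topd R d.+1 ord0).
  transitivity (W [set w : borel C | B (mv q w) /\ (topd ord0 @^-1` A) (blk a q 1 w)]).
    by congr (W _); apply/seteqP; split => w /= [].
  by rewrite block_indep // muleC.
rewrite /product_measure1 /=; apply: integral0_eq => z _ /=.
rewrite (_ : xsection Dg z = [set - a^-1 * z]).
  rewrite /distribution /= /pushforward; apply: mv_atom; rewrite q0 /=; exact: ltW.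
apply/seteqP; split => y /=; rewrite /xsection /= inE /Dg /= => h'.
  by rewrite -h' mulrA mulrNN mulVf // mul1r.
by rewrite h' mulrA mulrNN mulfV // mul1r.
Qed.
End Block.

(** Without such a crossing, the path would from some rational [r] on keep the sign of its endpoint
    and yet be zero at [tau]; its extreme increment after [r], scaled by [a], would then be exactly
    [- a * hd w r], the null event of [block_top]. Only countably many [r] and two signs are to be
    excluded. *)
Lemma good_ae : {ae W, forall w : C, good w}.
Proof.
have aeq : {ae W, forall w : C, forall pb : rat * bool, 0 < (ratr pb.1 : R) < 1 ->
    (- ((-1) ^+ pb.2 / Num.sqrt (1 - ratr pb.1))) * mv (ratr pb.1) w <>
    topd ord0 (blk ((-1) ^+ pb.2 / Num.sqrt (1 - ratr pb.1)) (ratr pb.1) 1 w)}.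
  apply: ae_count => -[r b] /=; have [r01|nr] := pselect (0 < (ratr r : R) < 1); last first.
    by apply: aeW => w /nr.
  set a := (-1) ^+ b / _; have s0 : 0 < Num.sqrt (1 - ratr r : R).
    by rewrite sqrtr_gt0 subr_gt0; case/andP: r01.
  have aq : `|a| * Num.sqrt (1 - ratr r) = 1.
    by rewrite /a normrM normfV normrX normrN1 expr1n mul1r (gtr0_norm s0) mulVf ?gt_eqF.
  have := block_top r01 aq => h.
  exists [set w : borel C | - a * mv (ratr r) w = topd ord0 (blk a (ratr r) 1 w)]; split => //.
    apply: measurable_eq; first by apply: measurable_funM => //; exact: measurable_mv.
    apply: (mcomp (topd ord0 : borel C -> R)) => //.
      exact: (@measurable_topd R d.+1 ord0).
    by apply: brownian_measurable; apply: brownian_blk bW _ _ aq => //;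
      case/andP: r01 => /ltW -> ->.
  by move=> w /= /not_implyP[_ /contrapT].
have ae1 : {ae W, forall w : C, mv 1 w != 0}.
  exists [set w : borel C | mv 1 w = 0]; split.
  - by apply: measurable_eq; [exact: measurable_mv | exact: measurable_cst].
  - by apply: mv_atom; rewrite ltr01 lexx.
  by move=> w /= /negP; rewrite negbK => /eqP.
have := ae_and (ae_and wiener_start ae1) aeq.
apply: ae_mono => w [[w0 m1] hr].
have h0 : hd w 0 = 0 by rewrite /hd w0 mxE.
have mvE u : mv u w = hd w u by rewrite /mv h0 subr0.
have w1 : hd w 1 != 0 by rewrite -mvE.
split => // q /andP[q0 qt]; apply: contrapT => no.
have t1 := tau_lt1 w1.
have [r] := rat_in_itvoo qt; rewrite in_itv /= => /andP[qr rt].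
have r01 : 0 < (ratr r : R) < 1.
  by rewrite (le_lt_trans q0 qr) (lt_trans rt).
have /andP[r0 r1] := r01.
have sg u : ratr r <= u <= 1 -> 0 <= hd w u * hd w 1.
  move=> /andP[ru u1]; rewrite leNgt; apply/negP => h; apply: no; exists u => //.
  by rewrite u1 andbT (le_trans (ltW qr)).
have := hr (r, 0 < hd w 1) r01; rewrite /= mvE; set b := 0 < hd w 1.
set a := (-1) ^+ b / _ => ne; apply: ne.
have s0 : 0 < Num.sqrt (1 - ratr r : R) by rewrite sqrtr_gt0 subr_gt0.
have ah u : ratr r <= u <= 1 -> a * hd w u <= 0.
  move=> /sg; rewrite /a mulrAC pmulr_lle0 ?invr_gt0 // /b.
  case: (ltrgtP 0 (hd w 1)) w1 => // s1 _.
    by rewrite pmulr_lge0 // expr1 mulN1r oppr_le0.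
  by rewrite nmulr_lge0 // expr0 mul1r.
have bs : blk a (ratr r) 1 w (clip 0) 0 ord0 = 0.
  by rewrite blkE time_clip ?lexx ?ler01 // mul0r addr0 subrr mulr0.
have be t : blk a (ratr r) 1 w t 0 ord0 = a * hd w (ratr r + time t * (1 - ratr r)) - a * hd w (ratr r).
  by rewrite blkE mulrBr.
apply/eqP; rewrite eq_le; apply/andP; split.
  set u := (tau w - ratr r) / (1 - ratr r).
  have u01 : 0 <= u <= 1.
    have h1 : 0 < 1 - ratr r :> R by lra.
    apply/andP; split; first by rewrite divr_ge0 ?subr_ge0 // ltW.
    by rewrite ler_pdivrMr // mul1r lerD2r; case/andP: (tau_itv w).
  have := topd_ub ord0 (blk a (ratr r) 1 w) (clip u).
  rewrite bs subr0 be time_clip // /u divfK; last by rewrite subr_eq0 eq_sym lt_eqF.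
  by rewrite [ratr r + _]addrC subrK tau_zero ?mulr0 ?sub0r ?mulNr //; apply: lt_trans rt.
apply: topd_le => t; rewrite bs subr0 be mulNr -[leRHS]add0r lerD2r; apply: ah.
apply: affine_itv (time_itv t); apply/andP; split; lra.
Qed.
End GoodPaths.

(** * Decomposition of the walk at its last visit to height zero *)

Section LastVisit.
Variables (R : realType) (d : nat) (D : {linear 'rV[R]_d.+1 -> 'rV[R]_d.+1}).
Local Notation pt := 'rV[int]_d.+1.
Local Notation C := (C01 'rV[R]_d.+1).
Implicit Types (c : pt -> step d -> R) (s p pre : seq pt) (X : trajectory d.+1).

Definition walk s : Prop := forall k, (k.+1 < size s)%N ->
  exists st, nth 0 s k.+1 = nth 0 s k + dir st.

Lemma walk_rcons s st : s != [::] -> walk s -> walk (rcons s (last 0 s + dir st)).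
Proof.
move=> s0 ws k; rewrite size_rcons ltnS !nth_rcons => ks.
rewrite ks; case: (ltngtP k.+1 (size s)) => [h|h|h].
- exact: ws.
- by move: ks; rewrite ltnNge -ltnS h.
by exists st; rewrite -nth_last -h.
Qed.

Lemma eq_pexp_walk c n pre (F G : seq pt -> R) : pre != [::] -> walk pre ->
  (forall s, size s = (size pre + n)%N -> take (size pre) s = pre -> walk s -> F s = G s) ->
  pexp c n pre F = pexp c n pre G.
Proof.
elim: n pre => [|n IH] pre p0 wp h.
  by apply: h => //; rewrite ?addn0 ?take_size.
rewrite !pexpS; apply: avg_eq => st; apply: IH.
- by case: (pre) p0.
- exact: walk_rcons.
move=> s ss ts ws; apply: h => //; first by rewrite ss size_rcons addSnnS.
rewrite size_rcons in ts.
have := congr1 (take (size pre)) ts; rewrite take_takel ?leqnSn // => ->.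
by rewrite -cats1 take_size_cat.
Qed.

(** The Markov property at a fixed time [k]. With the indicator of survival in [Psi] it isolates the
    last visit at [k], and the inner mean is the one estimated by [cond_est]. *)
Lemma last_visit c (n k : nat) (x : pt) (Psi : seq pt -> R) : (k <= n)%N ->
  pexp c n [:: x] (fun s => (height (nth 0 s k) == 0)%:R * Psi (drop k s)) =
  pexp c k [:: x] (fun p => (height (last 0 p) == 0)%:R *
    pexp c (n - k) [:: last 0 p] Psi).
Proof.
move=> kn; rewrite -{1}(subnKC kn) pexp_cat; apply: eq_pexp => p sp _.
case/lastP: p sp => [|p z] //; rewrite size_rcons add1n => -[sp].
rewrite pexp_markov last_rcons.
transitivity (pexp c (n - k) [:: z] (fun s => (height z == 0)%:R * Psi s)).
  apply: eq_pexp => s ss ts; have s0 : nth 0 s 0 = z by case: s ss ts => //= y s _ [].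
  by rewrite nth_cat sp ltnn subnn s0 drop_size_cat.
case: (height z == 0); rewrite ?mul1r ?mul0r.
  by apply: eq_pexp => s _ _; rewrite mul1r.
have : avg c (fun=> 0 : R) z = 0 by rewrite /avg big1 // => st _; rewrite mulr0.
move=> a0; elim: (n - k)%N [:: z] => [|m IH] q /=; first by rewrite mul0r.
by rewrite /avg big1 // => st _; rewrite IH mulr0.
Qed.

Variables (g : R) (g0 : 0 < g).
Hypothesis Dh : forall v : 'rV[R]_d.+1, D v 0 0 = g * v 0 0.

Lemma polygonal_shift (x : nat -> 'rV[R]_d.+1) k (v : R) : 0 <= v ->
  polygonal x (k%:R + v) = polygonal (fun j => x (k + j)%N) v.
Proof.
move=> v0; rewrite /polygonal.
have -> : Num.truncn (k%:R + v) = (k + Num.truncn v)%N.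
  apply: truncn_def; have /andP[h1 h2] := truncn_itv v0.
  by rewrite -addnS !natrD lerD2l h1 ltrD2l.
by rewrite addnS natrD opprD addrACA subrr add0r.
Qed.

Lemma dz_restart n X k t : (k < n)%N ->
  blk (Num.sqrt (1 - k%:R / n%:R))^-1 (k%:R / n%:R) 1 (dz D n X) t =
  dz D (n - k) (fun j => X (k + j)%N - X k) t.
Proof.
move=> kn; have n0 : (0 < n)%N by apply: leq_ltn_trans kn.
have nR : (0 : R) < n%:R by rewrite ltr0n.
have mR : (0 : R) < (n - k)%:R by rewrite ltr0n subn_gt0.
have kR : (k%:R : R) <= n%:R by rewrite ler_nat ltnW.
have mE : (n - k)%:R = n%:R - k%:R :> R by rewrite natrB // ltnW.
have /andP[t0 t1] := time_itv t.
have r01 : 0 <= (k%:R / n%:R : R) <= 1.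
  by rewrite divr_ge0 //= ler_pdivrMr // mul1r.
set u := k%:R / n%:R + time t * (1 - k%:R / n%:R).
have u01 : 0 <= u <= 1.
  have /andP[r0 _] := r01; have /andP[ru ->] := affine_itv r01 (time_itv t).
  by rewrite andbT; exact: le_trans ru.
have nu : n%:R * u = k%:R + (n - k)%:R * time t.
  by rewrite /u mE; field; rewrite gt_eqF.
have nr : n%:R * (k%:R / n%:R) = k%:R + 0 :> R by rewrite addr0 mulrC divfK // gt_eqF.
rewrite -[LHS]/(_ *: (D (Zpath n X (clip u)) - D (Zpath n X (clip (k%:R / n%:R))))).
rewrite -[RHS]/(D (Zpath (n - k) (fun j => X (k + j)%N - X k) t)).
rewrite -linearB -linearZ; congr (D _); rewrite /Zpath !time_clip // nu nr -scalerBr scalerA.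
rewrite !polygonal_shift // ?mulr_ge0 // ?ler0n //.
have -> : polygonal (fun j => intr_vec R (X (k + j)%N)) 0 = intr_vec R (X k).
  by rewrite /polygonal truncn0 subr0 scale0r !addn0 addr0.
have sq : (Num.sqrt (1 - k%:R / n%:R))^-1 * (Num.sqrt n%:R)^-1 = (Num.sqrt (n - k)%:R)^-1 :> R.
  rewrite -invfM -sqrtrM ?subr_ge0; last by case/andP: r01.
  by rewrite mulrBl mul1r divfK ?gt_eqF // mE.
rewrite sq; congr (_ *: _); rewrite /polygonal !intr_vecB.
by apply/rowP => i; rewrite !mxE; ring.
Qed.

Section TauPath.
Variables (n k : nat) (X : trajectory d.+1).
Hypotheses (kn : (k < n)%N) (Xk : height (X k) = 0).
Hypothesis Xp : forall j, (k < j <= n)%N -> 0 < height (X j).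
Let n0 : (0 < n)%N. Proof. exact: leq_ltn_trans kn. Qed.

Lemma hd_dz j : (j <= n)%N -> hd (dz D n X) (j%:R / n%:R) = g * ((height (X j))%:~R / Num.sqrt n%:R).
Proof. by move=> jn; rewrite /hd dz_at // (dpt_height _ Dh). Qed.

Lemma tau_path : tau (dz D n X) = k%:R / n%:R.
Proof.
have nR : (0 : R) < n%:R by rewrite ltr0n.
have r01 : 0 <= (k%:R / n%:R : R) <= 1.
  by rewrite divr_ge0 //= ler_pdivrMr // mul1r ler_nat ltnW.
have /andP[r0 r1] := r01.
apply/eqP; rewrite eq_le; apply/andP; split; last first.
  have hz : hd (dz D n X) (k%:R / n%:R) = 0 by rewrite hd_dz ?(ltnW kn) // Xk mul0r mulr0.
  by have := tau_ub (hz : dz D n X (clip (k%:R / n%:R)) 0 0 = 0); rewrite time_clip.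
apply: tau_le => // t; rewrite leNgt; apply: contraPN => tk.
have [j [th [/andP[th0 th1] jn jth tE ->]]] := dz_interp D X t n0.
rewrite !mxE !(dpt_height _ Dh).
have sq : 0 < Num.sqrt (n%:R : R) by rewrite sqrtr_gt0.
have kt : k%:R < j%:R + th by rewrite -tE mulrC -ltr_pdivrMr.
have hp i : (k <= i <= n)%N -> 0 <= g * ((height (X i))%:~R / Num.sqrt n%:R : R).
  move=> /andP[ki jn']; rewrite mulr_ge0 ?(ltW g0) // divr_ge0 ?(ltW sq) // ler0z.
  move: ki; rewrite leq_eqVlt => /orP[/eqP <-|ki]; first by rewrite Xk.
  by apply/ltW/Xp; rewrite ki.
have hpp i : (k < i <= n)%N -> 0 < g * ((height (X i))%:~R / Num.sqrt n%:R : R).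
  by move=> ki; rewrite mulr_gt0 // divr_gt0 // ltr0z Xp.
apply/eqP; rewrite gt_eqF //.
have [th_0|th_0] := eqVneq th 0.
  rewrite th_0 mul0r addr0 subr0 mul1r; apply: hpp; rewrite jn andbT.
  by move: kt; rewrite th_0 addr0 ltr_nat.
have thp : 0 < th by rewrite lt_def th_0.
have jn1 : (j < n)%N by case: jth => // th_z; rewrite th_z eqxx in th_0.
have th1' : k%:R < j.+1%:R :> R by rewrite -natr1; lra.
rewrite ltr_nat ltnS in th1'.
apply: ltr_wpDl; last by rewrite mulr_gt0 // hpp // ltnS th1'.
by rewrite mulr_ge0 ?subr_ge0 // hp // th1' ltnW.
Qed.

Lemma phi_path : phi (dz D n X) = dz D (n - k) (fun j => X (k + j)%N - X k).
Proof. by apply/continuousEP => t; rewrite /phi tau_path; exact: dz_restart. Qed.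
End TauPath.

Definition lastz n k X : bool :=
  (height (X k) == 0) && [forall j : 'I_n.+1, (k < j)%N ==> (0 < height (X j))].

(** A walk that starts at height zero and ends positive has exactly one last visit to zero and stays
    positive afterwards, because the height changes by at most one per step. If it does not end
    positive, both sides vanish. *)
Lemma end_path n X (F : C -> R) : (0 < n)%N -> height (X 0%N) = 0 ->
  (forall k, (k < n)%N -> (`|height (X k.+1) - height (X k)| <= 1)%N) ->
  (0 < hd (dz D n X) 1)%R%:R * F (phi (dz D n X)) =
  \sum_(k < n) (lastz n k X)%:R * F (dz D (n - k) (fun j => X (k + j)%N - X k)).
Proof.
move=> n0 X0 Xs; have nR : (0 : R) < n%:R by rewrite ltr0n.
have sq : 0 < Num.sqrt (n%:R : R) by rewrite sqrtr_gt0.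
have -> : (0 < hd (dz D n X) 1) = (0 < height (X n)).
  have := hd_dz X n0 (leqnn n); rewrite divff ?gt_eqF // => ->.
  by rewrite pmulr_rgt0 // pmulr_lgt0 ?invr_gt0 // ltr0z.
case: (ltP 0 (height (X n))) => hn; last first.
  rewrite mul0r big1 // => k _; rewrite (_ : lastz n k X = false) ?mul0r //.
  apply/negbTE; rewrite negb_and; apply/orP; right; rewrite negb_forall.
  by apply/existsP; exists ord_max; rewrite negb_imply ltn_ord -leNgt.
have exP : exists k, (k <= n)%N && (height (X k) == 0) by exists 0%N; rewrite X0.
have ubP k : (k <= n)%N && (height (X k) == 0) -> (k <= n)%N by case/andP.
case: (ex_maxnP exP ubP) => k /andP[kn /eqP Xk] kmax.
have {}kn : (k < n)%N.
  by rewrite ltn_neqAle kn andbT; apply/eqP => kE; move: hn; rewrite -kE Xk ltxx.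
(* Backwards from time [n]: a positive height is preceded by a nonnegative one, and zero is excluded
   by the maximality of [k]. *)
have Xp j : (k < j <= n)%N -> 0 < height (X j).
  move=> /andP[kj jn]; rewrite -(subKn jn); have : (n - j < n - k)%N by lia.
  elim: (n - j)%N => [|i IH] ik; first by rewrite subn0.
  have hi : 0 < height (X (n - i)%N) by apply: IH; apply: ltnW.
  have hne : height (X (n - i.+1)%N) != 0.
    apply/negP => h0; have := kmax (n - i.+1)%N; rewrite leq_subr h0 => /(_ isT).
    by move: ik; lia.
  have nn : (n - i.+1 < n)%N by move: n0; lia.
  have := Xs _ nn; rewrite (_ : (n - i.+1).+1 = (n - i)%N); last by move: ik; lia.
  by move: hi hne; lia.
have lk : lastz n k X.
  rewrite /lastz Xk eqxx /=; apply/forallP => j; apply/implyP => kj; apply: Xp.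
  by rewrite kj -ltnS ltn_ord.
rewrite (bigD1 (Ordinal kn)) //= lk !mul1r (phi_path kn Xk Xp) big1 ?addr0 // => i ik.
rewrite (_ : lastz n i X = false) ?mul0r //; apply/negP => /andP[/eqP Xi /forallP h].
case: (ltngtP i k) => ki.
- have := h (Ordinal (ltnW (kn : (k < n)%N) : (k < n.+1)%N)); rewrite /= ki Xk ltxx //.
- by have := kmax i; rewrite Xi eqxx andbT => /(_ (ltnW (ltn_ord i))); rewrite leqNgt ki.
by move: ik; rewrite -val_eqE /= ki eqxx.
Qed.
End LastVisit.

(** * Expectations over products of probability spaces *)

Section ProductExpectation.
Context {d1 d2 : measure_display} {T1 : measurableType d1} {T2 : measurableType d2}.
Variables (R : realType) (P1 : probability T1 R) (P2 : probability T2 R).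

Lemma bmf_section (G : T1 * T2 -> R) x : bmf G -> bmf (fun y => G (x, y)).
Proof.
move=> [mG [M GM]]; split; last by exists M => y; exact: GM.
apply: (mcomp G) => //.
Qed.

Lemma expect_fubini (G : T1 * T2 -> R) : bmf G ->
  \int[(P1 \x P2)%E]_p G p = \int[P1]_x (\int[P2]_y G (x, y)) /\
  bmf (fun x => \int[P2]_y G (x, y)).
Proof.
move=> bG; have iG := bmf_integrable (P1 \x P2)%E bG.
have E x : fubini_F P2 (EFin \o G) x = (\int[P2]_y G (x, y))%:E.
  rewrite /fubini_F /Rintegral fineK //; apply: integrable_fin_num => //.
  by apply: (bmf_integrable P2); exact: bmf_section.
split; last split.
- by rewrite /Rintegral -(integral12_prod_meas1 iG); congr fine; apply: eq_integral => x _; rewrite E.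
- have := measurable_fubini_F iG; rewrite (_ : fubini_F P2 _ = EFin \o (fun x => \int[P2]_y G (x, y))).
    by move/measurable_EFinP.
  by apply/funext => x; rewrite E.
have [_ [M GM]] := bG; exists M => x; apply: expect_abs => //; exact: bmf_section.
Qed.
End ProductExpectation.

Lemma expect_ae_eq {dT : measure_display} {T : measurableType dT} (R : realType)
    (P : probability T R) (f g : T -> R) : bmf f -> bmf g -> {ae P, forall x, f x = g x} ->
  \int[P]_x f x = \int[P]_x g x.
Proof.
move=> [mf [M fM]] [mg _] fg.
have h := @expect_dominated _ T R P (fun _ => f) g M (fun=> mf) mg (fun _ => fM).
have {}h : (fun n : nat => \int[P]_x f x) @ \oo --> \int[P]_x g x.
  by apply: h; apply: ae_mono fg => x ->; exact: cvg_cst.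
exact: (cvg_unique _ (cvg_cst _) h).
Qed.

(** * Measurable maps between path spaces *)

Section PathMaps.
Variable R : realType.

Lemma measurable_path_map (V V' : normedModType R) (f : C01 V -> C01 V') (L : R) : 0 < L ->
  (forall (w w' : C01 V) e, (forall t, `|w t - w' t| <= e) ->
    forall t, `|f w t - f w' t| <= L * e) ->
  measurable_fun setT (f : borel (C01 V) -> borel (C01 V')).
Proof.
move=> L0 fL.
apply: (@measurability _ _ (borel (C01 V)) (borel (C01 V')) setT f (@open (C01 V')) (erefl _)) => _ [U oU <-].
rewrite setTI; apply: sub_sigma_algebra; rewrite openE => w Ufw.
have : nbhs (f w) U by exact: open_nbhs_nbhs.
move=> /nbhs_c01P[e e0 he]; apply/nbhs_c01P; exists (e / (2 * L)).
  by rewrite divr_gt0 // mulr_gt0.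
move=> w' ww; apply: he => t.
have := fL w w' (e / (2 * L)) _ t; move=> h; apply: le_lt_trans (h _) _.
  by move=> s; exact: ltW.
rewrite (_ : L * (e / (2 * L)) = e / 2); last by field; rewrite gt_eqF.
by rewrite ltr_pdivrMr // mulr_natr mulr2n ltrDl.
Qed.

(** Real paths are carried over to one-dimensional row vectors, for which the Brownian machinery is
    set up. *)
Definition row1_fun (h : C01 R) (t : I01 R) : 'rV[R]_1 := h t *: const_mx 1.
Lemma row1_continuous h : continuous (row1_fun h).
Proof.
have cz : continuous (fun a : R => a *: (const_mx 1 : 'rV[R]_1)).
  by move=> a; apply: cvgZr_tmp; exact: cvg_id.
exact: (continuous_comp_fun (@cts_fun _ _ h) cz).
Qed.
Definition row1 h : C01 'rV[R]_1 := mkcts (@row1_continuous h).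

Lemma row1E h t i : row1 h t 0 i = h t.
Proof. by rewrite /= !mxE mulr1. Qed.

Lemma head_row1 h : head_path (row1 h) = h.
Proof. by apply/continuousEP => t; exact: (row1E h t 0). Qed.

Lemma measurable_head d : measurable_fun setT
  (@head_path R d : borel (C01 'rV[R]_d.+1) -> borel (C01 R)).
Proof.
apply: (@measurable_path_map _ _ _ 1) => // w w' e we t; rewrite mul1r.
apply: le_trans (we t) => /=.
by have := rv_coord_le (w t - w' t) 0; rewrite !mxE.
Qed.

Lemma measurable_tail d : measurable_fun setT
  (@tail_path R d : borel (C01 'rV[R]_d.+1) -> borel (C01 'rV[R]_d)).
Proof.
apply: (@measurable_path_map _ _ _ 1) => // w w' e we t; rewrite mul1r /=.
rewrite -linearB; apply: rv_norm_le => [|i]; first by apply: le_trans (we t).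
by apply: le_trans (we t); rewrite mxE rv_coord_le.
Qed.

Lemma measurable_path1 {dT : measure_display} {T : measurableType dT} (X : T -> C01 R) :
  (forall t, measurable_fun setT (fun o => X o t : R)) ->
  measurable_fun setT (X : T -> borel (C01 R)).
Proof.
move=> mX; rewrite (_ : X = (fun w => head_path w) \o (fun o => row1 (X o))); last first.
  by apply/funext => o /=; rewrite head_row1.
apply: (mcomp (@head_path R 0 : borel _ -> borel _)); first exact: measurable_head.
apply: measurable_path => t i; rewrite (_ : (fun o => _) = fun o => X o t) //.
by apply/funext => o; rewrite row1E.
Qed.

Lemma measurable_eval1 t : measurable_fun setT (fun h : borel (C01 R) => (h : C01 R) t : R).
Proof.
apply: (@continuous_borel R R (fun h => h t)).
by apply: (@lipf_continuous _ _ 1) => w w' e we; rewrite mul1r.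
Qed.

Lemma measurable_row1 : measurable_fun setT (row1 : borel (C01 R) -> borel (C01 'rV[R]_1)).
Proof.
apply: measurable_path => t i; rewrite (_ : (fun o => _) = fun h : borel (C01 R) => (h : C01 R) t).
  exact: measurable_eval1.
by apply/funext => h; rewrite row1E.
Qed.

Variable d : nat.
Local Notation T := (borel (C01 R) * borel (C01 'rV[R]_d))%type.

Definition jval (h : C01 R) (w : C01 'rV[R]_d) (t : I01 R) (j : 'I_d.+1) : R :=
  if unlift ord0 j is Some k then w t 0 k else h t.
Definition join_fun (h : C01 R) (w : C01 'rV[R]_d) (t : I01 R) : 'rV[R]_d.+1 :=
  \sum_(j < d.+1) jval h w t j *: delta_mx 0 j.

Lemma join_continuous h w : continuous (join_fun h w).
Proof.
apply: continuous_big => [|j _]; first exact: add_continuous.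
have cz : continuous (fun a : R => a *: (delta_mx 0 j : 'rV[R]_d.+1)).
  by move=> a; apply: cvgZr_tmp; exact: cvg_id.
suff cj : continuous (fun t => jval h w t j) by exact: (continuous_comp_fun cj cz).
rewrite /jval; case: (unlift ord0 j) => [k|]; last exact: (@cts_fun _ _ h).
exact: (continuous_comp_fun (@cts_fun _ _ w) (@coord_continuous R 1 d 0 k)).
Qed.
Definition join h w : C01 'rV[R]_d.+1 := mkcts (@join_continuous h w).

Lemma joinE h w t j : join h w t 0 j = jval h w t j.
Proof.
rewrite -[join h w t]/(join_fun h w t) /join_fun summxE (bigD1 j) //= mxE mxE !eqxx mulr1.
rewrite big1 ?addr0 // => i ij; by rewrite mxE mxE eqxx /= eq_sym (negbTE ij) mulr0.
Qed.

Lemma join_head h w t : join h w t 0 0 = h t.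
Proof. by rewrite joinE /jval unlift_none. Qed.

Lemma join_tail h w t k : join h w t 0 (lift ord0 k) = w t 0 k.
Proof. by rewrite joinE /jval liftK. Qed.

Lemma join_split (w : C01 'rV[R]_d.+1) : join (head_path w) (tail_path w) = w.
Proof.
apply/continuousEP => t; apply/rowP => j; case: (unliftP ord0 j) => [k ->|->].
  by rewrite [LHS]join_tail /= mxE.
by rewrite [LHS]join_head.
Qed.

Lemma measurable_join : measurable_fun setT (fun p : T => join p.1 p.2 : borel (C01 'rV[R]_d.+1)).
Proof.
apply: measurable_path => t j; case: (unliftP ord0 j) => [k ->|->].
  rewrite (_ : (fun o => _) = (fun w : borel (C01 'rV[R]_d) => (w : C01 'rV[R]_d) t 0 k) \o snd); last first.
    by apply/funext => p; rewrite join_tail.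
  apply: measurableT_comp; last exact: measurable_snd.
  exact: (@measurable_eval R d _ (borel (C01 'rV[R]_d)) (fun w => w) (@measurable_id _ _ _)).
rewrite (_ : (fun o => _) = (fun w : borel (C01 R) => (w : C01 R) t) \o fst); last first.
  by apply/funext => p; rewrite join_head.
by apply: measurableT_comp; [exact: measurable_eval1 | exact: measurable_fst].
Qed.

Lemma measurable_meander : measurable_fun setT (@meander R : borel (C01 R) -> borel (C01 R)).
Proof.
apply: measurable_path1 => t.
pose tu (h : borel (C01 R)) : R := tau (row1 h).
have tuE h : tu h = last_zero (h : C01 R).
  by rewrite /tu /tau; congr last_zero; apply/funext => s; rewrite row1E.
have mt : measurable_fun setT tu.
  apply: (mcomp (@tau R 0 : borel _ -> R)); first exact: measurable_tau.
  exact: measurable_row1.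
rewrite (_ : (fun o => _) = fun h : borel (C01 R) => (Num.sqrt (1 - tu h))^-1 *
  `|row1 h (clip (tu h + time t * (1 - tu h))) 0 0|); last first.
  by apply/funext => h; rewrite row1E tuE.
have m1 : measurable_fun setT (fun h : borel (C01 R) => 1 - tu h : R).
  exact: measurable_funB (measurable_cst _) mt.
apply: measurable_funM.
  apply: measurable_inv; apply: (mcomp (@Num.sqrt R)) => //.
  by apply: continuous_measurable_fun; exact: sqrt_continuous.
apply: measurableT_comp; first exact: normr_measurable.
apply: (@measurable_rtime R 1 _ (borel (C01 R)) row1) => [s i|].
  rewrite (_ : (fun o => _) = fun h : borel (C01 R) => (h : C01 R) s).
    exact: measurable_eval1.
  by apply/funext => h; rewrite row1E.
apply: measurable_funD mt _.
exact: measurable_funM (measurable_cst _) m1.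
Qed.
End PathMaps.

(** * The path after the last zero: a meander and an independent Brownian motion *)

Section Identification.
Variables (R : realType) (d : nat).
Local Notation C := (C01 'rV[R]_d.+1).
Variables (W1 : probability (borel (C01 R)) R) (hW1 : wiener_measure1 W1).
Variables (PW : probability (borel (C01 'rV[R]_d)) R) (hPW : wiener_measure PW).

Lemma row1_brownian : brownian W1 (@row1 R : borel (C01 R) -> C01 'rV[R]_1).
Proof.
split.
  move=> t i; rewrite (_ : (fun o => _) = fun h : borel (C01 R) => (h : C01 R) t).
    exact: measurable_eval1.
  by apply/funext => h; rewrite row1E.
rewrite (_ : (fun i t o => _) = fun (_ : 'I_1) t (w : borel (C01 R)) => (w : C01 R) t) //.
by apply/funext => i; apply/funext => t; apply/funext => h; rewrite row1E.
Qed.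

(** Rectangles of grid increments split into the head row and the tail rows, and the products of
    Gaussian probabilities split with them; the grid notion [gbm] spares arbitrary times. *)
Lemma join_gbm : gbm (W1 \x PW)%E (fun p => join p.1 p.2).
Proof.
have mj := @measurable_join R d.
have b1 := brownian_gbm row1_brownian; have b2 := brownian_gbm (wiener_brownian hPW).
split.
- by move=> t i; exact: (@measurable_eval R d.+1 _ _ _ mj).
- have [_ s1 _] := b1; have [_ s2 _] := b2.
  pose A0 := [set h : borel (C01 R) | forall i, row1 h (clip 0) 0 i = 0].
  pose B0 := [set w : borel (C01 'rV[R]_d) | forall i, (w : C01 'rV[R]_d) (clip 0) 0 i = 0].
  rewrite (_ : [set o | _] = [set h : borel (C01 R) | forall i, row1 h (clip 0) 0 i = 0] `*`
    [set w : borel (C01 'rV[R]_d) | forall i, (w : C01 'rV[R]_d) (clip 0) 0 i = 0]); last first.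
    apply/seteqP; split => -[h w] /=.
      by move=> H; split => [i|k]; [rewrite row1E -(join_head h w) H | rewrite -(join_tail h w) H].
    move=> [H1 H2] i; case: (unliftP ord0 i) => [k ->|->]; first by rewrite join_tail H2.
    by rewrite join_head -(row1E h (clip 0) ord0) H1.
  transitivity (W1 A0 * PW B0)%E; last first.
    by rewrite /A0 /B0 s1 s2 mul1e.
  apply: product_measure1E.
    apply: (@measurable_forall 'I_1 _ (borel (C01 R)) (fun i => [set h | row1 h (clip 0) 0 i = 0])) => i.
    by have [m1 _ _] := b1; rewrite -[X in measurable X]setTI; exact: (m1 (clip 0) i measurableT [set 0]).
  apply: (@measurable_forall 'I_d _ (borel (C01 'rV[R]_d)) (fun i => [set h | (h : C01 'rV[R]_d) (clip 0) 0 i = 0])) => i.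
  by have [m1 _ _] := b2; rewrite -[X in measurable X]setTI; exact: (m1 (clip 0) i measurableT [set 0]).
move=> N A mA.
pose A1 (ij : 'I_1 * 'I_N.+1) := A (ord0, ij.2).
pose A2 (ij : 'I_d * 'I_N.+1) := A (lift ord0 ij.1, ij.2).
rewrite (_ : [set o | _] = [set h : borel (C01 R) | forall ij, A1 ij (inc N.+1 (row1 h) ij)] `*`
    [set w : borel (C01 'rV[R]_d) | forall ij, A2 ij (inc N.+1 w ij)]); last first.
  apply/seteqP; split => -[h w] /=.
    move=> H; split => -[i j]; rewrite /A1 /A2 /inc /=.
      by have := H (ord0, j); rewrite /inc /= !join_head !row1E.
    by have := H (lift ord0 i, j); rewrite /inc /= !join_tail.
  move=> [H1 H2] [i j]; case: (unliftP ord0 i) => [k ->|->].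
    by have := H2 (k, j); rewrite /A2 /inc /= !join_tail.
  by have := H1 (ord0, j); rewrite /A1 /inc /= !join_head !row1E.
have [m1 _ r1] := b1; have [m2 _ r2] := b2.
transitivity (W1 [set h : borel (C01 R) | forall ij, A1 ij (inc N.+1 (row1 h) ij)] *
    PW [set w : borel (C01 'rV[R]_d) | forall ij, A2 ij (inc N.+1 w ij)])%E; last first.
  rewrite r1 ?r2; [|by move=> ij; exact: mA|by move=> ij; exact: mA].
  have pb (I : finType) (B : I * 'I_N.+1 -> set R) :
      (\prod_ij normal_prob 0 (Num.sqrt N.+1%:R^-1) (B ij) =
       \prod_i \prod_j normal_prob 0 (Num.sqrt N.+1%:R^-1) (B (i, j)))%E.
    by rewrite pair_bigA /=; apply: eq_bigr => -[i j] _.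
  rewrite !pb.
  by rewrite big_ord1 [RHS]big_ord_recl.
apply: product_measure1E.
  apply: (@measurable_forall _ _ (borel (C01 R)) (fun ij => [set h | A1 ij (inc N.+1 (row1 h) ij)])) => ij.
  rewrite -[X in measurable X]setTI; exact: (gbm_incr b1 _ _ _ measurableT (mA _)).
apply: (@measurable_forall _ _ (borel (C01 'rV[R]_d)) (fun ij => [set h | A2 ij (inc N.+1 h ij)])) => ij.
rewrite -[X in measurable X]setTI; exact: (gbm_incr b2 _ _ _ measurableT (mA _)).
Qed.

Variables (F : C -> R) (bF : blip F).
Let mF : bmf (F : borel C -> R) := blip_bmf bF.

Definition tail_mean (h : C01 R) : R := \int[PW]_w F (join h w).

Lemma bmf_join : bmf (fun p : borel (C01 R) * borel (C01 'rV[R]_d) => F (join p.1 p.2)).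
Proof.
exact: (bmf_comp mF (@measurable_join R d)).
Qed.

Lemma bmf_tail_mean : bmf (tail_mean : borel (C01 R) -> R).
Proof. exact: (expect_fubini W1 PW bmf_join).2. Qed.

Lemma phi_join (h : C01 R) (w : C01 'rV[R]_d) : 0 < h (clip 1) -> h (clip 0) = 0 ->
  phi (join h w) = join (meander h)
    (blk (Num.sqrt (1 - last_zero h))^-1 (last_zero h) 1 w).
Proof.
move=> h1 h0; have tE : tau (join h w) = last_zero h.
  by rewrite /tau; congr last_zero; apply/funext => t; rewrite join_head.
have hE u : hd (join h w) u = h (clip u) by rewrite /hd join_head.
have z1 : hd (join h w) 1 != 0 by rewrite hE gt_eqF.
have ht : h (clip (last_zero h)) = 0.
  rewrite -tE -hE; have /andP[] := tau_itv (join h w); rewrite le_eqVlt => /orP[/eqP <- _|t0 _].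
    by rewrite hE.
  exact: tau_zero.
apply/continuousEP => t; apply/rowP => j; rewrite /phi tE.
case: (unliftP ord0 j) => [k ->|->].
  by rewrite [RHS]join_tail [LHS]blkE !join_tail blkE.
rewrite [RHS]join_head [LHS]blkE !join_head ht subr0 /=; congr (_ * _).
set u := last_zero h + _.
have tau01 := tau_itv (join h w); rewrite tE in tau01; have /andP[t0 t1] := tau01.
have /andP[s0 s1] := time_itv t.
have u01 : last_zero h <= u <= 1 by apply: affine_itv (time_itv t).
suff : 0 <= h (clip u) by move=> /ger0_norm ->.
rewrite leNgt; apply/negP => hu; have /andP[ul u1] := u01.
have [c cu hc] : exists2 c, c \in `[u, 1] & hd (join h w) c = 0.
  apply: IVT => //; first exact: continuous_subspaceT (@hd_continuous _ _ _).
  by rewrite !hE ge_min le_max (ltW hu) (ltW h1) orbT.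
move: cu; rewrite in_itv /= => /andP[uc c1].
have c0 : 0 <= c by apply: le_trans t0 (le_trans ul uc).
have := tau_ub (hc : join h w (clip c) 0 0 = 0); rewrite time_clip ?c0 // tE => ct.
have cl : c = last_zero h.
  by apply/eqP; rewrite eq_le ct; apply: le_trans ul uc.
have uE : u = last_zero h by apply/eqP; rewrite eq_le ul andbT -cl.
by move: hu; rewrite uE ht ltxx.
Qed.

Lemma start_ae : {ae W1, forall h : C01 R, h (clip 0) = 0}.
Proof.
apply: ae_mono (brownian_start row1_brownian) => h /rowP /(_ ord0).
by rewrite row1E mxE.
Qed.

Let pos (h : C01 R) : R := (0 < h (clip 1))%R%:R.
Let neg (h : C01 R) : R := (h (clip 1) < 0)%R%:R.
Let mv1 : measurable_fun setT (fun h : borel (C01 R) => (h : C01 R) (clip 1) : R).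
Proof. exact: measurable_eval1. Qed.

Let bpos : bmf (pos : borel (C01 R) -> R).
Proof.
by apply: bmf_bool; apply: measurable_lt mv1; exact: measurable_cst.
Qed.

Let bneg : bmf (neg : borel (C01 R) -> R).
Proof.
by apply: bmf_bool; apply: (measurable_lt mv1); exact: measurable_cst.
Qed.

Let bM : bmf (fun h : borel (C01 R) => tail_mean (meander h)).
Proof.
exact: (bmf_comp bmf_tail_mean (@measurable_meander R)).
Qed.

(** Fubini freezes the head, and with it its last zero. The tail over the remaining time, rescaled,
    is then an ordinary Brownian block, so the inner mean depends on the head through its meander
    only. *)
Lemma full_to_head (W : probability (borel C) R) : wiener_measure W ->
  \int[W]_w ((0 < hd w 1)%R%:R * F (phi w)) =
  \int[W1]_h (pos h * tail_mean (meander h)).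
Proof.
move=> hW; have bG := bmf_end bF.
rewrite (gbm_expect (brownian_gbm (wiener_brownian hW)) join_gbm bG).
have bGj : bmf (fun p : borel (C01 R) * borel (C01 'rV[R]_d) =>
    (0 < hd (join p.1 p.2) 1)%R%:R * F (phi (join p.1 p.2)) : R).
  exact: (bmf_comp bG (@measurable_join R d)).
have [-> bi] := expect_fubini W1 PW bGj.
apply: expect_ae_eq; [exact: bi | exact: bmfM |].
apply: ae_mono start_ae => h h0 /=.
have hE (w : C01 'rV[R]_d) : hd (join h w) 1 = h (clip 1) by rewrite /hd join_head.
rewrite /pos; case: (ltP 0 (h (clip 1))) => h1; last first.
  rewrite mul0r; under eq_Rintegral do rewrite hE ltNge h1 /= mul0r.
  by rewrite expect_cst.
rewrite mul1r; under eq_Rintegral do rewrite hE h1 mul1r (phi_join _ h1 h0).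
have hz : 0 <= last_zero h < 1.
  have tE : tau (join h (cst 0 : C01 'rV[R]_d)) = last_zero h.
    by rewrite /tau; congr last_zero; apply/funext => t; rewrite join_head.
  rewrite -tE tau_lt1 ?hE ?gt_eqF // andbT.
  by case/andP: (tau_itv (join h (cst 0 : C01 'rV[R]_d))).
have s0 : 0 < Num.sqrt (1 - last_zero h) by rewrite sqrtr_gt0 subr_gt0; case/andP: hz.
apply: (@blk_expect R d PW hPW (fun w => F (join (meander h) w)) (Num.sqrt (1 - last_zero h))^-1
  (last_zero h) 1) => //.
- by rewrite gtr0_norm ?invr_gt0 // mulVf ?gt_eqF.
exact: (@bmf_section _ _ (borel (C01 R)) (borel (C01 'rV[R]_d)) R _ (meander h : borel (C01 R)) bmf_join).
Qed.

Lemma meander_opp (h h' : C01 R) : (forall t, h' t = - h t) -> meander h' = meander h.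
Proof.
move=> hh; have E : last_zero h' = last_zero h.
  rewrite /last_zero; congr sup; apply/seteqP; split => _ [s /= hs <-]; exists s => //=.
    by apply/eqP; rewrite -oppr_eq0 -hh hs.
  by rewrite hh hs oppr0.
apply/continuousEP => t; change (meander_fun h' t = meander_fun h t).
by rewrite /meander_fun E hh normrN.
Qed.

Lemma sign_symmetry : \int[W1]_h (pos h * tail_mean (meander h)) =
  \int[W1]_h (neg h * tail_mean (meander h)).
Proof.
pose K (w : C01 'rV[R]_1) : R := pos (head_path w) * tail_mean (meander (head_path w)).
have bK : bmf (K : borel (C01 'rV[R]_1) -> R).
  exact: (bmf_comp (bmfM bpos bM) (@measurable_head R 0)).
have bb : brownian W1 (fun h : borel (C01 R) => blk (-1) 0 1 (row1 h)).
  by apply: brownian_blk row1_brownian _ _ _; rewrite ?lexx ?ltr01 // normrN1 subr0 sqrtr1 mulr1.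
have := brownian_expect row1_brownian bb bK.
rewrite (_ : \int[W1]_o K (row1 o) = \int[W1]_h (pos h * tail_mean (meander h))); last first.
  by apply: eq_Rintegral => h _; rewrite /K head_row1.
move=> ->; apply: expect_ae_eq.
- exact: (bmf_comp bK (brownian_measurable bb)).
- exact: bmfM.
apply: ae_mono start_ae => h h0.
have E t : head_path (blk (-1) 0 1 (row1 h)) t = - h t.
  rewrite [LHS]blkE !row1E h0 subr0 mulN1r subr0 mulr1 add0r clip_time //.
by rewrite /K (meander_opp E) /pos /neg E oppr_gt0.
Qed.

Lemma end_ae : {ae W1, forall h : C01 R, h (clip 1) != 0}.
Proof.
have [_ _ hN] := hW1.
have tt : time (clip (0 : R)) < time (clip 1) by rewrite !time_clip ?lexx ?ler01.
have h := hN ord0 (clip 0) (clip 1) tt [set 0] (measurable_set1 0).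
rewrite normal_set1 in h.
have ae1 : {ae W1, forall h : C01 R, h (clip 1) - h (clip 0) <> 0}.
  exists [set w : borel (C01 R) | [set 0] ((w : C01 R) (clip 1) - (w : C01 R) (clip 0))]; split => //.
    apply: measurable_eq; last exact: measurable_cst.
    by apply: measurable_funB => //; exact: measurable_eval1.
  by move=> w /= /contrapT.
by apply: ae_mono (ae_and start_ae ae1) => w [-> ]; rewrite subr0 => /eqP.
Qed.

(** The meander sees only the modulus of the path, so both signs of the endpoint contribute
    equally. *)
Lemma head_half : \int[W1]_h (pos h * tail_mean (meander h)) =
  2^-1 * \int[W1]_h tail_mean (meander h).
Proof.
have E : \int[W1]_h tail_mean (meander h) =
    \int[W1]_h (pos h * tail_mean (meander h)) + \int[W1]_h (neg h * tail_mean (meander h)).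
  rewrite -expectD; [|exact: bmfM|exact: bmfM].
  apply: expect_ae_eq; [exact: bM | by apply: bmfD; exact: bmfM |].
  apply: ae_mono end_ae => h h1; rewrite -mulrDl /pos /neg.
  by case: (ltrgtP 0 (h (clip 1))) h1 => // _ _; rewrite ?addr0 ?add0r mul1r.
by rewrite E -sign_symmetry; set x := \int[W1]_h (pos h * _); field.
Qed.

Lemma meander_mean (PWplus : probability (borel (C01 R)) R)
    (nu : probability (borel C) R) :
  (forall A : set (borel (C01 R)), measurable A -> PWplus A = W1 (@meander R @^-1` A)) ->
  product_law nu PWplus PW -> \int[W1]_h tail_mean (meander h) = \int[nu]_w F w.
Proof.
move=> hp hn.
have E1 : \int[PWplus]_h tail_mean h = \int[W1]_h tail_mean (meander h).
  apply: (@same_law_expect R _ _ _ _ _ (borel (C01 R)) PWplus W1 (fun h => h) (@meander R)) => //.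
  - exact: measurable_meander.
  - exact: bmf_tail_mean.
rewrite -E1 -(expect_fubini PWplus PW bmf_join).1.
have mX : measurable_fun setT (fun w : borel C => (head_path w : borel (C01 R), tail_path w : borel (C01 'rV[R]_d))).
  by apply: measurable_fun_pair; [exact: measurable_head | exact: measurable_tail].
pose X : {mfun borel C >-> (borel (C01 R) * borel (C01 'rV[R]_d))%type} :=
  HB.pack (fun w : borel C => (head_path w : borel (C01 R), tail_path w : borel (C01 'rV[R]_d)))
  (isMeasurableFun.Build _ _ _ _ _ mX).
have hu := @product_measure_unique _ _ _ _ R PWplus PW (distribution nu X) _ .
transitivity (\int[nu]_w F (join (X w).1 (X w).2)); last first.
  by apply: eq_Rintegral => w _; rewrite /= join_split.
apply: (@same_law_expect R _ _ _ _ _ (borel (C01 R) * borel (C01 'rV[R]_d))%type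
  (PWplus \x PW)%E nu (fun p => p) X _ _ _ (fun p => F (join p.1 p.2))) => //.
  by move=> A mA; apply: hu => // B1 B2 m1 m2; rewrite -hn.
exact: bmf_join.
Qed.
End Identification.

Lemma linear_lower (R : realType) (d : nat) (D : {linear 'rV[R]_d.+1 -> 'rV[R]_d.+1}) :
  bijective D -> exists2 Ci : R, 0 < Ci & forall v, `|v| <= Ci * `|D v|.
Proof.
move=> [D' K1 K2].
pose E : {linear 'rV[R]_d.+1 -> 'rV[R]_d.+1} :=
  HB.pack D' (GRing.isLinear.Build R _ _ _ D' (can2_linear K1 K2)).
exists (opn E + 1); first by rewrite ltr_wpDl // opn_ge0.
move=> v; have := opnP E (D v); rewrite -[E (D v)]/(D' (D v)) K1 => h.
by apply: le_trans h _; rewrite ler_wpM2r // lerDl.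
Qed.

(** * A penalty for late zeros and for distant paths *)

Section Tail.
Variables (R : realType) (d : nat).
Local Notation C := (C01 'rV[R]_d.+1).
Implicit Types w : C.

(** Controls the last visits to which the conditional estimate does not apply. The first term is [1]
    if the first coordinate has a zero in the last fraction [1 / (j + 1)] of the time, the second if
    the path goes as far as [j + 1] from the origin; both vanish for large [j] when the end is not
    zero. *)
Definition edge_tail (j : nat) w : R :=
  clamp01 (j%:R * away (1 - j.+1%:R^-1) w + 1) +
  clamp01 (1 * dst w (cst 0 : C) + - j%:R).

Let inv01 (j : nat) : 0 < (j.+1%:R^-1 : R) <= 1.
Proof. by rewrite invr_gt0 ltr0n /= invf_le1 ?ltr0n // ler1n. Qed.

Lemma blip_tail j : blip (edge_tail j).
Proof.
have /andP[i0 i1] := inv01 j.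
apply: blipD.
  apply: (@blip_clamp R d.+1 _ 1 j%:R 1) => //; apply: away_lipf; by rewrite gerBl ltW.
exact: (@blip_clamp R d.+1 _ 1 1 (- j%:R) ler01 (@dst_lipf _ _ (cst 0 : C))).
Qed.

Lemma tail_ge0 j w : 0 <= edge_tail j w.
Proof.
rewrite /edge_tail addr_ge0 //; first by case/andP: (clamp01_itv (j%:R * away (1 - j.+1%:R^-1) w + 1)).
by case/andP: (clamp01_itv (1 * dst w (cst 0 : C) + - j%:R)).
Qed.

Lemma tail_le2 j w : edge_tail j w <= 2.
Proof.
have /andP[_ h1] := clamp01_itv (j%:R * away (1 - j.+1%:R^-1) w + 1).
have /andP[_ h2] := clamp01_itv (1 * dst w (cst 0 : C) + - j%:R).
rewrite /edge_tail; move: h1 h2; set a := clamp01 _; set b := clamp01 _; lra.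
Qed.

Lemma tail_zero w : hd w 1 != 0 -> exists N, forall j, (N <= j)%N -> edge_tail j w = 0.
Proof.
move=> w1; have m0 : 0 < `|hd w 1| / 2 by rewrite divr_gt0 // normr_gt0.
have [dl dl0 hdl] := path_unif w m0; have [N1 hN1] := inv_nat_small dl0.
have [B wB] := path_bounded w.
set N2 := (Num.truncn (2 / `|hd w 1|)).+1.
set N3 := (Num.truncn (Num.max 0 B)).+1.
exists (maxn N1 (maxn N2 N3)) => j; rewrite !geq_max => /and3P[j1 j2 j3].
have /andP[i0 i1] := inv01 j.
rewrite /edge_tail !clamp01_eq0 ?addr0 //.
  rewrite mul1r subr_le0; apply: (@le_trans _ _ B).
    by apply: dst_le => t; rewrite subr0.
  apply: (@le_trans _ _ (Num.max 0 B)); first by rewrite le_max lexx orbT.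
  have b0 : 0 <= Num.max 0 B by rewrite le_max lexx.
  have /andP[_ h] := truncn_itv b0; apply: le_trans (ltW h) _; by rewrite ler_nat.
have aw : away (1 - j.+1%:R^-1) w <= - (`|hd w 1| / 2).
  apply: ge_sup.
    exists (- `|w (clip 1) 0 0|), (clip 1) => //=; rewrite time_clip ?lexx ?ler01 //; lra.
  move=> _ [t /= ht <-]; rewrite lerN2 -hdE.
  have /andP[t0 t1] := time_itv t.
  have h : `|time (clip (1 : R)) - time t| <= dl.
    rewrite time_clip ?lexx ?ler01 // ger0_norm ?subr_ge0 //.
    by apply: le_trans (hN1 j j1); rewrite lerBlDr addrC -lerBlDr.
  have := hdl _ _ h => {}h.
  have h2 := rv_coord_le (w (clip 1) - w t) 0; rewrite !mxE in h2.
  have := lerB_dist (hd w 1) (hd w (time t)); rewrite hdE /hd; move: h2 h; rewrite /hd.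
  set a := `|w (clip 1) 0 0 - w t 0 0|; set b := `|w (clip 1) - w t|.
  set x := `|w (clip 1) 0 0|; set y := `|w t 0 0|; lra.
have jj : 2 / `|hd w 1| <= j%:R.
  have b0 : 0 <= 2 / `|hd w 1| by rewrite divr_ge0.
  have /andP[_ h] := truncn_itv b0; apply: le_trans (ltW h) _; by rewrite ler_nat.
have h1 : j%:R * away (1 - j.+1%:R^-1) w <= j%:R * - (`|hd w 1| / 2) by rewrite ler_wpM2l.
have h2 : 2 / `|hd w 1| * (`|hd w 1| / 2) <= j%:R * (`|hd w 1| / 2) by rewrite ler_wpM2r // ltW.
rewrite (_ : 2 / `|hd w 1| * (`|hd w 1| / 2) = 1) in h2; last by field; rewrite normr_eq0.
move: h1 h2; rewrite mulrN; set a := j%:R * away _ _; set b := j%:R * _; lra.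
Qed.

Lemma tail_small (W : probability (borel C) R) e : wiener_measure W -> 0 < e ->
  exists j, \int[W]_w edge_tail j w <= e.
Proof.
move=> hW e0.
have h : (fun j => \int[W]_w edge_tail j w) @ \oo --> \int[W]_w (0 : R).
  apply: (@expect_dominated _ (borel C) R W edge_tail (fun=> 0) 2).
  - by move=> j; have [] := blip_bmf (blip_tail j).
  - exact: measurable_cst.
  - by move=> j w; rewrite ger0_norm ?tail_ge0 // tail_le2.
  apply: ae_mono (good_ae hW) => w [w1 _]; apply/cvgn_epsP => e' e'0.
  have [N hN] := tail_zero w1; exists N => n nN; by rewrite hN // subr0 normr0 ltW.
rewrite expect_cst in h; move/cvgn_epsP: h => /(_ e e0)[N hN]; exists N.
have := hN N (leqnn N); rewrite subr0 ler_norml => /andP[_]; exact.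
Qed.
End Tail.

Lemma conditional_expect {dT : measure_display} {T : measurableType dT} (R : realType)
    (P : probability T R) (L : set T) (mL : measurable L) (h : T -> R) : P L != 0%E ->
  bmf h -> (forall x, 0 <= h x) ->
  \int[conditional P mL]_x h x = (fine (P L))^-1 * \int[P]_x (\1_L x * h x).
Proof.
move=> P0 bh h0; set P' := conditional P mL.
have p0 : 0 < fine (P L).
  rewrite lt_def pr_ge0 andbT; apply: contra P0 => /eqP E; by rewrite (pr_fin P mL) E.
have bLh : bmf (fun x => \1_L x * h x : R) by apply: bmfM => //; exact: bmf_indic.
have mh : measurable_fun setT (EFin \o h) by apply/measurable_EFinP; case: bh.
rewrite (@expect_ae_eq _ _ R P' h (fun x => \1_L x * h x)) //; last first.
  exists (~` L); split; first exact: measurableC.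
    by rewrite /P' conditionalE // setICl measure0 mul0e.
  move=> x /= nx Lx; apply: nx; by rewrite indicE mem_set // mul1r.
have E (m : probability T R) : (\int[m]_x (\1_L x * h x)%:E = \int[m]_(x in L) (h x)%:E)%E.
  rewrite [RHS]integral_mkcond; apply: eq_integral => x _; rewrite patchE indicE.
  by case: (x \in L); rewrite ?mul1r ?mul0r.
have pi0 : 0 <= (fine (P L))^-1 by rewrite invr_ge0 ltW.
have F : (\int[P']_(x in L) (h x)%:E = (fine (P L))^-1%:E * \int[P]_(x in L) (h x)%:E)%E.
  have := @ge0_integral_mscale _ T R P L mL (NngNum pi0) (EFin \o h) _ _.
  move=> <- //=; last first.
  - by move=> x _; rewrite lee_fin.
  - exact: measurable_funS mh.
  apply: eq_measure_integral => A mA AL.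
  have cE := @conditionalE _ _ R P L mL A P0; rewrite (setIidl AL) in cE.
  by rewrite -[LHS]/(conditional P mL A) cE muleC.
rewrite /Rintegral !E F fineM //; rewrite -E.
by apply: integrable_fin_num => //; exact: (bmf_integrable P bLh).
Qed.

(** * From the unconditioned path to the value of the constant *)

Section Level.
Variables (R : realType) (d : nat) (D : {linear 'rV[R]_d.+1 -> 'rV[R]_d.+1}).
Local Notation pt := 'rV[int]_d.+1.
Local Notation C := (C01 'rV[R]_d.+1).
Variables (W : probability (borel C) R) (hW : wiener_measure W).
Variables (kappa : R) (k0 : 0 < kappa) (c : pt -> step d -> R).
Hypotheses (cP : conductances kappa c) (hc : uniform_clt D W c).
Variables (g : R) (g0 : 0 < g).
Hypothesis Dh : forall v : 'rV[R]_d.+1, D v 0 0 = g * v 0 0.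
Variables (Ci : R) (Ci0 : 0 < Ci).
Hypothesis hCi : forall v, `|v| <= Ci * `|D v|.
Implicit Types (X : trajectory d.+1) (s p : seq pt).

Lemma nrm_intr (x : pt) : (nrm x)%:R <= `|intr_vec R x|.
Proof.
have n0 : 0 <= `|intr_vec R x| by exact: normr_ge0.
apply: (@le_trans _ _ (Num.truncn `|intr_vec R x|)%:R); last by case/andP: (truncn_itv n0).
rewrite ler_nat; apply/nrm_leP => i; rewrite truncn_ge_nat //.
apply: le_trans (rv_coord_le (intr_vec R x) i); rewrite mxE -intr_norm.
by rewrite -[X in X <= _]mulrz_nat natz -abszE.
Qed.

Definition badz (n0 : nat) (K : R) n k (x : pt) : bool :=
  (n - k < n0)%N || ~~ ((nrm x)%:R <= K * Num.sqrt (n - k)%:R :> R).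

(** Either little time remains, and the zero at time [k / n] is a late one; or [n - k] is comparable
    with [n], and a site beyond [K * sqrt (n - k)] gives a point of the rescaled path beyond
    [j + 1], where [Ci] accounts for the inverse of [D]. *)
Lemma lastz_tail (j n0 n k : nat) X : (n0 * j.+1 <= n)%N -> (k < n)%N -> lastz n k X ->
  badz n0 (Num.sqrt j.+1%:R * (Ci * j.+1%:R)) n k (X k) -> 1 <= edge_tail j (dz D n X).
Proof.
move=> n0n kn /andP[/eqP Xk _] bad; have n00 : (0 < n)%N by apply: leq_ltn_trans kn.
have nR : (0 : R) < n%:R by rewrite ltr0n.
have jR : (0 : R) < j.+1%:R by rewrite ltr0n.
have sq : 0 < Num.sqrt (n%:R : R) by rewrite sqrtr_gt0.
have /andP[c10 c11] := clamp01_itv (j%:R * away (1 - j.+1%:R^-1) (dz D n X) + 1).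
have /andP[c20 c21] := clamp01_itv (1 * dst (dz D n X) (cst 0 : C) + - j%:R).
have kR : (k%:R : R) <= n%:R by rewrite ler_nat ltnW.
have mE : (n - k)%:R = n%:R - k%:R :> R by rewrite natrB // ltnW.
have r01 : 0 <= (k%:R / n%:R : R) <= 1.
  by rewrite divr_ge0 //= ler_pdivrMr // mul1r.
rewrite /edge_tail; case: (leP ((n - k)%:R * j.+1%:R : R) n%:R) => h.
  have -> : clamp01 (j%:R * away (1 - j.+1%:R^-1) (dz D n X) + 1) = 1; last by rewrite lerDl.
  apply: clamp01_eq1; rewrite lerDr mulr_ge0 //.
  have hz : hd (dz D n X) (k%:R / n%:R) = 0 by rewrite (hd_dz Dh X kn (ltnW kn)) Xk mul0r mulr0.
  have i1 : (1 - j.+1%:R^-1 : R) <= 1 by rewrite gerBl invr_ge0 ltW.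
  rewrite leNgt; apply/negP => /(away_lt0 _ i1) /(_ (k%:R / n%:R)).
  rewrite hz eqxx => /(_ _)/negP; apply => //; case/andP: r01 => _ ->; rewrite andbT.
  rewrite lerBlDr -lerBlDl -{1}[1](@divff _ (n%:R : R)) ?gt_eqF // -mulrBl -mE.
  by rewrite ler_pdivrMr // mulrC ler_pdivlMr.
have nb : (n - k < n0)%N = false.
  apply/negbTE; rewrite -leqNgt -(ler_nat R) -(ler_pM2r jR); apply: le_trans (ltW h).
  by rewrite -natrM ler_nat.
move: bad; rewrite /badz nb /= -ltNge => bad.
have -> : clamp01 (1 * dst (dz D n X) (cst 0 : C) + - j%:R) = 1; last by rewrite lerDr.
apply: clamp01_eq1; rewrite mul1r lerBrDr.
apply: (@le_trans _ _ `|dz D n X (clip (k%:R / n%:R)) - (cst 0 : C) (clip (k%:R / n%:R))|); last exact: dst_ub.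
rewrite subr0 dz_at ?(ltnW kn) // -(ler_pM2l Ci0).
apply: le_trans (hCi _); rewrite normrZ ger0_norm ?invr_ge0 ?(ltW sq) //.
rewrite [1 + _]addrC natr1 [leRHS]mulrC ler_pdivlMr //.
apply: le_trans (nrm_intr _); apply: le_trans (ltW bad).
rewrite [leRHS]mulrAC [leLHS]mulrC; apply: ler_wpM2r; first by rewrite mulr_ge0 ?(ltW Ci0) ?(ltW jR).
by rewrite -sqrtrM ?(ltW jR) // ler_wsqrtr // mulrC ltW.
Qed.

Lemma sum_lastz (n : nat) X (b : nat -> R) B : 0 <= B ->
  (forall k, (k < n)%N -> lastz n k X -> b k <= B) ->
  \sum_(k < n) (lastz n k X)%:R * b k <= B.
Proof.
move=> B0 h; case: (pickP (fun k : 'I_n => lastz n k X)) => [k lk|no]; last first.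
  by rewrite big1 // => k _; rewrite no mul0r.
rewrite (bigD1 k) //= big1 ?addr0; first by rewrite lk mul1r h.
move=> i ik; rewrite (_ : lastz n i X = false) ?mul0r //; apply/negP => li.
have un (a a' : 'I_n) : lastz n a X -> lastz n a' X -> ~ (a < a')%N.
  move=> /andP[_ /forallP ha] /andP[/eqP ha' _] aa.
  by have := ha (widen_ord (leqnSn n) a'); rewrite /= aa ha' ltxx.
case: (ltngtP i k) => ki; [exact: (un i k) | exact: (un k i) | ].
by move: ik; rewrite -val_eqE /= ki eqxx.
Qed.

Lemma lastz_alive n k s : (k <= n)%N -> size s = n.+1 ->
  lastz n k (recen 0 s) = (height (nth 0 s k) == 0) && alive (n - k) (drop k s).
Proof.
move=> kn ss; rewrite /lastz /recen subr0; congr (_ && _).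
apply/forallP/forallP => h i.
  have iP : (k + i.+1 < n.+1)%N by have := ltn_ord i; lia.
  by have /implyP := h (Ordinal iP); rewrite /= subr0 nth_drop; apply; lia.
apply/implyP => ki; have iP : (i - k.+1 < n - k)%N by have := ltn_ord i; lia.
have := h (Ordinal iP); rewrite /= nth_drop subr0.
by rewrite (_ : (k + (i - k.+1).+1)%N = i) //; lia.
Qed.

Lemma walk_step s : walk s -> forall k, (k.+1 < size s)%N ->
  (`|height (recen 0 s k.+1) - height (recen 0 s k)| <= 1)%N.
Proof.
move=> ws k ks; have [st E] := ws k ks; rewrite /recen !subr0 E heightD.
have := height_dir st; set a := height (dir st); set b := height _; lia.
Qed.

(** At most one [k] is the last visit, so the terms [sigma] do not accumulate. For exceptional
    visits the trivial bound [2 * M] is paid, on an event dominated by [edge_tail]. *)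
Lemma level_est (F : C -> R) (M sigma : R) (n0 j : nat) n : (0 < n)%N -> 0 <= sigma ->
  0 <= M -> (forall w, `|F w| <= 2 * M) ->
  (forall m, (n0 <= m)%N -> forall y : pt, height y = 0 ->
    (nrm y)%:R <= Num.sqrt j.+1%:R * (Ci * j.+1%:R) * Num.sqrt m%:R :> R ->
    `|pexp c m [:: y] (fun s => (alive m s)%:R * F (dz D m (recen y s)))| <=
    sigma * surv c m y) ->
  (n0 * j.+1 <= n)%N ->
  `|clt D c (fun w => (0 < hd w 1)%R%:R * F (phi w)) n 0| <=
    sigma + 2 * M * clt D c (edge_tail j) n 0.
Proof.
move=> n00 s0 M0 FM hF nj; set K := _ * _ in hF.
pose Psi k s := (alive (n - k) s)%:R * F (dz D (n - k) (recen (nth 0 s 0) s)).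
pose Phi k s : R := (alive (n - k) s)%:R * (sigma + 2 * M * (badz n0 K n k (nth 0 s 0))%:R).
have hdP k z (G : seq pt -> R) G' : (forall s, nth 0 s 0 = z -> G s = G' s) ->
    pexp c (n - k) [:: z] G = pexp c (n - k) [:: z] G'.
  by move=> h; apply: eq_pexp => s ss ts; apply: h; case: s ss ts => //= y s _ [].
have E1 : clt D c (fun w => (0 < hd w 1)%R%:R * F (phi w)) n 0 =
    \sum_(k < n) pexp c n [:: 0] (fun s => (height (nth 0 s k) == 0)%:R * Psi k (drop k s)).
  have w0 : walk [:: (0 : pt)] by move=> k.
  rewrite -(pexp_sum k0 cP) /clt; apply: eq_pexp_walk; [by [] | exact: w0 | move=> s].
  rewrite add1n => ss ts ws; have s0' : nth 0 s 0 = 0 :> pt by case: s ss ts ws => //= y s _ [].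
  rewrite (end_path g0 Dh) //.
  - apply: eq_bigr => k _; rewrite lastz_alive ?(ltnW (ltn_ord k)) // /Psi nth_drop addn0.
    rewrite -mulnb natrM -mulrA; congr (_ * (_ * F (dz _ _ _))).
    by apply/funext => i; rewrite /recen !subr0 nth_drop.
  - by rewrite /recen s0' subr0 /height mxE.
  - by move=> k kn; apply: walk_step => //; rewrite ss.
have term (k : 'I_n) : `|pexp c n [:: 0] (fun s => (height (nth 0 s k) == 0)%:R * Psi k (drop k s))| <=
    pexp c n [:: 0] (fun s => (height (nth 0 s k) == 0)%:R * Phi k (drop k s)).
  have kn := ltnW (ltn_ord k); rewrite !last_visit //.
  have := @pexp_dist _ _ _ k0 c cP k [:: 0] (fun p => (height (last 0 p) == 0)%:R *
    pexp c (n - k) [:: last 0 p] (Psi k)) (fun=> 0) (fun p => (height (last 0 p) == 0)%:R *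
    pexp c (n - k) [:: last 0 p] (Phi k)).
  rewrite (pexp_cst k0 cP) subr0; apply => p; rewrite subr0.
  set z := last 0 p; rewrite normrM ger0_norm ?ler0n //.
  case: eqP => hz; last by rewrite !mul0r.
  rewrite !mul1r.
  have -> : pexp c (n - k) [:: z] (Psi k) = pexp c (n - k) [:: z]
      (fun s => (alive (n - k) s)%:R * F (dz D (n - k) (recen z s))).
    by apply: hdP => s sz; rewrite /Psi sz.
  have -> : pexp c (n - k) [:: z] (Phi k) =
      (sigma + 2 * M * (badz n0 K n k z)%:R) * surv c (n - k) z.
    by rewrite /surv -pexpZ; apply: hdP => s sz; rewrite /Phi sz mulrC.
  have sv0 : 0 <= surv c (n - k) z by apply: (pexp_ge0 k0 cP) => s; rewrite ler0n.
  case: (boolP (badz n0 K n k z)) => bz.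
    rewrite mulr1; apply: (@le_trans _ _ (2 * M * surv c (n - k) z)).
      have := @pexp_dist _ _ _ k0 c cP (n - k) [:: z]
        (fun s => (alive (n - k) s)%:R * F (dz D (n - k) (recen z s))) (fun=> 0)
        (fun s => 2 * M * (alive (n - k) s)%:R).
      rewrite (pexp_cst k0 cP) subr0 pexpZ; apply => s; rewrite subr0 normrM.
      by rewrite ger0_norm ?ler0n // mulrC ler_wpM2r ?ler0n.
    by rewrite ler_wpM2r // lerDr.
  move: bz; rewrite /badz negb_or -leqNgt negbK => /andP[b1 b2].
  by rewrite mulr0 addr0; exact: hF.
rewrite E1; apply: le_trans (ler_norm_sum _ _ _) _.
apply: (@le_trans _ _ (\sum_(k < n) pexp c n [:: 0] (fun s => (height (nth 0 s k) == 0)%:R * Phi k (drop k s)))).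
  by apply: ler_sum => k _; exact: term.
rewrite -(pexp_sum k0 cP).
have -> : sigma + 2 * M * clt D c (edge_tail j) n 0 =
    pexp c n [:: 0] (fun s => sigma + 2 * M * edge_tail j (dz D n (recen 0 s))).
  by rewrite pexpD pexpZ (pexp_cst k0 cP).
apply: (pexp_le_in k0 cP) => s; rewrite add1n => ss _.
rewrite (eq_bigr (fun k : 'I_n => (lastz n k (recen 0 s))%:R *
  (sigma + 2 * M * (badz n0 K n k (recen 0 s k))%:R))); last first.
  move=> k _; rewrite lastz_alive ?(ltnW (ltn_ord k)) // /Phi nth_drop addn0.
  by rewrite -mulnb natrM /recen subr0 mulrA.
have t0 := tail_ge0 j (dz D n (recen 0 s)).
apply: (sum_lastz (b := fun k => sigma + 2 * M * (badz n0 K n k (recen 0 s k))%:R)).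
  by rewrite addr_ge0 // mulr_ge0 // mulr_ge0.
move=> k kn lk; rewrite lerD2l ler_wpM2l ?mulr_ge0 //.
case: (boolP (badz n0 K n k (recen 0 s k))) => bz //.
exact: lastz_tail bz.
Qed.

(** For a single large [n], the walk from the origin is compared with Brownian motion twice: for the
    functional of the path after its last zero, continuous at almost every Brownian path by
    [good_ae], and for [edge_tail]. *)
Theorem level_mean (F : C -> R) (M sigma : R) : 0 < sigma -> 0 <= M -> blip F ->
  (forall w, `|F w| <= 2 * M) ->
  (forall K : R, exists n0, forall m, (n0 <= m)%N -> forall y : pt, height y = 0 ->
    (nrm y)%:R <= K * Num.sqrt m%:R :> R ->
    `|pexp c m [:: y] (fun s => (alive m s)%:R * F (dz D m (recen y s)))| <=
    sigma * surv c m y) ->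
  `|\int[W]_w ((0 < hd w 1)%R%:R * F (phi w))| <= 2 * sigma.
Proof.
move=> s0 M0 bF FM hF.
have M1 : 0 < 2 * M + 1 by rewrite ltr_wpDl // mulr_ge0.
have e0 : 0 < sigma / 4 / (2 * M + 1) by rewrite !divr_gt0.
have [j hj] := tail_small hW e0.
have [n0 hn0] := hF (Num.sqrt j.+1%:R * (Ci * j.+1%:R)).
have [n1 h1] := uclt_of_blip hc 0 (@blip_tail R d j) e0.
have [mG [B GB]] := bmf_end bF.
have s4 : 0 < sigma / 4 by rewrite divr_gt0.
have [|n2 h2] := hc 0 mG GB _ s4.
  by apply: ae_mono (good_ae hW) => w gw; exact: end_cont_at.
pose n := maxn 1 (maxn (n0 * j.+1) (maxn n1 n2)).
have z0 : (nrm (0 : pt))%:R <= 0 * Num.sqrt n%:R :> R by rewrite nrm0 mul0r.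
have nn1 : (n1 <= n)%N by rewrite /n !leq_max leqnn !orbT.
have nn2 : (n2 <= n)%N by rewrite /n !leq_max leqnn !orbT.
have a1 := h1 n nn1 0 z0; have a2 := h2 n nn2 0 z0.
have a3 : `|clt D c (fun w => (0 < hd w 1)%R%:R * F (phi w)) n 0| <=
    sigma + 2 * M * clt D c (edge_tail j) n 0.
  by apply: (level_est (n0 := n0)) => //; rewrite ?(ltW s0) // /n ?leq_max ?leqnn ?orbT.
have a4 : clt D c (edge_tail j) n 0 <= 2 * (sigma / 4 / (2 * M + 1)).
  move: a1; rewrite ler_distl => /andP[_ h]; apply: le_trans h _.
  by move: hj; set z := sigma / 4 / _; lra.
have a5 : 2 * M * clt D c (edge_tail j) n 0 <= sigma / 2.
  apply: (@le_trans _ _ ((2 * M + 1) * (2 * (sigma / 4 / (2 * M + 1))))); last first.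
    by apply: le_of_eq; field; rewrite gt_eqF.
  apply: ler_pM => //; rewrite ?mulr_ge0 ?lerDl //.
  by apply: (pexp_ge0 k0 cP) => s; exact: tail_ge0.
move: a2 a3 a5; set I := \int[W]_w _; set x := clt _ _ _ _ _; set t := 2 * M * _ => a2 a3 a5.
have := ler_distD x I 0; rewrite !subr0 distrC => h; apply: le_trans h _.
lra.
Qed.

Variables (W1 : probability (borel (C01 R)) R) (hW1 : wiener_measure1 W1).
Variables (PW : probability (borel (C01 'rV[R]_d)) R) (hPW : wiener_measure PW).
Variables (PWplus : probability (borel (C01 R)) R) (nu : probability (borel C) R).
Hypothesis hp : forall A : set (borel (C01 R)), measurable A ->
  PWplus A = W1 (@meander R @^-1` A).
Hypothesis hn : product_law nu PWplus PW.

(** Stepping up at every time is a surviving strategy of positive probability, so the conditioning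
    is never on a null event. *)
Lemma surv_up (n : nat) p : p != [::] -> 0 <= height (last 0 p) ->
  alive (size p).-1 p -> 0 < pexp c n p (fun s => (alive ((size p).-1 + n) s)%:R).
Proof.
elim: n p => [|n IH] p p0 hp' al /=; first by rewrite addn0 al.
have sp : (0 < size p)%N by case: (p) p0.
set f := fun y => _; have f0 y : 0 <= f y by apply: (pexp_ge0 k0 cP) => s; rewrite ler0n.
rewrite /avg (bigD1 (up d)) //=; apply: ltr_wpDr.
  by apply: sumr_ge0 => s _; rewrite mulr_ge0 // (tprob_ge0 k0 cP).
apply: mulr_gt0; first exact: (tprob_gt0 k0 cP).
have := IH (rcons p (last 0 p + dir (up d))); rewrite size_rcons /= last_rcons.
rewrite /f (_ : ((size p).-1 + n.+1)%N = (size p + n)%N); last by rewrite -addSnnS prednK.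
apply; first by case: (p).
  by rewrite heightD height_up addr_ge0.
apply/forallP => i; rewrite nth_rcons; case: ltngtP => h.
- have ip : (i < (size p).-1)%N by rewrite -ltnS prednK.
  by have /forallP /(_ (Ordinal ip)) := al.
- by move: h; rewrite ltnS leqNgt ltn_ord.
by rewrite heightD height_up ltr_wpDl.
Qed.

Lemma surv_gt0 n : 0 < surv c n 0.
Proof.
have := @surv_up n [:: 0]; rewrite add0n; apply => //=.
  by rewrite /height mxE.
by apply/forallP => -[].
Qed.

(** Applied to [F - a], [level_mean] says that half of the difference between the target mean and
    [a] is at most [2 * sigma]. So [a] is within [4 * sigma] of the target, and [sigma = rho / 5]
    leaves one fifth for the conditional estimate. *)
Theorem survival_limit (F : C -> R) (rho : R) : blip F -> 0 < rho ->
  exists N, forall n, (N <= n)%N ->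
  `|pexp c n [:: 0] (fun s => (alive n s)%:R * (F (dz D n (recen 0 s)) - \int[nu]_w F w))| <=
  rho * surv c n 0.
Proof.
move=> bF r0; have [[L0 fL0] [M FM]] := bF.
pose L := Num.max 0 L0; have L0' : 0 <= L by rewrite /L le_max lexx.
have fL : lipf L F by apply: lipf_le fL0; rewrite /L le_max lexx orbT.
have M0 : 0 <= M by apply: le_trans (FM (cst 0 : C)).
have s0 : 0 < rho / 5 by rewrite divr_gt0.
have [|a aM ha] := @cond_est R d D W hW kappa k0 c cP hc g g0 Dh F L M L0' fL FM
  (16 * 576 ^+ 2 * d.+1%:R) _ (erefl _) (rho / 5) s0.
  by apply: mulr_ge0 (ler0n _ _); apply: mulr_ge0; [exact: ler0n | apply: exprn_ge0; exact: ler0n].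
pose F' : C -> R := fun w => F w - a.
have bF' : blip F' by apply: blipD => //; exact: blip_cst.
have FM' w : `|F' w| <= 2 * M.
  rewrite mulr2n mulrDl mul1r; apply: le_trans (ler_normB _ _) _; exact: lerD.
have lm := level_mean s0 M0 bF' FM' ha.
rewrite (full_to_head hW1 hPW bF' hW) (head_half hW1 PW bF') (meander_mean bF' hp hn) in lm.
have E : \int[nu]_w F' w = \int[nu]_w F w - a.
  by rewrite /F' expectB ?expect_cst //; [exact: blip_bmf | exact: bmf_cst].
rewrite E in lm; move: lm; set m := \int[nu]_w F w => lm.
have ma : `|m - a| <= 4 * (rho / 5).
  move: lm; rewrite normrM ger0_norm ?invr_ge0 // ler_pdivrMl //; lra.
have [N hN] := ha 0; exists N => n nn.
have z0 : (nrm (0 : pt))%:R <= 0 * Num.sqrt n%:R :> R by rewrite nrm0 mul0r.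
have h0 : height (0 : pt) = 0 by rewrite /height mxE.
have h1 := hN n nn 0 h0 z0.
have -> : pexp c n [:: 0] (fun s => (alive n s)%:R * (F (dz D n (recen 0 s)) - m)) =
  pexp c n [:: 0] (fun s => (alive n s)%:R * (F (dz D n (recen 0 s)) - a)) - (m - a) * surv c n 0.
  by rewrite /surv -pexpZ -pexpB; apply: eq_pexp => s _ _; ring.
have sv := surv_gt0 n; move: h1; set x := pexp _ _ _ _ => h1.
apply: le_trans (ler_normB _ _) _; rewrite normrM (gtr0_norm sv).
have h2 : `|m - a| * surv c n 0 <= 4 * (rho / 5) * surv c n 0 by rewrite ler_wpM2r // ltW.
have -> : rho * surv c n 0 = rho / 5 * surv c n 0 + 4 * (rho / 5) * surv c n 0 by field.
exact: lerD.
Qed.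
End Level.

(** * Return to the quenched law and to weak convergence *)

Section Quenched.
Variables (R : realType) (d : nat) (D : {linear 'rV[R]_d.+1 -> 'rV[R]_d.+1}).
Local Notation pt := 'rV[int]_d.+1.
Local Notation C := (C01 'rV[R]_d.+1).
Variables (w : env R d.+1) (Q : probability (trajectory_space d.+1) R).
Hypotheses (QL : quenched_law w 0 Q).
Variables (kappa : R) (k0 : 0 < kappa) (cP : conductances kappa (cond_of w)).

Lemma stay_alive n (X : trajectory d.+1) (s : seq pt) : size s = n.+1 -> cyl s X ->
  (stay_positive n X : Prop) <-> alive n s.
Proof.
move=> ss cX; split => [h|/forallP h k /andP[k1 kn]].
  apply/forallP => i; have := h i.+1; rewrite /= ltn_ord => /(_ isT).
  by rewrite cX ?ss ?ltnS.
have iP : (k.-1 < n)%N by rewrite prednK.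
by have := h (Ordinal iP); rewrite /= prednK // -cX // ss ltnS.
Qed.

Lemma stay_expect n (F : C -> R) : (0 < n)%N -> blip F ->
  \int[Q]_X (\1_(stay_positive n) X * F (DZ D n X)) =
  pexp (cond_of w) n [:: 0] (fun s => (alive n s)%:R * F (dz D n (recen 0 s))).
Proof.
move=> n0 bF; have [mF [M FM]] := blip_bmf bF.
have mS := @measurable_stay_positive d n.
have b2 : bmf (fun X => \1_(stay_positive n) X * F (DZ D n X) : R).
  apply: bmfM; first exact: bmf_indic.
  exact: (bmf_comp (blip_bmf bF) (@measurable_DZ R d.+1 D n)).
have [m2 B2] := b2.
apply: (pexp_integral QL k0 cP (phi := fun X => \1_(stay_positive n) X * F (DZ D n X))) => //.
move=> X s ss cX; congr (_ * F _).
  rewrite indicE; case: (boolP (alive n s)) => al.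
    by rewrite mem_set //; apply/(stay_alive ss cX).
  by rewrite memNset // => /(stay_alive ss cX) h; rewrite h in al.
apply: dz_prefix => // k kn; by rewrite /recen subr0 cX // ss ltnS.
Qed.

Lemma stay_prob n : (0 < n)%N -> fine (Q (stay_positive n)) = surv (cond_of w) n 0.
Proof.
move=> n0; have mS := @measurable_stay_positive d n.
rewrite -(expect_indic Q mS).
have := stay_expect n0 (@blip_cst R d.+1 1).
under eq_Rintegral do rewrite mulr1; move=> ->.
by apply: eq_pexp => s _ _; rewrite mulr1.
Qed.

Lemma mu_cond_expect n (F : C -> R) (a : R) : (0 < n)%N -> blip F ->
  \int[mu_cond D Q n]_x F x - a = (surv (cond_of w) n 0)^-1 *
    pexp (cond_of w) n [:: 0] (fun s => (alive n s)%:R * (F (dz D n (recen 0 s)) - a)).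
Proof.
move=> n0 bF; have [mF [M FM]] := blip_bmf bF.
have mS := @measurable_stay_positive d n.
have sv := surv_gt0 k0 cP n.
have Q0 : Q (stay_positive n) != 0%E.
  by apply/eqP => E; have := stay_prob n0; rewrite E /= => E'; move: sv; rewrite -E' ltxx.
have bDZ : bmf (fun X => F (DZ D n X)).
  exact: (bmf_comp (blip_bmf bF) (@measurable_DZ R d.+1 D n)).
have -> : \int[mu_cond D Q n]_x F x = \int[conditional Q mS]_X F (DZ D n X).
  rewrite /Rintegral; congr fine; rewrite integral_distribution //; first exact/measurable_EFinP.
  exact: (bmf_integrable (conditional Q mS) bDZ).
(* [conditional_expect] is stated for nonnegative functions, so [F] is shifted by its bound [M]. *)
have bM : blip (fun w => F w + M) by apply: blipD => //; exact: blip_cst.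
have F0 v : 0 <= F v + M by have := FM v; rewrite ler_norml => /andP[h _]; lra.
have -> : \int[conditional Q mS]_X F (DZ D n X) = \int[conditional Q mS]_X (F (DZ D n X) + M) - M.
  by rewrite expectD ?expect_cst ?addrK //; exact: bmf_cst.
rewrite (conditional_expect mS Q0) //; last by apply: bmfD => //; exact: bmf_cst.
rewrite stay_prob // (stay_expect n0 bM).
have sn : surv (cond_of w) n 0 != 0 by rewrite gt_eqF.
have -> : pexp (cond_of w) n [:: 0] (fun s => (alive n s)%:R * (F (dz D n (recen 0 s)) + M)) =
  pexp (cond_of w) n [:: 0] (fun s => (alive n s)%:R * (F (dz D n (recen 0 s)) - a)) +
  (a + M) * surv (cond_of w) n 0.
  by rewrite /surv -pexpZ -pexpD; apply: eq_pexp => s _ _; ring.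
by rewrite mulrDr mulrCA mulVf // mulr1; ring.
Qed.
End Quenched.

(** A bounded continuous functional is approximated from below by members of [fam], which are
    bounded Lipschitz; the upper bound follows by passing to its negative. *)
Lemma weak_of_blip (R : realType) (k : nat) (mu : nat -> probability (borel (C01 'rV[R]_k)) R)
    (nu : probability (borel (C01 'rV[R]_k)) R) :
  (forall F e, blip F -> 0 < e -> exists N, forall n, (N <= n)%N ->
     `|\int[mu n]_x F x - \int[nu]_x F x| <= e) ->
  weak_cvg mu nu.
Proof.
move=> h f cf [M fM].
have mf := continuous_borel cf.
have bf : bmf (f : borel (C01 'rV[R]_k) -> R) by split => //; exists M.
have fE (P : probability (borel (C01 'rV[R]_k)) R) : (\int[P]_x (f x)%:E)%E = (\int[P]_x f x)%:E.
  rewrite /Rintegral fineK //; apply: integrable_fin_num => //.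
  exact: (bmf_integrable P bf).
rewrite fE; under eq_fun do rewrite fE.
apply: cvg_EFin; first by near=> n.
apply/cvgn_epsP => e e0.
pose m := (Num.truncn (Num.max 0 M)).+1.
have Mm : M <= m%:R.
  have h0 : 0 <= Num.max 0 M by rewrite le_max lexx.
  have /andP[_ h1] := truncn_itv h0; apply: le_trans (ltW h1).
  by rewrite le_max lexx orbT.
have lower (f' : C01 'rV[R]_k -> R) : continuous f' -> (forall x, `|f' x| <= M) ->
    exists N, forall n, (N <= n)%N -> \int[nu]_x f' x - e <= \int[mu n]_x f' x.
  move=> cf' fM'; have mf' := continuous_borel cf'.
  have bf' : bmf (f' : borel (C01 'rV[R]_k) -> R) by split => //; exists M.
  have e2 : 0 < e / 2 by rewrite divr_gt0.
  have [] := @approx_below R k nu m f' (e / 2) mf' _ _ e2.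
  - by move=> w; apply: le_trans (fM' w) Mm.
  - apply: aeW => w e' e'0; have := cf' w => /cvgrPdist_le /(_ e' e'0) /nbhs_c01P[r r0 hr].
    exists (r / 2); first by rewrite divr_gt0.
    move=> w' ww; apply: hr => t; apply: le_lt_trans (ww t) _.
    by rewrite ltr_pdivrMr // mulr_natr mulr2n ltrDl.
  move=> c [c1 c2]; have bc := @blip_fam R k c.
  have [N hN] := h _ _ bc e2; exists N => n nn.
  have := hN n nn; rewrite ler_distl => /andP[a1 _].
  have a3 : \int[mu n]_x fam c x <= \int[mu n]_x f' x.
    exact: (expect_le (mu n) (blip_bmf bc) bf' c1).
  move: a1 a3 c2; set x := \int[mu n]_x fam c x; set y := \int[nu]_x fam c x; lra.
have [N1 h1] := lower f cf fM.
have nc : continuous (fun y : R => - y) by move=> y; apply: cvgN; exact: cvg_id.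
have cN := continuous_comp_fun cf nc.
have [N2 h2] := lower (fun x => - f x) cN (fun x => eq_ind_r (fun y => y <= M) (fM x) (normrN (f x))).
exists (maxn N1 N2) => n; rewrite geq_max => /andP[n1 n2] /=.
have a1 := h1 n n1; have a2 := h2 n n2.
have EN (P : probability (borel (C01 'rV[R]_k)) R) : \int[P]_x (- f x) = - \int[P]_x f x.
  by rewrite -[RHS]mulN1r -expectZ //; apply: eq_Rintegral => x _; rewrite mulN1r.
by rewrite !EN in a2; rewrite ler_norml; apply: (two_sided _ a1); rewrite !mulN1r.
Unshelve. all: by end_near. Qed.

Theorem theorem1p1 (R : realType) (d : nat) (hd : (2 <= d.+1)%N)
  (P : probability (env_space R d.+1) R)
  (hnonneg : nonnegative_conductances P)
  (hstat : stationary P) (herg : ergodic P) (hUE : condition_UE P)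
  (Pq : env R d.+1 -> probability (trajectory_space d.+1) R)
  (hPq : forall w : env R d.+1, (forall b, 0 <= w b) ->
     (forall x, 0 < pi_env w x) -> quenched_law w 0 (Pq w))
  (D : {linear 'rV[R]_d.+1 -> 'rV[R]_d.+1})
  (hDbij : bijective D)
  (hDinv : forall v : 'rV[R]_d.+1, v 0 0 = 0 -> D v 0 0 = 0)
  (hDpos : 0 < D (delta_mx 0 0) 0 0)
  (PWfull : probability (borel (C01 'rV[R]_d.+1)) R)
  (hPWfull : wiener_measure PWfull)
  (hDconv : {ae P, forall w : env R d.+1,
     weak_cvg (fun n => distribution (Pq w) (DZ D n)) PWfull})
  (PWplus : probability (borel (C01 R)) R) (hPWplus : meander_law PWplus)
  (PW : probability (borel (C01 'rV[R]_d)) R) (hPW : wiener_measure PW)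
  (nu : probability (borel (C01 'rV[R]_d.+1)) R)
  (hnu : product_law nu PWplus PW) :
  {ae P, forall w : env R d.+1, weak_cvg (mu_cond D (Pq w)) nu}.
Proof.
have [kappa k0 hUE'] := hUE; have [W1 hW1 hp] := hPWplus.
set g := D (delta_mx 0 0) 0 0 in hDpos.
(* As [D] preserves the hyperplane of vanishing first coordinate, it multiplies the first coordinate
   by [g > 0]; positivity of the walk can thus be read off after applying [D]. *)
have Dh (v : 'rV[R]_d.+1) : D v 0 0 = g * v 0 0.
  have h0 : (v - v 0 0 *: delta_mx 0 0) 0 0 = 0.
    by rewrite !mxE !eqxx mulr1 subrr.
  have := hDinv _ h0; rewrite linearB linearZ !mxE => /eqP; rewrite subr_eq0 => /eqP ->.
  by rewrite mulrC.
have [Ci Ci0 hCi] := linear_lower hDbij.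
(* Stationarity carries the ellipticity from the origin to every site, outside one null set. *)
have hcond : {ae P, forall w : env R d.+1, conductances kappa (cond_of w)}.
  have := ae_shift hstat hUE'.
  by apply: ae_mono => w hw; apply: cond_of_conductances => z y; exact: hw.
have hql : {ae P, forall w : env R d.+1, quenched_law w 0 (Pq w)}.
  have := ae_and hnonneg hcond; apply: ae_mono => w [w0 cw]; apply: hPq => // x.
  by rewrite pi_envE; exact: (cweight_gt0 k0 cw).
have hclt : {ae P, forall w : env R d.+1, forall f, blip f ->
    (fun n => clt D (cond_of w) f n.+1 0) @ \oo --> \int[PWfull]_x f x}.
  have := ae_and (ae_and hcond hql) hDconv; apply: ae_mono => w [[cw ql] cv] f bf.
  exact: (clt_lim k0 cw ql cv bf).
have hu := uclt hstat k0 hcond hclt.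
have := ae_and (ae_and hcond hql) hu; apply: ae_mono => w [[cw ql] uc].
apply: weak_of_blip => F e bF e0.
have [N hN] := survival_limit hPWfull k0 cw uc hDpos Dh Ci0 hCi hW1 hPW hp hnu bF e0.
exists (maxn 1 N) => n; rewrite geq_max => /andP[n1 nN].
have sv := surv_gt0 k0 cw n.
rewrite (mu_cond_expect D ql k0 cw (\int[nu]_x F x) n1 bF) normrM.
rewrite ger0_norm ?invr_ge0 ?(ltW sv) // mulrC ler_pdivrMr //.
exact: hN.
Qed.
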